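(* Fix $\tau\in\mathbb R$, $\sigma\in\mathbb R$, $0<\varphi<\pi$, and let $$\mathcal L f(s)=i(1/2-is)f(s+i)+2(s-\tau)\cos\varphi\,f(s)-i(1/2+is-2i\tau)f(s-i).$$ Consider the operator $\mathcal L\oplus\mathcal L$, $(f_1,f_2)\mapsto(\mathcal L f_1,\mathcal L f_2)$, in $L^2(\mathbb R,ds)\oplus L^2(\mathbb R,e^{2\pi s}ds)$. a) The operator $\mathcal L\oplus\mathcal L$ has defect indices $(2,2)$ on $\mathcal H$. b) The operator $\mathcal L\oplus\mathcal L$ is essentially self-adjoint on the domain $\mathcal H_\sigma$.
   Context: A function is said to be holomorphic (meromorphic) in the closed strip $|\operatorname{Im}s|\le1$ if it is so in $|\operatorname{Im}s|<1+\delta$ for some $\delta>0$. $\mathcal H$ is the space of pairs $(f_1,f_2)$ of functions holomorphic in the closed strip $|\operatorname{Im}s|\le1$ such that, for some $\varepsilon>0$, $$f_1(s)=O(|\operatorname{Re}s|^{-3/2-\varepsilon}),\qquad e^{\pi s}f_2(s)=O(|\operatorname{Re}s|^{-3/2-\varepsilon}),\qquad|\operatorname{Re}s|\to\infty,\tag{$*$}$$ in this strip. $\mathcal H_\sigma$ is the space of pairs $(f_1,f_2)$ of functions meromorphic in the closed strip $|\operatorname{Im}s|\le1$, satisfying $( * )$ for some $\varepsilon>0$, holomorphic except for at most simple poles at the points $s=i/2$ and $s=-i/2+2\tau$, and such that $$\operatorname*{res}_{s=i/2}f_1(s)=\operatorname*{res}_{s=i/2}f_2(s),\qquad\operatorname*{res}_{s=-i/2+2\tau}f_1(s)=-e^{2\pi(\tau+i\sigma)}\operatorname*{res}_{s=-i/2+2\tau}f_2(s).$$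 The defect indices of a symmetric operator $T$ are $(\dim\ker(T^*-i),\dim\ker(T^*+i))$. *)

(* Defs.v *)
From HB Require Import structures.
From mathcomp Require Import all_boot all_order all_algebra.
From mathcomp Require Import complex.
From mathcomp Require Import all_classical all_reals all_analysis.

Set Implicit Arguments.
Unset Strict Implicit.
Unset Printing Implicit Defensive.

Import Order.TTheory GRing.Theory Num.Theory.
Import numFieldNormedType.Exports.

Local Open Scope classical_set_scope.
Local Open Scope complex_scope.
Local Open Scope ring_scope.

(** A Hilbert space is represented before passing to the quotient by null
    vectors: [vec H] is the set of vectors (for L^2, the square integrable
    functions) and [ip H] the semi-inner product on it, linear in its first
    argument.  A vector [u] with [ip H u u = 0] stands for zero (for L^2, a
    function vanishing almost everywhere).

    An operator is represented by its graph. *)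

Record ip_space (R : realType) (V : lmodType R[i]) := IPSpace {
  vec : set V ;
  ip : V -> V -> R[i] }.

Definition ip_sum (R : realType) (V W : lmodType R[i])
    (H : ip_space V) (K : ip_space W) : ip_space (V * W)%type :=
  @IPSpace R (V * W)%type
    [set u | vec H u.1 /\ vec K u.2]
    (fun u v => ip H u.1 v.1 + ip K u.2 v.2).

Section Operators.
Variables (R : realType) (V : lmodType R[i]) (H : ip_space V).
Implicit Types (T : set (V * V)) (K : set V).

Definition sqnorm (u : V) : R := complex.Re (ip H u u).

Definition null : set V := [set u | vec H u /\ ip H u u = 0].

Definition linear_graph T : Prop :=
  T (0, 0) /\
  forall (a : R[i]) (x y : V * V), T x -> T y ->
    T (a *: x.1 + y.1, a *: x.2 + y.2).

Definition dense_set K : Prop :=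
  forall u (e : R), vec H u -> 0 < e ->
    exists2 v, K v & sqnorm (u - v) < e.

(* Single-valuedness of the graph modulo null vectors is not listed: it
   follows from density of the domain and the symmetry identity. *)
Definition symmetric_op T : Prop :=
  [/\ forall x, T x -> vec H x.1 /\ vec H x.2,
      linear_graph T,
      dense_set (fst @` T)
    & forall x y, T x -> T y -> ip H x.2 y.1 = ip H x.1 y.2].

Definition adjoint T : set (V * V) :=
  [set y | [/\ vec H y.1, vec H y.2
             & forall x, T x -> ip H x.2 y.1 = ip H x.1 y.2]].

Definition closure_op T : set (V * V) :=
  [set y | [/\ vec H y.1, vec H y.2
             & forall e : R, 0 < e -> exists x, [/\ T x,
                 sqnorm (y.1 - x.1) < e & sqnorm (y.2 - x.2) < e]]].

Definition ker_sub T (z : R[i]) : set V := [set u | T (u, z *: u)].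

(* The image of [K] in the quotient by null vectors has dimension [n]. *)
Definition dim_mod_null K (n : nat) : Prop :=
  exists e : 'I_n -> V,
    [/\ forall j, K (e j),
        forall c : 'I_n -> R[i],
          null (\sum_j c j *: e j) -> forall j, c j = 0
      & forall u, K u ->
          exists c : 'I_n -> R[i], null (u - \sum_j c j *: e j)].

Definition defect_indices T (m n : nat) : Prop :=
  [/\ symmetric_op T,
      dim_mod_null (ker_sub (adjoint T) 'i%C) m
    & dim_mod_null (ker_sub (adjoint T) (- 'i%C)) n].

Definition essentially_selfadjoint T : Prop :=
  symmetric_op T /\ adjoint (closure_op T) = closure_op T.

End Operators.

Section L2.
Variables (R : realType) (w : R -> R).
Local Notation C := (R[i]^o).
Local Notation mu := (@lebesgue_measure R).

(* [lebesgue_measure] lives on the Borel sigma-algebra; every class of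
   Lebesgue measurable functions has a Borel measurable representative. *)
Definition L2_vec : set (R -> C) :=
  [set f : R -> C | [/\ measurable_fun setT (fun x : R => complex.Re (f x)),
               measurable_fun setT (fun x : R => complex.Im (f x))
             & (\int[mu]_(x in setT) (Normc.normc (f x) ^+ 2 * w x)%:E
                  < +oo)%E]].

Definition L2_ip (f g : R -> C) : R[i] :=
  let h x : R[i] := f x * conjc (g x) in
  (\int[mu]_(x in setT) (complex.Re (h x) * w x))%R
  +i* (\int[mu]_(x in setT) (complex.Im (h x) * w x))%R.

Definition L2 : ip_space (R -> C) := IPSpace L2_vec L2_ip.

End L2.

Section Complex.
Variable R : realType.
Local Notation C := (R[i]^o).
Implicit Types (f g : C -> C) (p : C) (U : set C).

Definition cexp (z : R[i]) : R[i] :=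
  (expR (complex.Re z))%:C * (cos (complex.Im z) +i* sin (complex.Im z)).

Definition holomorphic_on f U : Prop := forall s, U s -> derivable f s 1.

(* Principal part [q], a polynomial in [1 / (s - p)].  Its constant term is
   not determined (it can be absorbed by [g]), the other ones are. *)
Definition laurent_at f p (q : {poly R[i]}) : Prop :=
  exists g, (\forall s \near p, derivable g s 1) /\
            (\forall s \near p^', f s = q.[(s - p)^-1] + g s).

Definition at_most_simple_pole f p : Prop :=
  exists2 q : {poly R[i]}, (size q <= 2)%N & laurent_at f p q.

(* The coefficient of [1 / (s - p)] (0, by convention, if [f] is not
   meromorphic at [p]). *)
Definition res f p : R[i] :=
  xget 0 [set r | exists2 q : {poly R[i]}, laurent_at f p q & r = q`_1].

End Complex.

Section DifferenceOperator.
Variable R : realType.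
Local Notation C := (R[i]^o).
Implicit Types (f : C -> C) (F : (C -> C) * (C -> C)).

Definition L_op (tau phi : R) f : C -> C := fun s =>
  'i%C * (1 / 2%:R - 'i%C * s) * f (s + 'i%C)
  + 2%:R * (s - tau%:C) * (cos phi)%:C * f s
  - 'i%C * (1 / 2%:R + 'i%C * s - 2%:R * 'i%C * tau%:C) * f (s - 'i%C).

Definition strip (delta : R) : set C :=
  [set s | `|complex.Im s| < 1 + delta].

Definition decay (eps : R) f : Prop :=
  exists M B : R, forall s : C,
    `|complex.Im s| <= 1 -> B <= `|complex.Re s| ->
    Normc.normc (f s) <= M * `|complex.Re s| `^ (- (3%:R / 2%:R) - eps).

Definition decay_pair F : Prop :=
  exists2 eps : R, 0 < eps &
    decay eps F.1 /\ decay eps (fun s => cexp (pi%:C * s) * F.2 s).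

Definition space_H : set ((C -> C) * (C -> C)) :=
  [set F | (exists2 delta : R, 0 < delta &
              holomorphic_on F.1 (strip delta) /\
              holomorphic_on F.2 (strip delta))
           /\ decay_pair F].

Section Hsigma.
Variables tau sigma : R.

Definition pole1 : C := 0 +i* (1 / 2%:R).
Definition pole2 : C := (2%:R * tau) -i* (1 / 2%:R).

(* Meromorphy in the strip follows: a function differentiable on an open set
   is holomorphic there, and at the two remaining points a Laurent expansion
   is required.  The values of a function at [pole1] and [pole2] are irrelevant:
   on the real line [L_op] involves only the points with |Im s| = 0, 1. *)
Definition holomorphic_off_poles f : Prop :=
  [/\ exists2 delta : R, 0 < delta &
        holomorphic_on f (strip delta `\` [set pole1; pole2]),
      at_most_simple_pole f pole1
    & at_most_simple_pole f pole2].

Definition space_H_sigma : set ((C -> C) * (C -> C)) :=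
  [set F | [/\ holomorphic_off_poles F.1 /\ holomorphic_off_poles F.2,
               decay_pair F,
               res F.1 pole1 = res F.2 pole1
             & res F.1 pole2 =
               - cexp ((2%:R * pi)%:C * (tau +i* sigma)) * res F.2 pole2]].

End Hsigma.

Definition onR f : R -> C := fun x => f x%:C.

Definition L2_sum : ip_space ((R -> C) * (R -> C))%type :=
  ip_sum (L2 (fun=> 1)) (L2 (fun x => expR (2%:R * pi * x))).

(* As vectors of L^2, the elements of the domain [D] are restricted to R. *)
Definition LL_op (tau phi : R) (D : set ((C -> C) * (C -> C))) :
    set (((R -> C) * (R -> C)) * ((R -> C) * (R -> C))) :=
  [set ((onR F.1, onR F.2),
        (onR (L_op tau phi F.1), onR (L_op tau phi F.2))) | F in D].

End DifferenceOperator.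

(* Main.v *)
Require Import Defs.
From HB Require Import structures.
From mathcomp Require Import all_boot all_order all_algebra.
From mathcomp Require Import complex.
From mathcomp Require Import all_classical all_reals all_analysis.
From mathcomp Require Import measurable_realfun.
From mathcomp Require Import ring lra.

Import Order.TTheory GRing.Theory Num.Theory.
Import numFieldNormedType.Exports.

Set Implicit Arguments.
Unset Strict Implicit.
Unset Printing Implicit Defensive.

Local Open Scope classical_set_scope.
Local Open Scope complex_scope.
Local Open Scope ring_scope.


(** The difference operator is the Mellin image of a first-order differential operator. Put c = cos
    phi, q(y) = 1 + 2 c y + y^2 and E w = i (q w' + (1 + 2 i tau) (c + y) w). For polynomials w, u
    let [Utr] w u be the Mellin transform, with kernel y^(i s - 1/2), of the function equal to w(y)
    on (0, 1) and to y^(-1 - 2 i tau) u(1/y) on (1, oo). If w(1) = u(1), then L (Utr w u) = Utr (E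
    w) (- E u) ([Lc_Utr]), the transform decays like |s|^-2, and its residues at i/2 and -i/2 + 2
    tau are - i w(0) and i u(0) ([MerR_Utr]). Since c^2 < 1, q has no real zero, and E v = z v has
    the explicit solution v_z = q^(-1/2 - i tau) exp(i z theta), theta(y) being the integral of 1/q
    over [y, 1].

    Three facts carry the proof. Green's formula ([green]): shifting the line of integration by i or
    -i turns <L f, g> into <f, L g>, up to products of the residues of f and g. Density of ranges
    ([range_dense]): for every z the transforms of (E w - z w, - E u - z u) with w(0) = u(0) = 0 and
    no condition at y = 1 are dense in L^2(R). This reduces to the density of simple poles
    ([pole_span_dense]), because 1/(z + b) is the transform of y^b and E w - z w = y^b is solved by
    variation of constants. Approximate solutions ([eigen_approx]): polynomials with the exact
    endpoint values of v_z and v_(-z) have transforms that converge in L^2 and that L - z sends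
    almost to 0.

    Defect indices. On functions without poles the condition w(1) = u(1) has codimension one, so a
    defect space has dimension at most 1. The limit of the approximate solutions is a defect vector,
    and Green's formula against a function with a residue shows that it is not null
    ([def_vec_dim1]). Multiplication by e^(pi s) carries the weighted L^2 space to the unweighted
    one and L with parameter c to - L with parameter - c ([Lc_twist]), so the second component
    behaves in the same way and the dimensions add up to 2 ([ker_dim2]).

    Essential self-adjointness. On the domain with the residue conditions the boundary terms of the
    two components cancel, because the factor e^(2 pi (tau + i sigma)) has the modulus of e^(pi s)
    at s = -i/2 + 2 tau ([sigma_symmetric]). It remains to see that the ranges of T - i and T + i
    are dense ([esa_of_dense_range]). Given a target, [range_dense] supplies data vanishing at y = 0
    but mismatched at y = 1. Multiples of the approximate solutions are added: they hardly change
    the range, and their four coefficients are chosen to satisfy the two matching conditions and the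
    two residue conditions. This linear system is solvable for non-real z because of the moduli of
    v_z(0) ([endpoint_ratio], [coefficients]). *)

Notation nc := Normc.normc.

(** * Moduli, real and imaginary parts, complex differentiability *)

Section ComplexBasics.
Variable R : realType.
Implicit Types (z w : R[i]) (x y : R).

Lemma normc_sqr z : nc z ^+ 2 = complex.Re z ^+ 2 + complex.Im z ^+ 2.
Proof. by case: z => a b /=; rewrite sqr_sqrtr // addr_ge0 // sqr_ge0. Qed.

Lemma nc_ge0 z : 0 <= nc z.
Proof. by case: z => a b /=; rewrite sqrtr_ge0. Qed.

Lemma nc0 : nc (0 : R[i]) = 0.
Proof. exact: Normc.normc0. Qed.

Lemma nc_eq0 z : (nc z == 0) = (z == 0).
Proof.
apply/eqP/eqP => [/Normc.eq0_normc //|->]; exact: nc0.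
Qed.

Lemma nc_gt0 z : (0 < nc z) = (z != 0).
Proof. by rewrite lt_def nc_ge0 andbT nc_eq0. Qed.

Lemma nc1 : nc (1 : R[i]) = 1.
Proof. exact: Normc.normc1. Qed.

Lemma ncM z w : nc (z * w) = nc z * nc w.
Proof. exact: Normc.normcM. Qed.

Lemma ncV z : nc z^-1 = (nc z)^-1.
Proof. exact: Normc.normcV. Qed.

Lemma ncX z n : nc (z ^+ n) = nc z ^+ n.
Proof. by elim: n => [|n IH]; rewrite ?expr0 ?nc1 // !exprS ncM IH. Qed.

Lemma ncN z : nc (- z) = nc z.
Proof. exact: normcN. Qed.

Lemma ncD z w : nc (z + w) <= nc z + nc w.
Proof. exact: le_normcD. Qed.

Lemma ncB z w : nc (z - w) <= nc z + nc w.
Proof. by rewrite -(ncN w) ncD. Qed.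

Lemma nc_distC z w : nc (z - w) = nc (w - z).
Proof. by rewrite -ncN opprB. Qed.

Lemma ncBge z w : nc z - nc w <= nc (z - w).
Proof. by rewrite lerBlDr; have := ncD (z - w) w; rewrite subrK. Qed.

Lemma nc_sum (I : Type) (r : seq I) (P : pred I) (F : I -> R[i]) :
  nc (\sum_(i <- r | P i) F i) <= \sum_(i <- r | P i) nc (F i).
Proof.
elim/big_rec2: _ => [|i x z _ IH]; first by rewrite nc0.
by apply: (le_trans (ncD _ _)); rewrite lerD2l.
Qed.

Lemma nc_real x : nc x%:C = `|x|.
Proof. by rewrite /= expr0n /= addr0 sqrtr_sqr. Qed.

Lemma nc_conj z : nc (conjc z) = nc z.
Proof. by case: z => a b /=; rewrite sqrrN. Qed.

Lemma nc_i : nc ('i%C : R[i]) = 1.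
Proof. by rewrite /= expr0n expr1n add0r sqrtr1. Qed.

Lemma cRe_le z : `|complex.Re z| <= nc z.
Proof.
case: z => a b /=; rewrite -(sqrtr_sqr a) ler_wsqrtr //.
by rewrite lerDl sqr_ge0.
Qed.

Lemma cIm_le z : `|complex.Im z| <= nc z.
Proof.
case: z => a b /=; rewrite -(sqrtr_sqr b) ler_wsqrtr //.
by rewrite lerDr sqr_ge0.
Qed.

Lemma nc_le z : nc z <= `|complex.Re z| + `|complex.Im z|.
Proof.
rewrite -(@ler_pXn2r _ 2) ?nnegrE ?nc_ge0 ?addr_ge0 //.
rewrite normc_sqr sqrrD !real_normK ?num_real //.
by rewrite -addrA lerD2l lerDr mulrn_wge0 ?mulr_ge0.
Qed.

Lemma normCE z : `|z| = (nc z)%:C.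
Proof. by []. Qed.

Lemma cReD z w : complex.Re (z + w) = complex.Re z + complex.Re w.
Proof. by case: z w => [a b] [c d]. Qed.
Lemma cImD z w : complex.Im (z + w) = complex.Im z + complex.Im w.
Proof. by case: z w => [a b] [c d]. Qed.
Lemma cReN z : complex.Re (- z) = - complex.Re z.
Proof. by case: z. Qed.
Lemma cImN z : complex.Im (- z) = - complex.Im z.
Proof. by case: z. Qed.
Lemma cReM z w : complex.Re (z * w) =
  complex.Re z * complex.Re w - complex.Im z * complex.Im w.
Proof. by case: z w => [a b] [c d]. Qed.
Lemma cImM z w : complex.Im (z * w) =
  complex.Re z * complex.Im w + complex.Im z * complex.Re w.
Proof. by case: z w => [a b] [c d]. Qed.
Lemma cReJ z : complex.Re (conjc z) = complex.Re z.
Proof. by case: z. Qed.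
Lemma cImJ z : complex.Im (conjc z) = - complex.Im z.
Proof. by case: z. Qed.
Lemma cRe0 : complex.Re (0 : R[i]) = 0. Proof. by []. Qed.
Lemma cIm0 : complex.Im (0 : R[i]) = 0. Proof. by []. Qed.
Lemma cRe1 : complex.Re (1 : R[i]) = 1. Proof. by []. Qed.
Lemma cIm1 : complex.Im (1 : R[i]) = 0. Proof. by []. Qed.

Lemma cRe_nat n : complex.Re (n%:R : R[i]) = n%:R.
Proof. by elim: n => // n IH; rewrite -!natr1 cReD IH. Qed.
Lemma cIm_nat n : complex.Im (n%:R : R[i]) = 0.
Proof. by elim: n => // n IH; rewrite -natr1 cImD IH cIm1 addr0. Qed.

Definition ReImE := (cReD, cImD, cReN, cImN, cReM, cImM, cReJ, cImJ, cRe_nat, cIm_nat).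

Lemma complex_ext z w : complex.Re z = complex.Re w ->
  complex.Im z = complex.Im w -> z = w.
Proof. by case: z w => [a b] [c d] /= -> ->. Qed.

Lemma real_complex_nat n : (n%:R)%:C = n%:R :> R[i].
Proof. by rewrite rmorph_nat. Qed.

Lemma nearCP (p : R[i]^o) (P : R[i]^o -> Prop) :
  (\forall s \near p, P s) <->
  exists2 r : R, 0 < r & forall s : R[i], nc (s - p) < r -> P s.
Proof.
split.
  move=> /nbhs_ballP [e e0 He].
  have [er eq] : exists er : R, e = er%:C.
    by move: e0; rewrite /= lt_def lecE => /andP[_ /andP[/eqP/= + _]];
       case: e {He} => a b /= ->; exists a.
  move: e0 He; rewrite eq /= ltcR => er0 He.
  exists er => // s hs; apply: He; rewrite /ball /= distrC.
  by rewrite normCE ltcR.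
move=> [r r0 H]; apply/nbhs_ballP; exists r%:C; first by rewrite /= ltcR.
by move=> s; rewrite /ball /= distrC normCE ltcR => /H.
Qed.

Lemma dnearCP (p : R[i]^o) (P : R[i]^o -> Prop) :
  (\forall s \near p^', P s) <->
  exists2 r : R, 0 < r & forall s : R[i], nc (s - p) < r -> s != p -> P s.
Proof.
split.
  move=> H; have {H} : \forall s \near p, s != p -> P s by [].
  by move=> /nearCP.
move=> H; have : \forall s \near p, s != p -> P s by apply/nearCP.
by [].
Qed.

(** Complex derivative in Frechet form with real moduli: there is no division by the increment, and
    [h = 0] is allowed. *)
Definition cdiff (f : R[i] -> R[i]) (s l : R[i]) : Prop :=
  forall e : R, 0 < e -> exists2 d : R, 0 < d &
    forall h : R[i], nc h < d -> nc (f (s + h) - f s - l * h) <= e * nc h.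

Lemma derivable_cdiff (f : R[i]^o -> R[i]^o) (s : R[i]^o) :
  derivable f s 1 <-> exists l, cdiff f s l.
Proof.
split.
  move=> /cvg_ex [l /= Hl]; exists l => e e0.
  move/cvgrPdist_le: Hl => /(_ e%:C) /=.
  rewrite ltcR => /(_ e0) /dnearCP [d d0 Hd].
  exists d => // h hd.
  have [->|h0] := eqVneq h 0; first by rewrite addr0 mulr0 subr0 subrr nc0 mulr0.
  have := Hd h; rewrite subr0 => /(_ hd h0).
  rewrite normCE lecR => H.
  have -> : f (s + h) - f s - l * h =
      - (l - h^-1 *: (f (h *: 1 + s) - f s)) * h :> R[i].
    rewrite opprB mulrBl; congr (_ - _).
    rewrite mulrAC /GRing.scale /= mulr1 mulVf // mul1r.
    by rewrite [h + s]addrC.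
  by rewrite ncM ncN; apply: ler_wpM2r => //; apply: nc_ge0.
move=> [l Hl]; apply/cvg_ex; exists l.
apply/cvgrPdist_le => e e0.
have [er eq] : exists er : R, e = er%:C.
  by move: e0; rewrite /= lt_def lecE => /andP[_ /andP[/eqP/= + _]];
     case: e => a b /= ->; exists a.
move: e0; rewrite eq /= ltcR => er0.
have [d d0 Hd] := Hl _ er0.
apply/dnearCP; exists d => // h; rewrite subr0 => /Hd H h0.
rewrite normCE lecR -(@ler_pM2r _ (nc h)) ?nc_gt0 // -ncM.
rewrite -ncN; apply: le_trans H; rewrite le_eqVlt; apply/orP; left; apply/eqP.
congr nc; rewrite /GRing.scale /= mulr1 mulrBl opprB; congr (_ - _).
by rewrite mulrAC mulVf // mul1r [h + s]addrC.
Qed.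

End ComplexBasics.

(** * Integration of complex-valued functions of a real variable *)

Section ComplexIntegral.
Variable R : realType.
Implicit Types (f g : R -> R[i]) (D : set R) (F : R[i] -> R[i]).
Local Notation mu := (@lebesgue_measure R).

Definition ccont f (x : R) : Prop :=
  continuous_at x (fun t => complex.Re (f t)) /\
  continuous_at x (fun t => complex.Im (f t)).

Lemma ccontP f x : ccont f x <->
  forall e : R, 0 < e -> exists2 d : R, 0 < d &
    forall y, `|y - x| < d -> nc (f y - f x) <= e.
Proof.
split.
  move=> [h1 h2] e e0.
  have e20 : 0 < e / 2 by rewrite divr_gt0.
  move/cvgrPdist_le: h1 => /(_ _ e20) /nbhs_ballP [d1 /= d10 H1].
  move/cvgrPdist_le: h2 => /(_ _ e20) /nbhs_ballP [d2 /= d20 H2].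
  exists (Num.min d1 d2); first by rewrite lt_min d10.
  move=> y; rewrite lt_min => /andP[y1 y2].
  apply: (le_trans (nc_le _)); rewrite [leRHS](splitr e).
  apply: lerD; rewrite ?cReD ?cReN ?cImD ?cImN distrC.
    by apply: (H1 y); rewrite /ball /= distrC.
  by apply: (H2 y); rewrite /ball /= distrC.
move=> H; split; apply/cvgrPdist_le => e e0.
  have [d d0 Hd] := H _ e0; apply/nbhs_ballP; exists d => // y.
  rewrite /ball /= distrC => /Hd; apply: le_trans.
  by rewrite distrC -cReN -cReD cRe_le.
have [d d0 Hd] := H _ e0; apply/nbhs_ballP; exists d => // y.
rewrite /ball /= distrC => /Hd; apply: le_trans.
by rewrite distrC -cImN -cImD cIm_le.
Qed.

Lemma ccont_cst (c : R[i]) x : ccont (fun=> c) x.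
Proof. by split; exact: cvg_cst. Qed.

Lemma ccontD f g x : ccont f x -> ccont g x -> ccont (fun t => f t + g t) x.
Proof.
move=> [h1 h2] [h3 h4]; split; rewrite /continuous_at.
  under eq_fun do rewrite cReD; rewrite cReD; exact: cvgD.
under eq_fun do rewrite cImD; rewrite cImD; exact: cvgD.
Qed.

Lemma ccontN f x : ccont f x -> ccont (fun t => - f t) x.
Proof.
move=> [h1 h2]; split; rewrite /continuous_at.
  under eq_fun do rewrite cReN; rewrite cReN; exact: cvgN.
under eq_fun do rewrite cImN; rewrite cImN; exact: cvgN.
Qed.

Lemma ccontB f g x : ccont f x -> ccont g x -> ccont (fun t => f t - g t) x.
Proof. by move=> hf hg; apply: ccontD hf (ccontN hg). Qed.

Lemma ccontM f g x : ccont f x -> ccont g x -> ccont (fun t => f t * g t) x.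
Proof.
move=> [h1 h2] [h3 h4]; split; rewrite /continuous_at.
  under eq_fun do rewrite cReM; rewrite cReM.
  by apply: cvgB; apply: cvgM.
under eq_fun do rewrite cImM; rewrite cImM.
by apply: cvgD; apply: cvgM.
Qed.

Lemma ccontJ f x : ccont f x -> ccont (fun t => conjc (f t)) x.
Proof.
move=> [h1 h2]; split; rewrite /continuous_at.
  by under eq_fun do rewrite cReJ; rewrite cReJ.
under eq_fun do rewrite cImJ; rewrite cImJ; exact: cvgN.
Qed.

Lemma ccont_id x : ccont (fun t => t%:C) x.
Proof. by split; [exact: cvg_id | exact: cvg_cst]. Qed.

Lemma cdiff_cont F s l : cdiff F s l ->
  forall e : R, 0 < e -> exists2 d : R, 0 < d &
    forall h : R[i], nc h < d -> nc (F (s + h) - F s) <= e.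
Proof.
move=> H e e0; have [d d0 Hd] := H _ ltr01.
have l0 : 0 < nc l + 1 by rewrite ltr_wpDl ?nc_ge0.
exists (Num.min d (e / (nc l + 1))); first by rewrite lt_min d0 divr_gt0.
move=> h; rewrite lt_min => /andP[/Hd h1 h2].
have -> : F (s + h) - F s = (F (s + h) - F s - l * h) + l * h by rewrite subrK.
apply: (le_trans (ncD _ _)); rewrite ncM.
apply: (@le_trans _ _ ((nc l + 1) * nc h)).
  by rewrite mulrDl addrC lerD2l (le_trans h1).
by rewrite mulrC -ler_pdivlMr // ltW.
Qed.

Lemma cdiff_ccont F s l (v : R[i]) x : cdiff F (s + x%:C * v) l ->
  ccont (fun t => F (s + t%:C * v)) x.
Proof.
move=> /cdiff_cont H; apply/ccontP => e e0.
have [d d0 Hd] := H _ e0.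
have v0 : 0 < nc v + 1 by rewrite ltr_wpDl ?nc_ge0.
exists (d / (nc v + 1)); first by rewrite divr_gt0.
move=> y hy; have -> : s + y%:C * v = s + x%:C * v + (y - x)%:C * v.
  by rewrite -addrA -mulrDl -rmorphD /= [x + _]addrC subrK.
apply: Hd; rewrite ncM nc_real.
apply: (@le_lt_trans _ _ (`|y - x| * (nc v + 1))).
  by apply: ler_wpM2l => //; rewrite lerDl.
by rewrite -ltr_pdivlMr.
Qed.

Definition cI D f : R[i] :=
  (\int[mu]_(x in D) complex.Re (f x))%R +i*
  (\int[mu]_(x in D) complex.Im (f x))%R.

Definition cintegrable D f : Prop :=
  mu.-integrable D (EFin \o (fun x => complex.Re (f x))) /\
  mu.-integrable D (EFin \o (fun x => complex.Im (f x))).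

Lemma eq_cI D f g : {in D, f =1 g} -> cI D f = cI D g.
Proof.
move=> fg; rewrite /cI; congr (_ +i* _);
  by apply: eq_Rintegral => x xD; rewrite fg.
Qed.

Lemma eq_cintegrable D f g : measurable D -> {in D, f =1 g} ->
  cintegrable D f -> cintegrable D g.
Proof.
move=> mD fg [h1 h2]; split.
  by apply: eq_integrable h1 => // x xD /=; rewrite fg.
by apply: eq_integrable h2 => // x xD /=; rewrite fg.
Qed.

Lemma cintegrableD D f g : measurable D ->
  cintegrable D f -> cintegrable D g -> cintegrable D (fun x => f x + g x).
Proof.
move=> mD [h1 h2] [h3 h4]; split.
  rewrite (_ : _ \o _ = (EFin \o (fun x => complex.Re (f x))) \+
     (EFin \o (fun x => complex.Re (g x))))%E; first exact: integrableD.
  by apply/funext => x /=; rewrite cReD.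
rewrite (_ : _ \o _ = (EFin \o (fun x => complex.Im (f x))) \+
     (EFin \o (fun x => complex.Im (g x))))%E; first exact: integrableD.
by apply/funext => x /=; rewrite cImD.
Qed.

Lemma integrableRZ D (r : R) (h : R -> R) : measurable D ->
  mu.-integrable D (EFin \o h) -> mu.-integrable D (EFin \o (fun x => r * h x)).
Proof.
move=> mD ih.
rewrite (_ : _ \o _ = (fun x => r%:E * (EFin \o h) x)%E).
  exact: integrableZl.
by apply/funext => x.
Qed.

Lemma cID D f g : measurable D -> cintegrable D f -> cintegrable D g ->
  cI D (fun x => f x + g x) = cI D f + cI D g.
Proof.
move=> mD [h1 h2] [h3 h4]; apply: complex_ext => /=.
  by rewrite -RintegralD //; apply: eq_Rintegral => x _; rewrite cReD.
by rewrite -RintegralD //; apply: eq_Rintegral => x _; rewrite cImD.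
Qed.

Lemma cintegrableZ D (k : R[i]) f : measurable D ->
  cintegrable D f -> cintegrable D (fun x => k * f x).
Proof.
move=> mD [h1 h2]; split.
  rewrite (_ : _ \o _ =
     (fun x => (complex.Re k)%:E * (EFin \o (fun x => complex.Re (f x))) x) \+
     (fun x => (- complex.Im k)%:E * (EFin \o (fun x => complex.Im (f x))) x))%E.
    by apply: integrableD => //; apply: integrableZl.
  by apply/funext => x /=; rewrite cReM -!EFinM -EFinD mulNr.
rewrite (_ : _ \o _ =
   (fun x => (complex.Re k)%:E * (EFin \o (fun x => complex.Im (f x))) x) \+
   (fun x => (complex.Im k)%:E * (EFin \o (fun x => complex.Re (f x))) x))%E.
  by apply: integrableD => //; apply: integrableZl.
by apply/funext => x /=; rewrite cImM -!EFinM -EFinD.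
Qed.

Lemma cIZ D (k : R[i]) f : measurable D -> cintegrable D f ->
  cI D (fun x => k * f x) = k * cI D f.
Proof.
move=> mD [h1 h2]; apply: complex_ext => /=.
  rewrite cReM /= -!RintegralZl //.
  rewrite -RintegralB //; try exact: integrableRZ.
  by apply: eq_Rintegral => x _; rewrite cReM.
rewrite cImM /= -!RintegralZl //.
rewrite -RintegralD //; try exact: integrableRZ.
by apply: eq_Rintegral => x _; rewrite cImM.
Qed.

Lemma cintegrableB D f g : measurable D ->
  cintegrable D f -> cintegrable D g -> cintegrable D (fun x => f x - g x).
Proof.
move=> mD hf hg; apply: (@eq_cintegrable _ (fun x => f x + (-1) * g x)) => //.
  by move=> x _; rewrite mulN1r.
by apply: cintegrableD => //; apply: cintegrableZ.
Qed.

Lemma cIB D f g : measurable D -> cintegrable D f -> cintegrable D g ->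
  cI D (fun x => f x - g x) = cI D f - cI D g.
Proof.
move=> mD hf hg; rewrite -(mulN1r (cI D g)) -cIZ // -cID //;
  last exact: cintegrableZ.
by apply: eq_cI => x _; rewrite mulN1r.
Qed.

Lemma cI_conj D f : measurable D -> cintegrable D f ->
  cI D (fun x => conjc (f x)) = conjc (cI D f).
Proof.
move=> mD [h1 h2]; apply: complex_ext => /=.
  by apply: eq_Rintegral => x _; rewrite cReJ.
rewrite -[RHS]mulN1r -RintegralZl //.
by apply: eq_Rintegral => x _; rewrite cImJ mulN1r.
Qed.

Lemma cintegrable_itv (a b : R) f : {in `[a, b], forall x, ccont f x} ->
  cintegrable `[a, b] f.
Proof.
move=> H; split; apply: continuous_compact_integrable;
  try exact: segment_compact; apply: continuous_in_subspaceT => x;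
  by rewrite inE => /H[].
Qed.

(** The factor 2 comes from estimating the real and imaginary parts separately. *)
Lemma cI_bound (a b : R) f (M : R) : a <= b ->
  {in `[a, b], forall x, ccont f x} -> {in `[a, b], forall x, nc (f x) <= M} ->
  nc (cI `[a, b] f) <= 2 * M * (b - a).
Proof.
move=> ab /cintegrable_itv[h1 h2] fM.
have mD : measurable `[a, b]%classic by exact: measurable_itv.
have icst : mu.-integrable `[a, b] (EFin \o cst M).
  apply: continuous_compact_integrable; first exact: segment_compact.
  by apply: continuous_subspaceT => x; exact: cvg_cst.
have key (h : R -> R) : mu.-integrable `[a, b] (EFin \o h) ->
   {in `[a, b], forall x, `|h x| <= M} ->
   `|\int[mu]_(x in `[a, b]) h x| <= M * (b - a).
  move=> ih hM; apply: (le_trans (le_normr_Rintegral _ _)) => //.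
  have -> : M * (b - a) = \int[mu]_(x in `[a, b]) (cst M x).
    rewrite Rintegral_cst //.
    have := @lebesgue_measure_itv R `[a, b]; rewrite /= => ->.
    rewrite lte_fin.
    by case: ltP => // ba; rewrite (@le_anti _ _ a b) ?ab // subrr.
  apply: le_Rintegral => //.
  by apply: integrable_abse ih.
apply: (le_trans (nc_le _)).
rewrite -mulrA mulr2n mulrDl mul1r; apply: lerD; apply: key => // x xab.
  exact: le_trans (cRe_le _) (fM _ xab).
exact: le_trans (cIm_le _) (fM _ xab).
Qed.

Lemma Rint_split (a m b : R) (h : R -> R) : a <= m -> m <= b ->
  mu.-integrable `[a, b] (EFin \o h) ->
  \int[mu]_(x in `[a, b]) h x =
  \int[mu]_(x in `[a, m]) h x + \int[mu]_(x in `[m, b]) h x.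
Proof.
move=> am mb ih.
have := @Rintegral_itvB R h (BLeft a) (BRight b) m ih.
rewrite !bnd_simp => /(_ am mb).
rewrite Rintegral_itv_obnd_cbnd.
  by move/eqP; rewrite subr_eq addrC => /eqP.
apply: integrableS ih => //; apply: subset_itv; rewrite bnd_simp //.
Qed.

Lemma cI_split (a m b : R) f : a <= m -> m <= b -> cintegrable `[a, b] f ->
  cI `[a, b] f = cI `[a, m] f + cI `[m, b] f.
Proof.
move=> am mb [h1 h2]; apply: complex_ext => /=; exact: Rint_split.
Qed.

Lemma cI_set1 (a : R) f : cI `[a, a] f = 0.
Proof. by rewrite set_itv1 /cI !Rintegral_set1. Qed.

Lemma cI0 (D : set R) : cI D (fun=> 0) = 0.
Proof. by apply: complex_ext; rewrite /= /Rintegral integral0. Qed.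

End ComplexIntegral.

(** * Cauchy's theorem for rectangles, by Goursat's bisection *)

Section Goursat.
Variable R : realType.
Implicit Types (F G : R[i] -> R[i]).
Local Notation mu := (@lebesgue_measure R).

Lemma nested_itv (a w : nat -> R) : (forall n, 0 <= w n) ->
  (forall n, a n <= a n.+1) -> (forall n, a n.+1 + w n.+1 <= a n + w n) ->
  exists x, forall n, a n <= x <= a n + w n.
Proof.
move=> w0 a1 aw.
have amono : {homo a : n m / (n <= m)%N >-> n <= m} by apply/nondecreasing_seqP.
have wmono n k : a (n + k)%N + w (n + k)%N <= a n + w n.
  elim: k => [|k IH]; first by rewrite addn0.
  by rewrite addnS (le_trans (aw _)).
have ub n : ubound (range a) (a n + w n).
  move=> _ [m _ <-]; have [mn|nm] := leqP m n.
    by rewrite (le_trans (amono _ _ mn)) // lerDl.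
  by rewrite -(subnKC (ltnW nm)) (le_trans _ (wmono n (m - n)%N)) // lerDl.
have hs : has_sup (range a).
  by split; [exists (a 0%N), 0%N | exists (a 0%N + w 0%N); exact: ub].
exists (sup (range a)) => n; apply/andP; split.
  by apply: ub_le_sup; [case: hs | exists n].
by apply: ge_sup; [case: hs | exact: ub].
Qed.

Lemma itv_dist (p w x u : R) : p <= x <= p + w -> p <= u <= p + w ->
  `|u - x| <= w.
Proof. by rewrite ler_norml => ? ?; lra. Qed.

(* The boundary integral of [F] over the rectangle [[a, b] x [c, d]], with
   opposite sides grouped so that affine functions integrate to 0 pointwise. *)
Definition rectE F (a b c d : R) : R[i] :=
  cI `[a, b] (fun x => F (x +i* c) - F (x +i* d)) +
  'i%C * cI `[c, d] (fun y => F (b +i* y) - F (a +i* y)).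

Definition rdiff F (a b c d : R) : Prop :=
  forall x y, a <= x <= b -> c <= y <= d -> exists l, cdiff F (x +i* y) l.

Lemma cdiff_ccontH F (x y : R) l : cdiff F (x +i* y) l ->
  ccont (fun t => F (t +i* y)) x.
Proof.
have E t : t +i* y = (0 +i* y) + t%:C * 1.
  by apply: complex_ext; rewrite /= ?mulr1 ?mulr0 ?mul0r ?subr0 ?addr0 ?add0r.
by rewrite E => /cdiff_ccont; under eq_fun do rewrite -E.
Qed.

Lemma cdiff_ccontV F (x y : R) l : cdiff F (x +i* y) l ->
  ccont (fun t => F (x +i* t)) y.
Proof.
have E t : x +i* t = (x +i* 0) + t%:C * 'i%C.
  by apply: complex_ext; rewrite /= ?mulr1 ?mulr0 ?mul0r ?subr0 ?addr0 ?add0r.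
by rewrite E => /cdiff_ccont; under eq_fun do rewrite -E.
Qed.

Section Rect.
Variables (F : R[i] -> R[i]) (a b c d : R).
Hypothesis hF : rdiff F a b c d.

Lemma rect_contH y : c <= y <= d -> {in `[a, b], forall x, ccont (fun t => F (t +i* y)) x}.
Proof.
move=> hy x; rewrite in_itv /= => hx.
by have [l] := hF hx hy; exact: cdiff_ccontH.
Qed.

Lemma rect_contV x : a <= x <= b -> {in `[c, d], forall y, ccont (fun t => F (x +i* t)) y}.
Proof.
move=> hx y; rewrite in_itv /= => hy.
by have [l] := hF hx hy; exact: cdiff_ccontV.
Qed.

Lemma rect_cintH : c <= d -> cintegrable `[a, b] (fun x => F (x +i* c) - F (x +i* d)).
Proof.
move=> cd; apply: cintegrable_itv => x hx.
by apply: ccontB; apply: rect_contH; rewrite ?cd ?lexx.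
Qed.

Lemma rect_cintV : a <= b -> cintegrable `[c, d] (fun y => F (b +i* y) - F (a +i* y)).
Proof.
move=> ab; apply: cintegrable_itv => x hx.
by apply: ccontB; apply: rect_contV; rewrite ?ab ?lexx.
Qed.

End Rect.

Lemma rdiff_sub F a b c d a' b' c' d' : rdiff F a b c d ->
  a <= a' -> b' <= b -> c <= c' -> d' <= d -> rdiff F a' b' c' d'.
Proof.
move=> H h1 h2 h3 h4 x y /andP[x1 x2] /andP[y1 y2]; apply: H.
  by rewrite (le_trans h1) // (le_trans x2).
by rewrite (le_trans h3) // (le_trans y2).
Qed.

Lemma rectE_splitH F a m b c d : rdiff F a b c d -> a <= m -> m <= b -> c <= d ->
  rectE F a b c d = rectE F a m c d + rectE F m b c d.
Proof.
move=> H am mb cd; have ab := le_trans am mb.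
rewrite /rectE (@cI_split _ a m b) //; last exact: rect_cintH H cd.
rewrite addrACA -mulrDr -cID //.
- congr (_ + _ * _); apply: eq_cI => y _.
  ring.
- by apply: rect_cintV => //; apply: (rdiff_sub H).
- by apply: rect_cintV => //; apply: (rdiff_sub H).
Qed.

Lemma rectE_splitV F a b c n d : rdiff F a b c d -> a <= b -> c <= n -> n <= d ->
  rectE F a b c d = rectE F a b c n + rectE F a b n d.
Proof.
move=> H ab cn nd; have cd := le_trans cn nd.
rewrite /rectE (@cI_split _ c n d) //; last exact: rect_cintV H ab.
rewrite addrACA -mulrDr; congr (_ + _).
rewrite -cID //.
- by apply: eq_cI => y _; ring.
- by apply: rect_cintH => //; apply: rdiff_sub H _ _ _ _.
- by apply: rect_cintH => //; apply: rdiff_sub H _ _ _ _.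
Qed.

(** An affine function differs by a constant on opposite sides, and the two resulting multiples of
    the area cancel. *)
Lemma rectE_affine F (al be : R[i]) a b c d : a <= b -> c <= d ->
  rdiff F a b c d ->
  rectE F a b c d = rectE (fun s => F s - (al + be * s)) a b c d.
Proof.
move=> ab cd H; rewrite /rectE.
have E1 x : F (x +i* c) - (al + be * (x +i* c)) - (F (x +i* d) - (al + be * (x +i* d))) =
   (F (x +i* c) - F (x +i* d)) - be * ('i%C * (c - d)%:C).
  have -> : 'i%C * (c - d)%:C = (x +i* c) - (x +i* d) :> R[i].
    by apply: complex_ext; rewrite !ReImE /=; ring.
  ring.
have E2 y : F (b +i* y) - (al + be * (b +i* y)) - (F (a +i* y) - (al + be * (a +i* y))) =
   (F (b +i* y) - F (a +i* y)) - be * ((b - a)%:C).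
  have -> : (b - a)%:C = (b +i* y) - (a +i* y) :> R[i].
    by apply: complex_ext; rewrite !ReImE /=; ring.
  ring.
have icst (k : R[i]) (p q : R) : cintegrable `[p, q] (fun=> k).
  by apply: cintegrable_itv => x _; exact: ccont_cst.
have ccst (k : R[i]) (p q : R) : p <= q -> cI `[p, q] (fun=> k) = (q - p)%:C * k.
  move=> pq; rewrite /cI !Rintegral_cst //.
  have -> : fine (lebesgue_measure (`[p, q]%classic : set R)) = q - p.
    have := @lebesgue_measure_itv R `[p, q]; rewrite /= => ->.
    rewrite lte_fin; case: ltP => // qp.
    by rewrite (@le_anti _ _ p q) ?pq // subrr.
  by apply: complex_ext; rewrite /= ?ReImE /=; ring.
rewrite (_ : (fun x => F (x +i* c) - _ - _) = fun x => (F (x +i* c) - F (x +i* d))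
    - be * ('i%C * (c - d)%:C)); last by apply/funext.
rewrite (_ : (fun y => F (b +i* y) - _ - _) = fun y => (F (b +i* y) - F (a +i* y))
    - be * ((b - a)%:C)); last by apply/funext.
rewrite [in RHS]cIB; [|exact: measurable_itv|exact: rect_cintH H cd|exact: icst].
rewrite [cI `[c, d] (fun y => _ - be * _)]cIB; [|exact: measurable_itv|exact: rect_cintV H ab|exact: icst].
rewrite !ccst //.
have -> : (c - d)%:C = - (d - c)%:C :> R[i] by rewrite -rmorphN opprB.
ring.
Qed.

Lemma rectE_bound F a b c d (M : R) : a <= b -> c <= d -> rdiff F a b c d ->
  (forall x y, a <= x <= b -> c <= y <= d -> nc (F (x +i* y)) <= M) ->
  nc (rectE F a b c d) <= 4 * M * ((b - a) + (d - c)).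
Proof.
move=> ab cd H FM; apply: (le_trans (ncD _ _)); rewrite ncM nc_i mul1r.
have -> : 4 * M * ((b - a) + (d - c)) = 2 * (2 * M) * (b - a) + 2 * (2 * M) * (d - c) by ring.
apply: lerD; apply: cI_bound => // x hx.
- by apply: ccontB; apply: (rect_contH H); rewrite ?cd ?lexx.
- apply: (le_trans (ncB _ _)); rewrite mulr2n mulrDl mul1r.
  by move: hx; rewrite in_itv /= => hx; apply: lerD; apply: FM; rewrite ?cd ?lexx.
- by apply: ccontB; apply: (rect_contV H); rewrite ?ab ?lexx.
- apply: (le_trans (ncB _ _)); rewrite mulr2n mulrDl mul1r.
  by move: hx; rewrite in_itv /= => hx; apply: lerD; apply: FM; rewrite ?ab ?lexx.
Qed.

Section Bisection.
Variables (F : R[i] -> R[i]) (a b c d : R).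
Hypotheses (ab : a < b) (cd : c < d) (hF : rdiff F a b c d).
Hypothesis pos : 0 < nc (rectE F a b c d).
(** The bisection keeps the modulus of the boundary integral at least [k] times the area ([big]).
    The integral is additive over the four quarters, so one of them inherits the bound, and [step]
    selects it. *)
Let k : R := nc (rectE F a b c d) / ((b - a) * (d - c)).
Let W n : R := (b - a) / 2 ^+ n.
Let H n : R := (d - c) / 2 ^+ n.
Let E n (p : R * R) := rectE F p.1 (p.1 + W n) p.2 (p.2 + H n).
Let big n p := k * (W n * H n) <= nc (E n p).
Let step n (p : R * R) : R * R :=
  let w := W n.+1 in let h := H n.+1 in
  if big n.+1 p then p else
  if big n.+1 (p.1 + w, p.2) then (p.1 + w, p.2) else
  if big n.+1 (p.1, p.2 + h) then (p.1, p.2 + h) else (p.1 + w, p.2 + h).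
Let pt := fix pt n := if n is m.+1 then step m (pt m) else (a, c).

Let W0 n : 0 < W n. Proof. by rewrite divr_gt0 ?subr_gt0 // exprn_gt0. Qed.
Let H0 n : 0 < H n. Proof. by rewrite divr_gt0 ?subr_gt0 // exprn_gt0. Qed.

Let WS n : W n = W n.+1 + W n.+1.
Proof. by rewrite /W exprS; field; rewrite expf_neq0 // pnatr_eq0. Qed.

Let HS n : H n = H n.+1 + H n.+1.
Proof. by rewrite /H exprS; field; rewrite expf_neq0 // pnatr_eq0. Qed.

Let inside n (p : R * R) :=
  [/\ a <= p.1, p.1 + W n <= b, c <= p.2 & p.2 + H n <= d].

Let step_sub n p : let q := step n p in
  [/\ p.1 <= q.1, q.1 + W n.+1 <= p.1 + W n, p.2 <= q.2
    & q.2 + H n.+1 <= p.2 + H n].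
Proof.
have := W0 n.+1; have := H0 n.+1; rewrite /step (WS n) (HS n).
by case: ifP => _; [|case: ifP => _; [|case: ifP => _]] => h w; split => /=; lra.
Qed.

Let step_inside n p : inside n p -> inside n.+1 (step n p).
Proof.
case=> p1 p2 p3 p4; have [q1 q2 q3 q4] := step_sub n p; split.
- exact: le_trans q1.
- exact: le_trans p2.
- exact: le_trans q3.
- exact: le_trans p4.
Qed.

Let step_big n p : inside n p -> big n p -> big n.+1 (step n p).
Proof.
case=> p1 p2 p3 p4 bp; have w0 := W0 n.+1; have h0 := H0 n.+1.
rewrite /step; case: ifPn => [//|n1]; case: ifPn => [//|n2].
case: ifPn => [//|n3]; apply: contraLR bp => n4.
rewrite /big -ltNge.
have hFp : rdiff F p.1 (p.1 + W n) p.2 (p.2 + H n) by apply: rdiff_sub hF _ _ _ _.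
have -> : E n p = E n.+1 p + E n.+1 (p.1 + W n.+1, p.2) +
   (E n.+1 (p.1, p.2 + H n.+1) + E n.+1 (p.1 + W n.+1, p.2 + H n.+1)).
  have eW := WS n; have eH := HS n.
  have aW : p.1 + W n.+1 + W n.+1 = p.1 + W n by rewrite eW addrA.
  have aH : p.2 + H n.+1 + H n.+1 = p.2 + H n by rewrite eH addrA.
  rewrite /E /= aW aH.
  rewrite -(rectE_splitH (m := p.1 + W n.+1)); [|apply: (rdiff_sub hFp); lra|lra|lra|lra].
  rewrite -(rectE_splitH (m := p.1 + W n.+1)); [|apply: (rdiff_sub hFp); lra|lra|lra|lra].
  apply: rectE_splitV => //; lra.
have -> : k * (W n * H n) = k * (W n.+1 * H n.+1) + k * (W n.+1 * H n.+1)
     + (k * (W n.+1 * H n.+1) + k * (W n.+1 * H n.+1)) by rewrite (WS n) (HS n); ring.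
apply: (le_lt_trans (ncD _ _)); apply: ltrD;
  by apply: (le_lt_trans (ncD _ _)); apply: ltrD; rewrite ltNge.
Qed.

Let pt_inside n : inside n (pt n).
Proof.
elim: n => [|n IH]; last exact: step_inside.
by rewrite /inside /W /H expr0 !divr1 /=; split; lra.
Qed.

Let pt_big n : big n (pt n).
Proof.
elim: n => [|n IH]; last exact: step_big.
rewrite /big /E /W /H expr0 !divr1 /= [a + _]addrC [c + _]addrC !subrK /k mulfVK //.
by rewrite mulf_neq0 // gt_eqF ?subr_gt0.
Qed.

(** At the common point of the nested rectangles [F] is affine up to [e] times the distance. Hence
    the integral over the n-th rectangle is at most [4 * e * (S / 2 ^+ n) ^+ 2], less than the bound
    kept by [big]. *)
Lemma goursat_absurd : False.
Proof.
have [x hx] : exists x, forall n, (pt n).1 <= x <= (pt n).1 + W n.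
  apply: nested_itv => n; first exact: ltW.
  - by have [] := step_sub n (pt n).
  - by have [] := step_sub n (pt n).
have [y hy] : exists y, forall n, (pt n).2 <= y <= (pt n).2 + H n.
  apply: nested_itv => n; first exact: ltW.
  - by have [] := step_sub n (pt n).
  - by have [] := step_sub n (pt n).
have [l Hl] : exists l, cdiff F (x +i* y) l.
  apply: hF; [move: (hx 0%N)|move: (hy 0%N)]; rewrite /W /H expr0 divr1 /=; lra.
have ba0 : 0 < b - a by rewrite subr_gt0.
have dc0 : 0 < d - c by rewrite subr_gt0.
have k0 : 0 < k by rewrite divr_gt0 // mulr_gt0.
pose S := (b - a) + (d - c).
have S0 : 0 < S by rewrite addr_gt0.
(* With this [e] the upper bound is exactly half of the lower bound. *)
pose e := k * ((b - a) * (d - c)) / (8 * S ^+ 2).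
have e0 : 0 < e.
  by apply: divr_gt0; apply: mulr_gt0 => //; [exact: mulr_gt0|exact: exprn_gt0].
have [de de0 Hde] := Hl _ e0.
have [n hn] : exists n, S / 2 ^+ n < de.
  have [n hn] : exists n : nat, S / de < n%:R.
    by exists (Num.trunc (S / de)).+1; exact: truncnS_gt.
  exists n; rewrite ltr_pdivrMr ?exprn_gt0 // mulrC -ltr_pdivrMr //.
  by apply: (lt_trans hn); rewrite -natrX ltr_nat ltn_expl.
have := pt_big n; rewrite /big /E.
have := pt_inside n; rewrite /inside; set p := pt n; move=> [p1 p2 p3 p4].
have hFp : rdiff F p.1 (p.1 + W n) p.2 (p.2 + H n) by apply: rdiff_sub hF _ _ _ _.
have wn := ltW (W0 n); have hn' := ltW (H0 n).
pose al := F (x +i* y) - l * (x +i* y).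
rewrite (@rectE_affine _ al l) ?lerDl //.
have SE : W n + H n = S / 2 ^+ n by rewrite /W /H /S -mulrDl.
have bd : nc (rectE (fun s => F s - (al + l * s)) p.1 (p.1 + W n) p.2 (p.2 + H n))
   <= 4 * (e * (S / 2 ^+ n)) * ((p.1 + W n - p.1) + (p.2 + H n - p.2)).
  apply: rectE_bound; rewrite ?lerDl //.
    move=> u v hu hv; have [m Hm] := hFp u v hu hv; exists (m - l) => e' e'0.
    have [d1 d10 Hd1] := Hm _ e'0; exists d1 => // h /Hd1.
    rewrite (_ : F (u +i* v + h) - _ - _ = F (u +i* v + h) - (al + l * (u +i* v + h))
      - (F (u +i* v) - (al + l * (u +i* v))) - (m - l) * h) //; ring.
  move=> u v hu hv.
  have -> : u +i* v = (x +i* y) + ((u - x) +i* (v - y)).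
    by apply: complex_ext; rewrite !ReImE /=; ring.
  set h := (u - x) +i* _.
  have hh : nc h <= S / 2 ^+ n.
    apply: (le_trans (nc_le _)); rewrite -SE /=.
    by apply: lerD; [exact: itv_dist (hx n) hu|exact: itv_dist (hy n) hv].
  have -> : F (x +i* y + h) - (al + l * (x +i* y + h)) = F (x +i* y + h) - F (x +i* y) - l * h.
    by rewrite /al; ring.
  apply: (le_trans (Hde h _)); first exact: le_lt_trans hn.
  by apply: ler_wpM2l => //; apply: ltW.
move=> /le_trans/(_ bd).
rewrite [p.1 + _]addrC addrK [p.2 + _]addrC addrK SE /W /H /e.
have P0 : 0 < 2 ^+ n :> R by rewrite exprn_gt0.
rewrite leNgt => /negP; apply.
rewrite (_ : _ * (S / 2 ^+ n) = k * ((b - a) / 2 ^+ n * ((d - c) / 2 ^+ n)) / 2); last first.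
  by field; rewrite !gt_eqF.
set X := k * _; have X0 : 0 < X.
  by apply: mulr_gt0 => //; apply: mulr_gt0; apply: divr_gt0.
by rewrite ltr_pdivrMr // ltr_pMr // ltr1n.
Qed.

End Bisection.

Lemma goursat F a b c d : a <= b -> c <= d -> rdiff F a b c d ->
  rectE F a b c d = 0.
Proof.
move=> ab cd hF; apply/eqP; rewrite -nc_eq0; apply/negPn/negP => ne.
have pos : 0 < nc (rectE F a b c d) by rewrite lt_def ne nc_ge0.
have [abE|abN] := eqVneq a b.
  move: ne; rewrite /rectE abE cI_set1 add0r.
  rewrite (_ : (fun y => _) = fun=> 0); last by apply/funext => y; rewrite subrr.
  by rewrite cI0 mulr0 nc0 eqxx.
have [cdE|cdN] := eqVneq c d.
  move: ne; rewrite /rectE cdE cI_set1 mulr0 addr0.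
  rewrite (_ : (fun y => _) = fun=> 0); last by apply/funext => y; rewrite subrr.
  by rewrite cI0 nc0 eqxx.
by apply: (@goursat_absurd F a b c d) => //; rewrite lt_neqAle ?abN ?cdN.
Qed.

End Goursat.

(** * Moving a line of integration inside a strip *)

Section StripShift.
Variable R : realType.
Local Notation mu := (@lebesgue_measure R).

Lemma Rdominated (h_ : nat -> R -> R) (h g : R -> R) :
  (forall n, measurable_fun (setT : set R) (h_ n)) ->
  measurable_fun (setT : set R) h ->
  (forall x, h_ ^~ x @ \oo --> h x) ->
  mu.-integrable setT (EFin \o g) -> (forall n x, `|h_ n x| <= g x) ->
  (\int[mu]_(x in setT) h_ n x)%R @[n --> \oo] --> (\int[mu]_(x in setT) h x)%R.
Proof.
move=> mh_ mh hh ig hg.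
have meh n : measurable_fun (setT : set R) (EFin \o h_ n) by apply/measurable_EFinP.
have meh' : measurable_fun (setT : set R) (EFin \o h) by apply/measurable_EFinP.
have cE x : (fun n => (h_ n x)%:E) @ \oo --> (h x)%:E.
  by apply: cvg_EFin; [exact: nearW | exact: hh].
have [i1 _ i3] := @dominated_convergence _ _ _ mu setT measurableT
   (fun n => EFin \o h_ n) (EFin \o h) (EFin \o g) meh meh'
   (aeW mu (fun x _ => cE x))
   ig (aeW mu (fun x n _ => hg n x)).
apply: fine_cvg; rewrite fineK //.
by apply: integrable_fin_num.
Qed.

Lemma Rint_trunc (h : R -> R) : mu.-integrable setT (EFin \o h) ->
  (\int[mu]_(x in `[(- n%:R), n%:R]) h x)%R @[n --> \oo] -->
  (\int[mu]_(x in setT) h x)%R.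
Proof.
move=> ih.
have mh : measurable_fun (setT : set R) h.
  by apply/measurable_EFinP; exact: measurable_int ih.
under eq_fun do rewrite Rintegral_mkcond.
apply: (@Rdominated _ _ (fun x => `|h x|)) => //.
- move=> n; apply: (iffLR (measurable_restrictT h (measurable_itv _))).
  exact: measurable_funTS.
- move=> x; apply: cvg_near_cst; near=> n.
  rewrite patchE ifT //; rewrite inE /= in_itv /= -ler_norml.
  by near: n; exact: nbhs_infty_ger.
- by apply: integrable_abse ih.
- move=> n x; rewrite patchE; case: ifP => // _.
  by rewrite normr0.
Unshelve. all: by end_near.
Qed.

Lemma Rint_small (h : R -> R) (K : R) : mu.-integrable setT (EFin \o h) ->
  (\forall n \near \oo, `|\int[mu]_(x in `[(- n%:R), n%:R]) h x| <= K / n%:R) ->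
  \int[mu]_(x in setT) h x = 0.
Proof.
move=> ih hK; have c1 := Rint_trunc ih.
apply: (cvg_unique _ c1) => //.
have cK : (fun n : nat => K / n%:R) @ \oo --> (0 : R).
  rewrite -(mulr0 K); apply: cvgM; first exact: cvg_cst.
  exact/gtr0_cvgV0/cvgr_idn/nbhs_infty_gtr.
have cNK : (fun n : nat => - (K / n%:R)) @ \oo --> (0 : R).
  by rewrite -oppr0; apply: cvgN.
apply: (squeeze_cvgr _ cNK cK).
by near=> n; rewrite -ler_norml; near: n.
Unshelve. all: by end_near.
Qed.

(** Cauchy's theorem on [[-n, n] x [c, d]]: the decay makes the vertical sides O(1/n), so the
    truncated integrals over the two horizontal lines have the same limit. *)
Lemma strip_shift (G : R[i] -> R[i]) (c d K B : R) : c <= d ->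
  (forall x y, c <= y <= d -> exists l, cdiff G (x +i* y) l) ->
  (forall x y, c <= y <= d -> B <= `|x| -> nc (G (x +i* y)) <= K / `|x|) ->
  cintegrable setT (fun x => G (x +i* c)) ->
  cintegrable setT (fun x => G (x +i* d)) ->
  cI setT (fun x => G (x +i* c)) = cI setT (fun x => G (x +i* d)).
Proof.
move=> cd hG hK ic id; apply/eqP; rewrite -subr_eq0 -cIB //; apply/eqP.
have iD := cintegrableB measurableT ic id.
have small : \forall n \near \oo,
    nc (cI `[(- n%:R), n%:R] (fun x => G (x +i* c) - G (x +i* d))) <=
    (4 * `|K| * (d - c)) / n%:R.
  near=> n.
  have n0 : 0 < n%:R :> R by near: n; exact: nbhs_infty_gtr.
  have nB : B <= n%:R by near: n; exact: nbhs_infty_ger.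
  have nn : - n%:R <= n%:R :> R by rewrite (le_trans _ (ltW n0)) // oppr_le0 ltW.
  have rd : rdiff G (- n%:R) n%:R c d by move=> x y _ /hG.
  have := goursat nn cd rd.
  rewrite /rectE => /eqP; rewrite addr_eq0 => /eqP ->.
  rewrite ncN ncM nc_i mul1r.
  have -> : 4 * `|K| * (d - c) / n%:R = 2 * (2 * (`|K| / n%:R)) * (d - c) by ring.
  apply: cI_bound => // y hy.
    by apply: ccontB; apply: (rect_contV rd); rewrite ?nn ?lexx.
  move: hy; rewrite in_itv /= => hy.
  have b (x : R) : `|x| = n%:R -> nc (G (x +i* y)) <= `|K| / n%:R.
    move=> xn; apply: (le_trans (hK _ _ hy _)); rewrite xn //.
    by rewrite ler_pM2r ?invr_gt0 // ler_norm.
  apply: (le_trans (ncB _ _)); rewrite mulr2n mulrDl mul1r.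
  by apply: lerD; apply: b; rewrite ?normrN ger0_norm // ltW.
apply: complex_ext => /=.
  apply: (@Rint_small _ (4 * `|K| * (d - c))); first by case: iD.
  near=> n; apply: le_trans (cRe_le (cI _ _)) _; near: n.
  exact: small.
apply: (@Rint_small _ (4 * `|K| * (d - c))); first by case: iD.
near=> n; apply: le_trans (cIm_le (cI _ _)) _; near: n.
exact: small.
Unshelve. all: by end_near.
Qed.

End StripShift.

(** * Integrability from power decay *)

Section Decay.
Variable R : realType.
Local Notation mu := (@lebesgue_measure R).

Definition ptail (e x : R) : R := (1 + `|x|) `^ (- 1 - e).

Lemma ptail_ge0 e x : 0 <= ptail e x.
Proof. exact: powR_ge0. Qed.

Lemma ptail_cont e : continuous (ptail e).
Proof.
move=> x.
have c1 : {for x, continuous (fun x : R => 1 + `|x|)}.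
  apply: cvgD; first exact: cvg_cst.
  exact: norm_continuous.
have c2 : {for (1 + `|x|), continuous (fun y : R => y `^ (- 1 - e))}.
  apply: differentiable_continuous; apply/derivable1_diffP.
  by apply: derivable_powR; rewrite in_itv /= andbT ltr_wpDr.
exact: (continuous_comp c1 c2).
Qed.

Lemma powR_cvgy (e : R) : 0 < e -> (1 + x) `^ (- e) @[x --> +oo%R] --> (0 : R).
Proof.
move=> e0; apply/cvgr0Pnorm_le => d d0; near=> x.
have x1 : 0 <= 1 + x.
  have : 0 <= x by near: x; exact: nbhs_pinfty_ge.
  lra.
have p0 : 0 < d `^ (- e^-1) by apply: powR_gt0.
have hx : d `^ (- e^-1) <= 1 + x.
  have : d `^ (- e^-1) <= x by near: x; exact: nbhs_pinfty_ge.
  lra.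
rewrite ger0_norm ?powR_ge0 // powRN invf_ple ?posrE //; last first.
  by rewrite powR_gt0 // (lt_le_trans p0).
have -> : d^-1 = (d `^ (- e^-1)) `^ e.
  by rewrite -powRrM mulNr mulVf ?gt_eqF // powR_inv1 // ltW.
by apply: ge0_ler_powR; rewrite ?nnegrE // ltW.
Unshelve. all: by end_near.
Qed.

Lemma ptail_int e : 0 < e -> mu.-integrable setT (EFin \o ptail e).
Proof.
move=> e0; apply/integrableP; split.
  by apply/measurable_EFinP; apply: continuous_measurable_fun; exact: ptail_cont.
under eq_integral do rewrite /= ger0_norm ?ptail_ge0 //.
rewrite ge0_symfun_integralT //; last 3 first.
- by move=> x; exact: ptail_ge0.
- exact: ptail_cont.
- by move=> x; rewrite /ptail /= normrN.
rewrite -set_itvcy.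
pose F (x : R) : R := - e^-1 * (1 + x) `^ (- e).
have dF (x : R) : -1 < x -> is_derive x 1 F ((1 + x) `^ (- 1 - e)).
  move=> x0; have x1 : 0 < 1 + x by rewrite -ltrBlDl sub0r.
  have h1 : is_derive (1 + x) 1 (@powR R ^~ (- e)) (- e * (1 + x) `^ (- e - 1)).
    exact: is_derive1_powR.
  have h2 : is_derive x 1 (fun y : R => 1 + y) (1 : R).
    have h : is_derive x 1 ((cst 1 : R -> R) + id) ((0 : R) + 1) by exact: is_deriveD.
    by move: h; rewrite add0r.
  have h3 := is_derive1_comp h1 h2.
  rewrite /F; apply: (@is_derive_eq _ _ _ _ _ _ _ _ (is_deriveZ (- e^-1) h3)).
  rewrite /GRing.scale /= mulr1 mulrA mulrNN mulVf ?gt_eqF // mul1r.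
  by congr (_ `^ _); ring.
rewrite (@ge0_continuous_FTC2y _ (ptail e) F 0 0).
- by rewrite -EFinB -EFinM ltry.
- by move=> x _; exact: ptail_ge0.
- by apply: continuous_subspaceT; exact: ptail_cont.
- rewrite -(mulr0 (- e^-1)); apply: cvgM; first exact: cvg_cst.
  exact: powR_cvgy.
- by move=> x x0; apply: ex_derive; apply: (dF x); rewrite (lt_trans _ x0).
- apply: cvg_at_right_filter.
  have := dF 0 (ltrN10 _) => h; have := @ex_derive _ _ _ _ _ _ _ h.
  by move=> /derivable1_diffP /differentiable_continuous.
- move=> x; rewrite in_itv /= andbT => x0.
  rewrite derive1E; have h := dF x (lt_trans (ltrN10 _) x0).
  by rewrite (@derive_val _ _ _ _ _ _ _ h) /ptail gtr0_norm.
Unshelve. all: by end_near.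
Qed.

Lemma le_ptail_int e (K : R) (h : R -> R) : 0 < e ->
  measurable_fun (setT : set R) h -> (forall x, `|h x| <= K * ptail e x) ->
  mu.-integrable setT (EFin \o h).
Proof.
move=> e0 mh hK.
have i1 := integrableRZ K (@measurableT _ _) (ptail_int e0).
apply: (le_integrable (@measurableT _ _) _ _ i1); first exact/measurable_EFinP.
move=> x _ /=; rewrite lee_fin.
exact: le_trans (hK x) (ler_norm _).
Qed.

Lemma powR_le_neg (p a b : R) : p <= 0 -> 0 < a -> a <= b -> b `^ p <= a `^ p.
Proof.
move=> p0 a0 ab; have b0 := lt_le_trans a0 ab.
rewrite -[p]opprK !(powRN _ (- p)) lef_pV2 ?posrE ?powR_gt0 //.
by apply: ge0_ler_powR; rewrite ?nnegrE ?oppr_ge0 // ltW.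
Qed.

(* Continuity bounds [h] on the compact part, where no decay is assumed. *)
Lemma ptail_dom e (M B : R) (h : R -> R) : continuous h ->
  (forall x, B <= `|x| -> `|h x| <= M * `|x| `^ (- 1 - e)) -> - 1 - e <= 0 ->
  exists K, forall x, `|h x| <= K * ptail e x.
Proof.
move=> ch hM e0.
pose C := Num.max 1 B.
have C1 : 1 <= C by rewrite le_max lexx.
have C0 : 0 < C by apply: lt_le_trans C1.
have [K1 hK1] : exists K1, forall x, `|x| <= C -> `|h x| <= K1.
  have cN : {within `[(- C), C], continuous (fun x => `|h x|)}.
    apply: continuous_subspaceT => x; apply: continuous_comp; first exact: ch.
    exact: norm_continuous.
  have [|m _ hm] := EVT_max _ cN; first by lra.
  exists `|h m| => x xC; apply: hm; rewrite in_itv /= -ler_norml //.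
have q0 : 0 < (1 + C) `^ (- 1 - e) by rewrite powR_gt0 // ltr_wpDl // ltW.
have q1 : 0 < 2 `^ (- 1 - e) :> R by rewrite powR_gt0.
exists (Num.max (`|K1| / (1 + C) `^ (- 1 - e)) (`|M| / 2 `^ (- 1 - e))) => x.
rewrite maxr_pMl ?ptail_ge0 // le_max.
have [xC|Cx] := leP `|x| C.
  apply/orP; left; rewrite mulrAC ler_pdivlMr //.
  apply: ler_pM => //; first exact: powR_ge0.
    exact: le_trans (hK1 _ xC) (ler_norm _).
  by apply: powR_le_neg => //; lra.
apply/orP; right.
have x1 : 1 <= `|x| by apply: le_trans (ltW Cx).
have xB : B <= `|x| by apply: le_trans (ltW Cx); rewrite le_max lexx orbT.
apply: (le_trans (hM _ xB)).
rewrite mulrAC ler_pdivlMr // -mulrA.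
apply: (@le_trans _ _ (`|M| * (`|x| `^ (- 1 - e) * 2 `^ (- 1 - e)))).
  by apply: ler_wpM2r; [rewrite mulr_ge0 ?powR_ge0|exact: ler_norm].
apply: ler_wpM2l => //.
by rewrite -powRM ?normr_ge0 // /ptail; apply: powR_le_neg => //; lra.
Qed.

End Decay.

(** * Semi-inner products and a range criterion for essential self-adjointness *)

Section SemiHilbert.
Variables (R : realType) (V : lmodType R[i]) (H : ip_space V).
Implicit Types (u v w : V) (T : set (V * V)).

Record semi_hilbert : Prop := SemiHilbert {
  sh_vec0 : vec H 0;
  sh_vecD : forall (a : R[i]) u v, vec H u -> vec H v -> vec H (a *: u + v);
  sh_ipl : forall (a : R[i]) u v w, vec H u -> vec H v -> vec H w ->
    ip H (a *: u + v) w = a * ip H u w + ip H v w;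
  sh_conj : forall u v, vec H u -> vec H v -> ip H v u = conjc (ip H u v);
  sh_pos : forall u, vec H u -> 0 <= complex.Re (ip H u u) }.

Hypothesis hH : semi_hilbert.

Lemma sh_vecZ (a : R[i]) u : vec H u -> vec H (a *: u).
Proof. by move=> hu; rewrite -[_ *: _]addr0; apply: sh_vecD => //; exact: sh_vec0. Qed.

Lemma sh_vecA u v : vec H u -> vec H v -> vec H (u + v).
Proof. by move=> hu hv; rewrite -[u]scale1r; exact: sh_vecD. Qed.

Lemma sh_vecB u v : vec H u -> vec H v -> vec H (u - v).
Proof. by move=> hu hv; rewrite -scaleN1r; apply: sh_vecA => //; exact: sh_vecZ. Qed.

Lemma ip0l u : vec H u -> ip H 0 u = 0.
Proof.
move=> hu; have := sh_ipl hH 1 (sh_vec0 hH) (sh_vec0 hH) hu.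
rewrite scale1r addr0 mul1r => /eqP; rewrite -subr_eq0 opprD addrA subrr add0r oppr_eq0.
by move/eqP.
Qed.

Lemma ipDl u v w : vec H u -> vec H v -> vec H w ->
  ip H (u + v) w = ip H u w + ip H v w.
Proof. by move=> hu hv hw; rewrite -[u]scale1r sh_ipl // mul1r scale1r. Qed.

Lemma ipZl a u w : vec H u -> vec H w -> ip H (a *: u) w = a * ip H u w.
Proof.
move=> hu hw; rewrite -[_ *: _]addr0 sh_ipl ?ip0l ?addr0 //; exact: sh_vec0.
Qed.

Lemma ipBl u v w : vec H u -> vec H v -> vec H w ->
  ip H (u - v) w = ip H u w - ip H v w.
Proof.
move=> hu hv hw; rewrite -scaleN1r ipDl ?ipZl ?mulN1r //; exact: sh_vecZ.
Qed.

Lemma ipDr u v w : vec H u -> vec H v -> vec H w ->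
  ip H w (u + v) = ip H w u + ip H w v.
Proof.
move=> hu hv hw; rewrite (sh_conj hH (sh_vecA hu hv) hw) ipDl // rmorphD /=.
by rewrite -!(sh_conj hH _ hw).
Qed.

Lemma ipZr a u w : vec H u -> vec H w -> ip H w (a *: u) = conjc a * ip H w u.
Proof.
move=> hu hw; rewrite (sh_conj hH (sh_vecZ a hu) hw) ipZl // rmorphM /=.
by rewrite -(sh_conj hH _ hw).
Qed.

Lemma ipBr u v w : vec H u -> vec H v -> vec H w ->
  ip H w (u - v) = ip H w u - ip H w v.
Proof.
move=> hu hv hw; rewrite -scaleN1r ipDr ?ipZr //; last exact: sh_vecZ.
by rewrite rmorphN rmorph1 mulN1r.
Qed.

Lemma sqnorm_ip u : vec H u -> ip H u u = (sqnorm H u)%:C.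
Proof.
move=> hu; apply: complex_ext => //=.
have := sh_conj hH hu hu => /(congr1 (@complex.Im R)); rewrite cImJ => E; lra.
Qed.

Lemma sqnorm_ge0 u : vec H u -> 0 <= sqnorm H u.
Proof. exact: sh_pos. Qed.

Lemma sqnormZ a u : vec H u -> sqnorm H (a *: u) = nc a ^+ 2 * sqnorm H u.
Proof.
move=> hu; rewrite /sqnorm ipZl ?ipZr //; last exact: sh_vecZ.
rewrite sqnorm_ip // mulrA cReM /= mulr0 subr0; congr (_ * _).
by rewrite normc_sqr; case: a => x y; rewrite cReM /=; ring.
Qed.

Lemma sqnormD u v : vec H u -> vec H v ->
  sqnorm H (u + v) = sqnorm H u + sqnorm H v + 2 * complex.Re (ip H u v).
Proof.
move=> hu hv; rewrite /sqnorm ipDl ?ipDr //; try exact: sh_vecA.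
by rewrite (sh_conj hH hu hv) !ReImE; ring.
Qed.

Lemma cauchy_schwarz u v : vec H u -> vec H v ->
  nc (ip H u v) ^+ 2 <= sqnorm H u * sqnorm H v.
Proof.
move=> hu hv; set A := nc (ip H u v) ^+ 2.
have A0 : 0 <= A by rewrite exprn_ge0 ?nc_ge0.
have key (t : R) : 0 <= sqnorm H u - 2 * t * A + t ^+ 2 * A * sqnorm H v.
  pose k : R[i] := - (t%:C * ip H u v).
  have := sqnorm_ge0 (sh_vecA hu (sh_vecZ k hv)).
  rewrite sqnormD ?sqnormZ ?ipZr //; last exact: sh_vecZ.
  rewrite /k ncN ncM nc_real exprMn real_normK ?num_real // -/A.
  set B := complex.Re _; have -> : B = - (t * A).
    by rewrite /B /A normc_sqr !ReImE /=; ring.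
  by move=> h; apply: (le_trans h); rewrite le_eqVlt; apply/orP; left; apply/eqP; ring.
(* A vector of norm zero may be nonzero; [key] is then affine in [t], and a large [t] forces
   [A = 0]. *)
have [v0|v0] := eqVneq (sqnorm H v) 0.
  rewrite v0 mulr0.
  have [//|Apos] := leP A 0.
  have := key ((sqnorm H u + 1) / (2 * A)); rewrite v0 mulr0 addr0.
  rewrite (_ : 2 * ((sqnorm H u + 1) / (2 * A)) * A = sqnorm H u + 1); first lra.
  by field; rewrite gt_eqF.
have vp : 0 < sqnorm H v by rewrite lt_def v0 sqnorm_ge0.
have := key (sqnorm H v)^-1.
rewrite (_ : _ + _ = sqnorm H u - A / sqnorm H v); last by field.
by rewrite subr_ge0 ler_pdivrMr.
Qed.

Definition hn u : R := Num.sqrt (sqnorm H u).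

Lemma hn_ge0 u : 0 <= hn u. Proof. exact: sqrtr_ge0. Qed.

Lemma hn_sqr u : vec H u -> hn u ^+ 2 = sqnorm H u.
Proof. by move=> hu; rewrite sqr_sqrtr // sqnorm_ge0. Qed.

Lemma ip_hn u v : vec H u -> vec H v -> nc (ip H u v) <= hn u * hn v.
Proof.
move=> hu hv; rewrite -(@ler_pXn2r _ 2) ?nnegrE ?nc_ge0 ?mulr_ge0 ?hn_ge0 //.
by rewrite exprMn !hn_sqr // cauchy_schwarz.
Qed.

Lemma hnD u v : vec H u -> vec H v -> hn (u + v) <= hn u + hn v.
Proof.
move=> hu hv; rewrite -(@ler_pXn2r _ 2) ?nnegrE ?addr_ge0 ?hn_ge0 //.
rewrite hn_sqr ?sqnormD //; last exact: sh_vecA.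
rewrite sqrrD !hn_sqr //.
suff : complex.Re (ip H u v) <= hn u * hn v by rewrite -mulr_natl; lra.
by apply: (le_trans (ler_norm _)); apply: (le_trans (cRe_le _)); exact: ip_hn.
Qed.

Lemma hnZ a u : vec H u -> hn (a *: u) = nc a * hn u.
Proof.
move=> hu; rewrite /hn sqnormZ // sqrtrM ?exprn_ge0 ?nc_ge0 //.
by rewrite sqrtr_sqr ger0_norm ?nc_ge0.
Qed.

Lemma hnB u v : vec H u -> vec H v -> hn (u - v) <= hn u + hn v.
Proof.
move=> hu hv; apply: (le_trans (hnD hu _)); rewrite -scaleN1r; first exact: sh_vecZ.
by rewrite hnZ // ncN nc1 mul1r.
Qed.

Lemma hn_lt u (e : R) : vec H u -> 0 < e -> (sqnorm H u < e ^+ 2) = (hn u < e).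
Proof.
by move=> hu e0; rewrite -hn_sqr // ltr_pXn2r // ?nnegrE ?hn_ge0 ?ltW.
Qed.

Lemma null_hn u : vec H u -> hn u = 0 -> null H u.
Proof.
by move=> hu h; split=> //; rewrite sqnorm_ip // -hn_sqr // h expr0n.
Qed.

Lemma null_of_small u : vec H u ->
  (forall e, 0 < e -> hn u <= e) -> null H u.
Proof.
move=> hu h; apply: null_hn => //; apply/eqP; rewrite eq_le hn_ge0 andbT.
by apply/ler_addgt0Pl => e e0; rewrite addr0; exact: h.
Qed.

Lemma hn_null u : null H u -> hn u = 0.
Proof. by case=> hu h0; rewrite /hn /sqnorm h0 sqrtr0. Qed.

Lemma nullZ a u : null H u -> null H (a *: u).
Proof.
move=> nu; have hu := nu.1; apply: null_hn; first exact: sh_vecZ.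
by rewrite hnZ // hn_null // mulr0.
Qed.

Lemma nullD u v : null H u -> null H v -> null H (u + v).
Proof.
move=> nu nv; have hu := nu.1; have hv := nv.1; apply: null_hn; first exact: sh_vecA.
apply/eqP; rewrite eq_le hn_ge0 andbT; apply: (le_trans (hnD hu hv)).
by rewrite !hn_null // addr0.
Qed.

Lemma dense_orth_null (K : set V) u : vec H u ->
  (forall v, K v -> vec H v) ->
  (forall v e, vec H v -> 0 < e -> exists2 k, K k & hn (v - k) < e) ->
  (forall k, K k -> ip H k u = 0) -> null H u.
Proof.
move=> hu Kv Kd Ko; apply: null_of_small => // e e0.
have [k Kk hk] := Kd u e hu e0; have vk := Kv k Kk.
have := ip_hn (sh_vecB hu vk) hu; rewrite ipBl // (Ko _ Kk) subr0 sqnorm_ip //.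
rewrite nc_real ger0_norm ?sqnorm_ge0 // -hn_sqr // expr2 => h.
have [h0|h0] := eqVneq (hn u) 0; first by rewrite h0 ltW.
have hp : 0 < hn u by rewrite lt_def h0 hn_ge0.
by move: h; rewrite ler_pM2r // => h; exact: le_trans h (ltW hk).
Qed.

Lemma closure_ortho T y : (forall x, T x -> vec H x.1 /\ vec H x.2) ->
  vec H y.1 -> vec H y.2 ->
  (forall x, T x -> ip H x.2 y.1 = ip H x.1 y.2) ->
  forall x, closure_op H T x -> ip H x.2 y.1 = ip H x.1 y.2.
Proof.
move=> Tv y1 y2 Ty x [x1 x2 xc]; apply/eqP; rewrite -subr_eq0 -nc_eq0.
rewrite eq_le nc_ge0 andbT; apply/ler_addgt0Pl => e e0; rewrite addr0.
pose K := hn y.1 + hn y.2 + 1.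
have K0 : 0 < K by rewrite ltr_wpDl // addr_ge0 ?hn_ge0.
have d0 : 0 < e / K by rewrite divr_gt0.
have [x' [Tx' h1 h2]] := xc _ (exprn_gt0 2 d0).
have [v1 v2] := Tv _ Tx'.
move: h1 h2; rewrite !hn_lt //; try exact: sh_vecB.
move=> /ltW h1 /ltW h2.
have -> : ip H x.2 y.1 - ip H x.1 y.2 = ip H (x.2 - x'.2) y.1 - ip H (x.1 - x'.1) y.2.
  by rewrite !ipBl // (Ty _ Tx'); ring.
apply: (le_trans (ncB _ _)).
apply: (@le_trans _ _ (e / K * hn y.1 + e / K * hn y.2)).
  by apply: lerD; apply: (le_trans (ip_hn (sh_vecB _ _) _)) => //;
     apply: ler_wpM2r => //; exact: hn_ge0.
rewrite -mulrDr -[leRHS](@divfK _ K) ?gt_eqF //.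
by apply: ler_wpM2l; [exact: ltW | rewrite lerDl].
Qed.

Lemma sub_closure T x : (forall x, T x -> vec H x.1 /\ vec H x.2) ->
  T x -> closure_op H T x.
Proof.
move=> Tv Tx; have [v1 v2] := Tv _ Tx; split=> // e e0; exists x; split=> //;
  by rewrite subrr /sqnorm ip0l //; exact: sh_vec0.
Qed.

Section SelfAdjoint.
Variable T : set (V * V).
Hypothesis sT : symmetric_op H T.

(** By symmetry [<T x, x>] is real, so for imaginary [z] the cross terms cancel. *)
Lemma sym_norm (z : R[i]) x : conjc z = - z -> nc z = 1 -> T x ->
  sqnorm H (x.2 - z *: x.1) = sqnorm H x.2 + sqnorm H x.1.
Proof.
case: sT => Tv _ _ Ts zi z1 Tx; have [v1 v2] := Tv _ Tx.
rewrite -scaleNr sqnormD ?sqnormZ //; last exact: sh_vecZ.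
rewrite ncN z1 expr1n mul1r ipZr // rmorphN /= zi opprK.
have e := Ts _ _ Tx Tx; have := sh_conj hH v1 v2; rewrite e => ec.
have I0 : complex.Im (ip H x.1 x.2) = 0.
  by move/(congr1 (@complex.Im R)): ec; rewrite cImJ => h; lra.
have zr : complex.Re z = 0.
  by move/(congr1 (@complex.Re R)): zi; rewrite cReJ cReN => h; lra.
by rewrite cReM I0 zr mul0r mulr0 subrr mulr0 addr0.
Qed.

Hypothesis rT : forall (z : R[i]), (z = 'i%C \/ z = - 'i%C) ->
  forall u (e : R), vec H u -> 0 < e ->
  exists2 x, T x & hn (u - (x.2 - z *: x.1)) < e.

(** For [w = (T - i) x] one has [<w, a> = <x, b + i a>] and [|x| <= |w|]. The range of [T - i] is
    dense, so [w] may tend to [a], which gives [|a|^2 <= |a| |b + i a|]. *)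
Lemma adjoint_small a b : adjoint H T (a, b) ->
  hn a <= hn (b + 'i%C *: a).
Proof.
case: (sT) => Tv _ _ Ts [/= va vb Ta].
set r := b + _; have vr : vec H r by apply: sh_vecA => //; exact: sh_vecZ.
have [a0|a0] := eqVneq (hn a) 0; first by rewrite a0 hn_ge0.
have ap : 0 < hn a by rewrite lt_def a0 hn_ge0.
apply/ler_addgt0Pr => e e0.
(* Makes the right-hand side of [B2] at most [(hn r + e) * hn a]. *)
pose d := Num.min 1 (e / (1 + hn r / hn a)).
have den : 0 < 1 + hn r / hn a by rewrite ltr_wpDr // divr_ge0 ?hn_ge0.
have d0 : 0 < d by rewrite lt_min ltr01 divr_gt0.
have [x Tx hx] := rT (or_introl erefl) va d0.
have [v1 v2] := Tv _ Tx.
set w := x.2 - 'i%C *: x.1 in hx.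
have vw : vec H w by apply: sh_vecB => //; exact: sh_vecZ.
have E1 : ip H w a = ip H x.1 r.
  rewrite /w /r ipBl ?ipDr ?ipZl ?ipZr //; try exact: sh_vecZ.
  rewrite (Ta _ Tx) /=; congr (_ + _).
  by rewrite -mulNr; congr (_ * _); apply: complex_ext; rewrite /= ?oppr0.
have B1 : hn x.1 <= hn w.
  rewrite /hn ler_wsqrtr // sym_norm //; last 2 first.
  - by apply: complex_ext; rewrite /= ?oppr0.
  - exact: nc_i.
  by rewrite lerDr sqnorm_ge0.
have B2 : hn a ^+ 2 <= d * hn a + (hn a + d) * hn r.
  rewrite hn_sqr //.
  have -> : sqnorm H a = nc (ip H (a - w) a + ip H w a).
    by rewrite ipBl // subrK sqnorm_ip // nc_real ger0_norm ?sqnorm_ge0.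
  apply: (le_trans (ncD _ _)); apply: lerD.
    apply: (le_trans (ip_hn (sh_vecB va vw) va)).
    by apply: ler_wpM2r; [exact: hn_ge0|exact: ltW].
  rewrite E1; apply: (le_trans (ip_hn v1 vr)).
  apply: ler_wpM2r; first exact: hn_ge0.
  apply: (le_trans B1).
  have -> : w = a - (a - w) by rewrite opprB addrC subrK.
  apply: (le_trans (hnB _ _)) => //; first exact: sh_vecB.
  by rewrite lerD2l ltW.
rewrite -(@ler_pM2r _ (hn a)) // -expr2; apply: (le_trans B2).
rewrite (_ : d * hn a + (hn a + d) * hn r = (hn r + d * (1 + hn r / hn a)) * hn a);
  last by field.
rewrite ler_pM2r // lerD2l -ler_pdivlMr //.
by rewrite /d ge_min lexx orbT.
Qed.

(** For [y] in the adjoint of the closure, choose [x] in [T] with [(T + i) x] close to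
    [y.2 + i y.1]. The difference [y - x] lies in the adjoint, so [adjoint_small] makes both its
    components small and [y] lies in the closure. The other inclusion is the symmetry of the
    closure. *)
Lemma esa_of_dense_range : essentially_selfadjoint H T.
Proof.
split=> //; case: (sT) => Tv Tlin _ Ts.
apply/seteqP; split=> y.
  case=> v1 v2 hy; split=> // e e0.
  have Ty : adjoint H T y by split=> // x Tx; apply: hy; exact: sub_closure.
  (* Both components will be of norm below [2 * d < min 1 e], and [(min 1 e)^2 <= e] turns this into
     a bound on squared norms. *)
  pose d := Num.min 1 e / 3.
  have d0 : 0 < d by rewrite divr_gt0 // lt_min ltr01.
  have vr : vec H (y.2 + 'i%C *: y.1) by apply: sh_vecA => //; exact: sh_vecZ.
  have [x Tx hx] := rT (or_intror erefl) vr d0.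
  have [x1 x2] := Tv _ Tx.
  have ab : adjoint H T (y.1 - x.1, y.2 - x.2).
    split=> /=; try exact: sh_vecB.
    move=> x' Tx'; have [x'1 x'2] := Tv _ Tx'.
    by rewrite !ipBr // (Ts _ _ Tx' Tx); case: Ty => _ _ ->.
  have va := sh_vecB v1 x1; have vb := sh_vecB v2 x2.
  have E : y.2 - x.2 + 'i%C *: (y.1 - x.1) =
     y.2 + 'i%C *: y.1 - (x.2 - - 'i%C *: x.1).
    by rewrite scaleNr opprK scalerBr opprD addrACA.
  have := adjoint_small ab; rewrite E => h1.
  have ha : hn (y.1 - x.1) < d by apply: le_lt_trans hx.
  have hb : hn (y.2 - x.2) < d + d.
    have -> : y.2 - x.2 = (y.2 - x.2 + 'i%C *: (y.1 - x.1)) - 'i%C *: (y.1 - x.1).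
      by rewrite addrK.
    rewrite E; apply: (le_lt_trans (hnB _ _)); try exact: sh_vecZ.
      by rewrite -E; apply: sh_vecA => //; exact: sh_vecZ.
    by rewrite hnZ // nc_i mul1r ltrD.
  have m1 : Num.min 1 e <= 1 by rewrite ge_min lexx.
  have me : Num.min 1 e <= e by rewrite ge_min lexx orbT.
  have mp : 0 < Num.min 1 e by rewrite lt_min ltr01.
  have sq : Num.min 1 e ^+ 2 <= e.
    by apply: le_trans me; rewrite expr2 ler_piMl // ltW.
  exists x; split=> //; apply: (lt_le_trans _ sq); rewrite hn_lt //;
    [apply: (lt_trans ha)|apply: (lt_trans hb)]; rewrite /d; lra.
move=> yc; have [v1 v2 _] := yc; split=> // x xc; have [x1 x2 _] := xc.
have st1 (u : V * V) : T u -> ip H u.2 x.1 = ip H u.1 x.2.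
  move=> Tu; have [u1 u2] := Tv _ Tu.
  have := closure_ortho Tv u1 u2 (fun (p : V * V) Tp => Ts _ _ Tp Tu) xc.
  by rewrite (sh_conj hH x1 u2) (sh_conj hH x2 u1) => <-.
have := closure_ortho Tv x1 x2 st1 yc.
by rewrite (sh_conj hH v1 x2) (sh_conj hH v2 x1) => <-.
Qed.

End SelfAdjoint.
End SemiHilbert.

(** * Weighted L^2 spaces as semi-inner product spaces *)

Section L2Space.
Variables (R : realType) (w : R -> R).
Hypotheses (mw : measurable_fun (setT : set R) w) (w0 : forall x, 0 <= w x).
Local Notation mu := (@lebesgue_measure R).
Implicit Types (f g h : R -> R[i]^o).

Definition cmeas f : Prop :=
  measurable_fun (setT : set R) (fun x : R => complex.Re (f x)) /\
  measurable_fun (setT : set R) (fun x : R => complex.Im (f x)).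

Lemma cmeasD f g : cmeas f -> cmeas g -> cmeas (fun x => f x + g x).
Proof.
move=> [f1 f2] [g1 g2]; split.
  by under eq_fun do rewrite cReD; exact: measurable_funD.
by under eq_fun do rewrite cImD; exact: measurable_funD.
Qed.

Lemma cmeasM f g : cmeas f -> cmeas g -> cmeas (fun x => f x * g x).
Proof.
move=> [f1 f2] [g1 g2]; split.
  by under eq_fun do rewrite cReM; apply: measurable_funB; exact: measurable_funM.
by under eq_fun do rewrite cImM; apply: measurable_funD; exact: measurable_funM.
Qed.

Lemma cmeas_cst (c : R[i]) : cmeas (fun=> c).
Proof. by split; exact: measurable_cst. Qed.

Lemma cmeas_conj f : cmeas f -> cmeas (fun x => conjc (f x)).
Proof.
move=> [f1 f2]; split; first by under eq_fun do rewrite cReJ.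
under eq_fun do rewrite cImJ -mulN1r.
by apply: measurable_funM => //; exact: measurable_cst.
Qed.

Lemma cmeas_real (p : R -> R) : measurable_fun (setT : set R) p ->
  cmeas (fun x => (p x)%:C).
Proof. by move=> mp; split=> //=; exact: measurable_cst. Qed.

Lemma cmeas_cont f : (forall x, ccont f x) -> cmeas f.
Proof.
by move=> cf; split; apply: continuous_measurable_fun => x; case: (cf x).
Qed.

Lemma nc_meas f : cmeas f -> measurable_fun (setT : set R) (fun x => nc (f x) ^+ 2).
Proof.
move=> [f1 f2]; under eq_fun do rewrite normc_sqr !expr2.
by apply: measurable_funD; exact: measurable_funM.
Qed.

Lemma ncw_meas f : cmeas f ->
  measurable_fun (setT : set R) (fun x => nc (f x) ^+ 2 * w x).
Proof. by move=> /nc_meas mf; exact: measurable_funM. Qed.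

Lemma L2_vecP f : L2_vec w f <->
  cmeas f /\ mu.-integrable setT (EFin \o (fun x => nc (f x) ^+ 2 * w x)).
Proof.
have E : (\int[mu]_(x in setT) (nc (f x) ^+ 2 * w x)%:E =
   \int[mu]_(x in setT) `|(nc (f x) ^+ 2 * w x)%:E|)%E.
  by apply: eq_integral => x _; rewrite /= ger0_norm // mulr_ge0 // exprn_ge0 // nc_ge0.
split.
  move=> [m1 m2 i]; split; first by split.
  apply/integrableP; split; last by rewrite /= -E.
  by apply/measurable_EFinP; apply: ncw_meas.
move=> [[m1 m2] /integrableP[_ i]]; split=> //.
by rewrite E.
Qed.

Lemma L2_dom f (h : R -> R) : cmeas f ->
  mu.-integrable setT (EFin \o h) -> (forall x, nc (f x) ^+ 2 * w x <= h x) ->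
  L2_vec w f.
Proof.
move=> mf ih fh; apply/L2_vecP; split=> //.
apply: (le_integrable (@measurableT _ _) _ _ ih).
  by apply/measurable_EFinP; apply: ncw_meas.
move=> x _ /=; rewrite lee_fin ger0_norm ?mulr_ge0 ?exprn_ge0 ?nc_ge0 //.
exact: le_trans (fh x) (ler_norm _).
Qed.

Lemma integrableRD (p q : R -> R) : mu.-integrable setT (EFin \o p) ->
  mu.-integrable setT (EFin \o q) -> mu.-integrable setT (EFin \o (fun x => p x + q x)).
Proof.
move=> ip iq; rewrite (_ : _ \o _ = (EFin \o p) \+ (EFin \o q))%E //.
exact: integrableD.
Qed.

Lemma L2_vec0 : L2_vec w 0.
Proof.
apply: (@L2_dom _ (fun=> 0)); first exact: cmeas_cst.
  by rewrite (_ : _ \o _ = cst 0%E) //; exact: integrable0.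
by move=> x; rewrite (_ : (0 : R -> R[i]^o) x = 0) // nc0 expr0n mul0r.
Qed.

Lemma L2_vecA (a : R[i]) f g : L2_vec w f -> L2_vec w g -> L2_vec w (a *: f + g).
Proof.
move=> /L2_vecP[mf jf] /L2_vecP[mg jg].
apply: (@L2_dom _ (fun x => 2 * nc a ^+ 2 * (nc (f x) ^+ 2 * w x) +
     2 * (nc (g x) ^+ 2 * w x))).
- by apply: cmeasD => //; apply: cmeasM => //; exact: cmeas_cst.
- by apply: integrableRD; apply: integrableRZ.
- move=> x; rewrite (_ : _ + _ = (2 * (nc a * nc (f x)) ^+ 2 + 2 * nc (g x) ^+ 2) * w x);
    last by rewrite exprMn; ring.
  apply: ler_wpM2r => //.
  apply: (@le_trans _ _ ((nc a * nc (f x) + nc (g x)) ^+ 2)).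
    rewrite ler_pXn2r ?nnegrE ?addr_ge0 ?mulr_ge0 ?nc_ge0 //.
    by rewrite -ncM; exact: ncD.
  rewrite -subr_ge0 (_ : _ - _ = (nc a * nc (f x) - nc (g x)) ^+ 2); last by ring.
  exact: sqr_ge0.
Qed.

Lemma L2_prod f g : L2_vec w f -> L2_vec w g ->
  cintegrable setT (fun x => f x * conjc (g x) * (w x)%:C).
Proof.
move=> /L2_vecP[mf jf] /L2_vecP[mg jg].
have [m1 m2] : cmeas (fun x => f x * conjc (g x) * (w x)%:C).
  apply: cmeasM; last exact: cmeas_real.
  by apply: cmeasM => //; exact: cmeas_conj.
have ib := integrableRD jf jg.
have key x : nc (f x * conjc (g x) * (w x)%:C) <=
    `|nc (f x) ^+ 2 * w x + nc (g x) ^+ 2 * w x|.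
  apply: le_trans (ler_norm _); rewrite !ncM nc_conj nc_real ger0_norm //.
  rewrite -mulrDl; apply: ler_wpM2r => //.
  have := sqr_ge0 (nc (f x) - nc (g x)); have := sqr_ge0 (nc (f x) + nc (g x)).
  by rewrite sqrrB sqrrD; lra.
split; apply: (le_integrable (@measurableT _ _) _ _ ib);
  try (exact/measurable_EFinP); move=> x _ /=; rewrite lee_fin.
  exact: le_trans (cRe_le _) (key x).
exact: le_trans (cIm_le _) (key x).
Qed.

Lemma L2_ipE f g : L2_ip w f g = cI setT (fun x => f x * conjc (g x) * (w x)%:C).
Proof.
apply: complex_ext => /=; apply: eq_Rintegral => x _.
  by rewrite [in RHS]cReM /= mulr0 subr0.
by rewrite [in RHS]cImM /= mulr0 add0r.
Qed.

Lemma L2_sqnormE f : sqnorm (L2 w) f = \int[mu]_(x in setT) (nc (f x) ^+ 2 * w x).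
Proof.
rewrite /sqnorm /=; apply: eq_Rintegral => x _; congr (_ * _).
by rewrite normc_sqr; case: (f x) => a b /=; ring.
Qed.

Lemma L2_semi_hilbert : semi_hilbert (L2 w).
Proof.
split=> /=.
- exact: L2_vec0.
- exact: L2_vecA.
- move=> a u v h hu hv hh; rewrite !L2_ipE -cIZ //; last exact: L2_prod.
  rewrite -cID //; [|apply: cintegrableZ => //; exact: L2_prod|exact: L2_prod].
  apply: eq_cI => x _; rewrite -[(a *: u + v) x]/(a * u x + v x).
  by rewrite !mulrDl !mulrA.
- move=> u v hu hv; change (L2_ip w v u = conjc (L2_ip w u v)).
  rewrite !L2_ipE -cI_conj //; last exact: L2_prod.
  apply: eq_cI => x _; rewrite !rmorphM /= conjcK oppr0.
  by rewrite [conjc (u x) * _]mulrC.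
- move=> u hu; change (0 <= sqnorm (L2 w) u); rewrite L2_sqnormE.
  by apply: Rintegral_ge0 => x _; rewrite mulr_ge0 // exprn_ge0 // nc_ge0.
Qed.

Lemma L2_sqnorm_le f (h : R -> R) : L2_vec w f ->
  mu.-integrable setT (EFin \o h) -> (forall x, nc (f x) ^+ 2 * w x <= h x) ->
  sqnorm (L2 w) f <= \int[mu]_(x in setT) h x.
Proof.
move=> /L2_vecP[_ jf] ih fh; rewrite L2_sqnormE; exact: le_Rintegral.
Qed.

Lemma L2_dominated (f_ : nat -> R -> R[i]^o) (h : R -> R) :
  (forall n, L2_vec w (f_ n)) ->
  (forall x, (fun n => nc (f_ n x)) @ \oo --> (0 : R)) ->
  mu.-integrable setT (EFin \o h) ->
  (forall n x, nc (f_ n x) ^+ 2 * w x <= h x) ->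
  forall e, 0 < e -> exists N, forall n, (N <= n)%N -> hn (L2 w) (f_ n) < e.
Proof.
move=> vf fc ih fh e e0.
have : (\int[mu]_(x in setT) (nc (f_ n x) ^+ 2 * w x))%R @[n --> \oo] -->
   (0 : R).
  have <- : (\int[mu]_(x in setT) (0 : R))%R = 0 by rewrite /Rintegral integral0.
  apply: (@Rdominated _ _ (fun=> 0) h) => //.
  - by move=> n; apply: ncw_meas; case/L2_vecP: (vf n).
  - move=> x; rewrite (_ : (0 : R) = 0 ^+ 2 * w x); last by rewrite expr0n mul0r.
    apply: cvgM; last exact: cvg_cst.
    under eq_fun do rewrite expr2; rewrite expr2; exact: cvgM.
  - move=> n x; rewrite ger0_norm; first exact: fh.
    by rewrite mulr_ge0 // exprn_ge0 // nc_ge0.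
move=> /cvgr0Pnorm_lt /(_ _ (exprn_gt0 2 e0)) [N _ HN].
exists N => n Nn; have := HN n Nn; cbv beta.
rewrite -L2_sqnormE ger0_norm; last exact: (sqnorm_ge0 L2_semi_hilbert (vf n)).
by rewrite (hn_lt L2_semi_hilbert (vf n) e0).
Qed.

End L2Space.

(** * Density of simple poles in L^2(R): closed span and multipliers *)

Section Density.
Variable R : realType.
Local Notation mu := (@lebesgue_measure R).
Implicit Types (f g h m : R -> R[i]^o) (S : (R -> R[i]^o) -> Prop).

Definition one1 : R -> R := fun=> 1.
Local Notation H1 := (L2 one1).

Lemma one1_meas : measurable_fun (setT : set R) one1.
Proof. exact: measurable_cst. Qed.

Lemma one1_ge0 x : 0 <= one1 x.
Proof. exact: ler01. Qed.

Lemma H1_sh : semi_hilbert H1.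
Proof. exact: L2_semi_hilbert one1_meas one1_ge0. Qed.

Lemma H1_vecP f : vec H1 f <->
  cmeas f /\ mu.-integrable setT (EFin \o (fun x => nc (f x) ^+ 2)).
Proof.
have E : (fun x => nc (f x) ^+ 2 * one1 x) = (fun x => nc (f x) ^+ 2).
  by apply/funext => x; rewrite mulr1.
by split=> [/(L2_vecP one1_meas one1_ge0)|h]; rewrite ?E //;
  apply/(L2_vecP one1_meas one1_ge0); rewrite E.
Qed.

Lemma H1_sqnormE f : sqnorm H1 f = \int[mu]_(x in setT) (nc (f x) ^+ 2).
Proof. by rewrite L2_sqnormE; apply: eq_Rintegral => x _; rewrite mulr1. Qed.

Lemma H1_dom f (h : R -> R) : cmeas f ->
  mu.-integrable setT (EFin \o h) -> (forall x, nc (f x) ^+ 2 <= h x) ->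
  vec H1 f.
Proof.
move=> mf ih fh; apply: (L2_dom one1_meas one1_ge0 mf ih) => x.
by rewrite mulr1.
Qed.

Lemma H1_mul (B : R) m f : cmeas m -> (forall x, nc (m x) <= B) -> vec H1 f ->
  vec H1 (fun x => m x * f x) /\ hn H1 (fun x => m x * f x) <= B * hn H1 f.
Proof.
move=> mm mB vf; have [mf jf] := (H1_vecP f).1 vf.
have B0 : 0 <= B by apply: le_trans (mB 0); exact: nc_ge0.
have iB := integrableRZ (B ^+ 2) (@measurableT _ _) jf.
have le x : nc (m x * f x) ^+ 2 <= B ^+ 2 * nc (f x) ^+ 2.
  rewrite ncM exprMn; apply: ler_wpM2r; first by rewrite exprn_ge0 ?nc_ge0.
  by rewrite ler_pXn2r ?nnegrE ?nc_ge0.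
have vmf : vec H1 (fun x => m x * f x) by apply: H1_dom iB le; exact: cmeasM.
split=> //.
rewrite -(@ler_pXn2r _ 2) ?nnegrE ?mulr_ge0 ?hn_ge0 //.
rewrite exprMn !(hn_sqr H1_sh) // !H1_sqnormE -RintegralZl //.
apply: le_Rintegral => //; by have [_] := (H1_vecP _).1 vmf.
Qed.

Definition simple_pole (p : R[i]) : R -> R[i]^o := fun x => (x%:C - p)^-1.

Definition closed_subspace S : Prop :=
  [/\ forall f, S f -> vec H1 f,
      forall (a : R[i]) f g, S f -> S g -> S (a *: f + g)
    & forall f, vec H1 f ->
        (forall e, 0 < e -> exists2 g, S g & hn H1 (f - g) < e) -> S f].

(** The bound 5/2 makes [simple_pole p] a multiple of [1 / (zl + b)] or [1 / (zr + b)] with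
    [Re b >= 2], as needed to approximate the power [y^b] together with its derivative. Such poles
    also lie well outside the strip. *)
Definition far_pole (p : R[i]) : bool := 5 / 2 <= `|complex.Im p|.

(** The closed linear span, in impredicative form: a property holds on it as soon as it defines a
    closed subspace containing the poles. *)
Definition pole_span f : Prop := forall S, closed_subspace S ->
  (forall p, far_pole p -> S (simple_pole p)) -> S f.

Lemma far_dist p (x : R) : far_pole p -> 5 / 2 <= nc (x%:C - p).
Proof.
move=> fp; apply: (le_trans fp); apply: (le_trans _ (cIm_le _)).
by rewrite cImD cImN /= add0r normrN.
Qed.

Lemma far_neq p (x : R) : far_pole p -> x%:C - p != 0.
Proof.
by move=> /(far_dist x) h; rewrite -nc_gt0; apply: lt_le_trans h; lra.
Qed.

Lemma far_bound p (x : R) : far_pole p -> nc (simple_pole p x) <= 1.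
Proof.
move=> /(far_dist x) h; rewrite ncV invf_le1; first by apply: le_trans h; lra.
by apply: lt_le_trans h; lra.
Qed.

Lemma cmeasV m : cmeas m -> (forall x, m x != 0) -> cmeas (fun x => (m x)^-1).
Proof.
move=> mm m0.
have mi : measurable_fun (setT : set R) (fun x => (nc (m x) ^+ 2)^-1).
  have E : (fun x => (nc (m x) ^+ 2)^-1) = (fun x => expR (- ln (nc (m x) ^+ 2))).
    apply/funext => x; rewrite expRN lnK // posrE exprn_gt0 // nc_gt0 //.
  rewrite E; apply: measurableT_comp => //.
  under eq_fun do rewrite -mulN1r; apply: measurable_funM; first exact: measurable_cst.
  by apply: measurableT_comp; [exact: measurable_ln|exact: nc_meas].
have E : (fun x => (m x)^-1) = (fun x => conjc (m x) * ((nc (m x) ^+ 2)^-1)%:C).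
  apply/funext => x; rewrite normc_sqr; case: (m x) => a b /=.
  by apply: complex_ext; rewrite /= ?mulr0 ?subr0 ?add0r ?mulNr //; ring.
rewrite E; apply: cmeasM; first exact: cmeas_conj.
exact: cmeas_real.
Qed.

Lemma simple_pole_meas p : far_pole p -> cmeas (simple_pole p).
Proof.
move=> fp; apply: cmeasV; last by move=> x; exact: far_neq.
apply: cmeasD; last exact: cmeas_cst.
by apply: cmeas_real; exact: measurable_id.
Qed.

Lemma ptail1 (x : R) : ptail 1 x = (1 + `|x|) ^- 2.
Proof. by rewrite /ptail -powR_invn ?addr_ge0 //; congr (_ `^ _); ring. Qed.

Lemma pole_bound (p : R[i]) : complex.Im p != 0 ->
  exists K, forall x : R, (nc (x%:C - p) ^+ 2)^-1 <= K * ptail 1 x.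
Proof.
set b := complex.Im p; set a := complex.Re p => b0.
have b2 : 0 < b ^+ 2 by rewrite exprn_even_gt0.
(* From [(1 + |x|)^2 <= 2 (x - a)^2 + 2 (1 + |a|)^2], whose last term is a multiple of [b^2]. *)
exists (2 + 2 * (1 + `|a|) ^+ 2 / b ^+ 2) => x.
rewrite ptail1 normc_sqr cReD cImD cReN cImN /= sub0r sqrrN -/a -/b.
have x1 : 0 < (1 + `|x|) ^+ 2 by rewrite exprn_gt0 // ltr_wpDr.
have D : 0 < (x - a) ^+ 2 + b ^+ 2 by rewrite ltr_wpDl ?sqr_ge0.
rewrite ler_pdivlMr // mulrC ler_pdivrMr //.
have h1 : (1 + `|x|) ^+ 2 <= ((1 + `|a|) + `|x - a|) ^+ 2.
  rewrite ler_pXn2r ?nnegrE ?addr_ge0 //.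
  by rewrite -addrA lerD2l -lerBlDl lerB_dist.
apply: (le_trans h1).
have -> : (2 + 2 * (1 + `|a|) ^+ 2 / b ^+ 2) * ((x - a) ^+ 2 + b ^+ 2) =
  2 * (x - a) ^+ 2 + 2 * (1 + `|a|) ^+ 2 + (2 * b ^+ 2 + 2 * (1 + `|a|) ^+ 2 / b ^+ 2 * (x - a) ^+ 2).
  by field.
apply: (@le_trans _ _ (2 * (x - a) ^+ 2 + 2 * (1 + `|a|) ^+ 2)).
  rewrite -[(x - a) ^+ 2]real_normK ?num_real //.
  have := sqr_ge0 ((1 + `|a|) - `|x - a|); rewrite sqrrB sqrrD; lra.
rewrite lerDl; apply: addr_ge0; apply: mulr_ge0 => //; rewrite ?sqr_ge0 //.
by apply: divr_ge0; [apply: mulr_ge0 => //; exact: sqr_ge0|exact: sqr_ge0].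
Qed.

Lemma pole_L2 (p : R[i]) : far_pole p -> vec H1 (simple_pole p).
Proof.
move=> fp; have [K hK] : exists K, forall x : R, (nc (x%:C - p) ^+ 2)^-1 <= K * ptail 1 x.
  apply: pole_bound; rewrite -normr_gt0; apply: lt_le_trans fp; lra.
apply: (@H1_dom _ (fun x => K * ptail 1 x)); first exact: simple_pole_meas.
  by apply: integrableRZ => //; exact: ptail_int.
by move=> x; rewrite ncV exprVn.
Qed.

Lemma L2_closed_subspace : closed_subspace (vec H1).
Proof.
split=> // a f g hf hg; exact: (sh_vecD H1_sh).
Qed.

Lemma pole_span_gen p : far_pole p -> pole_span (simple_pole p).
Proof. by move=> fp S _; apply. Qed.

Lemma pole_span_L2 f : pole_span f -> vec H1 f.
Proof. by move=> /(_ _ L2_closed_subspace); apply=> p; exact: pole_L2. Qed.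

Lemma pole_span_closed : closed_subspace pole_span.
Proof.
split; first exact: pole_span_L2.
  move=> a f g hf hg S cS gS; have [_ h _] := cS; apply: h.
    exact: hf.
  exact: hg.
move=> f vf hf S cS gS; have [_ _ h] := cS; apply: h => // e e0.
by have [g hg hfg] := hf e e0; exists g => //; exact: hg.
Qed.

Lemma pole_span_lin (a : R[i]) f g : pole_span f -> pole_span g ->
  pole_span (fun x => a * f x + g x).
Proof. by case: pole_span_closed => _ h _ hf hg; exact: (h a f g). Qed.

Lemma pole_spanZ (a : R[i]) f : pole_span f -> pole_span (fun x => a * f x).
Proof.
move=> hf; have h0 : pole_span (fun x => (- 1) * f x + f x) by exact: pole_span_lin.
rewrite (_ : (fun x => a * f x) = (fun x => a * f x + ((- 1) * f x + f x))).
  exact: pole_span_lin.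
by apply/funext => x; ring.
Qed.

(** The multipliers form an algebra that is stable under bounded pointwise limits; the next steps
    enlarge it to all bounded measurable functions. *)
Definition multiplier m : Prop :=
  [/\ cmeas m, exists B : R, forall x, nc (m x) <= B
    & forall f, pole_span f -> pole_span (fun x => m x * f x)].

Lemma multiplier_gen m (B : R) : cmeas m -> (forall x, nc (m x) <= B) ->
  (forall p, far_pole p -> pole_span (fun x => m x * simple_pole p x)) ->
  multiplier m.
Proof.
move=> mm mB hm; split=> //; first by exists B.
move=> f hf.
pose S g := vec H1 g /\ pole_span (fun x => m x * g x).
suff cS : closed_subspace S.
  by case: (hf S cS (fun p fp => conj (pole_L2 fp) (hm p fp))).
have B0 : 0 <= B by apply: le_trans (mB 0); exact: nc_ge0.
split.
- by move=> g [].
- move=> a g k [vg hg] [vk hk]; split; first exact: (sh_vecD H1_sh).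
  rewrite (_ : (fun x => m x * _) = (fun x => a * (m x * g x) + m x * k x)).
    exact: pole_span_lin.
  by apply/funext => x; rewrite -[(a *: g + k) x]/(a * g x + k x); ring.
- move=> g vg hg; split=> //; case: pole_span_closed => _ _; apply.
    by have [] := H1_mul mm mB vg.
  move=> e e0; have B1 : 0 < B + 1 by rewrite ltr_wpDl.
  have [k [vk hk] gk] := hg (e / (B + 1)) (divr_gt0 e0 B1).
  exists (fun x => m x * k x) => //.
  rewrite (_ : _ - _ = (fun x => m x * (g - k) x)); last first.
    apply/funext => x; rewrite -[LHS]/(m x * g x - m x * k x).
    by rewrite -[(g - k) x]/(g x - k x); ring.
  have [_ h] := H1_mul mm mB (sh_vecB H1_sh vg vk).
  apply: (le_lt_trans h); apply: (@le_lt_trans _ _ ((B + 1) * hn H1 (g - k))).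
    by apply: ler_wpM2r; [exact: hn_ge0|rewrite lerDl].
  by rewrite mulrC -ltr_pdivlMr.
Qed.

Lemma multiplier_cst (c : R[i]) : multiplier (fun=> c).
Proof.
split; [exact: cmeas_cst|by exists (nc c)|by move=> f; exact: pole_spanZ].
Qed.

Lemma multiplierM m1 m2 : multiplier m1 -> multiplier m2 ->
  multiplier (fun x => m1 x * m2 x).
Proof.
move=> [mm1 [B1 b1] h1] [mm2 [B2 b2] h2]; split; first exact: cmeasM.
  exists (B1 * B2) => x; rewrite ncM.
  by apply: ler_pM; rewrite ?nc_ge0.
move=> f hf; rewrite (_ : (fun x => _) = (fun x => m1 x * (m2 x * f x))).
  by apply: h1; exact: h2.
by apply/funext => x; rewrite mulrA.
Qed.

Lemma multiplierD m1 m2 : multiplier m1 -> multiplier m2 ->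
  multiplier (fun x => m1 x + m2 x).
Proof.
move=> [mm1 [B1 b1] h1] [mm2 [B2 b2] h2]; split; first exact: cmeasD.
  by exists (B1 + B2) => x; apply: (le_trans (ncD _ _)); exact: lerD.
move=> f hf; rewrite (_ : (fun x => _) = (fun x => 1 * (m1 x * f x) + m2 x * f x)).
  by apply: pole_span_lin; [exact: h1|exact: h2].
by apply/funext => x; ring.
Qed.

(** For [f] in the span, [m_ n * f] tends to [m * f] in L^2 by dominated convergence, and the span
    is closed. *)
Lemma multiplier_lim (m_ : nat -> R -> R[i]^o) m (B : R) : cmeas m ->
  (forall n, multiplier (m_ n)) -> (forall n x, nc (m_ n x) <= B) ->
  (forall x, (fun n => nc (m x - m_ n x)) @ \oo --> (0 : R)) ->
  multiplier m.
Proof.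
move=> mm hm hB hl.
have mB x : nc (m x) <= B.
  apply/ler_addgt0Pl => e e0.
  have := hl x; move=> /cvgr0Pnorm_lt /(_ _ e0) [N _ /(_ N (leqnn N))].
  rewrite /= ger0_norm ?nc_ge0 // => h.
  rewrite -[m x](subrK (m_ N x)); apply: (le_trans (ncD _ _)).
  by apply: lerD => //; exact: ltW.
split=> //; first by exists B.
move=> f hf; have vf := pole_span_L2 hf.
case: pole_span_closed => _ _; apply.
  by have [] := H1_mul mm mB vf.
move=> e e0.
have [mf jf] := (H1_vecP f).1 vf.
have mdiff n : cmeas (fun x => m x - m_ n x).
  rewrite (_ : (fun x => _) = (fun x => m x + (-1) * m_ n x)).
    by apply: cmeasD => //; apply: cmeasM; [exact: cmeas_cst|case: (hm n)].
  by apply/funext => x; rewrite mulN1r.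
have bdiff n x : nc (m x - m_ n x) <= B + B.
  by apply: (le_trans (ncB _ _)); exact: lerD.
have c1 x : (fun n => nc ((m x - m_ n x) * f x)) @ \oo --> (0 : R).
  under eq_fun do rewrite ncM.
  by rewrite -(mul0r (nc (f x))); apply: cvgM; [exact: hl|exact: cvg_cst].
have c2 : mu.-integrable setT (EFin \o (fun x => (B + B) ^+ 2 * nc (f x) ^+ 2)).
  exact: integrableRZ.
have c3 n x : nc ((m x - m_ n x) * f x) ^+ 2 * one1 x <= (B + B) ^+ 2 * nc (f x) ^+ 2.
  rewrite mulr1 ncM exprMn; apply: ler_wpM2r.
    by rewrite exprn_ge0 ?nc_ge0.
  by rewrite ler_pXn2r ?nnegrE ?nc_ge0 ?bdiff // (le_trans _ (bdiff n x)) // nc_ge0.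
have [N HN] := L2_dominated one1_meas one1_ge0
   (fun n => (H1_mul (mdiff n) (bdiff n) vf).1) c1 c2 c3 e0.
exists (fun x => m_ N x * f x); first by case: (hm N) => _ _; apply.
rewrite (_ : _ - _ = (fun x => (m x - m_ N x) * f x)); first exact: HN.
by apply/funext => x; rewrite mulrBl.
Qed.

(** Moving a pole away from the real axis keeps it far; this separates the two factors of a double
    pole. *)
Lemma pole_shift p : far_pole p -> exists k : R[i], nc k = 1 /\
  forall t : R, 0 < t -> far_pole (p + t%:C * k) /\ p + t%:C * k != p.
Proof.
have neq (k : R[i]) (t : R) : nc k = 1 -> 0 < t -> p + t%:C * k != p.
  move=> k1 t0; rewrite -subr_eq0 [p + _]addrC addrK -nc_gt0 ncM k1 mulr1 nc_real.
  by rewrite normr_gt0 gt_eqF.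
have iN : nc (- 'i%C : R[i]) = 1 by rewrite ncN nc_i.
rewrite /far_pole; have [b0|b0] := leP 0 (complex.Im p) => h.
  exists 'i%C; split=> [|t t0]; first exact: nc_i.
  split; last by apply: neq => //; exact: nc_i.
  rewrite cImD cImM /= mulr1 mul0r addr0; move: h; rewrite !ger0_norm; lra.
exists (- 'i%C); split=> [//|t t0]; split; last exact: neq.
rewrite cImD cImM /= mulrN1 mul0r addr0; move: h; rewrite !ltr0_norm; lra.
Qed.

Lemma pole_prod p q : far_pole p -> far_pole q -> p != q ->
  pole_span (fun x => simple_pole p x * simple_pole q x).
Proof.
move=> fp fq pq.
rewrite (_ : (fun x => _) = (fun x => (p - q)^-1 * simple_pole p x +
    (- (p - q)^-1) * simple_pole q x)).
  apply: pole_span_lin; first exact: pole_span_gen.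
  by apply: pole_spanZ; exact: pole_span_gen.
apply/funext => x; rewrite /simple_pole.
have := far_neq x fp; have := far_neq x fq; move: pq; rewrite -subr_eq0 => h1 h2 h3.
by field; rewrite h1 h2 h3.
Qed.

(** A product of two distinct simple poles splits into partial fractions; the square of one pole is
    the limit of products with the pole at [p + t k] as [t] tends to 0. *)
Lemma multiplier_pole p : far_pole p -> multiplier (simple_pole p).
Proof.
move=> fp; apply: (@multiplier_gen _ 1); first exact: simple_pole_meas.
  by move=> x; exact: far_bound.
move=> q fq; have [pq|pq] := eqVneq p q; last exact: pole_prod.
rewrite -pq {q fq pq}.
have [k [k1 hk]] := pole_shift fp.
case: pole_span_closed => _ _; apply.
  have [] := H1_mul (simple_pole_meas fp) (fun x => far_bound x fp) (pole_L2 fp); done.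
move=> e e0.
set N := hn H1 (simple_pole p).
have N0 : 0 <= N by exact: hn_ge0.
have N1 : 0 < N + 1 by rewrite ltr_wpDl.
pose t := e / (N + 1); have t0 : 0 < t by rewrite divr_gt0.
have [fq qp] := hk t t0; set q := p + _ in fq qp.
exists (fun x => simple_pole q x * simple_pole p x); first exact: pole_prod.
rewrite (_ : _ - _ = (fun x => (simple_pole p x - simple_pole q x) * simple_pole p x));
  last by apply/funext => x; rewrite mulrBl.
have md : cmeas (fun x => simple_pole p x - simple_pole q x).
  rewrite (_ : (fun x => _) = (fun x => simple_pole p x + (-1) * simple_pole q x)).
    apply: cmeasD; first exact: simple_pole_meas.
    by apply: cmeasM; [exact: cmeas_cst|exact: simple_pole_meas].
  by apply/funext => x; rewrite mulN1r.
have bd x : nc (simple_pole p x - simple_pole q x) <= t.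
  have -> : simple_pole p x - simple_pole q x =
     - (t%:C * k) * (simple_pole p x * simple_pole q x).
    rewrite /simple_pole /q; have := far_neq x fp; have := far_neq x fq => h1 h2.
    by field; rewrite h1 h2.
  rewrite !ncM ncN ncM k1 mulr1 nc_real gtr0_norm //.
  rewrite ler_piMr ?(ltW t0) // mulr_ile1 ?nc_ge0 ?far_bound //.
have [_ h] := H1_mul md bd (pole_L2 fp).
apply: (le_lt_trans h); rewrite -/N /t mulrAC ltr_pdivrMr // ltr_pM2l //.
by rewrite ltrDl.
Qed.

End Density.

(** * Density of simple poles: indicator functions as multipliers *)

Section Density2.
Variable R : realType.
Local Notation mu := (@lebesgue_measure R).
Local Notation H1 := (L2 (@one1 R)).
Implicit Types (f g h m : R -> R[i]^o).

(** A polynomial, so it preserves multipliers. On [0, 1] its fixed points are 0, 1/2 and 1, with 1/2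
    repelling: its iterates converge to a step function. *)
Definition smoothstep (x : R) : R := x ^+ 2 * (3 - 2 * x).

Lemma smoothstep_itv x : 0 <= x <= 1 -> 0 <= smoothstep x <= 1.
Proof.
move=> /andP[x0 x1]; rewrite /smoothstep; apply/andP; split.
  by apply: mulr_ge0; [exact: sqr_ge0|lra].
rewrite -subr_ge0 (_ : 1 - _ = (1 - x) ^+ 2 * (1 + 2 * x)); last by ring.
by apply: mulr_ge0; [exact: sqr_ge0|lra].
Qed.

Lemma iter_smoothstep_itv n x : 0 <= x <= 1 -> 0 <= iter n smoothstep x <= 1.
Proof. by move=> hx; elim: n => //= n; exact: smoothstep_itv. Qed.

Lemma iter_smoothstep_half n : iter n smoothstep 2^-1 = 2^-1.
Proof. by elim: n => //= n ->; rewrite /smoothstep; field. Qed.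

Lemma iter_smoothstep_onem n x : iter n smoothstep (1 - x) = 1 - iter n smoothstep x.
Proof. by elim: n => //= n ->; rewrite /smoothstep; ring. Qed.

Lemma iter_smoothstep_lt x : 0 <= x -> x < 2^-1 ->
  (fun n => iter n smoothstep x) @ \oo --> (0 : R).
Proof.
(* Below 1/2 the iterates decrease, each step multiplying by at most [c < 1]. *)
move=> x0 x1; pose c := x * (3 - 2 * x).
have c0 : 0 <= c by apply: mulr_ge0 => //; lra.
have c1 : c < 1.
  by rewrite -subr_gt0 (_ : 1 - c = (1 - x) * (1 - 2 * x)); [apply: mulr_gt0; lra|rewrite /c; ring].
have key n : 0 <= iter n smoothstep x <= x * c ^+ n /\ iter n smoothstep x <= x.
  elim: n => [|n [/andP[h1 h2] h3]] /=; first by rewrite expr0 mulr1 lexx x0.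
  set y := iter n _ x in h1 h2 h3 *.
  have yc : y * (3 - 2 * y) <= c.
    rewrite -subr_ge0 (_ : c - _ = (x - y) * (3 - 2 * (x + y))); last by rewrite /c; ring.
    by apply: mulr_ge0; lra.
  have E : smoothstep y = y * (y * (3 - 2 * y)) by rewrite /smoothstep; ring.
  have y0 : 0 <= y * (3 - 2 * y) by apply: mulr_ge0 => //; lra.
  rewrite E; split.
    apply/andP; split; first exact: mulr_ge0.
    by rewrite exprSr [leRHS]mulrA; apply: ler_pM.
  apply: le_trans h3; rewrite ler_piMr //; exact: le_trans (ltW c1).
have lim : (fun n => x * c ^+ n) @ \oo --> (0 : R).
  by apply: cvg_geometric; rewrite ger0_norm.
apply: (squeeze_cvgr _ (cvg_cst 0) lim).
by apply: nearW => n; case: (key n).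
Qed.

Lemma iter_smoothstep_gt x : 2^-1 < x -> x <= 1 ->
  (fun n => iter n smoothstep x) @ \oo --> (1 : R).
Proof.
move=> x0 x1.
rewrite (_ : (fun n => _) = (fun n => 1 - iter n smoothstep (1 - x))); last first.
  by apply/funext => n; rewrite iter_smoothstep_onem; ring.
rewrite -[X in _ --> X]subr0; apply: cvgB; first exact: cvg_cst.
by apply: iter_smoothstep_lt; lra.
Qed.

Definition smooth_lim (x : R) : R := if x < 2^-1 then 0 else if x == 2^-1 then 2^-1 else 1.

Lemma iter_smoothstep_cvg x : 0 <= x <= 1 ->
  (fun n => iter n smoothstep x) @ \oo --> smooth_lim x.
Proof.
move=> /andP[x0 x1]; rewrite /smooth_lim; case: ltP => h; first exact: iter_smoothstep_lt.
case: eqP => [->|ne].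
  by under eq_fun do rewrite iter_smoothstep_half; exact: cvg_cst.
apply: iter_smoothstep_gt => //; rewrite lt_neqAle h andbT.
by apply/eqP => e; apply: ne.
Qed.

Lemma ext_multiplier m1 m2 : m1 =1 m2 -> multiplier m1 -> multiplier m2.
Proof. by move=> /funext ->. Qed.

Lemma multiplier_thresh (X : R -> R) : (forall x, 0 <= X x <= 1) ->
  multiplier (fun x => (X x)%:C) ->
  multiplier (fun x => ((2^-1 < X x)%R)%:R).
Proof.
move=> X01 mX.
have miter n : multiplier (fun x => (iter n smoothstep (X x))%:C).
  elim: n => //= n IH.
  apply: (@ext_multiplier (fun x => ((iter n smoothstep (X x))%:C * (iter n smoothstep (X x))%:C) *
    (3 + (- 2) * (iter n smoothstep (X x))%:C))).
    by move=> x; apply: complex_ext; rewrite /smoothstep !ReImE /= ?ReImE /=; ring.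
  apply: multiplierM; first exact: multiplierM.
  apply: multiplierD; first exact: multiplier_cst.
  by apply: multiplierM => //; exact: multiplier_cst.
have mX' : measurable_fun (setT : set R) X by case: mX => -[].
have ml : measurable_fun (setT : set R) (fun x => smooth_lim (X x)).
  apply: (@measurable_fun_cvg _ _ _ _ (fun n x => iter n smoothstep (X x))) => //.
    by move=> n; case: (miter n) => -[].
  by move=> x _; exact: iter_smoothstep_cvg.
have mlim : multiplier (fun x => (smooth_lim (X x))%:C).
  apply: (@multiplier_lim _ (fun n x => (iter n smoothstep (X x))%:C) _ 1) => //.
  - move=> n x; rewrite nc_real ger0_norm; first by case/andP: (iter_smoothstep_itv n (X01 x)).
    by case/andP: (iter_smoothstep_itv n (X01 x)).
  - move=> x; rewrite (_ : (fun n => _) = (fun n => `|smooth_lim (X x) - iter n smoothstep (X x)|)).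
      2: by apply/funext => n; rewrite -nc_real rmorphB.
    rewrite -(normr0 R) -(subrr (smooth_lim (X x))).
    by apply: cvg_norm; apply: cvgB; [exact: cvg_cst|exact: iter_smoothstep_cvg].
(* The polynomial [y (2 y - 1)] sends 0, 1/2, 1 to 0, 0, 1 and so removes the middle value. *)
apply: (@ext_multiplier (fun x => (smooth_lim (X x))%:C * (2 * (smooth_lim (X x))%:C + (-1)))).
  move=> x; rewrite /smooth_lim; case: ltgtP => h //=.
  - by rewrite mul0r.
  - by rewrite mulr1 mul1r [2]mulr2n addrK.
  - apply: complex_ext; rewrite !ReImE /= ?ReImE /=; lra.
apply: multiplierM => //; apply: multiplierD; last exact: multiplier_cst.
by apply: multiplierM => //; exact: multiplier_cst.
Qed.

Definition mul_set (A : set R) : Prop :=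
  measurable A /\ multiplier (fun x => (x \in A)%:R).

Lemma mul_set_ball (a : R) : mul_set [set x | (x - a) ^+ 2 < 1].
Proof.
(* A multiple of the product of the poles at [a + 5i/2] and [a - 5i/2], scaled to equal 1/2 at
   distance 1 from [a]. *)
pose X x : R := 29 / 8 / ((x - a) ^+ 2 + 25 / 4).
have D (x : R) : 0 < (x - a) ^+ 2 + 25 / 4 by rewrite ltr_wpDl ?sqr_ge0.
have X01 x : 0 <= X x <= 1.
  rewrite /X; apply/andP; split; first by rewrite divr_ge0 // ltW.
  by rewrite ler_pdivrMr // mul1r; have := sqr_ge0 (x - a); lra.
have mX : multiplier (fun x => (X x)%:C).
  have fp : far_pole (a +i* (5 / 2)) by rewrite /far_pole /= ger0_norm //; lra.
  have fq : far_pole (a -i* (5 / 2)).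
    by rewrite /far_pole /= normrN ger0_norm //; lra.
  apply: (@ext_multiplier (fun x => ((29 / 8)%:C) * (simple_pole (a +i* (5 / 2)) x *
      simple_pole (a -i* (5 / 2)) x))).
    move=> x; rewrite /simple_pole -invfM.
    have -> : (x%:C - a +i* (5 / 2)) * (x%:C - a -i* (5 / 2)) = ((x - a) ^+ 2 + 25 / 4)%:C.
      by apply: complex_ext; rewrite !ReImE /=; field.
    by rewrite /X [RHS]rmorphM fmorphV.
  apply: multiplierM; first exact: multiplier_cst.
  by apply: multiplierM; exact: multiplier_pole.
have E x : (x \in [set x | (x - a) ^+ 2 < 1]) = (2^-1 < X x).
  rewrite /X ltr_pdivlMr //; apply/idP/idP; rewrite inE /=; lra.
split.
  rewrite (_ : [set x | _] = X @^-1` `]2^-1, +oo[); last first.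
    by apply/seteqP; split=> x; rewrite /= in_itv /= andbT -E inE.
  have mX' : measurable_fun (setT : set R) X by case: mX => -[].
  by rewrite -[_ @^-1` _]setTI; apply: mX' => //; exact: measurable_itv.
by apply: (@ext_multiplier (fun x => ((2^-1 < X x)%R)%:R)) => [x|];
  [rewrite E|exact: multiplier_thresh].
Qed.

Lemma mul_set_sigma : sigma_algebra setT mul_set.
Proof.
split.
- split; first exact: measurable0.
  apply: (@ext_multiplier (fun=> 0)); last exact: multiplier_cst.
  by move=> x; rewrite in_set0.
- move=> A [mA hA]; split; first by apply: measurableD.
  apply: (@ext_multiplier (fun x => 1 + (-1) * (x \in A)%:R)).
    move=> x; rewrite in_setD in_setT /=.
    by case: (x \in A); rewrite /= ?mulr1 ?subrr ?mulr0 ?addr0.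
  apply: multiplierD; first exact: multiplier_cst.
  by apply: multiplierM => //; exact: multiplier_cst.
- move=> A hA; split.
    by apply: bigcupT_measurable => n; case: (hA n).
  (* Indicator of the union of the first [n] sets, in polynomial form. *)
  pose m_ n (x : R) : R[i] := 1 + (-1) * \prod_(k < n) (1 + (-1) * (x \in A k)%:R).
  have E n x : m_ n x = (has (fun k => x \in A k) (iota 0 n))%:R.
    rewrite /m_ -(big_mkord xpredT (fun k => 1 + -1 * (x \in A k)%:R)) /index_iota subn0.
    elim: (iota 0 n) => [|k s IH] /=; first by rewrite big_nil mulr1 subrr.
    rewrite big_cons; case: (x \in A k) => /=.
      by rewrite mulr1 subrr mul0r mulr0 addr0.
    by rewrite mulr0 addr0 mul1r IH.
  apply: (@multiplier_lim _ m_ _ 1).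
  - rewrite (_ : (fun x => _) = (fun x => (\1_(\bigcup_k A k) x : R)%:C)).
      by apply: cmeas_real; apply: measurable_indic; apply: bigcupT_measurable => n; case: (hA n).
    by apply/funext => x; rewrite indicE real_complex_nat.
  - move=> n; rewrite /m_; apply: multiplierD; first exact: multiplier_cst.
    apply: multiplierM; first exact: multiplier_cst.
    elim: n => [|n IH].
      apply: (@ext_multiplier (fun=> 1)); last exact: multiplier_cst.
      by move=> x; rewrite big_ord0.
    apply: (@ext_multiplier (fun x => \prod_(k < n) (1 + -1 * (x \in A k)%:R) *
       (1 + -1 * (x \in A n)%:R))).
      by move=> x; rewrite big_ord_recr.
    apply: multiplierM => //; apply: multiplierD; first exact: multiplier_cst.
    by apply: multiplierM; [exact: multiplier_cst|case: (hA n)].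
  - by move=> n x; rewrite E; case: has; rewrite ?nc1 ?nc0.
  - move=> x; apply: cvg_near_cst.
    have [|xN] := boolP (x \in \bigcup_k A k).
      rewrite inE => -[k _ xk]; exists k.+1 => // n /= kn.
      rewrite E (_ : has _ _ = true) ?subrr ?nc0 //.
      by apply/hasP; exists k; [rewrite mem_iota add0n|rewrite inE].
    apply: nearW => n; rewrite E (_ : has _ _ = false) ?subrr ?nc0 //.
    apply/negbTE/hasPn => k _; apply: contra xN; rewrite !inE => xk.
    by exists k.
Qed.

End Density2.

(** * Density of simple poles: from Borel sets to all of L^2(R) *)

Section Density3.
Variable R : realType.
Local Notation mu := (@lebesgue_measure R).
Local Notation H1 := (L2 (@one1 R)).
Implicit Types (f g h m : R -> R[i]^o).

(** The overlapping intervals of radius 1 about [c + n + 1] cover the ray. *)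
Lemma mul_set_ray (c : R) : mul_set `]c, +oo[%classic.
Proof.
have [_ _ hU] := mul_set_sigma R.
rewrite (_ : `]c, +oo[%classic = \bigcup_n [set x : R | (x - (c + n%:R + 1)) ^+ 2 < 1]).
  by apply: hU => n; exact: mul_set_ball.
apply/seteqP; split=> x /=; rewrite in_itv /= andbT.
  move=> cx; have x0 : 0 <= x - c by rewrite subr_ge0 ltW.
  set t := Num.trunc (x - c).
  have /andP[t1 t2] := truncn_itv x0; rewrite -/t in t1 t2.
  have [e|ne] := eqVneq (x - c) t%:R.
    case: t t1 t2 e => [|t] t1 t2 e; first by move: cx; rewrite -subr_gt0 e ltxx.
    exists t => //=; rewrite (_ : x - _ = 0) ?expr0n //.
    by rewrite -natr1 in e; lra.
  exists t => //=; rewrite -natr1 in t2.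
  have t3 : t%:R < x - c by rewrite lt_neqAle eq_sym ne.
  rewrite -subr_gt0 (_ : 1 - _ = (x - c - t%:R) * (t%:R + 2 - (x - c))); last by ring.
  by apply: mulr_gt0; lra.
move=> [n _ /=] h; have n0 : 0 <= n%:R :> R by [].
rewrite ltNge; apply/negP => xc.
have : 1 <= (c + n%:R + 1 - x) ^+ 2 by rewrite expr_ge1 //; lra.
have -> : (c + n%:R + 1 - x) ^+ 2 = (x - (c + n%:R + 1)) ^+ 2 by ring.
by rewrite leNgt h.
Qed.

Lemma mul_set_measurable (A : set R) : measurable A -> mul_set A.
Proof.
move=> mA; have {mA} : (RGenOInfty.G (R:=R)).-sigma.-measurable A.
  by rewrite -RGenOInfty.measurableE.
apply: smallest_sub; first exact: mul_set_sigma.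
by move=> _ [c ->]; exact: mul_set_ray.
Qed.

(** The sum counts the positive integers up to [y], so it is the integer part of [y]. *)
Lemma layers (y : R) (N : nat) : 0 <= y <= N%:R ->
  `|y - \sum_(k < N) ((k.+1%:R <= y)%R)%:R| <= 1.
Proof.
move=> /andP[y0 yN].
have -> : \sum_(k < N) ((k.+1%:R <= y)%R)%:R = (Num.trunc y)%:R :> R.
  rewrite -natr_sum; congr (_%:R).
  have tN : (Num.trunc y <= N)%N.
    by rewrite truncn_le_nat -natr1; lra.
  under eq_bigr do rewrite -truncn_ge_nat //.
  rewrite -(big_mkord xpredT (fun k => ((k < Num.trunc y)%N : nat))).
  elim: N {yN} tN => [|N IH]; first by rewrite leqn0 big_geq // => /eqP ->.
  rewrite leq_eqVlt big_nat_recr //= => /orP[/eqP e|].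
    rewrite e ltnSn addn1; congr _.+1.
    rewrite big_nat (eq_bigr (fun=> 1%N)); last by move=> k /andP[_ kN]; rewrite ltnS ltnW.
    by rewrite -big_nat sum_nat_const_nat subn0 muln1.
  by rewrite ltnS => h; rewrite IH // ltnNge h addn0.
have /andP[t1 t2] := truncn_itv y0; rewrite -natr1 in t2.
by rewrite ler_norml; lra.
Qed.

Lemma multiplier_nneg (h : R -> R) (N : nat) : measurable_fun (setT : set R) h ->
  (forall x, 0 <= h x <= N%:R) -> multiplier (fun x => (h x)%:C).
Proof.
move=> mh hN.
(* Layer-cake approximation of [h] by indicators of superlevel sets, at scale [1 / (n + 1)]. *)
pose m_ n (x : R) : R[i] := (n.+1%:R^-1)%:C * \sum_(k < n.+1 * N) ((k.+1%:R <= n.+1%:R * h x)%R)%:R.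
have err n x : nc ((h x)%:C - m_ n x) <= n.+1%:R^-1.
  have n0 : 0 < n.+1%:R :> R by [].
  have := @layers (n.+1%:R * h x) (n.+1 * N) _.
  have -> : 0 <= n.+1%:R * h x <= (n.+1 * N)%:R.
    by have /andP[h1 h2] := hN x; rewrite natrM mulr_ge0 //= ler_pM2l.
  move=> /(_ isT) hl.
  rewrite /m_ (_ : _ - _ = (n.+1%:R^-1)%:C *
     (n.+1%:R * h x - \sum_(k < n.+1 * N) ((k.+1%:R <= n.+1%:R * h x)%R)%:R)%:C); last first.
    rewrite [in RHS]rmorphB rmorph_sum /= mulrBr -rmorphM mulKf ?gt_eqF //.
    by congr (_ - _ * _); apply: eq_bigr => k _; rewrite real_complex_nat.
  rewrite ncM !nc_real ger0_norm ?invr_ge0 ?ler0n //.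
  by rewrite -[leRHS]mulr1 ler_pM2l ?invr_gt0.
apply: (@multiplier_lim _ m_ _ (N%:R + 1)).
- exact: cmeas_real.
- move=> n; apply: multiplierM; first exact: multiplier_cst.
  elim: (n.+1 * N)%N => [|k IH].
    apply: (@ext_multiplier _ (fun=> 0)); last exact: multiplier_cst.
    by move=> x; rewrite big_ord0.
  apply: (@ext_multiplier _ (fun x => \sum_(i < k) ((i.+1%:R <= n.+1%:R * h x)%R)%:R +
       ((k.+1%:R <= n.+1%:R * h x)%R)%:R)).
    by move=> x; rewrite big_ord_recr.
  apply: multiplierD => //.
  have mA : measurable (h @^-1` `[k.+1%:R / n.+1%:R, +oo[).
    by rewrite -[_ @^-1` _]setTI; apply: mh => //; exact: measurable_itv.
  have [_] := mul_set_measurable mA.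
  apply: ext_multiplier => x; congr ((_ : bool)%:R).
  apply/idP/idP; rewrite inE /= in_itv /= andbT ler_pdivrMr // mulrC //.
- move=> n x.
  rewrite -[m_ n x]opprK -[- m_ n x](addKr (h x)%:C) opprD opprK.
  apply: (le_trans (ncD _ _)); apply: lerD.
    rewrite nc_real ger0_norm; by have /andP[] := hN x.
  rewrite ncN; apply: (le_trans (err n x)).
  by rewrite invf_le1 // ler1n.
- move=> x; apply: (@squeeze_cvgr _ _ _ _ (fun=> 0) (fun n : nat => n.+1%:R^-1)).
  + by apply: nearW => n; rewrite nc_ge0 err.
  + exact: cvg_cst.
  + exact: cvg_harmonic.
Qed.

Lemma multiplier_real (h : R -> R) (B : R) : measurable_fun (setT : set R) h ->
  (forall x, `|h x| <= B) -> multiplier (fun x => (h x)%:C).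
Proof.
move=> mh hB.
pose N := (Num.trunc B).+1.
have BN : B <= N%:R by apply: ltW; exact: truncnS_gt.
apply: (@ext_multiplier _ (fun x => (h x + N%:R)%:C + (- N%:R)%:C)).
  by move=> x; rewrite -rmorphD /= addrK.
apply: multiplierD; last exact: multiplier_cst.
apply: (@multiplier_nneg _ (2 * N)).
  by apply: measurable_funD => //; exact: measurable_cst.
move=> x; have := hB x; rewrite ler_norml natrM => /andP[h1 h2].
by apply/andP; split; lra.
Qed.

Lemma multiplier_bounded m (B : R) : cmeas m -> (forall x, nc (m x) <= B) ->
  multiplier m.
Proof.
move=> [m1 m2] mB.
apply: (@ext_multiplier _ (fun x => (complex.Re (m x))%:C + 'i%C * (complex.Im (m x))%:C)).
  by move=> x; rewrite -complexE.
apply: multiplierD.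
  by apply: (multiplier_real m1) => x; apply: le_trans (cRe_le _) (mB x).
apply: multiplierM; first exact: multiplier_cst.
by apply: (multiplier_real m2) => x; apply: le_trans (cIm_le _) (mB x).
Qed.

(** Write [f = m * simple_pole p] with [m = f (x - p)]. Replacing [m] by 0 where it is large gives
    multipliers, and the resulting products tend to [f] by dominated convergence. *)
Theorem pole_span_dense f : vec H1 f -> pole_span f.
Proof.
move=> vf; have [mf jf] := (H1_vecP f).1 vf.
have fp : far_pole ('i%C * 3 : R[i]).
  by rewrite /far_pole cImM !ReImE /= mul0r add0r mul1r ger0_norm //; lra.
set p := 'i%C * 3 in fp.
pose m_ n (x : R) : R[i] := if nc (f x * (x%:C - p)) <= n%:R then f x * (x%:C - p) else 0.
have mg : cmeas (fun x => f x * (x%:C - p)).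
  apply: cmeasM => //; apply: cmeasD; last exact: cmeas_cst.
  by apply: cmeas_real; exact: measurable_id.
have mm n : multiplier (m_ n).
  have mc : cmeas (m_ n).
    have mA : measurable ((fun x : R => nc (f x * (x%:C - p)) ^+ 2) @^-1` `]-oo, n%:R ^+ 2]).
      by rewrite -[_ @^-1` _]setTI; apply: (nc_meas mg) => //; exact: measurable_itv.
    rewrite (_ : m_ n = fun x => f x * (x%:C - p) *
       (x \in (fun x : R => nc (f x * (x%:C - p)) ^+ 2) @^-1` `]-oo, n%:R ^+ 2])%:R).
      apply: cmeasM => //.
      by have [_ []] := mul_set_measurable mA.
    apply/funext => x; rewrite /m_.
    set b := (X in (X : bool)%:R); have -> : b = (nc (f x * (x%:C - p)) <= n%:R).
      rewrite /b; apply/idP/idP; rewrite inE /= in_itv /= ler_pXn2r ?nnegrE ?nc_ge0 //.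
    by case: ifP; rewrite ?mulr1 ?mulr0.
  apply: (@multiplier_bounded _ n%:R) => // x.
  by rewrite /m_; case: ifP; rewrite ?nc0.
have mS n : pole_span (fun x => m_ n x * simple_pole p x).
  by have [_ _] := mm n; apply; exact: pole_span_gen.
case: (pole_span_closed R) => _ _; apply=> // e e0.
have c0 n x : nc (f x - m_ n x * simple_pole p x) <= nc (f x).
  rewrite /m_; case: ifP => _; last by rewrite mul0r subr0.
  by rewrite /simple_pole mulfK ?far_neq // subrr nc0 nc_ge0.
have c1 x : (fun n => nc (f x - m_ n x * simple_pole p x)) @ \oo --> (0 : R).
  apply: cvg_near_cst; near=> n; rewrite /m_ ifT; last first.
    by near: n; exact: nbhs_infty_ger.
  by rewrite /simple_pole mulfK ?far_neq // subrr nc0.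
have c2 n x : nc (f x - m_ n x * simple_pole p x) ^+ 2 * one1 x <= nc (f x) ^+ 2.
  by rewrite mulr1 ler_pXn2r ?nnegrE ?nc_ge0.
have vd n : vec H1 (fun x => f x - m_ n x * simple_pole p x).
  exact: (sh_vecB (H1_sh R) vf (pole_span_L2 (mS n))).
have [N HN] := L2_dominated (@one1_meas R) (@one1_ge0 R) vd c1 jf c2 e0.
by exists (fun x => m_ N x * simple_pole p x) => //; exact: HN.
Unshelve. all: by end_near.
Qed.

End Density3.

(** * The complex exponential and derivatives along the real line *)

Section Exponential.
Variable R : realType.
Implicit Types (z w k l : R[i]) (x y : R) (f g : R -> R[i]).

Lemma cexpD z w : cexp (z + w) = cexp z * cexp w.
Proof.
case: z w => a b [c d]; rewrite /cexp /= expRD cosD sinD.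
by apply: complex_ext; rewrite !ReImE /=; ring.
Qed.

Lemma cexp0 : cexp 0 = 1 :> R[i].
Proof. by rewrite /cexp /= expR0 cos0 sin0; apply: complex_ext; rewrite !ReImE /=; ring. Qed.

Lemma nc_cexp z : nc (cexp z) = expR (complex.Re z).
Proof.
rewrite /cexp ncM nc_real ger0_norm ?expR_ge0 //.
set t := nc _; suff -> : t = 1 by rewrite mulr1.
have t0 : 0 <= t by exact: nc_ge0.
by apply/eqP; rewrite -sqrp_eq1 // /t normc_sqr /= cos2Dsin2.
Qed.

Lemma cexp_neq0 z : cexp z != 0.
Proof. by rewrite -nc_gt0 nc_cexp expR_gt0. Qed.

Lemma cexpN z : cexp (- z) = (cexp z)^-1.
Proof.
by apply: (mulIf (cexp_neq0 z)); rewrite -cexpD addNr cexp0 mulVf // cexp_neq0.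
Qed.

Lemma cexp_real x : cexp x%:C = (expR x)%:C.
Proof. by rewrite /cexp /= cos0 sin0; apply: complex_ext; rewrite !ReImE /=; ring. Qed.

Definition cderiv f x l : Prop :=
  is_derive x 1 (fun t => complex.Re (f t)) (complex.Re l) /\
  is_derive x 1 (fun t => complex.Im (f t)) (complex.Im l).

Lemma cderiv_eq f x l l' : cderiv f x l -> l = l' -> cderiv f x l'.
Proof. by move=> h <-. Qed.

Lemma cderiv_ext f g x l : f =1 g -> cderiv f x l -> cderiv g x l.
Proof. by move=> /funext ->. Qed.

Lemma cderiv_cst k x : cderiv (fun=> k) x 0.
Proof. by split; exact: is_derive_cst. Qed.

Lemma cderiv_real (h : R -> R) x d : is_derive x 1 h d -> cderiv (fun t => (h t)%:C) x d%:C.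
Proof. by move=> hd; split=> //=; exact: is_derive_cst. Qed.

Lemma cderivD f g x l k : cderiv f x l -> cderiv g x k ->
  cderiv (fun t => f t + g t) x (l + k).
Proof.
move=> [f1 f2] [g1 g2]; split.
  by rewrite cReD; under eq_fun do rewrite cReD; exact: is_deriveD.
by rewrite cImD; under eq_fun do rewrite cImD; exact: is_deriveD.
Qed.

Lemma cderivM f g x l k : cderiv f x l -> cderiv g x k ->
  cderiv (fun t => f t * g t) x (l * g x + f x * k).
Proof.
move=> [f1 f2] [g1 g2]; split.
  under eq_fun do rewrite cReM.
  apply: (@is_derive_eq _ _ _ _ _ _ _ _ (is_deriveB (is_deriveM f1 g1) (is_deriveM f2 g2))).
  by rewrite !ReImE /GRing.scale /=; ring.
under eq_fun do rewrite cImM.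
apply: (@is_derive_eq _ _ _ _ _ _ _ _ (is_deriveD (is_deriveM f1 g2) (is_deriveM f2 g1))).
by rewrite !ReImE /GRing.scale /=; ring.
Qed.

Lemma cderivZ k f x l : cderiv f x l -> cderiv (fun t => k * f t) x (k * l).
Proof.
move=> hf; apply: (cderiv_eq (cderivM (cderiv_cst k x) hf)).
by rewrite mul0r add0r.
Qed.

Lemma cderivN f x l : cderiv f x l -> cderiv (fun t => - f t) x (- l).
Proof.
move=> hf; rewrite -mulN1r; apply: cderiv_ext (cderivZ (-1) hf) => t.
by rewrite mulN1r.
Qed.

Lemma cderivB f g x l k : cderiv f x l -> cderiv g x k ->
  cderiv (fun t => f t - g t) x (l - k).
Proof. by move=> hf hg; exact: cderivD hf (cderivN hg). Qed.

Lemma cderiv_sum (I : Type) (r : seq I) (F : I -> R -> R[i]) (d : I -> R[i]) x :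
  (forall i, cderiv (F i) x (d i)) ->
  cderiv (fun t => \sum_(i <- r) F i t) x (\sum_(i <- r) d i).
Proof.
move=> h; elim: r => [|i r IH].
  rewrite big_nil; apply: cderiv_ext (cderiv_cst 0 x) => t; by rewrite big_nil.
rewrite big_cons; apply: cderiv_ext (cderivD (h i) IH) => t; by rewrite big_cons.
Qed.

Lemma is_derive1_compR (f g : R -> R) x a b : is_derive (g x) 1 f a ->
  is_derive x 1 g b -> is_derive x 1 (fun t => f (g t)) (a * b).
Proof. exact: is_derive1_comp. Qed.

Lemma cderiv_cexp f x l : cderiv f x l ->
  cderiv (fun t => cexp (f t)) x (l * cexp (f x)).
Proof.
move=> [f1 f2].
have he := is_derive1_compR (is_derive_expR (complex.Re (f x))) f1.
have hc := is_derive1_compR (is_derive_cos (complex.Im (f x))) f2.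
have hs := is_derive1_compR (is_derive_sin (complex.Im (f x))) f2.
have h1 := cderiv_real he.
have h2 : cderiv (fun t => cos (complex.Im (f t)) +i* sin (complex.Im (f t))) x
    ((- sin (complex.Im (f x)) * complex.Im l) +i* (cos (complex.Im (f x)) * complex.Im l)).
  by split.
apply: (cderiv_eq (cderivM h1 h2)).
by rewrite /cexp; case: (f x) l {f1 f2 he hc hs h1 h2} => a b [c d] /=;
  apply: complex_ext; rewrite !ReImE /=; ring.
Qed.

Lemma cderiv_ccont f x l : cderiv f x l -> ccont f x.
Proof.
move=> [f1 f2]; split; apply: differentiable_continuous; apply/derivable1_diffP.
  exact: (@ex_derive _ _ _ _ _ _ _ f1).
exact: (@ex_derive _ _ _ _ _ _ _ f2).
Qed.

Lemma cderiv_id x : cderiv (fun t => t%:C) x 1.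
Proof. exact: (cderiv_real (is_derive_id x 1)). Qed.

End Exponential.

(** * Bounds for Laplace transforms of exponential sums *)

Section LaplaceBound.
Variable R : realType.
Implicit Types (z w k l : R[i]) (x y : R) (g : seq (R[i] * R[i])).

(* [g] codes the exponential sum [x |-> sum c e^(-b x)] over its pairs [(c, b)];
   [lap g z] is the Laplace transform of that sum. *)
Definition expsum g (x : R) : R[i] := \sum_(cb <- g) cb.1 * cexp (- (cb.2 * x%:C)).
Definition expsum' g (x : R) : R[i] :=
  \sum_(cb <- g) - (cb.2 * cb.1) * cexp (- (cb.2 * x%:C)).
Definition lap g (z : R[i]) : R[i] := \sum_(cb <- g) cb.1 / (z + cb.2).
Definition nneg_exps g : bool := all (fun cb => 0 <= complex.Re cb.2) g.

Definition gscale k g := [seq (k * cb.1, cb.2) | cb <- g].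
Definition gderiv g := [seq (- (cb.2 * cb.1), cb.2) | cb <- g].

Lemma expsum_scale k g x : expsum (gscale k g) x = k * expsum g x.
Proof.
rewrite /expsum big_map mulr_sumr; apply: eq_bigr => cb _ /=.
by rewrite mulrA.
Qed.

Lemma lap_scale k g z : lap (gscale k g) z = k * lap g z.
Proof.
rewrite /lap big_map mulr_sumr; apply: eq_bigr => cb _ /=.
by rewrite mulrA.
Qed.

Lemma expsum_deriv g x : expsum (gderiv g) x = expsum' g x.
Proof. by rewrite /expsum big_map. Qed.

Lemma nneg_scale k g : nneg_exps (gscale k g) = nneg_exps g.
Proof. by rewrite /nneg_exps all_map. Qed.

Lemma nneg_deriv g : nneg_exps (gderiv g) = nneg_exps g.
Proof. by rewrite /nneg_exps all_map. Qed.

Lemma cexp_cvg0 (k l : R[i]) : 0 < complex.Re l ->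
  (fun n : nat => nc (k * cexp (- (l * (n%:R)%:C)))) @ \oo --> (0 : R).
Proof.
move=> l0; set a := complex.Re l in l0.
have E n : nc (k * cexp (- (l * (n%:R)%:C))) = nc k * (expR (- a)) ^+ n.
  rewrite ncM nc_cexp cReN cReM /= mulr0 subr0 -/a -expRM_natr.
  by rewrite mulNr.
under eq_fun do rewrite E.
apply: cvg_geometric; rewrite ger0_norm ?expR_ge0 //.
by rewrite -expR0 ltr_expR oppr_lt0.
Qed.

(** [P x] is the integral of [e^(-z t) * expsum g t] over [[x, oo)] in closed form, with
    [P 0 = lap g z]. The function [psi] is nondecreasing, and [P] vanishes at infinity, whence
    [psi 0 <= 0]. *)
Lemma lap_Re_bound g z (N : R) : nneg_exps g -> 0 < complex.Re z ->
  (forall x, 0 <= x -> nc (expsum g x) <= N) ->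
  complex.Re (lap g z) <= N / complex.Re z.
Proof.
move=> hg; set a := complex.Re z => a0 hN.
pose P x := \sum_(cb <- g) cb.1 / (z + cb.2) * cexp (- ((z + cb.2) * x%:C)).
have gpos cb : cb \in g -> 0 < complex.Re (z + cb.2).
  by move=> /(allP hg) h; rewrite cReD ltr_pwDl.
have dP x : cderiv P x (- (cexp (- (z * x%:C)) * expsum g x)).
  have -> : - (cexp (- (z * x%:C)) * expsum g x) =
      \sum_(cb <- g) - (cb.1 * cexp (- ((z + cb.2) * x%:C))).
    rewrite /expsum mulr_sumr -sumrN; apply: eq_bigr => cb _.
    by rewrite mulrDl opprD cexpD; ring.
  rewrite /P; have E : forall s, {subset s <= g} -> cderiv
      (fun x => \sum_(cb <- s) cb.1 / (z + cb.2) * cexp (- ((z + cb.2) * x%:C))) x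
      (\sum_(cb <- s) - (cb.1 * cexp (- ((z + cb.2) * x%:C)))).
    elim=> [|cb s IH] sg.
      by rewrite big_nil; apply: cderiv_ext (cderiv_cst 0 x) => t; rewrite big_nil.
    rewrite big_cons; apply: (@cderiv_ext _ (fun t =>
       cb.1 / (z + cb.2) * cexp (- ((z + cb.2) * t%:C)) +
       \sum_(cb <- s) cb.1 / (z + cb.2) * cexp (- ((z + cb.2) * t%:C)))).
      by move=> t; rewrite big_cons.
    apply: cderivD; last by apply: IH => u us; apply: sg; rewrite inE us orbT.
    have h0 : z + cb.2 != 0.
      have := gpos _ (sg _ (mem_head _ _)); apply: contraTneq => ->.
      by rewrite ltxx.
    apply: (cderiv_eq (cderivZ _ (cderiv_cexp (cderivN (cderivZ (z + cb.2) (cderiv_id x)))))).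
    by field.
  exact: E.
pose psi x := complex.Re (P x) - N / a * expR (- (a * x)).
have dpsi x : is_derive x 1 psi
   (complex.Re (- (cexp (- (z * x%:C)) * expsum g x)) + N * expR (- (a * x))).
  have [d1 _] := dP x.
  have d2 : is_derive x 1 (fun t : R => - (a * t)) (- a).
    apply: (@is_derive_eq _ _ _ _ _ _ _ _ (is_deriveN (is_deriveZ a (is_derive_id x 1)))).
    by rewrite /GRing.scale /= mulr1.
  have d3 := @is_derive1_compR _ _ (fun t : R => - (a * t)) x _ _ (is_derive_expR (- (a * x))) d2.
  apply: (@is_derive_eq _ _ _ _ _ _ _ _ (is_deriveB d1 (is_deriveZ (N / a) d3))).
  by rewrite /GRing.scale /=; field; rewrite gt_eqF.
have psi_mono (X : R) : 0 <= X -> psi 0 <= psi X.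
  move=> X0; apply: (@ger0_derive1_ndecr _ psi 0 X) => //.
  - move=> x; rewrite in_itv /= => /andP[x0 _].
    rewrite derive1E; case: (dpsi x) => _ ->.
    rewrite cReN addrC subr_ge0; apply: (le_trans (ler_norm _)).
    apply: (le_trans (cRe_le _)); rewrite ncM nc_cexp cReN cReM /= mulr0 subr0 mulrC -/a.
    by apply: ler_wpM2r; [exact: expR_ge0|apply: hN; exact: ltW].
  - apply: derivable_within_continuous => x _.
    by case: (dpsi x).
have P0 : P 0 = lap g z.
  by apply: eq_bigr => cb _; rewrite mulr0 oppr0 cexp0 mulr1.
have N0 : 0 <= N by apply: le_trans (hN 0 (lexx _)); exact: nc_ge0.
have le n : complex.Re (lap g z) <= N / a + nc (P n%:R).
  have := psi_mono n%:R (ler0n _ _); rewrite /psi P0 mulr0 oppr0 expR0 mulr1 => h.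
  have e0 : 0 <= N / a * expR (- (a * n%:R)).
    by rewrite mulr_ge0 ?expR_ge0 // divr_ge0 // ltW.
  have := le_trans (ler_norm _) (cRe_le (P n%:R)); lra.
have Plim : (fun n : nat => nc (P n%:R)) @ \oo --> (0 : R).
  have lim : (fun n : nat => \sum_(cb <- g) nc (cb.1 / (z + cb.2) * cexp (- ((z + cb.2) * (n%:R)%:C))))
     @ \oo --> (0 : R).
    elim: (g) (gpos) => [|cb s IH] sg.
      by under eq_fun do rewrite big_nil; exact: cvg_cst.
    under eq_fun do rewrite big_cons.
    have sg' u : u \in s -> 0 < complex.Re (z + u.2).
      by move=> us; apply: sg; rewrite inE us orbT.
    have := cvgD (cexp_cvg0 (cb.1 / (z + cb.2)) (sg _ (mem_head _ _))) (IH sg').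
    by rewrite addr0 => h; exact: h.
  apply: (squeeze_cvgr _ (cvg_cst 0) lim).
  by apply: nearW => n; rewrite nc_ge0 nc_sum.
have lim2 : (fun n : nat => N / a + nc (P n%:R)) @ \oo --> N / a.
  by have := cvgD (cvg_cst (N / a)) Plim; rewrite addr0 => h; exact: h.
rewrite -(cvg_lim _ lim2) //; apply: limr_ge.
  by apply/cvg_ex; exists (N / a).
exact: nearW.
Qed.

(** The one-sided bound, applied to [g] times 1, -1, i and -i, controls real and imaginary parts. *)
Lemma lap_bound0 g z (N : R) : nneg_exps g -> 0 < complex.Re z ->
  (forall x, 0 <= x -> nc (expsum g x) <= N) ->
  nc (lap g z) <= 2 * N / complex.Re z.
Proof.
move=> hg z0 hN; have N0 : 0 <= N by apply: le_trans (hN 0 (lexx _)); exact: nc_ge0.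
have key k : nc k = 1 -> complex.Re (k * lap g z) <= N / complex.Re z.
  move=> k1; rewrite -lap_scale; apply: lap_Re_bound => //; first by rewrite nneg_scale.
  by move=> x x0; rewrite expsum_scale ncM k1 mul1r hN.
apply: (le_trans (nc_le _)); rewrite -mulrA mulr2n mulrDl !mul1r; apply: lerD.
  rewrite ler_norml; apply/andP; split.
    have := key (-1); rewrite ncN nc1 mulN1r cReN => /(_ erefl); lra.
  by have := key 1; rewrite nc1 mul1r; apply.
rewrite ler_norml; apply/andP; split.
  have := key 'i%C; rewrite nc_i cReM /= mul0r sub0r mul1r => /(_ erefl); lra.
have := key (- 'i%C); rewrite ncN nc_i cReM /= oppr0 mul0r sub0r mulN1r opprK; exact.
Qed.

(** Integration by parts: [z * lap g z = expsum g 0 + lap (gderiv g) z], where the last term is at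
    most [4 * N] when [Re z = 1/2]. The gained factor [1 / |z|] makes the transform square
    integrable along the line. *)
Lemma lap_bound g z (N : R) : nneg_exps g -> complex.Re z = 2^-1 ->
  (forall x, 0 <= x -> nc (expsum g x) <= N) ->
  (forall x, 0 <= x -> nc (expsum' g x) <= N) ->
  nc (lap g z) <= 5 * N / nc z.
Proof.
move=> hg z2 hN hN'.
have z0 : 0 < complex.Re z by rewrite z2.
have zn : z != 0 by apply: contraTneq z0 => ->; rewrite ltxx.
have E : z * lap g z = expsum g 0 + lap (gderiv g) z.
  rewrite /lap /expsum big_map mulr_sumr -big_split /=; apply: eq_big_seq => cb gcb.
  rewrite mulr0 oppr0 cexp0 mulr1.
  have h0 : z + cb.2 != 0.
    have h : 0 < complex.Re (z + cb.2) by rewrite cReD ltr_pwDl // (allP hg).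
    by apply: contraTneq h => ->; rewrite ltxx.
  by field.
rewrite ler_pdivlMr ?nc_gt0 // mulrC -ncM E.
apply: (le_trans (ncD _ _)); rewrite (_ : 5 * N = N + 4 * N); last by ring.
apply: lerD; first exact: hN.
have := @lap_bound0 (gderiv g) z N _ z0 _.
rewrite z2 invrK (_ : 2 * N * 2 = 4 * N); last by ring.
by apply=> [|x x0]; rewrite ?nneg_deriv // expsum_deriv; exact: hN'.
Qed.

End LaplaceBound.

(** * Bernstein approximation and a mean value inequality *)

Section Approximation.
Variable R : realType.
Implicit Types (f h : R -> R[i]) (p : {poly R[i]}) (x y K e : R).

(* Bernstein polynomials through the recursion of the binomial walk. *)
Fixpoint bern (n : nat) (phi : nat -> R[i]) : {poly R[i]} :=
  if n is m.+1 then 'X * bern m (fun k => phi k.+1) + (1 - 'X) * bern m phi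
  else (phi 0%N)%:P.

Fixpoint wbern (n : nat) (phi : nat -> R) (x : R) : R :=
  if n is m.+1 then x * wbern m (fun k => phi k.+1) x + (1 - x) * wbern m phi x
  else phi 0%N.

Lemma bern_bound n phi (psi : nat -> R) (v : R[i]) x : 0 <= x <= 1 ->
  (forall k, (k <= n)%N -> nc (phi k - v) <= psi k) ->
  nc ((bern n phi).[x%:C] - v) <= wbern n psi x.
Proof.
move=> /andP[x0 x1]; elim: n phi psi => [|n IH] phi psi h /=.
  by rewrite hornerC h.
rewrite hornerD !hornerM hornerD hornerN hornerX -[1]/(1%:P) hornerC.
set a := (bern n _).[_]; set b := (bern n phi).[_].
have -> : x%:C * a + (1 - x%:C) * b - v = x%:C * (a - v) + (1 - x)%:C * (b - v).
  by rewrite rmorphB rmorph1; ring.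
apply: (le_trans (ncD _ _)); rewrite !ncM !nc_real !ger0_norm ?subr_ge0 //.
apply: lerD; apply: ler_wpM2l; rewrite ?subr_ge0 //; apply: IH => k kn; apply: h => //.
by rewrite (leq_trans kn).
Qed.

(** Second moment of the binomial law about [c]: variance plus squared bias. *)
Lemma wbern_var n (c A B x : R) :
  wbern n (fun k => A + B * (k%:R - c) ^+ 2) x =
  A + B * (n%:R * x * (1 - x) + (n%:R * x - c) ^+ 2).
Proof.
elim: n c => [|n IH] c /=; first by rewrite mulr0n; ring.
rewrite IH (_ : (fun k => A + B * (k.+1%:R - c) ^+ 2) = fun k => A + B * (k%:R - (c - 1)) ^+ 2).
  by rewrite IH -natr1; ring.
by apply/funext => k; rewrite -natr1; congr (_ + _ * _ ^+ 2); ring.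
Qed.

Definition lip01 f K : Prop := forall x y, 0 <= x <= 1 -> 0 <= y <= 1 ->
  nc (f x - f y) <= K * `|x - y|.

Lemma bernstein f K e : lip01 f K -> 0 < e ->
  exists p, forall x, 0 <= x <= 1 -> nc (p.[x%:C] - f x) <= e.
Proof.
move=> fK e0.
have K0 : 0 <= K.
  have := fK 0 1; rewrite lexx ler01 lexx sub0r normrN normr1 mulr1 => /(_ isT isT).
  exact: le_trans (nc_ge0 _).
pose d := e / (K + 1).
have K1 : 0 < K + 1 by rewrite ltr_wpDl.
have d0 : 0 < d by exact: divr_gt0.
(* [n * d^2 > 1] brings the variance term [x (1 - x) / (2 d n)] below [d / 2]. *)
pose n := (Num.trunc (d ^- 2)).+1.
have hn : d ^- 2 < n%:R by exact: truncnS_gt.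
have n0 : 0 < n%:R :> R by rewrite ltr0n.
exists (bern n (fun k => f (k%:R / n%:R))) => x /[dup] hx /andP[x0 x1].
(* From [|t| <= d / 2 + t^2 / (2 d)]: the Lipschitz bound is replaced by a quadratic one whose
   Bernstein mean is known. *)
pose psi (k : nat) : R := K * (d / 2) + K / (2 * d * n%:R ^+ 2) * (k%:R - n%:R * x) ^+ 2.
apply: (le_trans (@bern_bound _ _ psi _ _ hx _)).
  move=> k kn.
  have hk : 0 <= (k%:R / n%:R : R) <= 1.
    by rewrite divr_ge0 //= ler_pdivrMr // mul1r ler_nat.
  apply: (le_trans (fK _ _ hk hx)).
  rewrite /psi -mulrA -mulrDr; apply: ler_wpM2l => //.
  set t := k%:R / n%:R - x.
  have -> : (2 * d * n%:R ^+ 2)^-1 * (k%:R - n%:R * x) ^+ 2 = t ^+ 2 / (2 * d).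
    by rewrite /t; field; rewrite !gt_eqF.
  rewrite -(real_normK (num_real t)) -subr_ge0.
  rewrite (_ : _ - _ = (`|t| - d) ^+ 2 / (2 * d)); last by field; rewrite gt_eqF.
  by rewrite divr_ge0 ?sqr_ge0 // mulr_ge0 // ltW.
rewrite wbern_var subrr expr0n addr0.
rewrite (_ : _ + _ = K * (d / 2 + x * (1 - x) / (2 * d * n%:R))); last first.
  by field; rewrite !gt_eqF.
apply: (@le_trans _ _ (K * d)).
  apply: ler_wpM2l => //; rewrite [leRHS](splitr d) lerD2l.
  have dn : 0 < 2 * d * n%:R by apply: mulr_gt0 => //; exact: mulr_gt0.
  rewrite ler_pdivrMr // (_ : d / 2 * (2 * d * n%:R) = d ^+ 2 * n%:R); last by field.
  have x11 : x * (1 - x) <= 1 by rewrite mulr_ile1 // ?subr_ge0 // gerBl.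
  apply: (le_trans x11); move: hn; rewrite -[d ^- 2]mul1r ltr_pdivrMr ?exprn_gt0 //.
  by rewrite mulrC => /ltW.
by rewrite /d mulrCA ger_pMr // ler_pdivrMr // mul1r lerDl.
Qed.

Lemma lip01_cont f K : lip01 f K ->
  {within `[0, 1], continuous (fun x => complex.Re (f x))} /\
  {within `[0, 1], continuous (fun x => complex.Im (f x))}.
Proof.
move=> fK.
have K0 : 0 <= K.
  have := fK 0 1; rewrite lexx ler01 lexx sub0r normrN normr1 mulr1 => /(_ isT isT).
  exact: le_trans (nc_ge0 _).
have K1 : 0 < K + 1 by rewrite ltr_wpDl.
have key (h : R -> R) : (forall x y, 0 <= x <= 1 -> 0 <= y <= 1 -> `|h x - h y| <= K * `|x - y|) ->
    {within `[0, 1], continuous h}.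
  move=> hK; apply/subspace_continuousP => x /=; rewrite in_itv /= => hx.
  apply/cvgrPdist_le => e e0; rewrite near_withinE.
  apply/nbhs_ballP; exists (e / (K + 1)) => /=; first by rewrite divr_gt0.
  move=> y; rewrite /ball /= => yx hy; rewrite in_itv /= in hy.
  apply: (le_trans (hK _ _ hx hy)).
  apply: (@le_trans _ _ ((K + 1) * `|x - y|)); first by rewrite ler_wpM2r // lerDl.
  by rewrite mulrC -ler_pdivlMr // ltW.
split; apply: key => x y hx hy; apply: le_trans (fK _ _ hx hy).
  by rewrite -cReN -cReD cRe_le.
by rewrite -cImN -cImD cIm_le.
Qed.

Definition wcont01 h : Prop :=
  {within `[0, 1], continuous (fun x => complex.Re (h x))} /\
  {within `[0, 1], continuous (fun x => complex.Im (h x))}.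

Lemma cmvt h h' (M : R) : wcont01 h ->
  (forall x, 0 < x < 1 -> cderiv h x (h' x)) ->
  (forall x, 0 < x < 1 -> nc (h' x) <= M) -> lip01 h (2 * M).
Proof.
move=> [cR cI] dh hM.
have key (g g' : R -> R) : {within `[0, 1], continuous g} ->
   (forall x, 0 < x < 1 -> is_derive x 1 g (g' x)) ->
   (forall x, 0 < x < 1 -> `|g' x| <= M) ->
   forall x y, 0 <= x <= 1 -> 0 <= y <= 1 -> `|g x - g y| <= M * `|x - y|.
  move=> cg dg gM.
  have lt x y : x < y -> 0 <= x <= 1 -> 0 <= y <= 1 -> `|g y - g x| <= M * `|y - x|.
    move=> xy /andP[x0 x1] /andP[y0 y1].
    have d1 z : z \in `]x, y[ -> is_derive z 1 g (g' z).
      rewrite in_itv /= => /andP[xz zy]; apply: dg.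
      by rewrite (le_lt_trans x0) //= (lt_le_trans zy).
    have c1 : {within `[x, y], continuous g}.
      by apply: continuous_subspaceW cg; apply: subset_itv; rewrite bnd_simp //.
    have [c hc ->] := MVT xy d1 c1.
    rewrite normrM; apply: ler_wpM2r => //; apply: gM.
    move: hc; rewrite in_itv /= => /andP[xz zy].
    by rewrite (le_lt_trans x0) //= (lt_le_trans zy).
  move=> x y hx hy; have [xy|yx|->] := ltgtP x y; last by rewrite !subrr !normr0 mulr0.
    by rewrite distrC [`|x - y|]distrC; exact: lt.
  exact: lt.
move=> x y hx hy; apply: (le_trans (nc_le _)).
have -> : 2 * M * `|x - y| = M * `|x - y| + M * `|x - y| by ring.
rewrite cReD cReN cImD cImN; apply: lerD.
  apply: (key _ (fun t => complex.Re (h' t)) cR) => // t ht; first by case: (dh t ht).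
  exact: le_trans (cRe_le _) (hM _ ht).
apply: (key _ (fun t => complex.Im (h' t)) cI) => // t ht; first by case: (dh t ht).
exact: le_trans (cIm_le _) (hM _ ht).
Qed.

End Approximation.

(** * Polynomial approximation together with derivatives *)

Section PolyApproximation.
Variable R : realType.
Implicit Types (f g h : R -> R[i]) (p q : {poly R[i]}) (x y K M e : R).

Definition lipb f : Prop := exists K, lip01 f K.
Definition bnd01 f M : Prop := forall x, 0 <= x <= 1 -> nc (f x) <= M.

Lemma in01_0 : 0 <= (0 : R) <= 1. Proof. by rewrite lexx ler01. Qed.
Lemma in01_1 : 0 <= (1 : R) <= 1. Proof. by rewrite lexx ler01. Qed.

Lemma lip01_ge0 f K : lip01 f K -> 0 <= K.
Proof.
move=> fK; have := fK 0 1 in01_0 in01_1; rewrite sub0r normrN normr1 mulr1.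
exact: le_trans (nc_ge0 _).
Qed.

Lemma lipb_bnd f : lipb f -> exists M, bnd01 f M.
Proof.
move=> [K fK]; exists (nc (f 0) + K) => x hx.
rewrite -[f x](subrK (f 0)); apply: (le_trans (ncD _ _)).
rewrite [leLHS]addrC lerD2l; apply: (le_trans (fK _ _ hx in01_0)).
rewrite subr0 ler_piMr ?(lip01_ge0 fK) // ger0_norm; by case/andP: hx.
Qed.

Lemma lipb_cst k : lipb (fun=> k).
Proof. by exists 0 => x y _ _; rewrite subrr nc0 mul0r. Qed.

Lemma lipb_id : lipb (fun x => x%:C).
Proof. by exists 1 => x y _ _; rewrite -rmorphB nc_real mul1r. Qed.

Lemma lipbD f g : lipb f -> lipb g -> lipb (fun x => f x + g x).
Proof.
move=> [K fK] [L gL]; exists (K + L) => x y hx hy.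
rewrite opprD addrACA; apply: (le_trans (ncD _ _)); rewrite mulrDl.
by apply: lerD; [exact: fK|exact: gL].
Qed.

Lemma lipbM f g : lipb f -> lipb g -> lipb (fun x => f x * g x).
Proof.
move=> lf lg; have [M fM] := lipb_bnd lf; have [N gN] := lipb_bnd lg.
case: lf lg => K fK [L gL]; exists (K * N + M * L) => x y hx hy.
have -> : f x * g x - f y * g y = (f x - f y) * g x + f y * (g x - g y) by ring.
apply: (le_trans (ncD _ _)); rewrite !ncM mulrDl; apply: lerD.
  rewrite mulrAC; apply: ler_pM; rewrite ?nc_ge0 //; [exact: fK|exact: gN].
rewrite -mulrA; apply: ler_pM; rewrite ?nc_ge0 //; [exact: fM|exact: gL].
Qed.

Lemma lipb_poly p : lipb (fun x => p.[x%:C]).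
Proof.
elim/poly_ind: p => [|p k IH].
  by rewrite (_ : (fun x => _) = fun=> 0); [exact: lipb_cst|apply/funext => x; rewrite horner0].
rewrite (_ : (fun x => _) = fun x => p.[x%:C] * x%:C + k); last first.
  by apply/funext => x; rewrite hornerMXaddC.
by apply: lipbD; [apply: lipbM => //; exact: lipb_id|exact: lipb_cst].
Qed.

Lemma lipb_wcont f : lipb f -> wcont01 f.
Proof. by move=> [K /lip01_cont]. Qed.

Lemma ccont_wcont f : (forall x, ccont f x) -> wcont01 f.
Proof. by move=> cf; split; apply: continuous_subspaceT => x; case: (cf x). Qed.

Lemma ccont_bnd f : (forall x, ccont f x) -> exists M, bnd01 f M.
Proof.
move=> /ccont_wcont[c1 c2].
have key (h : R -> R) : {within `[0, 1], continuous h} ->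
    exists M, forall x, 0 <= x <= 1 -> `|h x| <= M.
  move=> ch.
  have cn : {within `[0, 1], continuous (fun x => `|h x|)}.
    by move=> x; apply: continuous_comp; [exact: ch|exact: norm_continuous].
  have [m _ hm] := EVT_max (@ler01 R) cn.
  by exists `|h m| => x hx; apply: hm; rewrite in_itv.
have [M1 h1] := key _ c1; have [M2 h2] := key _ c2.
exists (M1 + M2) => x hx; apply: (le_trans (nc_le _)).
by apply: lerD; [exact: h1|exact: h2].
Qed.

Lemma lipb_cderiv f f' : (forall x, cderiv f x (f' x)) ->
  (forall x, ccont f' x) -> lipb f.
Proof.
move=> df cf'; have [M hM] := ccont_bnd cf'.
exists (2 * M); apply: (@cmvt _ f f') => [|x _|x /andP[x0 x1]].
- by apply: ccont_wcont => x; exact: cderiv_ccont (df x).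
- exact: df.
- by apply: hM; rewrite !ltW.
Qed.

Lemma cderiv_poly p x : cderiv (fun t => p.[t%:C]) x (p^`().[x%:C]).
Proof.
elim/poly_ind: p => [|p k IH].
  rewrite (_ : (fun t => _) = fun=> 0); last by apply/funext => t; rewrite horner0.
  by rewrite deriv0 horner0; exact: cderiv_cst.
rewrite (_ : (fun t => _) = fun t => p.[t%:C] * t%:C + k); last first.
  by apply/funext => t; rewrite hornerMXaddC.
apply: (cderiv_eq (cderivD (cderivM IH (cderiv_id x)) (cderiv_cst k x))).
by rewrite derivMXaddC hornerD hornerM hornerX; ring.
Qed.

(** The antiderivative of [p] that vanishes at 0. *)
Definition pint p : {poly R[i]} :=
  \poly_(i < (size p).+1) (if i is k.+1 then p`_k / k.+1%:R else 0).

Lemma pint_deriv p : (pint p)^`() = p.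
Proof.
apply/polyP => i; rewrite coef_deriv coef_poly ltnS.
have i0 : i.+1%:R != 0 :> R[i] by rewrite pnatr_eq0.
case: ltnP => h; first by rewrite -[LHS]mulr_natr divfK.
by rewrite mul0rn nth_default.
Qed.

Lemma pint0 p : (pint p).[0] = 0.
Proof. by rewrite horner_coef0 coef_poly. Qed.

Definition app p h e : Prop := forall x, 0 <= x <= 1 -> nc (p.[x%:C] - h x) <= e.
(** Uniform control of a function and its derivative is what [lap_bound] converts into an L^2
    estimate of the transform. *)
Definition app1 p h h' e : Prop := app p h e /\ app p^`() h' e.
Definition C1ap h h' : Prop := forall e, 0 < e -> exists p, app1 p h h' e.

Lemma app_le p h e e' : app p h e -> e <= e' -> app p h e'.
Proof. by move=> ph ee x hx; exact: le_trans (ph x hx) ee. Qed.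

Lemma app1_le p h h' e e' : app1 p h h' e -> e <= e' -> app1 p h h' e'.
Proof. by move=> [h1 h2] ee; split; apply: app_le ee. Qed.

Lemma app_pint p h h' e : lipb h -> (forall x, 0 < x < 1 -> cderiv h x (h' x)) ->
  app p h' e -> app (pint p + (h 0)%:P) h (2 * e).
Proof.
move=> lh dh ph x hx.
pose P := pint p + (h 0)%:P.
have lP : lip01 (fun x => P.[x%:C] - h x) (2 * e).
  apply: (@cmvt _ _ (fun x => p.[x%:C] - h' x)).
  - apply: lipb_wcont; apply: lipbD; first exact: lipb_poly.
    rewrite (_ : (fun x => _) = (fun x => (-1) * h x)).
      by apply: lipbM => //; exact: lipb_cst.
    by apply/funext => t; rewrite mulN1r.
  - move=> t ht; apply: cderivB; last exact: dh.
    by have := cderiv_poly P t; rewrite /P derivD derivC addr0 pint_deriv.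
  - by move=> t /andP[t0 t1]; apply: ph; rewrite !ltW.
have := lP x 0 hx in01_0.
rewrite [P.[0%:C]]hornerD pint0 add0r hornerC subrr !subr0 => h1.
apply: (le_trans h1); rewrite ler_piMr //; last by rewrite ger0_norm; case/andP: hx.
exact: lip01_ge0 lP.
Qed.

Lemma C1ap_of h h' : lipb h -> lipb h' ->
  (forall x, 0 < x < 1 -> cderiv h x (h' x)) -> C1ap h h'.
Proof.
move=> lh [K lh'] dh e e0.
have [p hp] := bernstein lh' (divr_gt0 e0 (ltr0n R 2)).
exists (pint p + (h 0)%:P); split.
  by have := app_pint lh dh hp; rewrite mulrC divfK.
rewrite derivD derivC addr0 pint_deriv; apply: (app_le hp).
by rewrite ler_pdivrMr // ler_peMr ?ltW // ltr1n.
Qed.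

(** Integrating an approximation of [h'] gives the right value at 0, and a small linear term
    corrects the value at 1. The endpoint values must be exact: they become residues (at 0) and
    matching conditions (at 1). *)
Lemma C2ap_of h h' h'' : lipb h -> (forall x, 0 < x < 1 -> cderiv h x (h' x)) ->
  C1ap h' h'' -> forall e, 0 < e -> exists p,
  [/\ p.[0] = h 0, p.[1] = h 1, app p h e, app p^`() h' e & app p^`()^`() h'' e].
Proof.
move=> lh dh c1 e e0; have e4 : 0 < e / 4 by rewrite divr_gt0.
have [p [hp hp']] := c1 _ e4.
have hP := app_pint lh dh hp; set P := pint p + _ in hP.
pose k := h 1 - P.[1].
have hk : nc k <= 2 * (e / 4) by rewrite /k nc_distC; have := hP 1 in01_1.
have P' : (P + k *: 'X)^`() = p + k%:P.
  by rewrite /P !derivD derivC addr0 pint_deriv derivZ derivX alg_polyC.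
exists (P + k *: 'X); split.
- by rewrite hornerD hornerZ hornerX mulr0 addr0 hornerD pint0 add0r hornerC.
- by rewrite hornerD hornerZ hornerX mulr1 /k addrC subrK.
- move=> x hx; rewrite hornerD hornerZ hornerX addrAC.
  apply: (le_trans (ncD _ _)); rewrite (_ : e = 2 * (e / 4) + 2 * (e / 4)); last by field.
  apply: lerD; first exact: hP.
  rewrite ncM nc_real ger0_norm; last by case/andP: hx.
  apply: le_trans hk; rewrite ler_piMr ?nc_ge0 //; by case/andP: hx.
- move=> x hx; rewrite P' hornerD hornerC addrAC.
  apply: (le_trans (ncD _ _)); apply: (@le_trans _ _ (e / 4 + 2 * (e / 4))); last lra.
  by apply: lerD; [exact: hp|exact: hk].
- rewrite P' derivD derivC addr0; apply: (app_le hp'); lra.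
Qed.

Lemma app_mul p q f g e M : app p f e -> app q g e -> bnd01 f M -> bnd01 g M ->
  0 <= e -> e <= 1 -> app (p * q) (fun x => f x * g x) (e * (2 * M + 1)).
Proof.
move=> pf qg fM gM e0 e1 x hx; rewrite hornerM.
have -> : p.[x%:C] * q.[x%:C] - f x * g x =
  (p.[x%:C] - f x) * ((q.[x%:C] - g x) + g x) + f x * (q.[x%:C] - g x) by ring.
apply: (le_trans (ncD _ _)).
rewrite (_ : e * (2 * M + 1) = e * (1 + M) + M * e); last by ring.
rewrite !ncM; apply: lerD; apply: ler_pM; rewrite ?nc_ge0 //; try (exact: pf);
  try (exact: fM); try (exact: qg).
apply: (le_trans (ncD _ _)); apply: lerD; last exact: gM.
exact: le_trans (qg x hx) e1.
Qed.

Lemma app_add p q f g e e' : app p f e -> app q g e' ->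
  app (p + q) (fun x => f x + g x) (e + e').
Proof.
move=> pf qg x hx; rewrite hornerD opprD addrACA; apply: (le_trans (ncD _ _)).
by apply: lerD; [exact: pf|exact: qg].
Qed.

Lemma app_ext p f g e : (forall x, 0 <= x <= 1 -> f x = g x) -> app p f e -> app p g e.
Proof. by move=> fg pf x hx; rewrite -fg //; exact: pf. Qed.

Lemma app_self p : app p (fun x => p.[x%:C]) 0.
Proof. by move=> x _; rewrite subrr nc0. Qed.

Lemma app1_mul p q f f' g g' e M : app1 p f f' e -> app1 q g g' e ->
  bnd01 f M -> bnd01 f' M -> bnd01 g M -> bnd01 g' M -> 0 <= e -> e <= 1 ->
  app1 (p * q) (fun x => f x * g x) (fun x => f' x * g x + f x * g' x)
    (e * (2 * M + 1) + e * (2 * M + 1)).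
Proof.
move=> [h1 h2] [h3 h4] b1 b2 b3 b4 e0 e1; split.
  apply: app_le (app_mul h1 h3 b1 b3 e0 e1) _; rewrite lerDl mulr_ge0 //.
  have := le_trans (nc_ge0 _) (b1 0 in01_0); lra.
by rewrite derivM; apply: app_add; apply: app_mul.
Qed.

Lemma bnd_common (fs : seq (R -> R[i])) :
  (forall f, List.In f fs -> exists M, bnd01 f M) ->
  exists2 M, 0 < M & forall f, List.In f fs -> bnd01 f M.
Proof.
elim: fs => [|f fs IH] h; first by exists 1.
have [M1 h1] := h f (or_introl erefl).
have [M2 M20 h2] := IH (fun g hg => h g (or_intror hg)).
have M10 : 0 <= M1 := le_trans (nc_ge0 _) (h1 0 in01_0).
exists (M1 + M2); first by rewrite ltr_wpDl.
move=> g [<-|hg] x hx.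
  by apply: (le_trans (h1 x hx)); rewrite lerDl ltW.
by apply: (le_trans (h2 g hg x hx)); rewrite lerDr.
Qed.

Lemma C1apM f f' g g' : lipb f -> lipb f' -> lipb g -> lipb g' ->
  C1ap f f' -> C1ap g g' -> C1ap (fun x => f x * g x) (fun x => f' x * g x + f x * g' x).
Proof.
move=> l1 l2 l3 l4 cf cg e e0.
have [M M0 hM] : exists2 M, 0 < M & forall h, List.In h [:: f; f'; g; g'] -> bnd01 h M.
  by apply: bnd_common => h /= [<-|[<-|[<-|[<-|[]]]]]; exact: lipb_bnd.
have b1 : bnd01 f M by apply: hM; left.
have b2 : bnd01 f' M by apply: hM; right; left.
have b3 : bnd01 g M by apply: hM; right; right; left.
have b4 : bnd01 g' M by apply: hM; right; right; right; left.
pose d := Num.min 1 (e / (2 * (2 * M + 1))).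
have M1 : 0 < 2 * (2 * M + 1) by apply: mulr_gt0 => //; rewrite ltr_wpDl // mulr_ge0 // ltW.
have d0 : 0 < d by rewrite lt_min ltr01 divr_gt0.
have d1 : d <= 1 by rewrite ge_min lexx.
have de : d <= e / (2 * (2 * M + 1)) by rewrite ge_min lexx orbT.
have [p hp] := cf d d0; have [q hq] := cg d d0.
exists (p * q); apply: app1_le (app1_mul hp hq b1 b2 b3 b4 (ltW d0) d1) _.
move: de; rewrite ler_pdivlMr // => de.
by rewrite (_ : _ + _ = d * (2 * (2 * M + 1))) //; ring.
Qed.

End PolyApproximation.

(** * Explicit solutions of the first-order equation *)

Section OdeSolution.
Variables (R : realType) (c : R).
Hypothesis hc : c ^+ 2 < 1.
Implicit Types (x y e : R) (a b z : R[i]) (w p : {poly R[i]}).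

Definition qq y : R := 1 + 2 * c * y + y ^+ 2.

Lemma qqE y : qq y = (1 - c ^+ 2) + (y + c) ^+ 2.
Proof. by rewrite /qq; ring. Qed.

Lemma qq_gt0 y : 0 < qq y.
Proof. by rewrite qqE ltr_wpDr ?sqr_ge0 // subr_gt0. Qed.

Lemma is_derive_qq y : is_derive y 1 qq (2 * (c + y)).
Proof.
have h := cderiv_poly (1 + (2 * c)%:C *: 'X + 'X^2) y.
have E t : (1 + (2 * c)%:C *: 'X + 'X^2 : {poly R[i]}).[t%:C] = (qq t)%:C.
  by rewrite !hornerE /qq; ring.
have D : (1 + (2 * c)%:C *: 'X + 'X^2 : {poly R[i]})^`().[y%:C] = (2 * (c + y))%:C.
  by rewrite !derivD derivZ derivX derivXn derivC add0r !hornerE /=; ring.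
case: h => h _; move: h; under eq_fun do rewrite E /=.
by rewrite D.
Qed.

Definition root_disc : R := Num.sqrt (1 - c ^+ 2).

Lemma root_disc_gt0 : 0 < root_disc.
Proof. by rewrite sqrtr_gt0 subr_gt0. Qed.

Lemma root_disc_sqr : root_disc ^+ 2 = 1 - c ^+ 2.
Proof. by rewrite sqr_sqrtr // ltW // subr_gt0. Qed.

(* [theta y] is the integral of [1 / qq] over [[y, 1]]. *)
Definition theta y : R :=
  root_disc^-1 * (atan ((1 + c) / root_disc) - atan ((y + c) / root_disc)).

Lemma theta1 : theta 1 = 0.
Proof. by rewrite /theta subrr mulr0. Qed.

Lemma theta0_gt0 : 0 < theta 0.
Proof.
rewrite /theta mulr_gt0 ?invr_gt0 ?root_disc_gt0 // subr_gt0; apply: lt_atan.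
by rewrite ltr_pM2r ?invr_gt0 ?root_disc_gt0 // add0r ltrDr.
Qed.

Lemma is_derive_theta y : is_derive y 1 theta (- (qq y)^-1).
Proof.
have s0 := root_disc_gt0.
have d1 : is_derive y 1 (fun t : R => root_disc^-1 * (t + c)) root_disc^-1.
  have h := is_deriveZ root_disc^-1 (is_deriveD (is_derive_id y 1) (is_derive_cst c y (1 : R))).
  by apply: (@is_derive_eq _ _ _ _ _ _ _ _ h); rewrite addr0 /GRing.scale /= mulr1.
have d2 := @is_derive1_compR _ _ _ y _ _ (is_derive1_atan (root_disc^-1 * (y + c))) d1.
have d3 := is_deriveZ root_disc^-1
   (is_deriveB (is_derive_cst (atan ((1 + c) / root_disc)) y (1 : R)) d2).
rewrite (_ : theta = fun t => root_disc^-1 * (atan ((1 + c) / root_disc) -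
    atan (root_disc^-1 * (t + c)))).
  apply: (@is_derive_eq _ _ _ _ _ _ _ _ d3).
  rewrite /GRing.scale /= sub0r qqE -root_disc_sqr.
  have h1 : root_disc ^+ 2 + (y + c) ^+ 2 != 0.
    by rewrite gt_eqF // ltr_wpDr ?sqr_ge0 // exprn_gt0.
  rewrite exprMn exprVn; field.
  by rewrite h1 gt_eqF.
by apply/funext => t; rewrite /theta [_ * (t + c)]mulrC.
Qed.

(** The function [qq^a * exp(b * theta)]. The family is closed under products and reciprocals and
    contains the solutions of the transformed equation. *)
Definition vab a b y : R[i] := cexp (a * (ln (qq y))%:C + b * (theta y)%:C).

Lemma vabM a b a' b' y : vab a b y * vab a' b' y = vab (a + a') (b + b') y.
Proof. by rewrite /vab -cexpD; congr cexp; ring. Qed.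

Lemma vab0 y : vab 0 0 y = 1.
Proof. by rewrite /vab !mul0r addr0 cexp0. Qed.

Lemma vab_qq y : vab 1 0 y = (qq y)%:C.
Proof. by rewrite /vab mul1r mul0r addr0 cexp_real lnK // posrE qq_gt0. Qed.

Lemma vab_neq0 a b y : vab a b y != 0.
Proof. exact: cexp_neq0. Qed.

Definition vlin a b : {poly R[i]} := (2 * a) *: (c%:C%:P + 'X) - b%:P.

Lemma vlinE a b y : (vlin a b).[y%:C] = 2 * a * (c%:C + y%:C) - b.
Proof. by rewrite /vlin !hornerE. Qed.

Lemma cderiv_vab a b y :
  cderiv (vab a b) y ((vlin a b).[y%:C] * vab (a - 1) b y).
Proof.
have q0 := qq_gt0 y.
have h1 := @is_derive1_compR _ _ _ y _ _ (is_derive1_ln q0) (is_derive_qq y).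
have h2 := cderivD (cderivZ a (cderiv_real h1)) (cderivZ b (cderiv_real (is_derive_theta y))).
apply: (cderiv_eq (cderiv_cexp h2)).
rewrite -[cexp _]/(vab a b y) -[vab a b y](_ : (qq y)%:C * vab (a - 1) b y = _); last first.
  by rewrite -vab_qq vabM addrCA subrr addr0 add0r.
rewrite vlinE mulrA; congr (_ * _).
have qc : (qq y)%:C != 0 :> R[i] by rewrite eq_complex /= negb_and gt_eqF.
by field.
Qed.

Lemma ccont_vab a b y : ccont (vab a b) y.
Proof. exact: cderiv_ccont (cderiv_vab a b y). Qed.

Lemma lipb_vab a b : lipb (vab a b).
Proof.
apply: (lipb_cderiv (cderiv_vab a b)) => x; apply: ccontM; last exact: ccont_vab.
exact: cderiv_ccont (cderiv_poly _ x).
Qed.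

Definition vab' a b y : R[i] := (vlin a b).[y%:C] * vab (a - 1) b y.
Definition vab'' a b y : R[i] := (vlin a b)^`().[y%:C] * vab (a - 1) b y +
  (vlin a b).[y%:C] * ((vlin (a - 1) b).[y%:C] * vab (a - 1 - 1) b y).

Lemma cderiv_vab' a b y : cderiv (vab' a b) y (vab'' a b y).
Proof. exact: cderivM (cderiv_poly _ y) (cderiv_vab _ _ y). Qed.

Lemma lipb_vab' a b : lipb (vab' a b).
Proof. by apply: lipbM; [exact: lipb_poly|exact: lipb_vab]. Qed.

Lemma lipb_vab'' a b : lipb (vab'' a b).
Proof.
apply: lipbD; apply: lipbM; try exact: lipb_poly; try exact: lipb_vab.
by apply: lipbM; [exact: lipb_poly|exact: lipb_vab].
Qed.

Lemma C1ap_vab a b : C1ap (vab a b) (vab' a b).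
Proof.
by apply: C1ap_of => [||x _]; [exact: lipb_vab|exact: lipb_vab'|exact: cderiv_vab].
Qed.

Lemma C1ap_vab' a b : C1ap (vab' a b) (vab'' a b).
Proof.
by apply: C1ap_of => [||x _]; [exact: lipb_vab'|exact: lipb_vab''|exact: cderiv_vab'].
Qed.

Lemma C2ap_vab a b e : 0 < e -> exists p,
  [/\ p.[0] = vab a b 0, p.[1] = vab a b 1, app p (vab a b) e,
      app p^`() (vab' a b) e & app p^`()^`() (vab'' a b) e].
Proof.
apply: C2ap_of => [|x _|]; [exact: lipb_vab|exact: cderiv_vab|exact: C1ap_vab'].
Qed.

End OdeSolution.

(** * Powers with complex exponent on [0, 1] *)

Section RealPower.
Variable R : realType.
Implicit Types (x y : R) (b : R[i]).

(** The power [y^b], extended by 0; under [y = e^(-x)] it becomes [e^(-b x)], whose Laplace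
    transform is [1 / (z + b)]. *)
Definition cpw b y : R[i] := if y <= 0 then 0 else cexp (b * (ln y)%:C).

Lemma nc_cpw b y : 0 < y -> nc (cpw b y) = expR (complex.Re b * ln y).
Proof.
move=> y0; rewrite /cpw ifF; last by rewrite leNgt y0.
by rewrite nc_cexp cReM /= mulr0 subr0.
Qed.

Lemma cpw0 b : cpw b 0 = 0.
Proof. by rewrite /cpw lexx. Qed.

Lemma cpw_expR b x : cpw b (expR (- x)) = cexp (- (b * x%:C)).
Proof. by rewrite /cpw leNgt expR_gt0 /= expRK rmorphN mulrN. Qed.

Lemma nc_cpw_le b y : 0 <= complex.Re b -> 0 <= y <= 1 -> nc (cpw b y) <= 1.
Proof.
move=> b0 /andP[y0 y1]; have [->|yn] := eqVneq y 0; first by rewrite cpw0 nc0.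
have yp : 0 < y by rewrite lt_def yn.
rewrite nc_cpw // -expR0 ler_expR mulr_ge0_le0 //.
by rewrite -ln1 ler_ln ?posrE.
Qed.

Lemma cpwS b y : 0 <= y -> cpw b y = y%:C * cpw (b - 1) y.
Proof.
move=> y0; have [->|yn] := eqVneq y 0; first by rewrite !cpw0 mulr0.
have yp : 0 < y by rewrite lt_def yn.
rewrite /cpw leNgt yp /= -[y%:C](_ : cexp (ln y)%:C = _).
  by rewrite -cexpD; congr cexp; ring.
by rewrite cexp_real lnK // posrE.
Qed.

Lemma nc_cpw_lin b y : 1 <= complex.Re b -> 0 <= y <= 1 -> nc (cpw b y) <= y.
Proof.
move=> b1 /andP[y0 y1]; rewrite cpwS // ncM nc_real ger0_norm //.
rewrite ler_piMr // nc_cpw_le ?y0 // cReD cReN /= subr_ge0 //.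
Qed.

Lemma cderiv_cpw b y : 0 < y -> cderiv (cpw b) y (b * cpw (b - 1) y).
Proof.
move=> y0.
have h := cderiv_cexp (cderivZ b (cderiv_real (is_derive1_ln y0))).
have near_eq (f g : R -> R) l : (\forall t \near y, f t = g t) -> is_derive y 1 f l ->
    is_derive y 1 g l.
  move=> fg [df <-]; split; first exact: near_eq_derivable df.
  by apply/esym; exact: near_eq_derive fg.
have N : \forall t \near y, cexp (b * (ln t)%:C) = cpw b t.
  near=> t; rewrite /cpw leNgt (_ : 0 < t) //.
  by near: t; exact: lt_nbhsr.
have E : b * cpw (b - 1) y = b * (y^-1)%:C * cexp (b * (ln y)%:C).
  have := cpwS b (ltW y0); rewrite {1}/cpw leNgt y0 /= => ->.
  rewrite fmorphV; have yc : y%:C != 0 :> R[i] by rewrite eq_complex /= negb_and gt_eqF.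
  by field.
rewrite E; case: h => h1 h2; split.
  by apply: near_eq h1; apply: filterS N => t ->.
by apply: near_eq h2; apply: filterS N => t ->.
Unshelve. all: by end_near.
Qed.

Lemma lipb_cpw b : 1 <= complex.Re b -> lipb (cpw b).
Proof.
move=> b1.
suff wc : wcont01 (cpw b).
  exists (2 * nc b); apply: (@cmvt _ _ (fun y => b * cpw (b - 1) y)) => // x /andP[x0 x1].
    exact: cderiv_cpw.
  rewrite ncM ler_piMr ?nc_ge0 //; apply: nc_cpw_le; last by rewrite !ltW.
  by rewrite cReD cReN subr_ge0.
have key (k : R[i] -> R) : (forall z w, `|k z - k w| <= nc (z - w)) -> k 0 = 0 ->
    (forall y, 0 < y -> continuous_at y (fun t => k (cpw b t))) ->
    {within `[0, 1], continuous (fun t => k (cpw b t))}.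
  move=> kl k0 kc; apply/subspace_continuousP => x /=; rewrite in_itv /= => /andP[x0 x1].
  have [xE|xN] := eqVneq x 0; last first.
    by apply: cvg_within_filter; apply: kc; rewrite lt_def xN.
  apply/cvgrPdist_le => e e0; rewrite near_withinE; apply/nbhs_ballP; exists e => //=.
  move=> y; rewrite /ball /= xE sub0r normrN /from_subspace cpw0 k0 sub0r normrN => ye.
  rewrite in_itv /= => hy; rewrite -[k _]subr0 -k0; apply: (le_trans (kl _ _)).
  rewrite subr0; apply: (le_trans (nc_cpw_lin b1 hy)); apply: le_trans (ltW ye).
  exact: ler_norm.
split; apply: key => //.
- by move=> z w; rewrite -cReN -cReD cRe_le.
- by move=> y y0; case: (cderiv_ccont (cderiv_cpw b y0)).
- by move=> z w; rewrite -cImN -cImD cIm_le.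
- by move=> y y0; case: (cderiv_ccont (cderiv_cpw b y0)).
Qed.

(** [Re b >= 2] makes the derivative [b y^(b - 1)] Lipschitz up to [y = 0]. *)
Lemma C1ap_cpw b : 2 <= complex.Re b -> C1ap (cpw b) (fun y => b * cpw (b - 1) y).
Proof.
move=> b2; apply: C1ap_of.
- by apply: lipb_cpw; lra.
- apply: lipbM; first exact: lipb_cst.
  by apply: lipb_cpw; rewrite cReD cReN /=; lra.
- by move=> x /andP[x0 _]; exact: cderiv_cpw.
Qed.

End RealPower.

(** * The differential operator on (0, 1) and its range *)

Section SideRange.
Variables (R : realType) (c tau : R).
Hypothesis hc : c ^+ 2 < 1.
Implicit Types (x y e : R) (a b z : R[i]) (w p u P : {poly R[i]}).

Definition tw : R[i] := 1 + 2 * 'i%C * tau%:C.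
Definition qp : {poly R[i]} := 1 + (2 * c)%:C *: 'X + 'X^2.
(** The first-order operator to which the difference operator is conjugate under [Utr]; see
    [Lc_Utr]. *)
Definition EE w : {poly R[i]} := 'i%C *: (qp * w^`() + tw *: ((c%:C%:P + 'X) * w)).
Definition Ez z w : {poly R[i]} := EE w - z *: w.

Lemma qpE y : qp.[y%:C] = (qq c y)%:C.
Proof. by rewrite /qp !hornerE /qq; ring. Qed.

(** The exponent for which [qq^vexp] is annihilated by the differential operator. Then
    [vz z = qq^vexp * exp(i z theta)] is the eigenfunction for [z], normalised at [y = 1], where its
    value is independent of [z]. *)
Definition vexp : R[i] := - (2^-1) - 'i%C * tau%:C.
Definition vz z := vab c vexp ('i%C * z).
Definition vz' z := vab' c vexp ('i%C * z).
Definition vz'' z := vab'' c vexp ('i%C * z).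

Lemma i_sqr : 'i%C * 'i%C = -1 :> R[i].
Proof. by rewrite -expr2 sqr_i. Qed.

Lemma i_inv : ('i%C : R[i])^-1 = - 'i%C.
Proof.
have i0 : 'i%C != 0 :> R[i] by rewrite -nc_gt0 nc_i.
by apply: (mulfI i0); rewrite mulfV // mulrN i_sqr opprK.
Qed.

Lemma vz_ode z y : 'i%C * ((qq c y)%:C * vz' z y + tw * ((c%:C + y%:C) * vz z y)) = z * vz z y.
Proof.
have E : vz z y = (qq c y)%:C * vab c (vexp - 1) ('i%C * z) y.
  by rewrite -(vab_qq hc) vabM /vz addrCA subrr addr0 add0r.
rewrite /vz' /vab' vlinE E /tw /vexp.
set q := (qq c y)%:C; set V := vab _ _ _ _.
have -> : 'i%C * (q * ((2 * (- 2^-1 - 'i%C * tau%:C) * (c%:C + y%:C) - 'i%C * z) * V) +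
  (1 + 2 * 'i%C * tau%:C) * ((c%:C + y%:C) * (q * V))) = - ('i%C * 'i%C) * z * q * V.
  by field.
by rewrite i_sqr opprK mul1r mulrA.
Qed.

Lemma cderiv_unique (f : R -> R[i]) y l l' : cderiv f y l -> cderiv f y l' -> l = l'.
Proof.
by case=> [[_ h1] [_ h2]] [[_ h3] [_ h4]]; apply: complex_ext; rewrite -?h1 -?h2 ?h3 ?h4.
Qed.

Lemma app_mulp A p f e M : app p f e -> bnd01 (fun x => A.[x%:C]) M ->
  app (A * p) (fun x => A.[x%:C] * f x) (M * e).
Proof.
move=> pf AM x hx; rewrite hornerM -mulrBr ncM.
by apply: ler_pM; rewrite ?nc_ge0 //; [exact: AM|exact: pf].
Qed.

Lemma poly_bnd p : exists M, bnd01 (fun x => p.[x%:C]) M.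
Proof. by apply: lipb_bnd; exact: lipb_poly. Qed.

(** Variation of constants: since [vz z] solves the homogeneous equation, applying the operator to
    [vz z * P] leaves only [i * qq * vz z * P']. Replacing [vz z] by a polynomial close to it with
    two derivatives preserves this up to [e]. *)
Lemma Ez_approx_fun z P e : 0 < e -> exists u, [/\ u.[0] = vz z 0, u.[1] = vz z 1,
  app1 u (vz z) (vz' z) e &
  app1 (Ez z (u * P)) (fun y => 'i%C * ((qq c y)%:C * (vz z y * P^`().[y%:C])))
   (fun y => 'i%C * ((2 * (c + y))%:C * (vz z y * P^`().[y%:C]) +
       (qq c y)%:C * (vz' z y * P^`().[y%:C] + vz z y * P^`()^`().[y%:C]))) e].
Proof.
move=> e0.
pose A := 'i%C *: (qp * P).
pose B := 'i%C *: (qp * P^`()) + ('i%C * tw) *: ((c%:C%:P + 'X) * P) - z *: P.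
have EzE u : Ez z (u * P) = A * u^`() + B * u.
  rewrite /Ez /EE /A /B derivM -!mul_polyC; ring.
have [M M0 hM] : exists2 M, 0 < M & forall f, List.In f [:: (fun x => A.[x%:C]);
    (fun x => A^`().[x%:C]); (fun x => B.[x%:C]); (fun x => B^`().[x%:C])] -> bnd01 f M.
  by apply: bnd_common => f /= [<-|[<-|[<-|[<-|[]]]]]; exact: poly_bnd.
have b1 : bnd01 (fun x => A.[x%:C]) M by apply: hM; left.
have b2 : bnd01 (fun x => A^`().[x%:C]) M by apply: hM; right; left.
have b3 : bnd01 (fun x => B.[x%:C]) M by apply: hM; right; right; left.
have b4 : bnd01 (fun x => B^`().[x%:C]) M by apply: hM; right; right; right; left.
pose d := Num.min e (e / (4 * M)).
have M4 : 0 < 4 * M by exact: mulr_gt0.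
have d0 : 0 < d by rewrite lt_min e0 divr_gt0.
have de : d <= e by rewrite ge_min lexx.
have Md : M * d <= e / 4.
  have hd : d <= e / (4 * M) by rewrite ge_min lexx orbT.
  have : M * d <= M * (e / (4 * M)) by rewrite ler_pM2l.
  rewrite (_ : M * (e / (4 * M)) = e / 4) //; field; by rewrite gt_eqF.
have [u [u0 u1 hu hu' hu'']] := C2ap_vab hc vexp ('i%C * z) d0.
exists u; split=> //; first by split; apply: app_le de.
rewrite EzE.
pose F y := A.[y%:C] * vz' z y + B.[y%:C] * vz z y.
pose F' y := A^`().[y%:C] * vz' z y + A.[y%:C] * vz'' z y +
   (B^`().[y%:C] * vz z y + B.[y%:C] * vz' z y).
have aF : app1 (A * u^`() + B * u) F F' e.
  split.
    apply: (@app_le _ _ _ (M * d + M * d)).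
      by apply: app_add; apply: app_mulp.
    lra.
  rewrite derivD !derivM; apply: (@app_le _ _ _ (M * d + M * d + (M * d + M * d))).
    by apply: app_add; apply: app_add; apply: app_mulp.
  lra.
have FE y : F y = 'i%C * ((qq c y)%:C * (vz z y * P^`().[y%:C])).
  have -> : F y = A.[y%:C] * vz' z y + B.[y%:C] * vz z y by [].
  have -> : A.[y%:C] = 'i%C * ((qq c y)%:C * P.[y%:C]).
    by rewrite /A hornerZ hornerM qpE.
  have -> : B.[y%:C] = 'i%C * ((qq c y)%:C * P^`().[y%:C]) +
     'i%C * tw * ((c%:C + y%:C) * P.[y%:C]) - z * P.[y%:C].
    by rewrite /B hornerD hornerN hornerD !hornerZ !hornerM qpE hornerD hornerC hornerX.
  set q := (qq c y)%:C; set P1 := P^`().[_].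
  have -> : 'i%C * (q * P.[y%:C]) * vz' z y + ('i%C * (q * P1) +
     'i%C * tw * ((c%:C + y%:C) * P.[y%:C]) - z * P.[y%:C]) * vz z y =
     ('i%C * (q * vz' z y + tw * ((c%:C + y%:C) * vz z y)) - z * vz z y) * P.[y%:C] +
     'i%C * (q * (vz z y * P1)) by ring.
  by rewrite vz_ode subrr mul0r add0r.
have dF y : cderiv F y (F' y).
  by apply: cderivD; apply: cderivM; try exact: cderiv_poly;
    [exact: (cderiv_vab' hc)|exact: (cderiv_vab hc)].
have dG y : cderiv F y ('i%C * ((2 * (c + y))%:C * (vz z y * P^`().[y%:C]) +
       (qq c y)%:C * (vz' z y * P^`().[y%:C] + vz z y * P^`()^`().[y%:C]))).
  apply: (@cderiv_ext _ (fun y => 'i%C * ((qq c y)%:C * (vz z y * P^`().[y%:C])))).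
    by move=> t; rewrite FE.
  apply: cderivZ; apply: cderivM; first exact: (cderiv_real (is_derive_qq c y)).
  by apply: cderivM; [exact: (cderiv_vab hc)|exact: cderiv_poly].
case: aF => h1 h2; split.
  by apply: app_ext h1 => y _; exact: FE.
by apply: app_ext h2 => y _; exact: cderiv_unique (dF y) (dG y).
Qed.

(** The exact solution is [vz z * P] with [P' = y^b / (i * qq * vz z)] and [P(0) = 0]. Here [-i * r]
    is the reciprocal of [s = i * qq * vz z], and [y^b * (-i * r)] is approximated by a polynomial
    [p], whose antiderivative replaces [P]. *)
Lemma side_range z b e : 2 <= complex.Re b -> 0 < e -> exists w, w.[0] = 0 /\
  app1 (Ez z w) (cpw b) (fun y => b * cpw (b - 1) y) e.
Proof.
move=> b2 e0.
pose r := vab c (- vexp - 1) (- ('i%C * z)).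
pose r' := vab' c (- vexp - 1) (- ('i%C * z)).
pose s y : R[i] := 'i%C * ((qq c y)%:C * vz z y).
pose s' y : R[i] := 'i%C * ((2 * (c + y))%:C * vz z y + (qq c y)%:C * vz' z y).
have sr y : s y * (- 'i%C * r y) = 1.
  rewrite /s /r /vz -(vab_qq hc).
  have -> : 'i%C * (vab c 1 0 y * vab c vexp ('i%C * z) y) *
     (- 'i%C * vab c (- vexp - 1) (- ('i%C * z)) y) =
     - ('i%C * 'i%C) * (vab c 1 0 y * vab c vexp ('i%C * z) y *
        vab c (- vexp - 1) (- ('i%C * z)) y) by ring.
  rewrite !vabM i_sqr opprK mul1r.
  rewrite (_ : 1 + vexp + (- vexp - 1) = 0); last by ring.
  by rewrite (_ : 0 + _ + _ = 0) ?vab0 //; ring.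
have ds y : cderiv s y (s' y).
  apply: cderivZ; apply: cderivM; first exact: (cderiv_real (is_derive_qq c y)).
  exact: (cderiv_vab hc).
have dr y : cderiv r y (r' y) by exact: (cderiv_vab hc).
(* Derivative of the constant product [sr]; it rewrites the derivative of the target through [h] and
   [h']. *)
have dsr y : s' y * (- 'i%C * r y) + s y * (- 'i%C * r' y) = 0.
  have h1 := cderivM (ds y) (cderivZ (- 'i%C) (dr y)).
  apply: (cderiv_unique h1).
  by apply: cderiv_ext (cderiv_cst 1 y) => t; rewrite sr.
pose h y := cpw b y * (- 'i%C * r y).
pose h' y := b * cpw (b - 1) y * (- 'i%C * r y) + cpw b y * (- 'i%C * r' y).
have ch : C1ap h h'.
  apply: C1apM.
  - by apply: lipb_cpw; lra.
  - apply: lipbM; first exact: lipb_cst.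
    by apply: lipb_cpw; rewrite cReD cReN /=; lra.
  - by apply: lipbM; [exact: lipb_cst|exact: (lipb_vab hc)].
  - by apply: lipbM; [exact: lipb_cst|exact: (lipb_vab' hc)].
  - exact: C1ap_cpw.
  - apply: C1ap_of => [||x _].
    + by apply: lipbM; [exact: lipb_cst|exact: (lipb_vab hc)].
    + by apply: lipbM; [exact: lipb_cst|exact: (lipb_vab' hc)].
    + exact: cderivZ.
have ls : exists M, bnd01 s M by apply: ccont_bnd => y; exact: cderiv_ccont (ds y).
have ls' : exists M, bnd01 s' M.
  apply: ccont_bnd => y; rewrite /s'; apply: ccontM; first exact: ccont_cst.
  apply: ccontD; apply: ccontM.
  - have := ccontM (ccont_cst (2 : R[i]) y) (ccontD (ccont_cst (c%:C : R[i]) y) (ccont_id y)).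
    by under eq_fun do rewrite -rmorphD -[2](@real_complex_nat R) -rmorphM.
  - exact: (ccont_vab hc).
  - exact: cderiv_ccont (cderiv_real (is_derive_qq c y)).
  - exact: cderiv_ccont (cderiv_vab' hc _ _ _).
have [M M0 hM] : exists2 M, 0 < M & forall f, List.In f [:: s; s'] -> bnd01 f M.
  by apply: bnd_common => f /= [<-|[<-|[]]].
have bs : bnd01 s M by apply: hM; left.
have bs' : bnd01 s' M by apply: hM; right; left.
pose d := e / (4 * M).
have M4 : 0 < 4 * M by exact: mulr_gt0.
have d0 : 0 < d by exact: divr_gt0.
have [p [hp hp']] := ch d d0.
have [u [_ _ _ [hu hu']]] := Ez_approx_fun z (pint p) (divr_gt0 e0 (ltr0n R 2)).
rewrite pint_deriv in hu hu'.
exists (u * pint p); split; first by rewrite hornerM pint0 mulr0.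
have dM : M * d = e / 4 by rewrite /d; field; rewrite gt_eqF.
split=> y hy.
  have -> : (Ez z (u * pint p)).[y%:C] - cpw b y =
    ((Ez z (u * pint p)).[y%:C] - 'i%C * ((qq c y)%:C * (vz z y * p.[y%:C]))) +
    s y * (p.[y%:C] - h y).
    rewrite /h -[cpw b y in LHS]mulr1 -(sr y) /s; ring.
  apply: (le_trans (ncD _ _)); apply: (@le_trans _ _ (e / 2 + M * d)); last by rewrite dM; lra.
  apply: lerD; first exact: hu.
  by rewrite ncM; apply: ler_pM; rewrite ?nc_ge0 //; [exact: bs|exact: hp].
have -> : (Ez z (u * pint p))^`().[y%:C] - b * cpw (b - 1) y =
   ((Ez z (u * pint p))^`().[y%:C] - 'i%C * ((2 * (c + y))%:C * (vz z y * p.[y%:C]) +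
       (qq c y)%:C * (vz' z y * p.[y%:C] + vz z y * p^`().[y%:C]))) +
    (s' y * (p.[y%:C] - h y) + s y * (p^`().[y%:C] - h' y)).
  have -> : b * cpw (b - 1) y = s' y * h y + s y * h' y.
    rewrite /h /h'.
    have -> : s' y * (cpw b y * (- 'i%C * r y)) + s y * (b * cpw (b - 1) y * (- 'i%C * r y) +
      cpw b y * (- 'i%C * r' y)) = cpw b y * (s' y * (- 'i%C * r y) + s y * (- 'i%C * r' y)) +
      b * cpw (b - 1) y * (s y * (- 'i%C * r y)) by ring.
    by rewrite dsr sr mulr0 add0r mulr1.
  by rewrite /s' /s; ring.
apply: (le_trans (ncD _ _)); apply: (@le_trans _ _ (e / 2 + (M * d + M * d))); last by rewrite dM; lra.
apply: lerD; first exact: hu'.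
apply: (le_trans (ncD _ _)); apply: lerD; rewrite ncM.
  by apply: ler_pM; rewrite ?nc_ge0 //; [exact: bs'|exact: hp].
by apply: ler_pM; rewrite ?nc_ge0 //; [exact: bs|exact: hp'].
Qed.

End SideRange.

(** * The Mellin transform and the conjugation of the operators *)

Section Transform.
Variables (R : realType) (tau c : R).
Local Notation H1 := (L2 (@one1 R)).
Implicit Types (x y e N : R) (s z b : R[i]) (w p u : {poly R[i]}) (g : seq (R[i] * R[i])).

(** Mellin variables of the two halves (0, 1) and (1, oo). Real [s] lie on [Re z = 1/2]; replacing
    [s] by [s + i] lowers [zl] by 1 and raises [zr] by 1. Their zeros are [pole1] and [pole2]. *)
Definition zl s : R[i] := 2^-1 + 'i%C * s.
Definition zr s : R[i] := 2^-1 + 2 * ('i%C * tau%:C) - 'i%C * s.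

Definition pexp w : seq (R[i] * R[i]) := [seq (w`_k, k%:R) | k <- iota 0 (size w)].
(** For [Re z > 0] this is the integral of [w(y) y^(z - 1)] over [0, 1]. *)
Definition lapp w z : R[i] := lap (pexp w) z.

Lemma iota_index n : iota 0 n = index_iota 0 n.
Proof. by rewrite /index_iota subn0. Qed.

Lemma lappE n w z : (size w <= n)%N -> lapp w z = \sum_(k < n) w`_k / (z + k%:R).
Proof.
move=> wn; rewrite /lapp /lap big_map iota_index.
rewrite -(subnK wn) addnC -(big_mkord xpredT (fun k => w`_k / (z + k%:R))).
rewrite [RHS](@big_cat_nat _ _ _ (size w)) //= ?leq_addr // [X in _ + X]big_nat_cond.
rewrite [X in _ + X]big1 ?addr0 // => k; rewrite andbT => /andP[h _].
by rewrite nth_default // mul0r.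
Qed.

Lemma lappD w u z : lapp (w + u) z = lapp w z + lapp u z.
Proof.
set n := maxn (size w) (size u).
rewrite (@lappE n (w + u)) ?size_polyD // (@lappE n w) ?leq_maxl // (@lappE n u) ?leq_maxr //.
by rewrite -big_split; apply: eq_bigr => k _; rewrite coefD mulrDl.
Qed.

Lemma lappZ a w z : lapp (a *: w) z = a * lapp w z.
Proof.
rewrite (@lappE (size w) (a *: w)) ?size_scale_leq // (@lappE (size w)) // mulr_sumr.
by apply: eq_bigr => k _; rewrite coefZ mulrA.
Qed.

Lemma lapp0 z : lapp 0 z = 0.
Proof. by rewrite (@lappE 0) ?size_poly0 // big_ord0. Qed.

Lemma lapp_sum (I : Type) (r : seq I) (F : I -> {poly R[i]}) z :
  lapp (\sum_(i <- r) F i) z = \sum_(i <- r) lapp (F i) z.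
Proof. by elim: r => [|i r IH]; rewrite ?big_nil ?lapp0 // !big_cons lappD IH. Qed.

Lemma lappXn k z : lapp 'X^k z = (z + k%:R)^-1.
Proof.
rewrite (@lappE k.+1) ?size_polyXn // (bigD1 ord_max) //= coefXn eqxx mul1r.
rewrite big1 ?addr0 // => i ik; rewrite coefXn.
by move: ik; rewrite -val_eqE /= => /negbTE ->; rewrite mul0r.
Qed.

Lemma nneg_pexp w : nneg_exps (pexp w).
Proof. by rewrite /nneg_exps /pexp all_map; apply/allP => k _ /=; rewrite cRe_nat. Qed.

Lemma expR_poly (k : nat) x : cexp (- (k%:R * x%:C)) = (expR (- x))%:C ^+ k :> R[i].
Proof.
elim: k => [|k IH]; first by rewrite mul0r oppr0 cexp0.
by rewrite -natr1 mulrDl mul1r opprD cexpD IH -rmorphN cexp_real exprSr.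
Qed.

Lemma expsum_pexp w x : expsum (pexp w) x = w.[(expR (- x))%:C].
Proof.
rewrite /expsum big_map iota_index big_mkord horner_coef.
by apply: eq_bigr => k _ /=; rewrite expR_poly.
Qed.

Lemma expsum'_pexp w x : expsum' (pexp w) x = - ((expR (- x))%:C * w^`().[(expR (- x))%:C]).
Proof.
have := cderiv_cexp (cderivN (cderiv_id x)) => h.
have h1 : cderiv (fun t => (expR (- t))%:C : R[i]) x (- (expR (- x))%:C).
  apply: (@cderiv_ext _ (fun t => cexp (- t%:C))) => [t|]; first by rewrite -rmorphN cexp_real.
  by apply: (cderiv_eq h); rewrite mulN1r -rmorphN cexp_real.
have h2 (p : {poly R[i]}) : cderiv (fun t => p.[(expR (- t))%:C]) x
    (- ((expR (- x))%:C * p^`().[(expR (- x))%:C])).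
  elim/poly_ind: p => [|p k IH].
    rewrite (_ : (fun t => _) = fun=> 0); last by apply/funext => t; rewrite horner0.
    by rewrite deriv0 horner0 mulr0 oppr0; exact: cderiv_cst.
  rewrite (_ : (fun t => _) = fun t => p.[(expR (- t))%:C] * (expR (- t))%:C + k); last first.
    by apply/funext => t; rewrite hornerMXaddC.
  apply: (cderiv_eq (cderivD (cderivM IH h1) (cderiv_cst k x))).
  by rewrite derivMXaddC hornerD hornerM hornerX; ring.
have h3 : cderiv (expsum (pexp w)) x (expsum' (pexp w) x).
  apply: cderiv_sum => cb.
  apply: (cderiv_eq (cderivZ _ (cderiv_cexp (cderivN (cderivZ cb.2 (cderiv_id x)))))).
  by ring.
apply: (cderiv_unique h3); apply: cderiv_ext (h2 w) => t.
by rewrite expsum_pexp.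
Qed.

Lemma half_realC : (2^-1 : R[i]) = (2^-1)%:C.
Proof. by rewrite fmorphV rmorph_nat. Qed.

Lemma Re_zl x : complex.Re (zl x%:C) = 2^-1.
Proof.
rewrite /zl half_realC.
by rewrite cReD cReM /= mul0r mulr0 subr0 addr0.
Qed.

Lemma Re_zr x : complex.Re (zr x%:C) = 2^-1.
Proof.
rewrite /zr half_realC.
by rewrite !ReImE /= !(mul0r, mulr0, subr0, addr0, oppr0).
Qed.

Lemma half_neq0 z b : complex.Re z = 2^-1 -> 0 <= complex.Re b -> z + b != 0.
Proof.
move=> z2 b0; have h : 0 < complex.Re (z + b) by rewrite cReD z2 ltr_wpDr.
by apply: contraTneq h => ->; rewrite ltxx.
Qed.

Lemma zl_meas : cmeas (fun x => zl x%:C).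
Proof.
apply: cmeasD; first exact: cmeas_cst.
apply: cmeasM; first exact: cmeas_cst.
by apply: cmeas_real; exact: measurable_id.
Qed.

Lemma zr_meas : cmeas (fun x => zr x%:C).
Proof.
rewrite (_ : (fun x => _) = fun x => (2^-1 + 2 * ('i%C * tau%:C)) + (- 'i%C) * x%:C).
  apply: cmeasD; first exact: cmeas_cst.
  apply: cmeasM; first exact: cmeas_cst.
  by apply: cmeas_real; exact: measurable_id.
by apply/funext => x; rewrite /zr mulNr.
Qed.

Lemma lap_meas (Z : R -> R[i]) g : cmeas Z -> (forall x, complex.Re (Z x) = 2^-1) ->
  nneg_exps g -> cmeas (fun x => lap g (Z x)).
Proof.
move=> mZ Z2; rewrite /lap; elim: g => [|[k b] g IH] /=.
  move=> _; rewrite (_ : (fun x => _) = fun=> 0); first exact: cmeas_cst.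
  by apply/funext => x; rewrite big_nil.
move=> /andP[b0 hg].
rewrite (_ : (fun x => _) = fun x => k * (Z x + b)^-1 + \sum_(cb <- g) cb.1 / (Z x + cb.2)).
  apply: cmeasD; last exact: IH.
  apply: cmeasM; first exact: cmeas_cst.
  apply: cmeasV; first by apply: cmeasD => //; exact: cmeas_cst.
  by move=> x; exact: half_neq0.
by apply/funext => x; rewrite big_cons.
Qed.

Lemma line_inv_L2 (Z : R -> R[i]) : cmeas Z -> (forall x, complex.Re (Z x) = 2^-1) ->
  (exists2 p : R[i], complex.Im p != 0 & forall x, nc (Z x) = nc (x%:C - p)) ->
  vec H1 (fun x => (Z x)^-1).
Proof.
move=> mZ Z2 [p p0 Zp]; have [K hK] := pole_bound p0.
apply: (@H1_dom _ _ (fun x => K * ptail 1 x)).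
- apply: cmeasV => // x; rewrite -[Z x]addr0; apply: half_neq0 => //.
- by apply: integrableRZ => //; exact: ptail_int.
- by move=> x; rewrite ncV exprVn Zp.
Qed.

Lemma zl_inv_L2 : vec H1 (fun x => (zl x%:C)^-1).
Proof.
apply: (line_inv_L2 zl_meas Re_zl); exists ('i%C / 2).
  by rewrite half_realC cImM /= mul0r add0r mul1r invr_neq0.
have hi z : nc z = nc (- 'i%C * z) by rewrite ncM ncN nc_i mul1r.
move=> x; rewrite [LHS]hi; congr nc.
rewrite /zl (_ : - 'i%C * (2^-1 + 'i%C * x%:C) = - ('i%C * 'i%C) * x%:C - 'i%C / 2).
  by rewrite i_sqr opprK mul1r.
by field.
Qed.

Lemma zr_inv_L2 : vec H1 (fun x => (zr x%:C)^-1).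
Proof.
apply: (line_inv_L2 zr_meas Re_zr); exists (2 * tau%:C - 'i%C / 2).
  rewrite half_realC -!real_complex_nat cImD cImN !cImM /= !mulr0 !mul0r !add0r mul1r.
  by rewrite oppr_eq0 invr_neq0.
have hi z : nc z = nc ('i%C * z) by rewrite ncM nc_i mul1r.
move=> x; rewrite [LHS]hi; congr nc.
rewrite /zr (_ : 'i%C * (2^-1 + 2 * ('i%C * tau%:C) - 'i%C * x%:C) =
  'i%C / 2 + ('i%C * 'i%C) * (2 * tau%:C - x%:C)); last by field.
by rewrite i_sqr; ring.
Qed.

Lemma lap_L2 (Z : R -> R[i]) g N : cmeas Z -> (forall x, complex.Re (Z x) = 2^-1) ->
  vec H1 (fun x => (Z x)^-1) -> nneg_exps g ->
  (forall x, 0 <= x -> nc (expsum g x) <= N) ->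
  (forall x, 0 <= x -> nc (expsum' g x) <= N) ->
  vec H1 (fun x => lap g (Z x)) /\
  hn H1 (fun x => lap g (Z x)) <= 5 * N * hn H1 (fun x => (Z x)^-1).
Proof.
move=> mZ Z2 vZ hg hN hN'.
have Z0 x : Z x != 0 by rewrite -[Z x]addr0; exact: half_neq0.
rewrite (_ : (fun x => lap g (Z x)) = fun x => (lap g (Z x) * Z x) * (Z x)^-1).
  apply: H1_mul => //; first by apply: cmeasM => //; exact: lap_meas.
  move=> x; rewrite ncM; have := lap_bound hg (Z2 x) hN hN'.
  by rewrite ler_pdivlMr // nc_gt0.
by apply/funext => x; rewrite mulfK.
Qed.

(** Mellin transform, with kernel [y^(i s - 1/2)], of the function equal to [w(y)] for [y < 1] and
    to [y^(-1 - 2 i tau) u(1/y)] for [y > 1]. *)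
Definition Utr w u s : R[i] := lapp w (zl s) + lapp u (zr s).

Lemma onR_Utr_linear a w u w' u' :
  onR (Utr (a *: w + w') (a *: u + u')) = a *: onR (Utr w u) + onR (Utr w' u') :> (R -> R[i]^o).
Proof.
apply/funext => x; rewrite /onR /Utr !lappD !lappZ.
by rewrite -[RHS]/(a * (_ + _) + (_ + _)); ring.
Qed.

(* A common L2 bound for the transforms of C^1-bounded data on both sides. *)
Lemma Utr_L2 : exists2 K, 0 < K & forall w u N,
  bnd01 (fun x => w.[x%:C]) N -> bnd01 (fun x => w^`().[x%:C]) N ->
  bnd01 (fun x => u.[x%:C]) N -> bnd01 (fun x => u^`().[x%:C]) N ->
  vec H1 (onR (Utr w u)) /\ hn H1 (onR (Utr w u)) <= K * N.
Proof.
set Kl := hn H1 (fun x => (zl x%:C)^-1); set Kr := hn H1 (fun x => (zr x%:C)^-1).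
exists (5 * Kl + 5 * Kr + 1).
  by rewrite ltr_wpDl // addr_ge0 // mulr_ge0 // hn_ge0.
move=> w u N w0 w1 u0 u1.
have N0 : 0 <= N := le_trans (nc_ge0 _) (w0 0 (in01_0 R)).
have ex01 x : 0 <= x -> 0 <= expR (- x) <= 1.
  by move=> x0; rewrite expR_ge0 /= -expR0 ler_expR oppr_le0.
have b0 (p : {poly R[i]}) : bnd01 (fun x => p.[x%:C]) N ->
    forall x, 0 <= x -> nc (expsum (pexp p) x) <= N.
  by move=> h x x0; rewrite expsum_pexp; apply: h; exact: ex01.
have b1 (p : {poly R[i]}) : bnd01 (fun x => p^`().[x%:C]) N ->
    forall x, 0 <= x -> nc (expsum' (pexp p) x) <= N.
  move=> h x x0; rewrite expsum'_pexp ncN ncM nc_real ger0_norm ?expR_ge0 //.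
  have /andP[e0 e1] := ex01 x x0.
  apply: (@le_trans _ _ (1 * N)); last by rewrite mul1r.
  by apply: ler_pM; rewrite ?nc_ge0 //; apply: h; exact: ex01.
have [v1 h1] := lap_L2 zl_meas Re_zl zl_inv_L2 (nneg_pexp w) (b0 _ w0) (b1 _ w1).
have [v2 h2] := lap_L2 zr_meas Re_zr zr_inv_L2 (nneg_pexp u) (b0 _ u0) (b1 _ u1).
split; first exact: (sh_vecA (H1_sh R) v1 v2).
apply: (le_trans (hnD (H1_sh R) v1 v2)).
rewrite -/Kl -/Kr in h1 h2; lra.
Qed.

Lemma Utr_vec w u : vec H1 (onR (Utr w u)).
Proof.
have [K _ hK] := Utr_L2.
have [N N0 hN] : exists2 N, 0 < N & forall f, List.In f [:: (fun x => w.[x%:C]);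
    (fun x => w^`().[x%:C]); (fun x => u.[x%:C]); (fun x => u^`().[x%:C])] -> bnd01 f N.
  by apply: bnd_common => f /= [<-|[<-|[<-|[<-|[]]]]]; exact: poly_bnd.
have [] := hK w u N => //; apply: hN; first by left.
- by right; left.
- by right; right; left.
- by right; right; right; left.
Qed.

(** The cosine is replaced by a free parameter [c], because the weighted component leads to the
    value [- c]. *)
Definition Lc f s : R[i] :=
  'i%C * (1 / 2%:R - 'i%C * s) * f (s + 'i%C)
  + 2%:R * (s - tau%:C) * c%:C * f s
  - 'i%C * (1 / 2%:R + 'i%C * s - 2%:R * 'i%C * tau%:C) * f (s - 'i%C).

(** The operator [Lc] in the variable [z = zl s]; in the variable [z = zr s] it becomes [- LLz]. *)
Definition LLz f z : R[i] :=
  'i%C * (1 - z) * f (z - 1) - 2 * 'i%C * (z - 2^-1 - 'i%C * tau%:C) * c%:C * f z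
  - 'i%C * (z - 2 * ('i%C * tau%:C)) * f (z + 1).

(** Integration by parts on (0, 1), checked on monomials; the boundary term at [y = 1] is
    [i * qq(1) * w(1)]. *)
Lemma LLz_lapp w z : complex.Re z = 2^-1 ->
  LLz (lapp w) z = lapp (EE c tau w) z - 2 * 'i%C * (1 + c%:C) * w.[1].
Proof.
move=> z2.
have znk (k : nat) : z + k%:R != 0 by apply: half_neq0; rewrite ?cRe_nat.
(* A zero would have real part 0, that is [2 k + 1 = 2], which parity excludes. *)
have znk1 (k : nat) : z + k%:R - 1 != 0.
  have h : complex.Re (z + k%:R - 1) != 0.
    rewrite !ReImE z2 /=; apply/eqP => e.
    have : (k.*2.+1)%:R = 2%:R :> R by rewrite -muln2 -natr1 natrM; lra.
    by move/eqP; rewrite eqr_nat => /eqP e2; have := congr1 odd e2; rewrite /= odd_double.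
  by apply: contra_neq h => ->.
have mon (k : nat) : LLz (lapp 'X^k) z =
    lapp (EE c tau 'X^k) z - 2 * 'i%C * (1 + c%:C) * 1.
  have z1 : z + 1 + k%:R != 0 by rewrite addrAC -addrA -(natrD _ k 1) addn1.
  have zm : z - 1 + k%:R != 0 by rewrite addrAC znk1.
  have E0 : ((c%:C)%:P + 'X : {poly R[i]}) * 'X^k = c%:C *: 'X^k + 'X^(k.+1).
    by rewrite mulrDl mul_polyC exprS.
  rewrite /LLz !lappXn /EE {}E0 lappZ lappD [lapp (tw tau *: _) _]lappZ lappD lappZ !lappXn -[k.+1%:R]natr1.
  have zk1 : z + (k%:R + 1) != 0 by rewrite addrA addrAC.
  case: k znk znk1 z1 zm zk1 => [|k] znk znk1 z1 zm zk1.
    rewrite derivXn mulr0n mulr0 lapp0 add0r /tw.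
    have := znk 0%N; have := znk1 0%N; rewrite mulr0n !addr0 !add0r in z1 zm zk1 * => h1 h2.
    by field; rewrite h1 h2 z1.
  have E1 : qp c * ('X^k *+ k.+1) =
      k.+1%:R *: ('X^k + (2 * c)%:C *: 'X^(k.+1) + 'X^(k.+2)).
    rewrite -scaler_nat -scalerAr; congr (_ *: _).
    by rewrite /qp 2!mulrDl [1 * _ ^+ _]mul1r -scalerAl -exprS -exprD.
  rewrite derivXn /= E1 lappZ !lappD lappZ !lappXn /tw -![k.+2%:R]natr1 -![k.+1%:R]natr1.
  rewrite -![k.+1%:R]natr1 in zm z1 zk1.
  have h1 := znk k; have h2 := znk k.+1; have h3 := znk k.+2.
  rewrite -![k.+2%:R]natr1 -![k.+1%:R]natr1 in h2 h3.
  have zm' : z - 1 + (k%:R + 1) = z + k%:R by ring.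
  rewrite zm' in zm *.
  have z1' : z + 1 + (k%:R + 1) = z + (k%:R + 1 + 1) by ring.
  rewrite z1' in z1 *.
  by field; rewrite h1 h2 h3.
rewrite -[w]coefK poly_def.
have lin f1 f2 a : LLz (fun t => a * f1 t + f2 t) z = a * LLz f1 z + LLz f2 z.
  by rewrite /LLz; ring.
elim/big_rec: _ => [|k p _ IH].
  have -> : EE c tau 0 = 0 by rewrite /EE deriv0 !mulr0 scaler0 addr0 scaler0.
  by rewrite /LLz !lapp0 horner0; ring.
have -> : LLz (lapp (w`_k *: 'X^k + p)) z = w`_k * LLz (lapp 'X^k) z + LLz (lapp p) z.
  rewrite -lin; congr LLz; apply/funext => t; by rewrite lappD lappZ.
rewrite IH mon.
have -> : EE c tau (w`_k *: 'X^k + p) = w`_k *: EE c tau 'X^k + EE c tau p.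
  rewrite /EE derivD derivZ -!mul_polyC; ring.
rewrite lappD lappZ hornerD hornerZ hornerXn expr1n; ring.
Qed.

(** The two sides produce boundary terms at [y = 1] of opposite sign, which cancel under the
    matching condition. *)
Lemma Lc_Utr w u x : w.[1] = u.[1] ->
  Lc (Utr w u) x%:C = Utr (EE c tau w) (- EE c tau u) x%:C.
Proof.
move=> wu; have h1 := LLz_lapp w (Re_zl x); have h2 := LLz_lapp u (Re_zr x).
have ii := i_sqr R.
have e1 : zl (x%:C + 'i%C) = zl x%:C - 1 by rewrite /zl mulrDr ii addrA.
have e2 : zl (x%:C - 'i%C) = zl x%:C + 1 by rewrite /zl mulrBr ii opprK addrA.
have e3 : zr (x%:C + 'i%C) = zr x%:C + 1 by rewrite /zr mulrDr ii opprD opprK addrA.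
have e4 : zr (x%:C - 'i%C) = zr x%:C - 1 by rewrite /zr mulrBr ii opprK opprD addrA.
rewrite -scaleN1r /Utr [lapp (-1 *: _) _]lappZ.
have -> : lapp (EE c tau w) (zl x%:C) = LLz (lapp w) (zl x%:C) + 2 * 'i%C * (1 + c%:C) * w.[1].
  by rewrite h1 subrK.
have -> : lapp (EE c tau u) (zr x%:C) = LLz (lapp u) (zr x%:C) + 2 * 'i%C * (1 + c%:C) * w.[1].
  by rewrite h2 -wu subrK.
rewrite /Lc /LLz e1 e2 e3 e4.
set A := lapp w _; set B := lapp w (zl x%:C); set C := lapp w (_ + 1).
set A' := lapp u (zr x%:C + 1); set B' := lapp u (zr x%:C); set C' := lapp u (zr x%:C - 1).
rewrite /zl /zr.
have k1 : (x%:C - tau%:C) = - 'i%C * (2^-1 + 'i%C * x%:C - 2^-1 - 'i%C * tau%:C).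
  rewrite (_ : - 'i%C * _ = - ('i%C * 'i%C) * (x%:C - tau%:C)); last by ring.
  by rewrite ii opprK mul1r.
have k2 : 2^-1 + 2 * ('i%C * tau%:C) - 'i%C * x%:C - 2^-1 - 'i%C * tau%:C =
   - ('i%C * (x%:C - tau%:C)) by ring.
have k3 : (x%:C - tau%:C) = - 'i%C * ('i%C * (x%:C - tau%:C)).
  by rewrite mulNr mulrA ii mulN1r opprK.
have k4 : 2^-1 + 'i%C * x%:C - 2^-1 - 'i%C * tau%:C = 'i%C * (x%:C - tau%:C) by ring.
rewrite k2 k4 {1}k3.
by field.
Qed.

End Transform.

(** With [pole_span_dense] this reduces the density of a linear class [K] to the approximation of
    each far simple pole. *)
Lemma closed_subspace_closure (R : realType) (K : set (R -> R[i]^o)) :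
  (forall f, K f -> vec (L2 (@one1 R)) f) ->
  (forall (a : R[i]) f g, K f -> K g -> K (a *: f + g)) ->
  closed_subspace (fun f => vec (L2 (@one1 R)) f /\
    forall e, 0 < e -> exists2 k, K k & hn (L2 (@one1 R)) (f - k) < e).
Proof.
move=> Kv Kl; have shH := H1_sh R; split.
- by move=> g [].
- move=> a g h [vg hg] [vh hh]; split; first exact: (sh_vecD shH).
  move=> d d0; have na : 0 < 2 * (nc a + 1) by apply: mulr_gt0 => //; rewrite ltr_wpDl ?nc_ge0.
  have [k Kk h1] := hg _ (divr_gt0 d0 na).
  have [k' Kk' h2] := hh _ (divr_gt0 d0 (ltr0n R 2)).
  exists (a *: k + k'); first exact: Kl.
  rewrite opprD addrACA -scalerBr.
  have v1 := sh_vecB shH vg (Kv _ Kk); have v2 := sh_vecB shH vh (Kv _ Kk').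
  apply: (le_lt_trans (hnD shH (sh_vecZ shH a v1) v2)).
  rewrite (splitr d); apply: ler_ltD => //.
  rewrite (hnZ shH) //; apply: (@le_trans _ _ ((nc a + 1) * (d / (2 * (nc a + 1))))).
    by apply: ler_pM; rewrite ?nc_ge0 ?hn_ge0 ?lerDl // ltW.
  rewrite le_eqVlt; apply/orP; left; apply/eqP; field.
  by rewrite gt_eqF // ltr_wpDl ?nc_ge0.
- move=> g vg hg; split=> // d d0.
  have d2 := divr_gt0 d0 (ltr0n R 2).
  have [h [vh hh] gh] := hg _ d2; have [k Kk h1] := hh _ d2.
  exists k => //; rewrite -[g](subrK h) -addrA (splitr d).
  apply: (le_lt_trans (hnD shH (sh_vecB shH vg vh) (sh_vecB shH vh (Kv _ Kk)))).
  exact: ltrD.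
Qed.

(** * Density of the range without the matching condition *)

Section RangeDensity.
Variables (R : realType) (tau c : R).
Hypothesis hc : c ^+ 2 < 1.
Local Notation H1 := (L2 (@one1 R)).
Implicit Types (x y e N : R) (s z b : R[i]) (w p u : {poly R[i]}).

(** Formally [(L - z) (Utr w u)], and equal to it on matched pairs ([Tz_matched]). *)
Definition Tz z w u : R -> R[i]^o := onR (Utr tau (Ez c tau z w) (- Ez c tau (- z) u)).

Lemma Ez_linear z a w w' : Ez c tau z (a *: w + w') = a *: Ez c tau z w + Ez c tau z w'.
Proof. by rewrite /Ez /EE derivD derivZ -!mul_polyC; ring. Qed.

Lemma Tz_linear z a w u w' u' :
  Tz z (a *: w + w') (a *: u + u') = a *: Tz z w u + Tz z w' u'.
Proof.
rewrite /Tz !Ez_linear -onR_Utr_linear; congr (onR (Utr _ _ _)).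
by rewrite opprD scalerN.
Qed.

Lemma Tz_vec z w u : vec H1 (Tz z w u).
Proof. exact: Utr_vec. Qed.

Lemma expsum_cons k b g x : expsum ((k, b) :: g) x = k * cexp (- (b * x%:C)) + expsum g x.
Proof. by rewrite /expsum big_cons. Qed.

(** [1 / (Z + b)] is the transform of [y^b]; [side_range] approximates [y^b] with its derivative,
    and [lap_L2] carries the error to L^2. *)
Lemma pole_approx (Z : R -> R[i]) z b e : cmeas Z ->
  (forall x, complex.Re (Z x) = 2^-1) -> vec H1 (fun x => (Z x)^-1) ->
  2 <= complex.Re b -> 0 < e -> exists w, w.[0] = 0 /\
  hn H1 (fun x => (Z x + b)^-1 - lapp (Ez c tau z w) (Z x)) < e /\
  vec H1 (fun x => (Z x + b)^-1 - lapp (Ez c tau z w) (Z x)).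
Proof.
move=> mZ Z2 vZ b2 e0.
set C := hn H1 (fun x => (Z x)^-1).
have C0 : 0 <= C by exact: hn_ge0.
pose d := e / (5 * C + 1).
have C1 : 0 < 5 * C + 1 by rewrite ltr_wpDl // mulr_ge0.
have d0 : 0 < d by exact: divr_gt0.
have [w [w0 [h1 h2]]] := side_range tau hc z b2 d0.
exists w; split=> //.
(* Codes the error [y^b - Ez z w] as an exponential sum in [x], where [y = e^(-x)]. *)
pose g := (1, b) :: gscale (-1) (pexp (Ez c tau z w)).
have ex01 x : 0 <= x -> 0 <= expR (- x) <= 1.
  by move=> x0; rewrite expR_ge0 /= -expR0 ler_expR oppr_le0.
have gE x : (Z x + b)^-1 - lapp (Ez c tau z w) (Z x) = lap g (Z x).
  by rewrite /lap big_cons -/(lap _ _) lap_scale mulN1r /= mul1r.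
have E : (fun x => (Z x + b)^-1 - lapp (Ez c tau z w) (Z x)) = (fun x => lap g (Z x)).
  exact/funext.
rewrite E.
have ng : nneg_exps g.
  by rewrite /g /= nneg_scale nneg_pexp andbT; apply: le_trans b2.
have b1 x : 0 <= x -> nc (expsum g x) <= d.
  move=> x0; rewrite expsum_cons expsum_scale expsum_pexp mulN1r mul1r nc_distC.
  by rewrite -cpw_expR; apply: h1; exact: ex01.
have b1' x : 0 <= x -> nc (expsum' g x) <= d.
  move=> x0; rewrite /expsum' big_cons /= -/(expsum' _ _) mulr1.
  rewrite -[expsum' _ _]expsum_deriv.
  have -> : gderiv (gscale (-1) (pexp (Ez c tau z w))) =
       gscale (-1) (gderiv (pexp (Ez c tau z w))).
    by rewrite /gderiv /gscale -!map_comp; apply: eq_map => cb /=; congr (_, _); ring.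
  rewrite expsum_scale expsum_deriv expsum'_pexp mulN1r opprK.
  have /andP[e1 e2] := ex01 x x0.
  have -> : - b * cexp (- (b * x%:C)) = - ((expR (- x))%:C * (b * cpw (b - 1) (expR (- x)))).
    by rewrite -cpw_expR (cpwS _ e1); ring.
  rewrite addrC -mulrBr ncM nc_real ger0_norm //.
  apply: (@le_trans _ _ (1 * d)); last by rewrite mul1r.
  by apply: ler_pM; rewrite ?nc_ge0 //; apply: h2; exact: ex01.
have [v h] := lap_L2 mZ Z2 vZ ng b1 b1'.
split=> //; apply: (le_lt_trans h); rewrite -/C.
rewrite /d (_ : 5 * (e / (5 * C + 1)) * C = e * (5 * C) / (5 * C + 1)); last by ring.
by rewrite ltr_pdivrMr // ltr_pM2l // ltrDl.
Qed.

(** It suffices to approximate simple poles. Those in the upper half plane come from the side of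
    [zl], those in the lower half plane from the side of [zr], the other polynomial being 0. *)
Theorem range_dense z (f : R -> R[i]^o) e : vec H1 f -> 0 < e ->
  exists w u, [/\ w.[0] = 0, u.[0] = 0 & hn H1 (f - Tz z w u) < e].
Proof.
move=> vf e0.
pose K (g : R -> R[i]^o) := exists w u, [/\ w.[0] = 0, u.[0] = 0 & g = Tz z w u].
suff [_ /(_ e e0)[_ [w [u [w0 u0 ->]]] h]] : vec H1 f /\
    forall e, 0 < e -> exists2 g, K g & hn H1 (f - g) < e by exists w, u.
have shH := H1_sh R.
apply: (pole_span_dense vf (closed_subspace_closure (K := K) _ _)).
- by move=> _ [w [u [_ _ ->]]]; exact: Tz_vec.
- move=> a _ _ [w [u [w0 u0 ->]]] [w' [u' [w'0 u'0 ->]]]; exists (a *: w + w'), (a *: u + u').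
  split; [| |by rewrite Tz_linear].
  + by rewrite hornerD hornerZ w0 w'0 mulr0 addr0.
  + by rewrite hornerD hornerZ u0 u'0 mulr0 addr0.
move=> p fp; split; first exact: pole_L2.
move=> d d0.
have lapp00 t : lapp (- Ez c tau (- z) 0) t = 0.
  by rewrite /Ez /EE deriv0 !mulr0 scaler0 addr0 !scaler0 subr0 oppr0 lapp0.
have lapp00' t : lapp (Ez c tau z 0) t = 0.
  by rewrite /Ez /EE deriv0 !mulr0 scaler0 addr0 !scaler0 subr0 lapp0.
have ii := i_sqr R.
have [ip|ip] := leP 0 (complex.Im p).
  pose b := - ('i%C * p) - 2^-1.
  have b2 : 2 <= complex.Re b.
    rewrite /b half_realC !ReImE /= mul0r mul1r sub0r opprK.
    move: fp; rewrite /far_pole ger0_norm //; lra.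
  have [w [w0 [h vh]]] := pole_approx z (zl_meas R) (@Re_zl R) (zl_inv_L2 R) b2 d0.
  exists (Tz z ('i%C *: w) 0).
    by exists ('i%C *: w), 0; rewrite hornerZ w0 mulr0 horner0.
  rewrite (_ : _ - _ = 'i%C *: (fun x => (zl x%:C + b)^-1 - lapp (Ez c tau z w) (zl x%:C))).
    by rewrite (hnZ shH) // nc_i mul1r.
  apply/funext => x.
  rewrite -[LHS]/(simple_pole p x - Utr tau (Ez c tau z ('i%C *: w)) (- Ez c tau (- z) 0) x%:C).
  rewrite -[RHS]/('i%C * (_ - _)) /Utr lapp00 addr0 mulrBr; congr (_ - _).
    have -> : zl x%:C + b = 'i%C * (x%:C - p) by rewrite /zl /b; ring.
    rewrite invfM mulrA mulfV ?mul1r //.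
    by rewrite -nc_gt0 nc_i.
  have := Ez_linear z 'i%C w 0; rewrite addr0 => ->.
  by rewrite lappD lappZ lapp00' addr0.
pose b := 'i%C * (p - 2 * tau%:C) - 2^-1.
have b2 : 2 <= complex.Re b.
  rewrite /b half_realC !ReImE /= !(mul0r, mulr0, mul1r, subr0, addr0, add0r, oppr0).
  move: fp; rewrite /far_pole ltr0_norm //; lra.
have [w [w0 [h vh]]] := pole_approx (- z) (zr_meas tau) (Re_zr tau) (zr_inv_L2 tau) b2 d0.
exists (Tz z 0 ('i%C *: w)).
  by exists 0, ('i%C *: w); rewrite hornerZ w0 mulr0 horner0.
rewrite (_ : _ - _ = (- 'i%C) *: (fun x => (zr tau x%:C + b)^-1 - lapp (Ez c tau (- z) w) (zr tau x%:C))).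
  by rewrite (hnZ shH) // ncN nc_i mul1r.
apply/funext => x.
rewrite -[LHS]/(simple_pole p x - Utr tau (Ez c tau z 0) (- Ez c tau (- z) ('i%C *: w)) x%:C).
rewrite -[RHS]/(- 'i%C * (_ - _)) /Utr lapp00' add0r mulrBr; congr (_ - _).
  have -> : zr tau x%:C + b = - 'i%C * (x%:C - p) by rewrite /zr /b; ring.
  rewrite invfM mulrA mulfV ?mul1r //.
  by rewrite -nc_gt0 ncN nc_i.
have := Ez_linear (- z) 'i%C w 0; rewrite addr0 => ->.
rewrite -[in LHS]scaleN1r lappZ lappD lappZ.
have -> : lapp (Ez c tau (- z) 0) (zr tau x%:C) = 0.
  by have := lapp00 (zr tau x%:C); rewrite -scaleN1r lappZ mulN1r => /eqP; rewrite oppr_eq0 => /eqP.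
by rewrite addr0 mulN1r mulNr.
Qed.

End RangeDensity.

(** * Approximate eigenfunctions and the limit of their transforms *)

Section LaplaceLimit.
Variables (R : realType) (tau c : R).
Hypothesis hc : c ^+ 2 < 1.
Local Notation H1 := (L2 (@one1 R)).
Implicit Types (x y e N : R) (s z b : R[i]) (w p u : {poly R[i]}).

Lemma cauchy_real (s_ : nat -> R) (C : R) : 0 <= C ->
  (forall n m, `|s_ n - s_ m| <= C * (n.+1%:R^-1 + m.+1%:R^-1)) ->
  exists l : R, s_ @ \oo --> l.
Proof.
move=> C0 h; suff h1 : cvg (s_ @ \oo) by exists (lim (s_ @ \oo)).
apply: (@cauchy_cvg R (s_ @ \oo)); apply: cauchy_exP => e e0.
pose N := Num.trunc (2 * C / e).
exists (s_ N); exists N => // n /= Nn; rewrite /ball /=.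
have hN : 2 * C / e < N.+1%:R by exact: truncnS_gt.
have hn : n.+1%:R^-1 <= N.+1%:R^-1 :> R by rewrite lef_pV2 ?posrE // ler_nat.
apply: (le_lt_trans (h N n)); apply: (@le_lt_trans _ _ (2 * C / N.+1%:R)).
  have : C * n.+1%:R^-1 <= C * N.+1%:R^-1 by exact: ler_wpM2l.
  move: (n.+1%:R^-1) (N.+1%:R^-1) => a b ab.
  rewrite mulrDr (_ : 2 * C * b = C * b + C * b); last by ring.
  by rewrite lerD2l.
by rewrite ltr_pdivrMr // [e * _]mulrC -ltr_pdivrMr.
Qed.

Lemma cauchy_cplx (s_ : nat -> R[i]) (C : R) : 0 <= C ->
  (forall n m, nc (s_ n - s_ m) <= C * (n.+1%:R^-1 + m.+1%:R^-1)) ->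
  exists l : R[i], [/\ (fun n => complex.Re (s_ n)) @ \oo --> complex.Re l,
                (fun n => complex.Im (s_ n)) @ \oo --> complex.Im l &
                forall n, nc (l - s_ n) <= C * n.+1%:R^-1].
Proof.
move=> C0 h.
have [a ha] : exists a : R, (fun n => complex.Re (s_ n)) @ \oo --> a.
  apply: (cauchy_real C0) => n m; apply: le_trans (h n m).
  by rewrite -cReN -cReD cRe_le.
have [b hb] : exists b : R, (fun n => complex.Im (s_ n)) @ \oo --> b.
  apply: (cauchy_real C0) => n m; apply: le_trans (h n m).
  by rewrite -cImN -cImD cIm_le.
exists (a +i* b); split=> // n.
have lim : (fun m => `|a - complex.Re (s_ m)| + `|b - complex.Im (s_ m)|) @ \oo --> (0 : R).
  have h1 := cvgD (cvg_norm (cvgB (cvg_cst a) ha)) (cvg_norm (cvgB (cvg_cst b) hb)).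
  by rewrite !subrr normr0 addr0 in h1; exact: h1.
have lim2 : (fun m => C * (n.+1%:R^-1 + m.+1%:R^-1) + (`|a - complex.Re (s_ m)| + `|b - complex.Im (s_ m)|))
    @ \oo --> C * n.+1%:R^-1.
  have h1 := cvgD (cvgM (cvg_cst C) (cvgD (cvg_cst (n.+1%:R^-1 : R)) (@cvg_harmonic R))) lim.
  by rewrite !addr0 in h1; exact: h1.
rewrite -(cvg_lim _ lim2) //; apply: limr_ge.
  exact: (cvgP _ lim2).
apply: nearW => m.
rewrite (_ : a +i* b - s_ n = (a +i* b - s_ m) + (s_ m - s_ n)); last by rewrite addrA subrK.
rewrite addrC; apply: (le_trans (ncD _ _)); apply: lerD.
  by rewrite [n.+1%:R^-1 + _]addrC; exact: h.
by apply: (le_trans (nc_le _)); rewrite !cReD !cImD cReN cImN.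
Qed.

(** The limit is taken pointwise: by [lap_bound] the transforms multiplied by [|Z x|] are uniformly
    Cauchy, which also yields the L^2 rate. *)
Lemma lap_limit (Z : R -> R[i]) (w_ : nat -> {poly R[i]}) (v v' : R -> R[i]) :
  cmeas Z -> (forall x, complex.Re (Z x) = 2^-1) -> vec H1 (fun x => (Z x)^-1) ->
  (forall n, app1 (w_ n) v v' n.+1%:R^-1) ->
  exists G : R -> R[i]^o, forall n, vec H1 (fun x => G x - lapp (w_ n) (Z x)) /\
    hn H1 (fun x => G x - lapp (w_ n) (Z x)) <= 5 * n.+1%:R^-1 * hn H1 (fun x => (Z x)^-1).
Proof.
move=> mZ Z2 vZ hw.
have Z0 x : Z x != 0 by rewrite -[Z x]addr0; exact: half_neq0.
have ex01 x : 0 <= x -> 0 <= expR (- x) <= 1.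
  by move=> x0; rewrite expR_ge0 /= -expR0 ler_expR oppr_le0.
have diff n m x : nc (lapp (w_ n) (Z x) - lapp (w_ m) (Z x)) <=
    5 / nc (Z x) * (n.+1%:R^-1 + m.+1%:R^-1).
  have -> : lapp (w_ n) (Z x) - lapp (w_ m) (Z x) = lapp (w_ n - w_ m) (Z x).
    by rewrite -[- w_ m]scaleN1r lappD lappZ mulN1r.
  rewrite (_ : 5 / nc (Z x) * _ = 5 * (n.+1%:R^-1 + m.+1%:R^-1) / nc (Z x)); last by ring.
  have [h1 h1'] := hw n; have [h2 h2'] := hw m.
  apply: lap_bound => //; first exact: nneg_pexp.
    move=> y y0; rewrite expsum_pexp hornerD hornerN.
    set X := (expR (- y))%:C.
    rewrite (_ : _ - _ = ((w_ n).[X] - v (expR (- y))) - ((w_ m).[X] - v (expR (- y)))); last by ring.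
    by apply: (le_trans (ncB _ _)); apply: lerD; [apply: h1|apply: h2]; exact: ex01.
  move=> y y0; rewrite expsum'_pexp ncN ncM nc_real ger0_norm ?expR_ge0 //.
  have /andP[e1 e2] := ex01 y y0.
  rewrite -[leRHS]mul1r; apply: ler_pM; rewrite ?nc_ge0 //.
  rewrite derivB hornerD hornerN; set X := (expR (- y))%:C.
  rewrite (_ : _ - _ = ((w_ n)^`().[X] - v' (expR (- y))) - ((w_ m)^`().[X] - v' (expR (- y)))); last by ring.
  by apply: (le_trans (ncB _ _)); apply: lerD; [apply: h1'|apply: h2']; exact: ex01.
have ex x : exists l : R[i], [/\ (fun n => complex.Re (lapp (w_ n) (Z x))) @ \oo --> complex.Re l,
                (fun n => complex.Im (lapp (w_ n) (Z x))) @ \oo --> complex.Im l &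
                forall n, nc (l - lapp (w_ n) (Z x)) <= 5 / nc (Z x) * n.+1%:R^-1].
  by apply: cauchy_cplx => //; rewrite divr_ge0 ?nc_ge0.
pose G x := projT1 (cid (ex x)).
have GP x := projT2 (cid (ex x)).
have mw n := lap_meas mZ Z2 (nneg_pexp (w_ n)).
have mG : cmeas G.
  split.
    apply: (@measurable_fun_cvg _ _ _ _ (fun n x => complex.Re (lapp (w_ n) (Z x)))) => //.
      by move=> n; case: (mw n).
    by move=> x _; case: (GP x).
  apply: (@measurable_fun_cvg _ _ _ _ (fun n x => complex.Im (lapp (w_ n) (Z x)))) => //.
    by move=> n; case: (mw n).
  by move=> x _; case: (GP x).
exists G => n.
rewrite (_ : (fun x => G x - lapp (w_ n) (Z x)) = fun x => ((G x - lapp (w_ n) (Z x)) * Z x) * (Z x)^-1).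
  apply: H1_mul => //.
    apply: cmeasM => //; rewrite (_ : (fun x => _) = fun x => G x + (-1) * lapp (w_ n) (Z x)).
      by apply: cmeasD => //; apply: cmeasM; [exact: cmeas_cst|exact: mw].
    by apply/funext => x; rewrite mulN1r.
  move=> x; have [_ _ /(_ n) h] := GP x; rewrite ncM -ler_pdivlMr ?nc_gt0 //.
  by apply: (le_trans h); rewrite mulrAC.
by apply/funext => x; rewrite mulfK.
Qed.

Lemma vz1 z z' : vz c tau z 1 = vz c tau z' 1.
Proof. by rewrite /vz /vab theta1 !mulr0. Qed.

Lemma vz_neq0 z y : vz c tau z y != 0.
Proof. exact: vab_neq0. Qed.

(* Polynomial approximations of the solutions of the transformed equation on
   the two sides, and the limit of their transforms. *)
Lemma eigen_approx z : exists w_ u_ : nat -> {poly R[i]}, exists g : R -> R[i]^o,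
  [/\ forall n, [/\ (w_ n).[0] = vz c tau z 0, (w_ n).[1] = vz c tau z 1,
         (u_ n).[0] = vz c tau (- z) 0 & (u_ n).[1] = vz c tau z 1],
      forall n, app1 (Ez c tau z (w_ n)) (fun=> 0) (fun=> 0) n.+1%:R^-1 /\
                app1 (Ez c tau (- z) (u_ n)) (fun=> 0) (fun=> 0) n.+1%:R^-1,
      vec H1 g &
      exists2 K, 0 < K & forall n, hn H1 (g - onR (Utr tau (w_ n) (u_ n))) <= K * n.+1%:R^-1].
Proof.
have ex z' (n : nat) : exists w, [/\ w.[0] = vz c tau z' 0, w.[1] = vz c tau z' 1,
    app1 w (vz c tau z') (vz' c tau z') n.+1%:R^-1 &
    app1 (Ez c tau z' w) (fun=> 0) (fun=> 0) n.+1%:R^-1].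
  have n0 : 0 < n.+1%:R^-1 :> R by rewrite invr_gt0.
  (* For [P = 1] the term with [P'] vanishes, so [Ez] of the approximant is small with its
     derivative. *)
  have [w [w0 w1 hw [h1 h2]]] := Ez_approx_fun tau hc z' 1 n0.
  exists w; split=> //; rewrite mulr1 in h1 h2.
  have d1 : (1 : {poly R[i]})^`() = 0 by exact: derivC.
  split.
    by apply: app_ext h1 => y _; rewrite d1 horner0 !mulr0.
  by apply: app_ext h2 => y _; rewrite !(d1, deriv0, horner0, mulr0, addr0).
pose w_ n := projT1 (cid (ex z n)); pose u_ n := projT1 (cid (ex (- z) n)).
have wP n := projT2 (cid (ex z n)); have uP n := projT2 (cid (ex (- z) n)).
have [G hG] : exists G : R -> R[i]^o, forall n, vec H1 (fun x => G x - lapp (w_ n) (zl x%:C)) /\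
    hn H1 (fun x => G x - lapp (w_ n) (zl x%:C)) <= 5 * n.+1%:R^-1 * hn H1 (fun x => (zl x%:C)^-1).
  apply: (lap_limit (zl_meas R) (@Re_zl R) (zl_inv_L2 R)).
  by move=> n; case: (wP n) => _ _ h _; exact: h.
have [G' hG'] : exists G : R -> R[i]^o, forall n, vec H1 (fun x => G x - lapp (u_ n) (zr tau x%:C)) /\
    hn H1 (fun x => G x - lapp (u_ n) (zr tau x%:C)) <= 5 * n.+1%:R^-1 * hn H1 (fun x => (zr tau x%:C)^-1).
  apply: (lap_limit (zr_meas tau) (@Re_zr R tau) (zr_inv_L2 tau)).
  by move=> n; case: (uP n) => _ _ h _; exact: h.
have shH := H1_sh R.
exists w_, u_, (fun x => G x + G' x); split.
- move=> n; have [a1 a2 _ _] := wP n; have [b1 b2 _ _] := uP n; split=> //.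
  by rewrite [LHS]b2; exact: vz1.
- by move=> n; have [_ _ _ a4] := wP n; have [_ _ _ b4] := uP n; split.
- have -> : (fun x => G x + G' x) = ((fun x => G x - lapp (w_ 0%N) (zl x%:C)) +
    (fun x => G' x - lapp (u_ 0%N) (zr tau x%:C))) + onR (Utr tau (w_ 0%N) (u_ 0%N)).
    apply/funext => x; rewrite -[RHS]/((G x - _) + (G' x - _) + (_ + _)).
    by ring.
  apply: (sh_vecA shH _ (Utr_vec tau _ _)).
  exact: (sh_vecA shH (hG 0%N).1 (hG' 0%N).1).
- exists (5 * hn H1 (fun x => (zl x%:C)^-1) + 5 * hn H1 (fun x => (zr tau x%:C)^-1) + 1).
    by rewrite ltr_wpDl // addr_ge0 // mulr_ge0 // hn_ge0.
  move=> n.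
  have -> : (fun x => G x + G' x) - onR (Utr tau (w_ n) (u_ n)) =
    ((fun x => G x - lapp (w_ n) (zl x%:C)) + (fun x => G' x - lapp (u_ n) (zr tau x%:C))).
    apply/funext => x; rewrite -[LHS]/((G x + G' x) - (_ + _)).
    rewrite -[RHS]/((G x - _) + (G' x - _)); by ring.
  apply: (le_trans (hnD shH (hG n).1 (hG' n).1)).
  have n0 : 0 < n.+1%:R^-1 :> R by rewrite invr_gt0.
  apply: (le_trans (lerD (hG n).2 (hG' n).2)).
  rewrite [leRHS](_ : _ = 5 * n.+1%:R^-1 * hn H1 (fun x => (zl x%:C)^-1) +
    5 * n.+1%:R^-1 * hn H1 (fun x => (zr tau x%:C)^-1) + n.+1%:R^-1); last by ring.
  by rewrite lerDl ltW.
Qed.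

End LaplaceLimit.

(** * Calculus of complex differentiable functions *)

Section Differentiability.
Variable R : realType.
Implicit Types (x y e : R) (s t h k l p a b v : R[i]) (f g : R[i] -> R[i]).

Definition dv f s : Prop := exists l, cdiff f s l.

Lemma dvP (f : R[i]^o -> R[i]^o) s : derivable f s 1 <-> dv f s.
Proof. exact: derivable_cdiff. Qed.

Lemma dv_near f g s : (exists2 r : R, 0 < r & forall t, nc (t - s) < r -> f t = g t) ->
  dv f s -> dv g s.
Proof.
move=> [r r0 fg] [l hl]; exists l => e e0; have [d d0 hd] := hl e e0.
exists (Num.min d r); first by rewrite lt_min d0.
move=> h; rewrite lt_min => /andP[h1 h2].
rewrite -!fg ?subrr ?nc0 //; first exact: hd.
by rewrite addrAC subrr add0r.
Qed.

Lemma dv_ext f g s : f =1 g -> dv f s -> dv g s.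
Proof. by move=> fg; apply: dv_near; exists 1. Qed.

Lemma dv_cst k s : dv (fun=> k) s.
Proof. by exists 0 => e e0; exists 1 => // h _; rewrite mul0r !subrr nc0 mulr_ge0 ?nc_ge0 ?ltW. Qed.

Lemma dv_id s : dv (fun t => t) s.
Proof.
exists 1 => e e0; exists 1 => // h _.
rewrite (_ : s + h - s - 1 * h = 0); last by ring.
by rewrite nc0 mulr_ge0 ?nc_ge0 ?ltW.
Qed.

Lemma dvD f g s : dv f s -> dv g s -> dv (fun t => f t + g t) s.
Proof.
move=> /dvP hf /dvP hg; apply/dvP.
exact: (@derivableD _ _ _ (f : R[i]^o -> R[i]^o) (g : R[i]^o -> R[i]^o) s 1 hf hg).
Qed.

Lemma dvM f g s : dv f s -> dv g s -> dv (fun t => f t * g t) s.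
Proof.
move=> /dvP hf /dvP hg; apply/dvP.
exact: (@derivableM _ _ (f : R[i]^o -> R[i]) (g : R[i]^o -> R[i]) s 1 hf hg).
Qed.

Lemma dvV f s : f s != 0 -> dv f s -> dv (fun t => (f t)^-1) s.
Proof.
move=> fs /dvP hf; apply/dvP.
exact: (@derivableV _ _ (f : R[i]^o -> R[i]) s 1 fs hf).
Qed.

Lemma dvZ k f s : dv f s -> dv (fun t => k * f t) s.
Proof. by move=> hf; apply: dvM => //; exact: dv_cst. Qed.

Lemma dvN f s : dv f s -> dv (fun t => - f t) s.
Proof. by move=> /(dvZ (-1)); apply: dv_ext => t; rewrite mulN1r. Qed.

Lemma dvB f g s : dv f s -> dv g s -> dv (fun t => f t - g t) s.
Proof. by move=> hf hg; apply: dvD => //; exact: dvN. Qed.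

Lemma dv_shift f k s : dv f (s + k) -> dv (fun t => f (t + k)) s.
Proof.
move=> [l hl]; exists l => e e0; have [d d0 hd] := hl e e0; exists d => // h hh.
by rewrite (addrAC s h k); exact: hd.
Qed.

Lemma dv_scale f k s : dv f (k * s) -> dv (fun t => f (k * t)) s.
Proof.
move=> [l hl]; exists (k * l) => e e0.
have k1 : 0 < nc k + 1 by rewrite ltr_wpDl ?nc_ge0.
have [d d0 hd] := hl _ (divr_gt0 e0 k1); exists (d / (nc k + 1)); first exact: divr_gt0.
move=> h; rewrite ltr_pdivlMr // => hh; rewrite mulrDr [k * l]mulrC -[_ * k * h]mulrA.
have kh : nc (k * h) <= nc h * (nc k + 1).
  by rewrite ncM mulrC ler_wpM2l ?nc_ge0 // lerDl.
apply: (le_trans (hd _ (le_lt_trans kh hh))).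
apply: (@le_trans _ _ (e / (nc k + 1) * (nc h * (nc k + 1)))).
  by rewrite ler_pM2l // divr_gt0.
by rewrite le_eqVlt; apply/orP; left; apply/eqP; field; rewrite gt_eqF.
Qed.

Lemma dv_conj f s : dv f (conjc s) -> dv (fun t => conjc (f (conjc t))) s.
Proof.
move=> [l hl]; exists (conjc l) => e e0; have [d d0 hd] := hl e e0; exists d => // h hh.
have := hd (conjc h); rewrite !nc_conj => /(_ hh).
by rewrite -[X in X <= _]nc_conj !rmorphB /= rmorphM /= conjcK -rmorphD.
Qed.

Lemma dv_ccont f s v x : dv f (s + x%:C * v) -> ccont (fun y => f (s + y%:C * v)) x.
Proof. by case=> l; exact: cdiff_ccont. Qed.

(** The mean value inequality, applied three times on the segment from 0 to [h]; each use costs a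
    factor [2 * nc h]. *)
Lemma cexp_taylor h : nc h <= 1 ->
  nc (cexp h - 1 - h) <= 8 * expR 1 * nc h ^+ 2 /\
  nc (cexp h - 1 - h - h ^+ 2 / 2) <= 8 * expR 1 * nc h ^+ 3.
Proof.
move=> h1; set E := expR 1; have E0 : 0 <= E := expR_ge0 1.
have i1 : 0 <= (1 : R) <= 1 by rewrite ler01 lexx.
have i0 : 0 <= (0 : R) <= 1 by rewrite lexx ler01.
have dth x : cderiv (fun y => h * y%:C) x h.
  by apply: (cderiv_eq (cderivZ h (cderiv_id x))); rewrite mulr1.
have d0 x : cderiv (fun y => cexp (h * y%:C) - 1) x (h * cexp (h * x%:C)).
  by apply: (cderiv_eq (cderivB (cderiv_cexp (dth x)) (cderiv_cst 1 x))); rewrite subr0.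
have d1 x : cderiv (fun y => cexp (h * y%:C) - 1 - h * y%:C) x (h * (cexp (h * x%:C) - 1)).
  by apply: (cderiv_eq (cderivB (d0 x) (dth x))); rewrite mulrBr mulr1.
have d2 x : cderiv (fun y => cexp (h * y%:C) - 1 - h * y%:C - (h * y%:C) * (h * y%:C) / 2) x
    (h * (cexp (h * x%:C) - 1 - h * x%:C)).
  apply: (@cderiv_ext _ (fun y => cexp (h * y%:C) - 1 - h * y%:C - 2^-1 * ((h * y%:C) * (h * y%:C)))).
    by move=> y; rewrite [2^-1 * _]mulrC.
  apply: (cderiv_eq (cderivB (d1 x) (cderivZ 2^-1 (cderivM (dth x) (dth x))))).
  by field.
have b x : 0 <= x <= 1 -> nc (cexp (h * x%:C)) <= E.
  move=> /andP[x0 x1]; rewrite nc_cexp ler_expR; apply: (le_trans (ler_norm _)).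
  apply: (le_trans (cRe_le _)); rewrite ncM nc_real ger0_norm //.
  by rewrite -[leRHS]mulr1; apply: ler_pM; rewrite ?nc_ge0.
have mvt F F' M : (forall x, cderiv F x (F' x)) -> F 0 = 0 ->
    (forall x, 0 <= x <= 1 -> nc (F' x) <= M) -> forall x, 0 <= x <= 1 -> nc (F x) <= 2 * M.
  move=> dF F0 FM x hx.
  have M0 : 0 <= M := le_trans (nc_ge0 _) (FM 0 i0).
  have wF : wcont01 F.
    by split; apply: continuous_subspaceT => y; case: (cderiv_ccont (dF y)).
  have := cmvt wF.
  move=> /(_ F' M (fun y _ => dF y)) h2.
  have FM' y : 0 < y < 1 -> nc (F' y) <= M by move=> /andP[y0 y1]; apply: FM; rewrite !ltW.
  have := h2 FM' x 0 hx i0; rewrite F0 !subr0 => h3; apply: (le_trans h3).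
  case/andP: hx => x0 x1; rewrite ger0_norm //.
  by rewrite ler_piMr // mulr_ge0.
have n0 := nc_ge0 h.
have c0 x : 0 <= x <= 1 -> nc (cexp (h * x%:C) - 1) <= 2 * (nc h * E).
  apply: (mvt _ _ (nc h * E) d0); first by rewrite mulr0 cexp0 subrr.
  by move=> y hy; rewrite ncM ler_wpM2l // b.
have c1 x : 0 <= x <= 1 -> nc (cexp (h * x%:C) - 1 - h * x%:C) <= 2 * (nc h * (2 * (nc h * E))).
  apply: (mvt _ _ _ d1); first by rewrite mulr0 cexp0 subrr subr0.
  by move=> y hy; rewrite ncM ler_wpM2l // c0.
have c2 x : 0 <= x <= 1 -> nc (cexp (h * x%:C) - 1 - h * x%:C - (h * x%:C) * (h * x%:C) / 2) <=
    2 * (nc h * (2 * (nc h * (2 * (nc h * E))))).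
  apply: (mvt _ _ _ d2); first by rewrite mulr0 cexp0 subrr subr0 mul0r mul0r subr0.
  by move=> y hy; rewrite ncM ler_wpM2l // c1.
have := c1 1 i1; have := c2 1 i1; rewrite mulr1 -expr2 => k3 k2.
split.
- apply: (le_trans k2); rewrite [leLHS](_ : _ = 4 * E * nc h ^+ 2); last by ring.
  by rewrite ler_wpM2r ?exprn_ge0 // ler_wpM2r // ler_nat.
- by apply: (le_trans k3); rewrite le_eqVlt; apply/orP; left; apply/eqP; ring.
Qed.

Lemma small_lin (M e : R) : 0 <= M -> 0 < e -> exists2 d, 0 < d & d <= 1 /\
  forall n : R, 0 <= n -> n < d -> M * n <= e.
Proof.
move=> M0 e0; have M1 : 0 < M + 1 by rewrite ltr_wpDl.
exists (Num.min 1 (e / (M + 1))); first by rewrite lt_min ltr01 divr_gt0.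
split; first by rewrite ge_min lexx.
move=> n n0; rewrite lt_min ltr_pdivlMr // => /andP[_ h].
by apply: ltW; apply: le_lt_trans h; rewrite mulrDr mulr1 mulrC lerDl.
Qed.

Lemma dv_cexp s : dv (@cexp R) s.
Proof.
exists (cexp s) => e e0; pose M : R := 8 * expR 1.
have M0 : 0 <= M by rewrite mulr_ge0 ?expR_ge0.
have [d d0 [d1 hd]] := small_lin (mulr_ge0 (nc_ge0 (cexp s)) M0) e0.
exists d => // h hh; rewrite cexpD.
rewrite (_ : _ - _ = cexp s * (cexp h - 1 - h)); last by ring.
have [k _] := cexp_taylor (ltW (lt_le_trans hh d1)).
rewrite ncM; apply: (@le_trans _ _ (nc (cexp s) * M * nc h * nc h)).
  by rewrite -mulrA -expr2 -mulrA ler_wpM2l ?nc_ge0.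
by rewrite ler_wpM2r ?nc_ge0 // hd ?nc_ge0.
Qed.

(** An entire function; it supplies the regular part of [cexp (k * s) * f s] at a simple pole of
    [f]. *)
Definition expdd v : R[i] := if v == 0 then 1 else (cexp v - 1) / v.

Lemma expddE v : cexp v = 1 + v * expdd v.
Proof.
rewrite /expdd; case: eqP => [->|/eqP v0]; first by rewrite cexp0 mul0r addr0.
by rewrite mulrCA mulfV // mulr1 addrC subrK.
Qed.

Lemma dv_expdd v : dv expdd v.
Proof.
have [->|v0] := eqVneq v 0.
  exists 2^-1 => e e0; pose M : R := 8 * expR 1.
  have M0 : 0 <= M by rewrite mulr_ge0 ?expR_ge0.
  have [d d0 [d1 hd]] := small_lin M0 e0.
  exists d => // h hh; rewrite add0r /expdd eqxx.
  case: eqP => [->|/eqP h0]; first by rewrite mulr0 !subrr nc0 mulr_ge0 // ltW.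
  rewrite (_ : _ - _ = (cexp h - 1 - h - h ^+ 2 / 2) / h); last by field.
  have [_ k] := cexp_taylor (ltW (lt_le_trans hh d1)).
  have hp : 0 < nc h by rewrite nc_gt0.
  rewrite ncM ncV ler_pdivrMr //; apply: (le_trans k).
  rewrite (_ : _ * nc h ^+ 3 = M * nc h * nc h * nc h); last by rewrite /M; ring.
  by rewrite !ler_wpM2r ?nc_ge0 // hd ?nc_ge0.
apply: (@dv_near (fun t => (cexp t - 1) / t)).
  exists (nc v); first by rewrite nc_gt0.
  move=> t; rewrite /expdd; case: eqP => // ->.
  by rewrite sub0r ncN ltxx.
apply: dvM; last by apply: dvV => //; exact: dv_id.
by apply: dvB; [exact: dv_cexp|exact: dv_cst].
Qed.

End Differentiability.

(** * Simple poles and residues *)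

Section SimplePoles.
Variable R : realType.
Implicit Types (x y e r M : R) (s t h k p a b v : R[i]) (f g : R[i] -> R[i]) (q d : {poly R[i]}).

Lemma bounded_poly_const d M r :
  (forall t, r <= nc t -> nc d.[t] <= M) -> (size d <= 1)%N.
Proof.
elim/poly_ind: d M r => [|d c IH] M r hd; first by rewrite size_poly0.
have key t : r <= nc t -> 1 <= nc t -> nc d.[t] * nc t <= M + nc c.
  move=> h1 h2; rewrite -ncM -[_ * _](addrK c); apply: (le_trans (ncB _ _)).
  by rewrite lerD2r -hornerMXaddC hd.
have d1 : (size d <= 1)%N.
  apply: (IH (M + nc c) (Num.max r 1)) => t; rewrite ge_max => /andP[h1 h2].
  by apply: le_trans (key t h1 h2); rewrite ler_peMr ?nc_ge0.
have [a dE] : exists a, d = a%:P by exists d`_0; exact: size1_polyC.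
have [a0|a0] := eqVneq a 0; first by rewrite dE a0 mul0r add0r size_polyC_leq1.
have na : 0 < nc a by rewrite nc_gt0.
pose T := Num.max (Num.max r 1) ((M + nc c) / nc a + 1).
have T1 : 1 <= T by rewrite /T !le_max lexx orbT.
have Tr : r <= T by rewrite /T !le_max lexx.
have TM : (M + nc c) / nc a + 1 <= T by rewrite /T le_max lexx orbT.
have nT : nc T%:C = T by rewrite nc_real ger0_norm // (le_trans ler01).
have := key T%:C; rewrite nT dE hornerC => /(_ Tr T1).
have h : (M + nc c) / nc a < T by apply: lt_le_trans TM; rewrite ltrDl.
by rewrite ltr_pdivrMr // mulrC in h; rewrite leNgt h.
Qed.

Lemma dv_bounded g p : dv g p -> exists r M, 0 < r /\ forall t, nc (t - p) < r -> nc (g t) <= M.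
Proof.
case=> l /cdiff_cont /(_ 1 ltr01)[r r0 hr]; exists r, (1 + nc (g p)); split=> // t ht.
have := hr _ ht; rewrite (_ : p + (t - p) = t); last by ring.
have := ncD (g t - g p) (g p); rewrite subrK => h1 h2; apply: (le_trans h1).
by rewrite lerD2r.
Qed.

(** The difference of two principal parts is a polynomial in [1 / (s - p)] that is bounded near [p],
    hence constant. *)
Lemma laurent_unique f p q q' : laurent_at f p q -> laurent_at f p q' -> q`_1 = q'`_1.
Proof.
move=> [g [/nearCP[r1 r10 dg] /dnearCP[r2 r20 fg]]] [g' [/nearCP[r3 r30 dg'] /dnearCP[r4 r40 fg']]].
have self r : 0 < r -> nc (p - p) < r by rewrite subrr nc0.
have [r5 [M [r50 hM]]] := dv_bounded ((dvP _ _).1 (dg p (self _ r10))).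
have [r6 [M' [r60 hM']]] := dv_bounded ((dvP _ _).1 (dg' p (self _ r30))).
pose r := Num.min (Num.min r2 r4) (Num.min r5 r6).
have r0 : 0 < r by rewrite !lt_min r20 r40 r50.
have s1 : (size (q - q')%R <= 1)%N.
  apply: (@bounded_poly_const _ (M + M') (2 / r)) => t ht.
  have t0 : 0 < nc t by apply: lt_le_trans ht; exact: divr_gt0.
  have tn : t != 0 by rewrite -nc_gt0.
  (* Large [t] correspond to points [s] near [p]. *)
  pose s := p + t^-1.
  have sp : s - p = t^-1 by rewrite /s addrC addKr.
  have : nc (s - p) < r.
    rewrite sp ncV -[r]invrK ltf_pV2 ?posrE ?invr_gt0 //; apply: lt_le_trans ht.
    by rewrite -[ltLHS]mul1r ltr_pM2r ?invr_gt0 // ltr1n.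
  rewrite !lt_min => /andP[/andP[h2 h4] /andP[h5 h6]].
  have s0 : s != p by rewrite -subr_eq0 sp invr_neq0.
  have := fg s h2 s0; rewrite (fg' s h4 s0) sp invrK => E.
  have -> : (q - q').[t] = g' s - g s.
    have -> : g' s = q.[t] + g s - q'.[t] by rewrite -E; ring.
    by rewrite hornerD hornerN; ring.
  by apply: (le_trans (ncB _ _)); rewrite addrC; apply: lerD; [exact: hM|exact: hM'].
have := nth_default 0 s1; rewrite coefB => /eqP; rewrite subr_eq0 => /eqP //.
Qed.

(** Working form of [at_most_simple_pole] that carries the residue [a]; a removable singularity is
    the case [a = 0]. *)
Definition spl f p a : Prop := exists g r, [/\ 0 < r,
  forall t, nc (t - p) < r -> dv g t &
  forall t, nc (t - p) < r -> t != p -> f t = a / (t - p) + g t].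

Lemma spl_laurent f p a : spl f p a -> laurent_at f p (a *: 'X).
Proof.
move=> [g [r [r0 dg fg]]]; exists g; split.
  by apply/nearCP; exists r => // s hs; apply/dvP; exact: dg.
by apply/dnearCP; exists r => // s hs sp; rewrite hornerZ hornerX fg.
Qed.

Lemma res_laurent f p q : laurent_at f p q -> res f p = q`_1.
Proof.
move=> hq; apply: xget_unique; first by exists q.
by move=> _ [q' hq' ->]; exact: laurent_unique hq' hq.
Qed.

Lemma spl_res f p a : spl f p a -> res f p = a.
Proof. by move=> /spl_laurent/res_laurent ->; rewrite coefZ coefX mulr1. Qed.

Lemma spl_simple f p a : spl f p a -> at_most_simple_pole f p.
Proof.
move=> h; exists (a *: 'X); last exact: spl_laurent.
by apply: (leq_trans (size_scale_leq _ _)); rewrite size_polyX.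
Qed.

Lemma simple_spl f p : at_most_simple_pole f p -> spl f p (res f p).
Proof.
move=> [q q2 hq]; rewrite (res_laurent hq).
case: hq => g [/nearCP[r1 r10 dg] /dnearCP[r2 r20 fg]].
exists (fun t => q`_0 + g t), (Num.min r1 r2); split; first by rewrite lt_min r10.
  move=> t; rewrite lt_min => /andP[h1 _]; apply: dvD; first exact: dv_cst.
  by apply/dvP; exact: dg.
move=> t; rewrite lt_min => /andP[_ h2] tp; rewrite fg // addrA; congr (_ + _).
rewrite (horner_coef_wide _ q2) !big_ord_recl big_ord0 /= expr0 expr1 mulr1 addr0.
by rewrite addrC.
Qed.

Lemma spl_lin k f g p a b : spl f p a -> spl g p b ->
  spl (fun s => k * f s + g s) p (k * a + b).
Proof.
move=> [f1 [r1 [r10 df ff]]] [g1 [r2 [r20 dg gg]]].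
exists (fun t => k * f1 t + g1 t), (Num.min r1 r2); split; first by rewrite lt_min r10.
  by move=> t; rewrite lt_min => /andP[h1 h2]; apply: dvD; [apply: dvZ; exact: df|exact: dg].
by move=> t; rewrite lt_min => /andP[h1 h2] tp; rewrite ff // gg //; ring.
Qed.

Lemma spl_hol f p : (exists2 r, 0 < r & forall t, nc (t - p) < r -> dv f t) -> spl f p 0.
Proof.
by move=> [r r0 df]; exists f, r; split=> // t _ _; rewrite mul0r add0r.
Qed.

Lemma spl_ext f g p a : f =1 g -> spl f p a -> spl g p a.
Proof. by move=> /funext ->. Qed.

Lemma spl_cexp k f p a : spl f p a -> spl (fun s => cexp (k * s) * f s) p (cexp (k * p) * a).
Proof.
move=> [g [r [r0 dg fg]]].
exists (fun t => cexp (k * p) * (k * a * expdd (k * (t - p))) + cexp (k * t) * g t), r.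
split=> // t ht.
  apply: dvD.
    apply: dvZ; apply: dvZ.
    apply: (dv_shift (f := fun t => expdd (k * t))); apply: dv_scale; exact: dv_expdd.
  by apply: dvM; [apply: dv_scale; exact: dv_cexp|exact: dg].
move=> tp; rewrite fg // mulrDr addrA; congr (_ + _).
have -> : k * t = k * p + k * (t - p) by ring.
rewrite cexpD [cexp (k * (t - p))]expddE.
have tp0 : t - p != 0 by rewrite subr_eq0.
by field.
Qed.

End SimplePoles.

(** * Meromorphic functions in the strip with prescribed residues *)

Section MeromorphicClass.
Variables (R : realType) (tau : R).
Implicit Types (x y e r M : R) (s t h k p a b v : R[i]) (f g : R[i] -> R[i]) (q d : {poly R[i]}).
Local Notation p1 := (pole1 R).
Local Notation p2 := (pole2 tau).

(** Working form of [holomorphic_off_poles] with the residues at the two poles as parameters, so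
    that they add up under linear combinations. *)
Definition HolR f a b : Prop := [/\ exists2 delta : R, 0 < delta & forall s,
    `|complex.Im s| < 1 + delta -> s != p1 -> s != p2 -> dv f s,
  spl f p1 a & spl f p2 b].

Lemma HolRP f a b : HolR f a b <->
  [/\ holomorphic_off_poles tau f, res f p1 = a & res f p2 = b].
Proof.
split.
  move=> [[e e0 df] s1 s2]; split; [|exact: spl_res|exact: spl_res].
  split; [|exact: spl_simple s1|exact: spl_simple s2].
  exists e => // s [h1 h2]; apply/dvP; apply: df => //; apply/eqP => E; apply: h2; rewrite E.
    by left.
  by right.
move=> [[[e e0 df] s1 s2] <- <-]; split; [|exact: simple_spl|exact: simple_spl].
exists e => // s h1 h2 h3; apply/dvP; apply: df; split=> //= -[E|E].
  by rewrite E eqxx in h2.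
by rewrite E eqxx in h3.
Qed.

Lemma HolR_lin k f g a b a' b' : HolR f a b -> HolR g a' b' ->
  HolR (fun s => k * f s + g s) (k * a + a') (k * b + b').
Proof.
move=> [[d d0 df] f1 f2] [[e e0 dg] g1 g2]; split; try exact: spl_lin.
exists (Num.min d e); first by rewrite lt_min d0.
move=> s hs s1 s2.
have h1 : `|complex.Im s| < 1 + d by apply: (lt_le_trans hs); rewrite lerD2l ge_min lexx.
have h2 : `|complex.Im s| < 1 + e by apply: (lt_le_trans hs); rewrite lerD2l ge_min lexx orbT.
by apply: dvD; [apply: dvZ; exact: df|exact: dg].
Qed.

Lemma Im_near s p r : nc (s - p) < r -> `|complex.Im s| < `|complex.Im p| + r.
Proof.
move=> h; rewrite -[s](subrK p) cImD; apply: (le_lt_trans (ler_normD _ _)).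
by rewrite addrC ltrD2l; exact: le_lt_trans (cIm_le _) h.
Qed.

Lemma Im_p1 : `|complex.Im p1| = 2^-1.
Proof. by rewrite /= div1r ger0_norm ?invr_ge0. Qed.
Lemma Im_p2 : `|complex.Im p2| = 2^-1.
Proof. by rewrite /= div1r normrN ger0_norm ?invr_ge0. Qed.

Lemma HolR_entire f : (exists2 d, 0 < d & forall s, `|complex.Im s| < 1 + d -> dv f s) ->
  HolR f 0 0.
Proof.
move=> [d d0 df]; split; first by exists d => // s h _ _; exact: df.
  apply: spl_hol; exists 2^-1; first by rewrite invr_gt0.
  by move=> t /Im_near; rewrite Im_p1 => h; apply: df; lra.
apply: spl_hol; exists 2^-1; first by rewrite invr_gt0.
by move=> t /Im_near; rewrite Im_p2 => h; apply: df; lra.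
Qed.

Lemma HolR_cexp k f a b : HolR f a b ->
  HolR (fun s => cexp (k * s) * f s) (cexp (k * p1) * a) (cexp (k * p2) * b).
Proof.
move=> [[d d0 df] s1 s2]; split; try exact: spl_cexp.
exists d => // s h h1 h2; apply: dvM; last exact: df.
by apply: dv_scale; exact: dv_cexp.
Qed.

Lemma HolR_ext f g a b : f =1 g -> HolR f a b -> HolR g a b.
Proof. by move=> /funext ->. Qed.

Lemma HolR_eq f a b a' b' : HolR f a b -> a = a' -> b = b' -> HolR f a' b'.
Proof. by move=> h <- <-. Qed.

Lemma HolR_sum n (c : nat -> R[i]) (F : nat -> R[i] -> R[i]) (A B : nat -> R[i]) :
  (forall j, HolR (F j) (A j) (B j)) ->
  HolR (fun s => \sum_(j < n) c j * F j s) (\sum_(j < n) c j * A j) (\sum_(j < n) c j * B j).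
Proof.
move=> h; elim: n => [|n IH].
  rewrite !big_ord0; apply: (@HolR_ext (fun=> 0)); first by move=> s; rewrite big_ord0.
  by apply: HolR_entire; exists 1 => // s _; exact: dv_cst.
rewrite !big_ord_recr /= ![\sum_(i < n) _ + _]addrC.
apply: HolR_ext (HolR_lin (c n) (h n) IH) => s.
by rewrite big_ord_recr /= addrC.
Qed.

Lemma decay_mono e e' f : e' <= e -> decay e f -> decay e' f.
Proof.
move=> ee [M [B h]]; exists (Num.max M 0), (Num.max 1 B) => s s1; rewrite ge_max => /andP[s2 s3].
apply: (le_trans (h s s1 s3)).
apply: (@le_trans _ _ (Num.max M 0 * `|complex.Re s| `^ (- (3%:R / 2%:R) - e))).
  by rewrite ler_wpM2r ?powR_ge0 // le_max lexx.
by rewrite ler_wpM2l ?le_max ?lexx ?orbT // ler_powR // lerD2l lerN2.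
Qed.

Lemma decay_lin e k f g : decay e f -> decay e g -> decay e (fun s => k * f s + g s).
Proof.
move=> [M [B hf]] [M' [B' hg]]; exists (nc k * M + M'), (Num.max B B') => s s1.
rewrite ge_max => /andP[s2 s3]; apply: (le_trans (ncD _ _)); rewrite ncM mulrDl -mulrA.
by apply: lerD; [apply: ler_wpM2l (hf s s1 s2); exact: nc_ge0|exact: hg].
Qed.

Definition MerR f a b : Prop := HolR f a b /\ exists2 e, 0 < e & decay e f.

Lemma MerR_lin k f g a b a' b' : MerR f a b -> MerR g a' b' ->
  MerR (fun s => k * f s + g s) (k * a + a') (k * b + b').
Proof.
move=> [hf [e e0 df]] [hg [e' e'0 dg]]; split; first exact: HolR_lin.
exists (Num.min e e'); first by rewrite lt_min e0.
by apply: decay_lin; [apply: decay_mono df|apply: decay_mono dg]; rewrite ge_min lexx ?orbT.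
Qed.

Lemma MerR_ext f g a b : f =1 g -> MerR f a b -> MerR g a b.
Proof. by move=> /funext ->. Qed.

Lemma MerR_eq f a b a' b' : MerR f a b -> a = a' -> b = b' -> MerR f a' b'.
Proof. by move=> h <- <-. Qed.

Lemma decay0 e : decay e (fun=> 0 : R[i]).
Proof. by exists 0, 0 => s _ _; rewrite nc0 mul0r. Qed.

Lemma MerR0 : MerR (fun=> 0) 0 0.
Proof.
split; first by apply: HolR_entire; exists 1 => // s _; exact: dv_cst.
by exists 1 => //; exact: decay0.
Qed.

Lemma MerR_sum n (c : nat -> R[i]) (F : nat -> R[i] -> R[i]) (A B : nat -> R[i]) :
  (forall j, MerR (F j) (A j) (B j)) ->
  MerR (fun s => \sum_(j < n) c j * F j s) (\sum_(j < n) c j * A j) (\sum_(j < n) c j * B j).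
Proof.
move=> h; elim: n => [|n IH].
  rewrite !big_ord0; apply: MerR_ext MerR0 => s; by rewrite big_ord0.
rewrite !big_ord_recr /= ![\sum_(i < n) _ + _]addrC.
apply: MerR_ext (MerR_lin (c n) (h n) IH) => s.
by rewrite big_ord_recr /= addrC.
Qed.

End MeromorphicClass.

(** * Power decay along the real line *)

Section LineDecay.
Variable R : realType.
Local Notation H1 := (L2 (@one1 R)).
Local Notation mu := (@lebesgue_measure R).
Implicit Types (x y e r M B p : R) (f g : R -> R[i]).

Definition ldec p f : Prop := exists M B, [/\ 0 <= M, 1 <= B &
  forall x, B <= `|x| -> nc (f x) <= M * `|x| `^ p].

Lemma ldec_of p f M B : (forall x, B <= `|x| -> nc (f x) <= M * `|x| `^ p) -> ldec p f.
Proof.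
move=> h; exists (Num.max M 0), (Num.max 1 B); split; rewrite ?le_max ?lexx ?orbT //.
move=> x; rewrite ge_max => /andP[x1 x2]; apply: (le_trans (h x x2)).
by rewrite ler_wpM2r ?powR_ge0 // le_max lexx.
Qed.

Lemma ldecD p f g : ldec p f -> ldec p g -> ldec p (fun x => f x + g x).
Proof.
move=> [M [B [M0 B1 hf]]] [M' [B' [M'0 B'1 hg]]].
apply: (@ldec_of _ _ (M + M') (Num.max B B')) => x; rewrite ge_max => /andP[x1 x2].
by apply: (le_trans (ncD _ _)); rewrite mulrDl lerD ?hf ?hg.
Qed.

Lemma ldecM p p' f g : ldec p f -> ldec p' g -> ldec (p + p') (fun x => f x * g x).
Proof.
move=> [M [B [M0 B1 hf]]] [M' [B' [M'0 B'1 hg]]].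
apply: (@ldec_of _ _ (M * M') (Num.max B B')) => x; rewrite ge_max => /andP[x1 x2].
have x0 : 0 < `|x| by rewrite (lt_le_trans ltr01) // (le_trans B1).
rewrite powRD; last by apply/implyP => _; rewrite gt_eqF.
rewrite ncM mulrACA.
by apply: ler_pM; rewrite ?nc_ge0 ?hf ?hg.
Qed.

Lemma ldec_le p p' f : p <= p' -> ldec p f -> ldec p' f.
Proof.
move=> pp [M [B [M0 B1 hf]]]; apply: (@ldec_of _ _ M B) => x hx.
apply: (le_trans (hf x hx)); rewrite ler_wpM2l // ler_powR //.
exact: le_trans B1 hx.
Qed.

Lemma ldec_cst k : ldec 0 (fun=> k).
Proof. by apply: (@ldec_of _ _ (nc k) 0) => x _; rewrite powRr0 mulr1. Qed.

Lemma ldec_lin k : ldec 1 (fun x => x%:C - k).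
Proof.
apply: (@ldec_of _ _ (1 + nc k) 1) => x x1; rewrite powRr1 //.
apply: (le_trans (ncB _ _)); rewrite nc_real mulrDl mul1r lerD2l.
by rewrite ler_peMr ?nc_ge0.
Qed.

Lemma ldecZ p k f : ldec p f -> ldec p (fun x => k * f x).
Proof. by move=> h; rewrite -[p]add0r; apply: ldecM => //; exact: ldec_cst. Qed.

Lemma ldecJ p f : ldec p f -> ldec p (fun x => conjc (f x)).
Proof.
by move=> [M [B [M0 B1 hf]]]; exists M, B; split=> // x; rewrite nc_conj; exact: hf.
Qed.

Lemma ldec_L2 p f : (forall x, ccont f x) -> ldec p f -> p < - 2^-1 -> vec H1 f.
Proof.
move=> cf [M [B [M0 B1 hf]]] p2.
have [K hK] : exists K, forall x, `|nc (f x) ^+ 2| <= K * ptail (- 1 - (p + p)) x.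
  apply: (@ptail_dom _ _ (M ^+ 2) B).
  - move=> x; have [c1 c2] := cf x.
    rewrite /continuous_at; under eq_fun do rewrite normc_sqr !expr2.
    by rewrite normc_sqr !expr2; apply: cvgD; apply: cvgM.
  - move=> x hx; have x0 : 0 < `|x| by rewrite (lt_le_trans ltr01) // (le_trans B1).
    rewrite ger0_norm ?exprn_ge0 ?nc_ge0 // (_ : -1 - (-1 - (p + p)) = p + p); last by ring.
    rewrite powRD; last by apply/implyP => _; rewrite gt_eqF.
    rewrite -expr2 -exprMn.
    by rewrite ler_pXn2r ?nnegrE ?nc_ge0 ?mulr_ge0 ?powR_ge0 ?hf.
  - lra.
apply: (@H1_dom _ _ (fun x => K * ptail (- 1 - (p + p)) x)); first exact: cmeas_cont.
  by apply: integrableRZ => //; apply: ptail_int; lra.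
by move=> x; apply: le_trans (hK x); exact: ler_norm.
Qed.

Lemma ldec_int p f : (forall x, ccont f x) -> ldec p f -> p < - 1 -> cintegrable setT f.
Proof.
move=> cf [M [B [M0 B1 hf]]] p1.
have key (h : R -> R) : continuous h -> (forall x, `|h x| <= nc (f x)) ->
    mu.-integrable setT (EFin \o h).
  move=> ch hh.
  have [K hK] : exists K, forall x, `|h x| <= K * ptail (- 1 - p) x.
    apply: (@ptail_dom _ _ M B) => //; last by lra.
    move=> x hx; apply: (le_trans (hh x)).
    by rewrite (_ : -1 - (-1 - p) = p); [exact: hf|ring].
  apply: (@le_ptail_int _ (-1 - p) K) => //; first by lra.
  exact: continuous_measurable_fun.
split; apply: key; try by move=> x; case: (cf x).
  by move=> x; exact: cRe_le.
by move=> x; exact: cIm_le.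
Qed.

End LineDecay.

(** * Functions in the closed strip seen by one shift *)

Section StripClass.
Variable R : realType.
Implicit Types (x y e r M : R) (s t h k p a b v P : R[i]) (f g : R[i] -> R[i]).

(* A function on the closed strip with at most one pole off the line
   [Im s = - Im P], as seen by a shift of a real integral by [2 * Im P]. *)
Definition strip_fun f P a : Prop := [/\
  forall s, `|complex.Im s| <= 1 -> s != P -> complex.Im s != - complex.Im P -> dv f s,
  spl f P a & exists2 e, 0 < e & decay e f].

Lemma MerR_strip1 (tau : R) f a b : MerR tau f a b -> strip_fun f (pole1 R) a.
Proof.
move=> [[[d d0 df] s1 s2] hd]; split=> // s s1' sP sI; apply: df => //.
  by apply: (le_lt_trans s1'); rewrite ltrDl.
by apply: contra_neq sI => ->.
Qed.

Lemma MerR_strip2 (tau : R) f a b : MerR tau f a b -> strip_fun f (pole2 tau) b.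
Proof.
move=> [[[d d0 df] s1 s2] hd]; split=> // s s1' sP sI; apply: df => //.
  by apply: (le_lt_trans s1'); rewrite ltrDl.
by apply: contra_neq sI => -> /=; rewrite opprK.
Qed.

Lemma decay_half e f : 0 < e -> decay e f -> exists M B, [/\ 0 <= M, 1 <= B &
  forall s, `|complex.Im s| <= 1 -> B <= `|complex.Re s| ->
    nc (f s) <= M * `|complex.Re s| `^ (- (3 / 2))].
Proof.
move=> e0 [M [B h]]; exists (Num.max M 0), (Num.max 1 B); split; rewrite ?le_max ?lexx ?orbT //.
move=> s s1; rewrite ge_max => /andP[x1 x2]; apply: (le_trans (h s s1 x2)).
apply: (@le_trans _ _ (Num.max M 0 * `|complex.Re s| `^ (- (3%:R / 2%:R) - e))).
  by rewrite ler_wpM2r ?powR_ge0 // le_max lexx.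
rewrite ler_wpM2l ?le_max ?lexx ?orbT // ler_powR //; lra.
Qed.

Lemma strip_fun_line f P a k : strip_fun f P a -> `|complex.Im k| <= 1 ->
  complex.Im k != complex.Im P -> complex.Im k != - complex.Im P ->
  forall x, ccont (fun x => f (x%:C + k)) x.
Proof.
move=> [df _ _] k1 k2 k3 x.
have E : (fun x => f (x%:C + k)) = (fun x => f (k + x%:C * 1)).
  by apply/funext => t; rewrite mulr1 addrC.
rewrite E; apply: dv_ccont.
have I : complex.Im (k + x%:C * 1) = complex.Im k by rewrite mulr1 cImD /= addr0.
apply: df; rewrite ?I //; apply: contra_neq k2 => <-; by rewrite I.
Qed.

Lemma strip_fun_dec f P a k : strip_fun f P a -> `|complex.Im k| <= 1 -> complex.Re k = 0 ->
  exists2 e, 0 < e & ldec (- (3 / 2) - e) (fun x => f (x%:C + k)).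
Proof.
move=> [_ _ [e e0 [M [B h]]]] k1 k0; exists e => //.
apply: (@ldec_of _ _ _ M B) => x hx.
have Re : complex.Re (x%:C + k) = x by rewrite cReD k0 addr0.
have := h (x%:C + k); rewrite Re; apply=> //.
by rewrite cImD /= add0r.
Qed.

End StripClass.

(** * Shifting a sesquilinear integral across a pole *)

Section GreenShift.
Variable R : realType.
Local Notation mu := (@lebesgue_measure R).
Implicit Types (x y e r M : R) (s t h k p a b v P z w : R[i]) (f g : R[i] -> R[i]).

(** A model with a simple pole of residue 1 at 0 and decay [|v|^-3], whose other poles stay off the
    strip that is crossed. Subtracting a multiple of it removes the pole of the shifted
    integrand. *)
Definition ckern v : R[i] := (v * (v ^+ 2 + 1))^-1.

(** The integrals of the model along the lines on the two sides of its pole 0; for [|Im P| = 1/2]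
    the residue theorem gives [2 pi i] up to sign. *)
Definition jump P : R[i] :=
  cI setT (fun x => ckern (x%:C - conjc P)) - cI setT (fun x => ckern (x%:C - P)).

Lemma cReB z w : complex.Re (z - w) = complex.Re z - complex.Re w.
Proof. by rewrite cReD cReN. Qed.
Lemma cImB z w : complex.Im (z - w) = complex.Im z - complex.Im w.
Proof. by rewrite cImD cImN. Qed.

Lemma ckern_split v : v != 0 -> v ^+ 2 + 1 != 0 -> ckern v = v^-1 - v / (v ^+ 2 + 1).
Proof. by move=> v0 v1; rewrite /ckern; field; rewrite v1 v0. Qed.

Lemma sqr1_factor v : v ^+ 2 + 1 = (v + 'i%C) * (v - 'i%C).
Proof.
have -> : (v + 'i%C) * (v - 'i%C) = v ^+ 2 - 'i%C * 'i%C by ring.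
by rewrite i_sqr opprK.
Qed.

Lemma ckern_neq0 v : `|complex.Im v| < 1 -> v ^+ 2 + 1 != 0.
Proof.
move=> v1; rewrite sqr1_factor mulf_neq0 //.
  have : complex.Im (v + 'i%C) != 0.
    by rewrite cImD /=; apply: contraTneq v1 => E; rewrite ltr_norml; lra.
  by apply: contra_neq => ->.
have : complex.Im (v - 'i%C) != 0.
  by rewrite cImD cImN /=; apply: contraTneq v1 => E; rewrite ltr_norml; lra.
by apply: contra_neq => ->.
Qed.

Lemma ckern_bound v x : 1 <= x -> x <= `|complex.Re v| -> nc (ckern v) <= x ^- 2.
Proof.
move=> x1 xv.
have x0 : 0 < x by apply: lt_le_trans x1.
have le1 w : complex.Re w = complex.Re v -> x <= nc w.
  by move=> E; apply: (le_trans _ (cRe_le w)); rewrite E.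
have h1 := le1 v erefl.
have h2 : x <= nc (v + 'i%C) by apply: le1; rewrite cReD /= addr0.
have h3 : x <= nc (v - 'i%C) by apply: le1; rewrite cReD cReN /= subr0.
rewrite /ckern ncV sqr1_factor !ncM lef_pV2 ?posrE ?exprn_gt0 //; last first.
  by rewrite !mulr_gt0 // (lt_le_trans x0).
apply: (@le_trans _ _ (x * (x * 1))); first by rewrite mulr1 expr2.
apply: ler_pM => //; first exact: ltW.
  by rewrite mulr1 ltW.
by apply: ler_pM => //; [exact: ltW|exact: le_trans x1 h3].
Qed.

Lemma dv_ckern v : v != 0 -> `|complex.Im v| < 1 -> dv ckern v.
Proof.
move=> v0 v1; apply: dvV; first by rewrite mulf_neq0 // ckern_neq0.
apply: dvM; first exact: dv_id.
by apply: dvD; [apply: dvM; exact: dv_id|exact: dv_cst].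
Qed.

Section Shift.
Variables (P a b : R[i]) (f g : R[i] -> R[i]).
Hypotheses (hP : `|complex.Im P| = 2^-1) (hf : strip_fun f P a) (hg : strip_fun g P b).
Let p := conjc P.
Let kap : R[i] := P - p.

(** The integrand of [<shift1 P f, g>] for real [s], and that of [<f, shift1 P g>] for
    [s = x - kap]. In the strip between, both [f (s + kap)] and [conjc (g (conjc s))] have their
    pole at [p], and the factor [s - p] reduces the product to a simple pole. *)
Definition shift_term s : R[i] := (s - p) * f (s + kap) * conjc (g (conjc s)).
Definition shift_diff s : R[i] := shift_term s - a * conjc b * ckern (s - p).
Definition in_strip s : bool := `|complex.Im s + complex.Im P| <= 2^-1.

Lemma Im_kap : complex.Im kap = 2 * complex.Im P.
Proof. by rewrite /kap /p cImB cImJ opprK; ring. Qed.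
Lemma Re_kap : complex.Re kap = 0.
Proof. by rewrite /kap /p cReB cReJ subrr. Qed.

Lemma ImP_cases : complex.Im P = 2^-1 \/ complex.Im P = - 2^-1.
Proof.
move: hP; have [h|h] := leP 0 (complex.Im P); first by rewrite ger0_norm //; left.
by rewrite ltr0_norm // => E; right; rewrite -E opprK.
Qed.

Lemma in_strip_bounds s : in_strip s ->
  [/\ `|complex.Im s| <= 1, `|complex.Im (s + kap)| <= 1,
      complex.Im s != complex.Im P, complex.Im (s + kap) != - complex.Im P &
      `|complex.Im (s - p)| < 1].
Proof.
rewrite /in_strip cImD Im_kap cImB cImJ opprK ler_norml => /andP[h1 h2].
by case: ImP_cases => E; move: h1 h2; rewrite E => h1 h2; split;
  rewrite ?ler_norml ?ltr_norml; try (apply/andP; split); try lra;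
  apply/eqP; lra.
Qed.

Lemma dv_shift_diff s : in_strip s -> s != p -> dv shift_diff s.
Proof.
move=> /in_strip_bounds[b1 b2 b3 b4 b5] sp; apply: dvB.
  apply: dvM; first apply: dvM.
  - by apply: dvB; [exact: dv_id|exact: dv_cst].
  - apply: dv_shift; case: hf => df _ _; apply: df => //.
    by apply: contra_neq sp => E; rewrite -[s](addrK kap) E /kap; ring.
  - apply: dv_conj; case: hg => dg _ _; apply: dg; rewrite ?cImJ ?normrN ?eqr_opp //.
    by apply: contra_neq sp => E; rewrite /p -E conjcK.
apply: dvZ; apply: (dv_shift (f := ckern)); apply: dv_ckern => //.
by rewrite subr_eq0.
Qed.

(** In the product of the two local expansions the only singular term is [a * conjc b / (s - p)],
    which the kernel cancels. *)
Lemma shift_removable : exists H, dv H p /\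
  exists2 r, 0 < r & forall s, nc (s - p) < r -> s != p -> shift_diff s = H s.
Proof.
case: hf => _ [f1 [r1 [r10 df ff]]] _; case: hg => _ [g1 [r2 [r20 dg gg]]] _.
pose F s := f1 (s + kap); pose G s := conjc (g1 (conjc s)).
exists (fun s => a * G s + conjc b * F s + (s - p) * F s * G s +
   a * conjc b * ((s - p) / ((s - p) ^+ 2 + 1))); split.
  have kp0 : p + kap - P = 0 by rewrite /kap; ring.
  have dF : dv F p by apply: dv_shift; apply: df; rewrite kp0 nc0.
  have dG : dv G p by apply: dv_conj; apply: dg; rewrite /p conjcK subrr nc0.
  have dp : dv (fun s => s - p) p by apply: dvB; [exact: dv_id|exact: dv_cst].
  apply: dvD; first apply: dvD; first apply: dvD; try exact: dvZ.
    by apply: dvM => //; exact: dvM.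
  apply: dvZ; apply: dvM => //; apply: dvV.
    by rewrite subrr expr0n /= add0r oner_eq0.
  by apply: dvD; [exact: dvM|exact: dv_cst].
exists (Num.min 1 (Num.min r1 r2)); first by rewrite !lt_min ltr01 r10.
move=> s; rewrite !lt_min => /and3P[h0 h1 h2] sp.
have sp0 : s - p != 0 by rewrite subr_eq0.
have s1 : (s - p) ^+ 2 + 1 != 0 by apply: ckern_neq0; exact: le_lt_trans (cIm_le _) h0.
have kE : s + kap - P = s - p by rewrite /kap; ring.
have cE : conjc s - P = conjc (s - p) by rewrite /p rmorphB /= conjcK.
rewrite /shift_diff /shift_term ckern_split // ff; last 2 first.
- by rewrite kE.
- by rewrite -subr_eq0 kE.
rewrite gg; last 2 first.
- by rewrite cE nc_conj.
- by rewrite -subr_eq0 cE conjc_eq0.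
rewrite kE cE rmorphD /= fmorph_div /= conjcK -/(F s) -/(G s).
by field; rewrite s1 sp0.
Qed.

(** One growing factor [s - p] against two factors of order [|Re s|^(-3/2)] leaves [|Re s|^-2]; here
    the exponent 3/2 of the decay condition enters. *)
Lemma shift_bound : exists K B, 1 <= B /\ forall s, in_strip s -> B <= `|complex.Re s| ->
  nc (shift_diff s) <= K * `|complex.Re s| ^- 2.
Proof.
have [_ _ [e e0 df]] := hf; have [_ _ [e' e'0 dg]] := hg.
have [M [B [M0 B1 hM]]] := decay_half e0 df; have [M' [B' [M'0 B'1 hM']]] := decay_half e'0 dg.
exists (3 * M * M' + nc (a * conjc b) * 4), (Num.max (Num.max B B') (2 * nc p + 2)); split.
  by rewrite !le_max B1.
move=> s hs; rewrite !ge_max => /andP[/andP[s1 s2] s3].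
set x := `|complex.Re s| in s1 s2 s3 *.
have [b1 b2 _ _ _] := in_strip_bounds hs.
have x1 : 1 <= x by apply: le_trans B1 s1.
have x0 : 0 < x by apply: lt_le_trans x1.
have np := nc_ge0 p.
apply: (le_trans (ncB _ _)); rewrite mulrDl; apply: lerD; last first.
  rewrite [leLHS]ncM -mulrA ler_wpM2l ?nc_ge0 //.
  apply: (le_trans (@ckern_bound _ (x / 2) _ _)); first by lra.
    rewrite cReB; apply: le_trans (lerB_dist _ _); rewrite -/x.
    have := cRe_le p; lra.
  by rewrite expr_div_n invf_div [4](_ : _ = 2 ^+ 2) //; ring.
have hf1 : nc (f (s + kap)) <= M * x `^ (- (3 / 2)).
  have := hM (s + kap); rewrite cReD Re_kap addr0; exact.
have hg1 : nc (conjc (g (conjc s))) <= M' * x `^ (- (3 / 2)).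
  have := hM' (conjc s); rewrite nc_conj cImJ normrN cReJ; exact.
have hs1 : nc (s - p) <= 3 * x.
  apply: (le_trans (ncB _ _)); have := nc_le s; rewrite -/x; lra.
rewrite /shift_term !ncM.
apply: (@le_trans _ _ (3 * x * (M * x `^ (- (3 / 2))) * (M' * x `^ (- (3 / 2))))).
  by apply: ler_pM; rewrite ?mulr_ge0 ?nc_ge0 //; apply: ler_pM; rewrite ?nc_ge0.
have E : x * (x `^ (- (3 / 2)) * x `^ (- (3 / 2))) = x ^- 2.
  rewrite -powRD; last by apply/implyP => _; rewrite gt_eqF.
  rewrite -{1}[x]powRr1 ?(ltW x0) // -powRD; last by apply/implyP => _; rewrite gt_eqF.
  rewrite (_ : 1 + _ = - 2%:R); last by field.
  by rewrite powRN powR_mulrn ?(ltW x0).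
rewrite -E le_eqVlt; apply/orP; left; apply/eqP; ring.
Qed.

(** The corrected integrand [G] is holomorphic between the two lines and decays, so [strip_shift]
    equates its integrals; the kernel put back contributes [jump P]. *)
Lemma green_shift :
  cI setT (fun x => (x%:C - p) * f (x%:C + kap) * conjc (g x%:C)) -
  cI setT (fun x => (x%:C - P) * f x%:C * conjc (g (x%:C + kap))) = a * conjc b * jump P.
Proof.
have [H [dH [r r0 hH]]] := shift_removable.
have [K [B [B1 hK]]] := shift_bound.
pose G s := if s == p then H s else shift_diff s.
have G_off s : s != p -> G s = shift_diff s by rewrite /G => /negbTE ->.
have dG s : in_strip s -> dv G s.
  move=> hs; have [->|sp] := eqVneq s p.
    apply: (@dv_near _ H) dH; exists r => // t ht; rewrite /G.
    by case: eqP => // /eqP tp; rewrite hH.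
  apply: (@dv_near _ shift_diff); last exact: dv_shift_diff.
  exists (nc (s - p)); first by rewrite nc_gt0 subr_eq0.
  move=> t ht; rewrite G_off //; apply: contraTneq ht => ->.
  by rewrite nc_distC ltxx.
have bG s : in_strip s -> Num.max B (nc p + 1) <= `|complex.Re s| ->
    nc (G s) <= K * `|complex.Re s| ^- 2.
  move=> hs; rewrite ge_max => /andP[s1 s2]; rewrite G_off; first exact: hK.
  apply: contraTneq s2 => ->; rewrite -ltNge.
  by apply: le_lt_trans (cRe_le p) _; rewrite ltrDl.
have line (y : R) : `|y + complex.Im P| <= 2^-1 -> cintegrable setT (fun x => G (x +i* y)).
  move=> hy; apply: (@ldec_int _ (- 2)).
  - move=> x; have E : (fun x => G (x +i* y)) = (fun x => G ((0 +i* y) + x%:C * 1)).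
      by apply/funext => t; congr G; apply: complex_ext => /=; ring.
    rewrite E; apply: dv_ccont; apply: dG; rewrite /in_strip mulr1 cImD /= addr0.
    exact: hy.
  - apply: (@ldec_of _ _ _ K (Num.max B (nc p + 1))) => x hx.
    by rewrite powRN powR_mulrn //; exact: (bG (x +i* y)).
  - lra.
have shiftG (c d : R) : c <= d -> (forall y, c <= y <= d -> `|y + complex.Im P| <= 2^-1) ->
    cI setT (fun x => G (x +i* c)) = cI setT (fun x => G (x +i* d)).
  move=> cd hcd; apply: (@strip_shift _ G c d K (Num.max B (nc p + 1)) cd).
  - by move=> x y hy; exact: (dG (x +i* y) (hcd y hy)).
  - move=> x y hy hx; apply: (le_trans (bG (x +i* y) (hcd y hy) hx)).
    have x1 : 1 <= `|x| by apply: le_trans hx; rewrite le_max B1.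
    have x0 : 0 < `|x| by apply: lt_le_trans x1.
    have K0 : 0 <= K.
      have := le_trans (nc_ge0 _) (bG (x +i* y) (hcd y hy) hx).
      by rewrite pmulr_lge0 // invr_gt0 exprn_gt0.
    by rewrite /= ler_wpM2l // lef_pV2 ?posrE ?exprn_gt0 // expr2 ler_peMr // ltW.
  - by apply: line; apply: hcd; rewrite lexx.
  - by apply: line; apply: hcd; rewrite lexx cd.
have h0 : `|0 + complex.Im P| <= 2^-1 by rewrite add0r hP.
have h1 : `|- complex.Im kap + complex.Im P| <= 2^-1.
  by rewrite Im_kap (_ : - (2 * _) + _ = - complex.Im P) ?normrN ?hP //; ring.
have eqG : cI setT (fun x => G (x +i* 0)) = cI setT (fun x => G (x +i* (- complex.Im kap))).
  (* The sign of [Im P] decides which of the two lines is the lower one. *)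
  have [kp|kp] := leP 0 (complex.Im kap).
    apply/esym; apply: shiftG; first by rewrite oppr_le0.
    move=> y; rewrite Im_kap in kp * => /andP[y1 y2].
    move: hP; rewrite ger0_norm; last by lra.
    by rewrite ler_norml => ?; apply/andP; split; lra.
  apply: shiftG; first by rewrite oppr_ge0 ltW.
  move=> y; rewrite Im_kap in kp * => /andP[y1 y2].
  move: hP; rewrite ltr0_norm; last by lra.
  by rewrite ler_norml => ?; apply/andP; split; lra.
have ImP0 : complex.Im P != 0 by case: ImP_cases => ->; apply/eqP; lra.
have off (x y : R) : y != - complex.Im P -> x +i* y != p.
  by move=> h; apply: contra_neq h => E; rewrite -cImJ -/p -E.
have offR (x : R) (Q : R[i]) : complex.Im Q != 0 -> x%:C - Q != 0.
  by move=> h; apply: contra_neq h => /(congr1 (@complex.Im R)); rewrite cImB /= sub0r => /eqP; rewrite oppr_eq0 => /eqP.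
have kint (Q : R[i]) : `|complex.Im Q| = 2^-1 -> cintegrable setT (fun x => ckern (x%:C - Q)).
  move=> hQ; apply: (@ldec_int _ (- 2)); last by lra.
    move=> x; have E : (fun x => ckern (x%:C - Q)) = (fun x => ckern (- Q + x%:C * 1)).
      by apply/funext => t; congr ckern; ring.
    rewrite E; apply: dv_ccont; apply: dv_ckern.
      rewrite mulr1 addrC offR // -normr_gt0 hQ invr_gt0 //.
    by rewrite mulr1 cImD cImN /= addr0 normrN hQ; lra.
  apply: (@ldec_of _ _ _ 4 (2 * nc Q + 2)) => x hx.
  have nQ := nc_ge0 Q.
  rewrite powRN powR_mulrn //; apply: (le_trans (@ckern_bound _ (`|x| / 2) _ _)); first by lra.
    rewrite cReB /=; apply: le_trans (lerB_dist _ _).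
    have := cRe_le Q; lra.
  by rewrite expr_div_n invf_div [4](_ : _ = 2 ^+ 2) //; ring.
have hp : `|complex.Im p| = 2^-1 by rewrite cImJ normrN.
pose T0 x : R[i] := (x%:C - p) * f (x%:C + kap) * conjc (g x%:C).
pose T1 x : R[i] := (x%:C - P) * f x%:C * conjc (g (x%:C + kap)).
have E0 x : G (x +i* 0) = T0 x - a * conjc b * ckern (x%:C - p).
  rewrite G_off; first by rewrite /shift_diff /shift_term conjc_real.
  by apply: off; rewrite eq_sym oppr_eq0.
have E1 x : G (x +i* (- complex.Im kap)) = T1 x - a * conjc b * ckern (x%:C - P).
  have sE : x +i* (- complex.Im kap) = x%:C - kap.
    apply: complex_ext; first by rewrite cReB Re_kap subr0.
    transitivity (complex.Im x%:C - complex.Im kap); last by rewrite [RHS]cImB.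
    by rewrite (_ : complex.Im x%:C = 0) // sub0r.
  rewrite G_off; last first.
    by apply: off; rewrite Im_kap eqr_opp; apply/eqP; case: ImP_cases => ->; lra.
  rewrite sE /shift_diff /shift_term subrK (_ : x%:C - kap - p = x%:C - P); last by rewrite /kap; ring.
  rewrite (_ : conjc (x%:C - kap) = x%:C + kap) //.
  apply: complex_ext; first by rewrite cReJ [LHS]cReB [RHS]cReD Re_kap subr0 addr0.
  by rewrite cImJ [X in - X]cImB [RHS]cImD opprB (_ : complex.Im x%:C = 0) // subr0 add0r.
have int_T (T : R -> R[i]) (Q : R[i]) y : `|y + complex.Im P| <= 2^-1 -> `|complex.Im Q| = 2^-1 ->
    (forall x, G (x +i* y) = T x - a * conjc b * ckern (x%:C - Q)) ->
    cI setT T = cI setT (fun x => G (x +i* y)) + a * conjc b * cI setT (fun x => ckern (x%:C - Q)).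
  move=> hy hQ E; have iQ := kint Q hQ; have iy := line y hy.
  rewrite -(cIZ _ measurableT iQ) -(cID measurableT iy (cintegrableZ _ measurableT iQ)).
  by apply: eq_cI => x _; rewrite E subrK.
rewrite -/T0 -/T1 (int_T T0 p 0 h0 hp E0) (int_T T1 P _ h1 hP E1) eqG /jump; ring.
Qed.

End Shift.

End GreenShift.

(** * Green's formula for the difference operator *)

Section Green.
Variables (R : realType) (tau c : R).
Local Notation H1 := (L2 (@one1 R)).
Local Notation mu := (@lebesgue_measure R).
Local Notation p1 := (pole1 R).
Local Notation p2 := (pole2 tau).
Implicit Types (x y e r M : R) (s t h k p a b u v P z : R[i]) (f g : R[i] -> R[i]).

Lemma cIm_inv z : complex.Im z^-1 = - complex.Im z / nc z ^+ 2.
Proof. by rewrite normc_sqr; case: z => u v /=; rewrite mulNr. Qed.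

Lemma cJM u v : conjc (u * v) = conjc u * conjc v.
Proof. exact: (rmorphM (@conjc R)). Qed.
Lemma cJB u v : conjc (u - v) = conjc u - conjc v.
Proof. exact: (rmorphB (@conjc R)). Qed.
Lemma cJJ u : conjc (conjc u) = u.
Proof. by case: u => x y; rewrite /= opprK. Qed.

Lemma ckern_conj v : ckern (conjc v) = conjc (ckern v).
Proof. by rewrite /ckern !expr2 fmorphV !(rmorphM, rmorphD, rmorph1). Qed.

(** The two integrals are complex conjugates, so the jump is [2 i] times an imaginary part, and the
    imaginary part of the kernel is negative on the line [Im v = 1/2]. *)
Lemma jump_pole1 : jump p1 != 0.
Proof.
pose z x : R[i] := ckern (x%:C - conjc p1).
have vE x : x%:C - conjc p1 = x +i* 2^-1.
  by apply: complex_ext; rewrite !ReImE /=; field.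
have hp : `|complex.Im (conjc p1)| = 2^-1 by rewrite cImJ normrN Im_p1.
have n0 x : (x +i* 2^-1 : R[i]) != 0.
  by apply/eqP => /(congr1 (@complex.Im R)) /= => /eqP; rewrite invr_eq0 pnatr_eq0.
have h1 x : `|complex.Im (x +i* 2^-1 : R[i])| < 1 by rewrite /= ger0_norm ?invr_ge0 //; lra.
have iz : cintegrable setT z.
  apply: (@ldec_int _ (- 2)); last by lra.
    move=> x; have E : z = (fun x => ckern (- conjc p1 + x%:C * 1)).
      by apply/funext => t; congr ckern; ring.
    rewrite E; apply: dv_ccont; rewrite mulr1 addrC vE; apply: dv_ckern; [exact: n0|exact: h1].
  apply: (@ldec_of _ _ _ 1 1) => x hx.
  by rewrite mul1r powRN powR_mulrn // /z vE; exact: ckern_bound.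
have [iR iI] := iz.
have -> : jump p1 = cI setT z - conjc (cI setT z).
  rewrite -cI_conj //; congr (_ - _); apply: eq_cI => x _.
  rewrite /z -ckern_conj; congr ckern.
  by apply: complex_ext; rewrite !ReImE /=; ring.
suff : complex.Im (cI setT z) < 0.
  move=> h; apply/eqP => /(congr1 (@complex.Im R)); rewrite cImB cImJ /= => E.
  move: h E; rewrite /=; lra.
have zE x : complex.Im (z x) = - ((3 / 2 * x ^+ 2 + 3 / 8) /
    ((x ^+ 2 + 4^-1) * ((x ^+ 2 + 3 / 4) ^+ 2 + x ^+ 2))).
  rewrite /z vE /ckern cIm_inv mulNr; congr (- (_ / _)).
    by rewrite expr2 !ReImE /=; field.
  by rewrite ncM exprMn !normc_sqr expr2 !ReImE /=; congr (_ * _); field.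
have zneg x : complex.Im (z x) <= 0.
  by rewrite zE oppr_le0; have := sqr_ge0 x; move: (x ^+ 2) => X X0; apply: divr_ge0; nra.
(* A uniform bound on [0, 1] makes the integral strictly negative. *)
have z01 x : 0 <= x <= 1 -> complex.Im (z x) <= - 16^-1.
  move=> /andP[x0 x1]; rewrite zE lerN2.
  have x2 : 0 <= x ^+ 2 <= 1 by rewrite sqr_ge0 expr_le1.
  set X := x ^+ 2 in x2 *; case/andP: x2 => X0 X1.
  have D : 0 < (X + 4^-1) * ((X + 3 / 4) ^+ 2 + X) by rewrite mulr_gt0 //; nra.
  by rewrite ler_pdivlMr //; nra.
rewrite /cI /= -[ltLHS]opprK oppr_lt0.
have -> : - (\int[mu]_(x in setT) complex.Im (z x))%R = (\int[mu]_(x in setT) (- complex.Im (z x)))%R.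
  rewrite -mulN1r -RintegralZl //; by apply: eq_Rintegral => x _; rewrite mulN1r.
have iN : mu.-integrable setT (EFin \o (fun x => - complex.Im (z x))).
  have := integrableRZ (-1) measurableT iI; under [X in EFin \o X]eq_fun do rewrite mulN1r; exact.
have fin := integrable_fin_num measurableT iN.
rewrite /Rintegral fine_gt0 //; apply/andP; split; last by case/fin_numPlt/andP: fin.
have mN := measurable_int _ iN.
pose I01 : set R := `[(0 : R), (1 : R)]%classic.
have le1 : (\int[mu]_(x in I01) (- complex.Im (z x))%:E <=
    \int[mu]_(x in setT) (- complex.Im (z x))%:E)%E.
  apply: ge0_subset_integral => //; first exact: measurable_itv.
  by move=> x _; rewrite lee_fin oppr_ge0.
apply: lt_le_trans le1.
apply: (@lt_le_trans _ _ (\int[mu]_(x in I01) (16^-1)%:E)%E).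
  rewrite integral_cst //=; last exact: measurable_itv.
  rewrite lebesgue_measure_itv /= lte_fin ltr01 oppr0 adde0 mule1.
  by rewrite lte_fin invr_gt0.
apply: ge0_le_integral => //.
- exact: measurable_itv.
- by apply: measurable_funS mN.
- move=> x; rewrite /I01 /= in_itv /= => h; rewrite lee_fin lerNr; exact: z01.
Qed.

(** For [P = p1] and [P = p2] these are the two shift terms of the difference operator
    ([Lc_split]). *)
Definition shift1 P f : R -> R[i]^o := fun x => (x%:C - conjc P) * f (x%:C + (P - conjc P)).

Section OnePole.
Variables (P : R[i]).
Hypothesis hP : `|complex.Im P| = 2^-1.

Lemma ImP_neq0 : complex.Im P != 0.
Proof. by rewrite -normr_gt0 hP invr_gt0. Qed.

Lemma onR_line f a : strip_fun f P a -> (forall x, ccont (onR f) x) /\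
  exists2 e, 0 < e & ldec (- (3 / 2) - e) (onR f).
Proof.
move=> hf; have z1 : `|complex.Im (0 : R[i])| <= 1 by rewrite /= normr0.
have E : onR f = (fun x => f (x%:C + 0)) by apply/funext => x; rewrite addr0.
rewrite !E; split; last exact: (strip_fun_dec hf z1 erefl).
by apply: (strip_fun_line hf z1); rewrite /= eq_sym ?oppr_eq0 ImP_neq0.
Qed.

Lemma onR_L2 f a : strip_fun f P a -> vec H1 (onR f).
Proof.
move=> /onR_line[h [e e0 h']]; apply: ldec_L2 h h' _; lra.
Qed.

Lemma shift1_L2 f a : strip_fun f P a -> vec H1 (shift1 P f).
Proof.
move=> hf.
have Ik : complex.Im (P - conjc P) = 2 * complex.Im P by rewrite cImB cImJ opprK; ring.
have k1 : `|complex.Im (P - conjc P)| <= 1 by rewrite Ik normrM hP ger0_norm //; lra.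
have k0 : complex.Re (P - conjc P) = 0 by rewrite cReB cReJ subrr.
have [e e0 h] := strip_fun_dec hf k1 k0.
have hI := ImP_neq0.
apply: (@ldec_L2 _ (1 + (- (3 / 2) - e))); last by lra.
  move=> x; apply: ccontM.
    by apply: ccontB; [exact: ccont_id|exact: ccont_cst].
  by apply: (strip_fun_line hf k1); rewrite Ik; apply: contra_neq hI => ?; lra.
by apply: ldecM h; exact: ldec_lin.
Qed.

Lemma green1 f g a b : strip_fun f P a -> strip_fun g P b ->
  ip H1 (shift1 P f) (onR g) - ip H1 (onR f) (shift1 P g) = a * conjc b * jump P.
Proof.
move=> hf hg; rewrite -(green_shift hP hf hg) -[ip _ _ _]/(L2_ip _ _ _).
rewrite -[X in _ - X = _]/(L2_ip _ _ _) !L2_ipE.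
congr (_ - _); apply: eq_cI => x _; rewrite /shift1 /onR /one1 mulr1 //.
by rewrite cJM cJB cJJ conjc_real; ring.
Qed.

End OnePole.

Definition mid f : R -> R[i]^o := fun x => (2 * (x - tau) * c)%:C * f x%:C.

Lemma mid_L2 f a : strip_fun f p1 a -> vec H1 (mid f).
Proof.
move=> /(onR_line (Im_p1 R))[h [e e0 h']].
have E : mid f = fun x => (2 * c)%:C * ((x%:C - tau%:C) * onR f x).
  by apply/funext => x; rewrite /mid /onR; ring.
rewrite E; apply: (@ldec_L2 _ (1 + (- (3 / 2) - e))); last by lra.
  move=> x; apply: ccontM; first exact: ccont_cst.
  by apply: ccontM => //; apply: ccontB; [exact: ccont_id|exact: ccont_cst].
by apply: ldecZ; apply: ldecM h'; exact: ldec_lin.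
Qed.

Lemma Lc_split f : onR (Lc tau c f) = shift1 p1 f + (mid f + shift1 p2 f) :> (R -> R[i]^o).
Proof.
apply/funext => x; rewrite -[RHS]/(shift1 p1 f x + (mid f x + shift1 p2 f x)).
have c1 : conjc p1 = - ('i%C / 2).
  by rewrite half_realC; apply: complex_ext; rewrite !ReImE /=; field.
have c2 : conjc p2 = 2 * tau%:C + 'i%C / 2.
  by rewrite half_realC -!real_complex_nat; apply: complex_ext; rewrite !ReImE /=; field.
have k1 : p1 - conjc p1 = 'i%C by apply: complex_ext; rewrite !ReImE /=; field.
have k2 : p2 - conjc p2 = - 'i%C by apply: complex_ext; rewrite !ReImE /=; field.
rewrite /shift1 /mid /onR /Lc k1 k2 c1 c2.
have -> : 'i%C * (1 / 2%:R - 'i%C * x%:C) = x%:C - - ('i%C / 2).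
  rewrite [LHS](_ : _ = - ('i%C * 'i%C) * x%:C + 'i%C / 2); last by field.
  by rewrite i_sqr; ring.
have -> : 'i%C * (1 / 2%:R + 'i%C * x%:C - 2%:R * 'i%C * tau%:C) = - (x%:C - (2 * tau%:C + 'i%C / 2)).
  rewrite [LHS](_ : _ = ('i%C * 'i%C) * (x%:C - 2 * tau%:C) + 'i%C / 2); last by field.
  by rewrite i_sqr; ring.
ring.
Qed.

Lemma Lc_L2 f a b : MerR tau f a b -> vec H1 (onR f) /\ vec H1 (onR (Lc tau c f)).
Proof.
move=> hf; have s1 := MerR_strip1 hf; have s2 := MerR_strip2 hf.
split; first exact: onR_L2 (Im_p1 R) _ _ s1.
have shH := H1_sh R; rewrite Lc_split.
apply: (sh_vecA shH (shift1_L2 (Im_p1 R) s1)).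
exact: (sh_vecA shH (mid_L2 s1) (shift1_L2 (Im_p2 tau) s2)).
Qed.

(** The middle term multiplies by a real function and drops out; each shift term contributes the
    residues at its own pole. *)
Theorem green f g a b a' b' : MerR tau f a b -> MerR tau g a' b' ->
  ip H1 (onR (Lc tau c f)) (onR g) - ip H1 (onR f) (onR (Lc tau c g)) =
  a * conjc a' * jump p1 + b * conjc b' * jump p2.
Proof.
move=> hf hg; have shH := H1_sh R.
have f1 := MerR_strip1 hf; have f2 := MerR_strip2 hf.
have g1 := MerR_strip1 hg; have g2 := MerR_strip2 hg.
have vf := (Lc_L2 hf).1; have vg := (Lc_L2 hg).1.
have vf1 := shift1_L2 (Im_p1 R) f1; have vf2 := shift1_L2 (Im_p2 tau) f2; have vfm := mid_L2 f1.
have vg1 := shift1_L2 (Im_p1 R) g1; have vg2 := shift1_L2 (Im_p2 tau) g2; have vgm := mid_L2 g1.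
rewrite !Lc_split (ipDl shH vf1 (sh_vecA shH vfm vf2) vg) (ipDl shH vfm vf2 vg).
rewrite (ipDr shH vg1 (sh_vecA shH vgm vg2) vf) (ipDr shH vgm vg2 vf).
have -> : ip H1 (mid f) (onR g) = ip H1 (onR f) (mid g).
  rewrite -[LHS]/(L2_ip _ _ _) -[RHS]/(L2_ip _ _ _) !L2_ipE; apply: eq_cI => x _.
  by rewrite /mid /onR cJM conjc_real; ring.
rewrite -(green1 (Im_p1 R) f1 g1) -(green1 (Im_p2 tau) f2 g2).
ring.
Qed.

End Green.

(** * Poles, residues and decay of the transforms *)

Section TransformMeromorphic.
Variables (R : realType) (tau : R).
Local Notation H1 := (L2 (@one1 R)).
Local Notation p1 := (pole1 R).
Local Notation p2 := (pole2 tau).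
Implicit Types (x y e r M : R) (s t h k p a b v P z : R[i]) (w u : {poly R[i]}) (n j : nat).

Definition polyL j s : R[i] := (zl s + j%:R)^-1.
Definition polyR j s : R[i] := (zr tau s + j%:R)^-1.

Lemma zlE s : zl s = 'i%C * (s - p1).
Proof.
have -> : p1 = 'i%C / 2.
  by rewrite half_realC; apply: complex_ext; rewrite !ReImE /=; field.
rewrite [RHS](_ : _ = 'i%C * s - 'i%C * 'i%C / 2); last by ring.
by rewrite i_sqr /zl; ring.
Qed.

Lemma zrE s : zr tau s = - 'i%C * (s - p2).
Proof.
have -> : p2 = 2 * tau%:C - 'i%C / 2.
  by rewrite half_realC -!real_complex_nat; apply: complex_ext; rewrite !ReImE /=; field.
rewrite [RHS](_ : _ = - ('i%C * s) + 2 * ('i%C * tau%:C) - 'i%C * 'i%C / 2); last by ring.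
by rewrite i_sqr /zr; ring.
Qed.

Lemma dv_zl s : dv (@zl R) s.
Proof. by apply: dvD; [exact: dv_cst|apply: dvZ; exact: dv_id]. Qed.
Lemma dv_zr s : dv (zr tau) s.
Proof. by apply: dvB; [exact: dv_cst|apply: dvZ; exact: dv_id]. Qed.

Lemma cIm_zl s j : complex.Im (zl s + j%:R) = complex.Re s.
Proof. by rewrite /zl half_realC !ReImE /=; ring. Qed.
Lemma cRe_zl s j : complex.Re (zl s + j%:R) = 2^-1 - complex.Im s + j%:R.
Proof. by rewrite /zl half_realC !ReImE /=; ring. Qed.
Lemma cIm_zr s j : complex.Im (zr tau s + j%:R) = 2 * tau - complex.Re s.
Proof. by rewrite /zr half_realC -!real_complex_nat !ReImE /=; ring. Qed.
Lemma cRe_zr s j : complex.Re (zr tau s + j%:R) = 2^-1 + complex.Im s + j%:R.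
Proof. by rewrite /zr half_realC -!real_complex_nat !ReImE /=; ring. Qed.

Lemma dv_polyL j s : zl s + j%:R != 0 -> dv (polyL j) s.
Proof. by move=> h; apply: dvV => //; apply: dvD; [exact: dv_zl|exact: dv_cst]. Qed.
Lemma dv_polyR j s : zr tau s + j%:R != 0 -> dv (polyR j) s.
Proof. by move=> h; apply: dvV => //; apply: dvD; [exact: dv_zr|exact: dv_cst]. Qed.

Lemma neq0_Re z : complex.Re z != 0 -> z != 0.
Proof. by apply: contra_neq => ->. Qed.

Lemma HolR_polyL j : HolR tau (polyL j) (- 'i%C * (j == 0%N)%:R) 0.
Proof.
case: j => [|j]; last first.
  rewrite mulr0; apply: HolR_entire; exists 4^-1; first by rewrite invr_gt0.
  move=> s; rewrite ltr_norml => /andP[s1 s2]; apply: dv_polyL; apply: neq0_Re.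
  have j0 : 0 <= j%:R :> R by [].
  by rewrite cRe_zl -[j.+1%:R]natr1; apply/eqP; lra.
rewrite mulr1; have i0 : 'i%C != 0 :> R[i] by rewrite -nc_gt0 nc_i.
split.
- exists 1 => // s _ s1 _; apply: dv_polyL; rewrite addr0 zlE mulf_neq0 //.
  by rewrite subr_eq0.
- exists (fun=> 0), 1; split=> // [t _|t _ tp]; first exact: dv_cst.
  by rewrite addr0 /polyL addr0 zlE invfM i_inv.
- apply: spl_hol; exists 2^-1; first by rewrite invr_gt0.
  move=> t ht; apply: dv_polyL; apply: neq0_Re; rewrite cRe_zl addr0.
  have := le_lt_trans (cIm_le _) ht; rewrite cImB /= ltr_norml => /andP[h1 h2].
  by apply/eqP; lra.
Qed.

Lemma HolR_polyR j : HolR tau (polyR j) 0 ('i%C * (j == 0%N)%:R).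
Proof.
case: j => [|j]; last first.
  rewrite mulr0; apply: HolR_entire; exists 4^-1; first by rewrite invr_gt0.
  move=> s; rewrite ltr_norml => /andP[s1 s2]; apply: dv_polyR; apply: neq0_Re.
  have j0 : 0 <= j%:R :> R by [].
  by rewrite cRe_zr -[j.+1%:R]natr1; apply/eqP; lra.
rewrite mulr1; have i0 : 'i%C != 0 :> R[i] by rewrite -nc_gt0 nc_i.
split.
- exists 1 => // s _ _ s1; apply: dv_polyR; rewrite addr0 zrE mulf_neq0 ?oppr_eq0 //.
  by rewrite subr_eq0.
- apply: spl_hol; exists 2^-1; first by rewrite invr_gt0.
  move=> t ht; apply: dv_polyR; apply: neq0_Re; rewrite cRe_zr addr0.
  have := le_lt_trans (cIm_le _) ht; rewrite cImB /= ltr_norml => /andP[h1 h2].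
  by apply/eqP; lra.
- exists (fun=> 0), 1; split=> // [t _|t _ tp]; first exact: dv_cst.
  by rewrite addr0 /polyR addr0 zrE invfM invrN i_inv opprK.
Qed.

Lemma decay_sqr (f : R[i] -> R[i]) K B : 1 <= B ->
  (forall s, B <= `|complex.Re s| -> nc (f s) <= K * `|complex.Re s| ^- 2) ->
  exists2 e, 0 < e & decay e f.
Proof.
move=> B1 h; exists 2^-1; first by rewrite invr_gt0.
exists K, B => s _ hs; rewrite (_ : _ - _ = - 2%:R); last by field.
by rewrite powRN powR_mulrn //; exact: h.
Qed.

Lemma zl_ge s j : `|complex.Re s| <= nc (zl s + j%:R).
Proof. by rewrite -(cIm_zl s j) cIm_le. Qed.

Lemma zr_ge s j : 4 * `|tau| <= `|complex.Re s| -> `|complex.Re s| / 2 <= nc (zr tau s + j%:R).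
Proof.
move=> h; apply: le_trans (cIm_le _); rewrite cIm_zr distrC.
apply: le_trans (lerB_dist _ _); rewrite normrM ger0_norm //; lra.
Qed.

Lemma inv_prod_bound x z z' : 0 < x -> x / 2 <= nc z -> x / 2 <= nc z' ->
  nc ((z * z')^-1) <= 4 * x ^- 2.
Proof.
move=> x0 h h'; have x2 : 0 < x / 2 by apply: divr_gt0.
have z0 : 0 < nc z := lt_le_trans x2 h; have z'0 : 0 < nc z' := lt_le_trans x2 h'.
have E : 4 * x ^- 2 = ((x / 2) * (x / 2))^-1 by field; rewrite gt_eqF.
rewrite E ncV ncM lef_pV2 ?posrE ?mulr_gt0 //.
by apply: ler_pM => //; exact: ltW.
Qed.

Lemma neq0_nc x z : 0 < x -> x / 2 <= nc z -> z != 0.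
Proof. by move=> x0 h; rewrite -nc_gt0 (lt_le_trans _ h) // divr_gt0. Qed.

Lemma zz : (0%N == 0%N)%:R = 1 :> R[i].
Proof. by []. Qed.

Lemma MerR_polyL j : MerR tau (fun s => polyL j s - polyL 0 s) ('i%C - 'i%C * (j == 0%N)%:R) 0.
Proof.
split.
  have := HolR_lin (-1) (HolR_polyL 0) (HolR_polyL j) => h.
  apply: HolR_ext (HolR_eq h _ _) => [s||]; rewrite ?zz; ring.
apply: (@decay_sqr _ (nc j%:R * 4) 1) => // s s1; set x := `|_| in s1 *.
have x0 : 0 < x by apply: lt_le_trans s1.
have hx n : x / 2 <= nc (zl s + n%:R) by apply: le_trans (zl_ge s n); rewrite -/x; lra.
have h0 := hx 0%N; have hj := hx j.
rewrite [polyL j s - _](_ : _ = - j%:R * ((zl s + j%:R) * (zl s + 0%:R))^-1); last first.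
  rewrite /polyL; have := neq0_nc x0 h0; have := neq0_nc x0 hj.
  by rewrite mulr0n addr0 => n1 n2; field; rewrite n1 n2.
by rewrite ncM ncN -mulrA ler_wpM2l ?nc_ge0 // inv_prod_bound.
Qed.

Lemma MerR_polyR j : MerR tau (fun s => polyR j s - polyR 0 s) 0 ('i%C * (j == 0%N)%:R - 'i%C).
Proof.
split.
  have := HolR_lin (-1) (HolR_polyR 0) (HolR_polyR j) => h.
  apply: HolR_ext (HolR_eq h _ _) => [s||]; rewrite ?zz; ring.
apply: (@decay_sqr _ (nc j%:R * 4) (Num.max 1 (4 * `|tau|))); first by rewrite le_max lexx.
move=> s; rewrite ge_max => /andP[s1 st]; set x := `|complex.Re s| in s1 st *.
have x0 : 0 < x by apply: lt_le_trans s1.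
have hx n : x / 2 <= nc (zr tau s + n%:R) by exact: zr_ge.
have h0 := hx 0%N; have hj := hx j.
rewrite [polyR j s - _](_ : _ = - j%:R * ((zr tau s + j%:R) * (zr tau s + 0%:R))^-1); last first.
  rewrite /polyR; have := neq0_nc x0 h0; have := neq0_nc x0 hj.
  by rewrite mulr0n addr0 => n1 n2; field; rewrite n1 n2.
by rewrite ncM ncN -mulrA ler_wpM2l ?nc_ge0 // inv_prod_bound.
Qed.

Lemma MerR_polyLR : MerR tau (fun s => polyL 0 s + polyR 0 s) (- 'i%C) 'i%C.
Proof.
split.
  have := HolR_lin 1 (HolR_polyL 0) (HolR_polyR 0) => h.
  apply: HolR_ext (HolR_eq h _ _) => [s||]; rewrite ?zz; ring.
apply: (@decay_sqr _ (nc (1 + 2 * ('i%C * tau%:C)) * 4) (Num.max 1 (4 * `|tau|))).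
  by rewrite le_max lexx.
move=> s; rewrite ge_max => /andP[s1 st]; set x := `|complex.Re s| in s1 st *.
have x0 : 0 < x by apply: lt_le_trans s1.
have h1 : x / 2 <= nc (zr tau s + 0%:R) by exact: zr_ge.
have h2 : x / 2 <= nc (zl s + 0%:R) by apply: le_trans (zl_ge s 0%N); rewrite -/x; lra.
rewrite [polyL 0 s + _](_ : _ = (1 + 2 * ('i%C * tau%:C)) * ((zl s + 0%:R) * (zr tau s + 0%:R))^-1); last first.
  rewrite /polyR /polyL; have := neq0_nc x0 h1; have := neq0_nc x0 h2.
  rewrite mulr0n !addr0 => n1 n2.
  rewrite [1 + 2 * _](_ : _ = zl s + zr tau s).
    by field; rewrite n1 n2.
  by rewrite /zl /zr; field.
by rewrite ncM -mulrA ler_wpM2l ?nc_ge0 // inv_prod_bound.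
Qed.

(** Single terms decay only like [1 / |s|]. The leading part is [w.[1] * polyL 0 + u.[1] * polyR 0],
    and [polyL 0 + polyR 0] is O(|s|^-2), so matching yields the decay. Only the constant
    coefficients produce poles in the strip. *)
Lemma MerR_Utr w u : w.[1] = u.[1] ->
  MerR tau (Utr tau w u) (- 'i%C * w.[0]) ('i%C * u.[0]).
Proof.
move=> wu; pose n := (maxn (size w) (size u)).+1.
have wn : (size w <= n)%N by rewrite /n ltnW // ltnS leq_maxl.
have un : (size u <= n)%N by rewrite /n ltnW // ltnS leq_maxr.
have val1 (p : {poly R[i]}) : (size p <= n)%N -> p.[1] = \sum_(k < n) p`_k.
  by move=> pn; rewrite (horner_coef_wide _ pn); apply: eq_bigr => k _; rewrite expr1n mulr1.
have val0 (p : {poly R[i]}) : \sum_(k < n) p`_k * (k == 0%N :> nat)%:R = p.[0].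
  rewrite big_ord_recl eqxx mulr1 big1 ?addr0 ?horner_coef0 // => k _.
  by rewrite /= mulr0.
have mL := MerR_sum n (fun j => w`_j) MerR_polyL.
have mR := MerR_sum n (fun j => u`_j) MerR_polyR.
have := MerR_lin 1 mL (MerR_lin 1 mR (MerR_lin (w.[1]) MerR_polyLR (MerR0 tau))).
move=> h; apply: MerR_ext (MerR_eq h _ _).
- move=> s; rewrite /Utr (lappE (zl s) wn) (lappE (zr tau s) un).
  under eq_bigr do rewrite mulrBr; under [X in _ + (1 * X + _)]eq_bigr do rewrite mulrBr.
  rewrite !sumrB -!mulr_suml -!val1 // -wu !mul1r /polyL /polyR; ring.
- under eq_bigr do rewrite mulrBr mulrCA; rewrite sumrB -mulr_suml -mulr_sumr val0 -val1 //.
  rewrite big1; first by ring.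
  by move=> k _; rewrite mulr0.
- rewrite big1; last by move=> k _; rewrite mulr0.
  under eq_bigr do rewrite mulrBr mulrCA; rewrite sumrB -mulr_suml -mulr_sumr val0 -val1 //.
  by rewrite -wu; ring.
Qed.

End TransformMeromorphic.

(** * Density of the functions without residues *)

Section MeromorphicDensity.
Variables (R : realType) (tau : R).
Local Notation H1 := (L2 (@one1 R)).
Implicit Types (x y e r M : R) (s t h k p a b v P z : R[i]) (n : nat).

(** Tends to 1 pointwise, decays like [1 / |s|], and has its pole at [s = i (n + 3)], outside the
    strip. *)
Definition cutoff n s : R[i] := n.+3%:R * (n.+3%:R + 'i%C * s)^-1.

Lemma cutoff_neq0 n s : complex.Im s < 2 -> n.+3%:R + 'i%C * s != 0.
Proof.
move=> h; apply: neq0_Re; rewrite !ReImE /=.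
have : 3 <= n.+3%:R :> R by rewrite ler_nat.
by move=> h3; apply/eqP; lra.
Qed.

Lemma MerR_cutoff n p : far_pole p -> MerR tau (fun s => (s - p)^-1 * cutoff n s) 0 0.
Proof.
move=> fp; split.
  apply: HolR_entire; exists 4^-1; first by rewrite invr_gt0.
  move=> s hs; apply: dvM.
    apply: dvV; last by apply: dvB; [exact: dv_id|exact: dv_cst].
    rewrite subr_eq0; apply: contraTneq hs => ->; rewrite -leNgt.
    by apply: le_trans fp; lra.
  apply: dvZ; apply: dvV; last by apply: dvD; [exact: dv_cst|apply: dvZ; exact: dv_id].
  by apply: cutoff_neq0; move: hs; rewrite ltr_norml => /andP[_]; lra.
apply: (@decay_sqr _ _ (nc n.+3%:R * 4) (Num.max 1 (2 * nc p))); first by rewrite le_max lexx.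
move=> s; rewrite ge_max => /andP[s1 s2]; set x := `|complex.Re s| in s1 s2 *.
have x0 : 0 < x by apply: lt_le_trans s1.
rewrite /cutoff (_ : _ * _ = n.+3%:R * ((s - p) * (n.+3%:R + 'i%C * s))^-1); last first.
  by rewrite invfM mulrCA.
rewrite ncM -mulrA ler_wpM2l ?nc_ge0 //; apply: inv_prod_bound => //.
  apply: le_trans (cRe_le _); rewrite cReB; apply: le_trans (lerB_dist _ _).
  have := cRe_le p; rewrite -/x; lra.
apply: le_trans (cIm_le _); rewrite !ReImE /= (_ : 0 + _ = complex.Re s); last by ring.
rewrite -/x; lra.
Qed.

Lemma mer_dense (f : R -> R[i]^o) e : vec H1 f -> 0 < e ->
  exists2 g, MerR tau g 0 0 & hn H1 (f - onR g) < e.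
Proof.
move=> vf e0; have shH := H1_sh R.
pose K (g : R -> R[i]^o) := exists2 h, MerR tau h 0 0 & g = onR h.
suff [_ /(_ e e0)[_ [h mh ->] hf]] : vec H1 f /\
    forall e, 0 < e -> exists2 g, K g & hn H1 (f - g) < e by exists h.
apply: (pole_span_dense vf (closed_subspace_closure (K := K) _ _)).
- by move=> _ [h mh ->]; exact: (Lc_L2 0 mh).1.
- move=> a _ _ [h mh ->] [h' mh' ->]; exists (fun s => a * h s + h' s) => //.
  by apply: MerR_eq (MerR_lin a mh mh') _ _; rewrite mulr0 addr0.
move=> p fp; have vp := pole_L2 fp; split=> // d d0.
have [C hC] : exists C, forall x : R, (nc (x%:C - p) ^+ 2)^-1 <= C * ptail 1 x.
  by apply: pole_bound; rewrite -normr_gt0; apply: lt_le_trans fp; lra.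
have vn n := (Lc_L2 0 (MerR_cutoff n fp)).1.
have N0 n (x : R) : n.+3%:R + 'i%C * x%:C != 0.
  by apply: cutoff_neq0 => /=.
have diffE n (x : R) : nc (simple_pole p x - (x%:C - p)^-1 * cutoff n x%:C) =
    nc (simple_pole p x) * (`|x| / nc (n.+3%:R + 'i%C * x%:C)).
  have -> : simple_pole p x - (x%:C - p)^-1 * cutoff n x%:C =
     simple_pole p x * ('i%C * x%:C * (n.+3%:R + 'i%C * x%:C)^-1).
    rewrite /simple_pole /cutoff; have := far_neq x fp; move: (N0 n x).
    by move: (n.+3%:R) => m h1 h2; field; rewrite h1 h2.
  by rewrite !ncM ncV nc_i nc_real mul1r.
have nge n (x : R) : n.+3%:R <= nc (n.+3%:R + 'i%C * x%:C).
  apply: le_trans (cRe_le _); rewrite !ReImE /= !(mul0r, mulr0, subr0, addr0, oppr0).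
  by rewrite ger0_norm.
have nge' n (x : R) : `|x| <= nc (n.+3%:R + 'i%C * x%:C).
  apply: le_trans (cIm_le _); rewrite !ReImE /= (_ : 0 + _ = x) //; ring.
have [||||N hN] := @L2_dominated R (@one1 R) (@one1_meas R) (@one1_ge0 R)
  (fun n => simple_pole p - onR (fun s => (s - p)^-1 * cutoff n s)) (fun x => C * ptail 1 x) _ _ _ _ d d0.
- by move=> n; apply: (sh_vecB shH).
- move=> x; apply: (@squeeze_cvgr _ _ _ _ (fun=> 0) (fun n => nc (simple_pole p x) * `|x| * n.+1%:R^-1)).
  + apply: nearW => n; rewrite nc_ge0 /= diffE -mulrA ler_wpM2l ?nc_ge0 //.
    rewrite ler_wpM2l // lef_pV2 ?posrE ?nc_gt0 //.
    by apply: le_trans (nge n x); rewrite ler_nat ltnW // ltnW.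
  + exact: cvg_cst.
  + have := cvgM (cvg_cst (nc (simple_pole p x) * `|x| : R)) (@cvg_harmonic R).
    by rewrite mulr0 => h; exact: h.
- by apply: integrableRZ => //; exact: ptail_int.
- move=> n x; rewrite /one1 mulr1; apply: le_trans (hC x).
  rewrite -exprVn -ncV ler_pXn2r ?nnegrE ?nc_ge0 // [leLHS]diffE.
  rewrite ler_piMr ?nc_ge0 // ler_pdivrMr ?nc_gt0 ?mul1r //.
exists (onR (fun s => (s - p)^-1 * cutoff N s)); last exact: hN.
by eexists; first exact: (MerR_cutoff N fp).
Qed.

End MeromorphicDensity.

(** * Deficiency spaces of a single component *)

Section HalfLineComponent.
Variables (R : realType) (tau c : R).
Hypothesis hc : c ^+ 2 < 1.
Local Notation H1 := (L2 (@one1 R)).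
Local Notation p1 := (pole1 R).
Local Notation p2 := (pole2 tau).
Implicit Types (x e M N : R) (y g : R -> R[i]^o) (s t h k a b z : R[i]) (f : R[i] -> R[i]) (w u : {poly R[i]}) (n : nat).

Lemma Tz_matched z w u : w.[1] = u.[1] ->
  onR (Lc tau c (Utr tau w u)) - z *: onR (Utr tau w u) = Tz tau c z w u.
Proof.
move=> wu; apply/funext => x.
rewrite -[LHS]/(Lc tau c (Utr tau w u) x%:C - z * Utr tau w u x%:C) Lc_Utr //.
have E1 : Ez c tau z w = - z *: w + EE c tau w by rewrite /Ez scaleNr addrC.
have E2 : - Ez c tau (- z) u = - z *: u + (- EE c tau u).
  by rewrite /Ez opprB scaleNr.
by rewrite /Tz E1 E2 /onR /Utr !(lappD _ (- EE _ _ _)) !lappD !lappZ; ring.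
Qed.

Lemma Tz_small : exists2 K, 0 < K & forall z w u N,
  app1 (Ez c tau z w) (fun=> 0) (fun=> 0) N -> app1 (Ez c tau (- z) u) (fun=> 0) (fun=> 0) N ->
  hn H1 (Tz tau c z w u) <= K * N.
Proof.
have [K K0 hK] := Utr_L2 tau; exists K => // z w u N [h1 h2] [h3 h4].
apply: (hK _ _ N _ _ _ _).2 => x hx; rewrite ?derivN ?hornerN ?ncN.
- by have := h1 x hx; rewrite subr0.
- by have := h2 x hx; rewrite subr0.
- by have := h3 x hx; rewrite subr0.
- by have := h4 x hx; rewrite subr0.
Qed.

(** The candidate [g] for a defect vector is an L^2 limit of transforms with fixed residues along
    which [L - z] tends to 0. *)
Lemma eigen z : exists (G_ : nat -> R[i] -> R[i]) (g : R -> R[i]^o) (K : R),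
  [/\ 0 <= K, vec H1 g,
      forall n, MerR tau (G_ n) (- 'i%C * vz c tau z 0) ('i%C * vz c tau (- z) 0),
      forall n, hn H1 (g - onR (G_ n)) <= K * n.+1%:R^-1 &
      forall n, hn H1 (onR (Lc tau c (G_ n)) - z *: onR (G_ n)) <= K * n.+1%:R^-1].
Proof.
have [w_ [u_ [g [hv hE vg [K K0 hK]]]]] := eigen_approx tau hc z.
have [K' K'0 hK'] := Tz_small.
have match_ n : (w_ n).[1] = (u_ n).[1] by have [_ -> _ ->] := hv n.
exists (fun n => Utr tau (w_ n) (u_ n)), g, (K + K'); split=> //.
- by rewrite addr_ge0 // ltW.
- by move=> n; have [<- _ <- _] := hv n; exact: MerR_Utr.
- move=> n; apply: le_trans (hK n) _.
  by rewrite ler_wpM2r // lerDl ltW.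
- move=> n; rewrite Tz_matched //; have [h1 h2] := hE n.
  by apply: le_trans (hK' z _ _ _ h1 h2) _; rewrite ler_wpM2r // lerDr ltW.
Qed.

Lemma small_eq0 (X : R[i]) K : (forall n, nc X <= K * n.+1%:R^-1) -> X = 0.
Proof.
move=> h; apply/eqP; rewrite -nc_eq0 eq_le nc_ge0 andbT leNgt; apply/negP => X0.
have := truncnS_gt (K / nc X); rewrite ltNge => /negP; apply.
by rewrite ler_pdivlMr // mulrC -ler_pdivlMr // mulrC -invrK; exact: h.
Qed.

(** Green's formula passes to the limit, its right-hand side being constant along [G_]. *)
Lemma green_limit z f g a b K (G_ : nat -> R[i] -> R[i]) a' b' :
  MerR tau f a b -> vec H1 g -> (forall n, MerR tau (G_ n) a' b') ->
  (forall n, hn H1 (g - onR (G_ n)) <= K * n.+1%:R^-1) ->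
  (forall n, hn H1 (onR (Lc tau c (G_ n)) - z *: onR (G_ n)) <= K * n.+1%:R^-1) ->
  ip H1 (onR (Lc tau c f)) g - ip H1 (onR f) (z *: g) =
  a * conjc a' * jump p1 + b * conjc b' * jump p2.
Proof.
move=> mf vg mG hG hL; have shH := H1_sh R; have [vf vLf] := Lc_L2 c mf.
apply/eqP; rewrite -subr_eq0; apply/eqP.
pose A := hn H1 (onR (Lc tau c f)); pose B := hn H1 (onR f).
apply: (@small_eq0 _ (A * K + nc z * B * K + B * K)) => n.
have [vG vLG] := Lc_L2 c (mG n); rewrite -(green c mf (mG n)).
have vd := sh_vecB shH vg vG; have vr := sh_vecB shH vLG (sh_vecZ shH z vG).
have -> : ip H1 (onR (Lc tau c f)) g - ip H1 (onR f) (z *: g) -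
    (ip H1 (onR (Lc tau c f)) (onR (G_ n)) - ip H1 (onR f) (onR (Lc tau c (G_ n)))) =
    ip H1 (onR (Lc tau c f)) (g - onR (G_ n)) - conjc z * ip H1 (onR f) (g - onR (G_ n)) +
    ip H1 (onR f) (onR (Lc tau c (G_ n)) - z *: onR (G_ n)).
  rewrite (ipBr shH vg vG vLf) (ipBr shH vg vG vf) (ipBr shH vLG (sh_vecZ shH z vG) vf).
  by rewrite !(ipZr shH) //; ring.
apply: (le_trans (ncD _ _)); apply: (@le_trans _ _ ((A * (K * n.+1%:R^-1) +
   nc z * (B * (K * n.+1%:R^-1))) + B * (K * n.+1%:R^-1))); last first.
  by rewrite le_eqVlt; apply/orP; left; apply/eqP; ring.
apply: lerD; last first.
  by apply: le_trans (ip_hn shH vf vr) _; rewrite ler_wpM2l ?hn_ge0 ?hL.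
apply: (le_trans (ncB _ _)); apply: lerD.
  by apply: le_trans (ip_hn shH vLf vd) _; rewrite ler_wpM2l ?hn_ge0 ?hG.
rewrite ncM nc_conj ler_wpM2l ?nc_ge0 //.
by apply: le_trans (ip_hn shH vf vd) _; rewrite ler_wpM2l ?hn_ge0 ?hG.
Qed.

Lemma null_ip (g h : R -> R[i]^o) : vec H1 h -> null H1 g -> ip H1 h g = 0.
Proof.
move=> vh ng; apply/eqP; rewrite -nc_eq0 eq_le nc_ge0 andbT.
by have := ip_hn (H1_sh R) vh ng.1; rewrite (hn_null ng) mulr0.
Qed.

(** The kernel of the adjoint minus [z], for [Lc] on functions without residues. *)
Definition def_vec z (y : R -> R[i]^o) : Prop := vec H1 y /\
  forall f, MerR tau f 0 0 -> ip H1 (onR (Lc tau c f)) y = ip H1 (onR f) (z *: y).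

Lemma def_vec_lin z a y y' : def_vec z y -> def_vec z y' -> def_vec z (y - a *: y').
Proof.
have shH := H1_sh R; move=> [vy hy] [vy' hy'].
have va := sh_vecZ shH a vy'; split; first exact: (sh_vecB shH).
move=> f mf; have [vf vLf] := Lc_L2 c mf.
have -> : z *: (y - a *: y') = z *: y - a *: (z *: y').
  by rewrite scalerBr !scalerA [z * a]mulrC.
rewrite (ipBr shH vy va vLf) (ipZr shH a vy' vLf) hy // hy' //.
rewrite (ipBr shH (sh_vecZ shH z vy) (sh_vecZ shH a (sh_vecZ shH z vy')) vf).
by rewrite (ipZr shH a (sh_vecZ shH z vy') vf).
Qed.

(** A defect vector is orthogonal to [Tz (conjc z)] of matched pairs that vanish at 0. Any pair
    vanishing at 0 becomes matched after subtracting a multiple of [('X, 0)], so the extra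
    hypothesis makes [y] orthogonal to the dense set of [range_dense]. *)
Lemma def_vec_null z y : def_vec z y ->
  ip H1 (Tz tau c (conjc z) 'X 0) y = 0 -> null H1 y.
Proof.
move=> [vy hy] h0; have shH := H1_sh R.
pose K (g : R -> R[i]^o) := exists w u, [/\ w.[0] = 0, u.[0] = 0 & g = Tz tau c (conjc z) w u].
apply: (dense_orth_null shH (K := K) vy).
- by move=> _ [w [u [_ _ ->]]]; exact: Tz_vec.
- move=> v e vv e0; have [w [u [w0 u0 h]]] := range_dense tau hc (conjc z) vv e0.
  by exists (Tz tau c (conjc z) w u) => //; exists w, u.
move=> _ [w [u [w0 u0 ->]]].
pose d := w.[1] - u.[1].
have m1 : ((- d) *: 'X + w).[1] = ((- d) *: 0 + u).[1].
  by rewrite !hornerE /d; ring.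
have m0 : MerR tau (Utr tau ((- d) *: 'X + w) ((- d) *: 0 + u)) 0 0.
  by apply: MerR_eq (MerR_Utr tau m1) _ _; rewrite !hornerE ?w0 ?u0; ring.
have [vf vLf] := Lc_L2 c m0.
have E := Tz_matched (conjc z) m1; rewrite Tz_linear in E.
have : ip H1 (- d *: Tz tau c (conjc z) 'X 0 + Tz tau c (conjc z) w u) y = 0.
  rewrite -E (ipBl shH vLf (sh_vecZ shH _ vf) vy) (ipZl shH _ vf vy) hy //.
  by rewrite (ipZr shH _ vy vf) subrr.
rewrite (ipDl shH (sh_vecZ shH _ (Tz_vec _ _ _ _ _)) (Tz_vec _ _ _ _ _) vy).
by rewrite (ipZl shH _ (Tz_vec _ _ _ _ _) vy) h0 mulr0 add0r.
Qed.

(** By [def_vec_null] a single linear functional detects null vectors, so the dimension is at most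
    1. The vector of [eigen] is not null, since Green's formula pairs it nontrivially with a
    function that has a residue. *)
Lemma def_vec_dim1 z : exists g, [/\ def_vec z g, ~ null H1 g &
  forall y, def_vec z y -> exists a, null H1 (y - a *: g)].
Proof.
have shH := H1_sh R; have [G_ [g [K [K0 vg mG hG hL]]]] := eigen z.
have lim f a b (mf : MerR tau f a b) := green_limit mf vg mG hG hL.
have dg : def_vec z g.
  split=> // f mf; apply/eqP; rewrite -subr_eq0 (lim _ _ _ mf).
  by rewrite !mul0r addr0.
have ng : ~ null H1 g.
  move=> n0.
  (* The transform of this pair has residue [- i] at [pole1] and 0 at [pole2]. *)
  have m1 : (1 - 'X : {poly R[i]}).[1] = (0 : {poly R[i]}).[1] by rewrite !hornerE subrr.
  have mk := MerR_Utr tau m1; have [vk vLk] := Lc_L2 c mk.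
  have := lim _ _ _ mk; rewrite (null_ip vLk n0) (null_ip vk (nullZ shH z n0)) subrr.
  rewrite (_ : (1 - 'X : {poly R[i]}).[0] = 1); last by rewrite !hornerE subr0.
  rewrite horner0 mulr0 !mul0r addr0 mulr1 => /esym/eqP; apply/negP.
  rewrite -nc_gt0 !ncM nc_conj ncM ncN nc_i !mul1r.
  by rewrite mulr_gt0 // nc_gt0 ?jump_pole1 ?vz_neq0.
exists g; split=> // y dy.
pose t0 := Tz tau c (conjc z) 'X 0.
have vt : vec H1 t0 by exact: Tz_vec.
have g0 : ip H1 t0 g != 0 by apply/eqP => /(def_vec_null dg).
exists (conjc (ip H1 t0 y / ip H1 t0 g)).
apply: (@def_vec_null z); first exact: def_vec_lin.
rewrite (ipBr shH dy.1 (sh_vecZ shH _ vg) vt) (ipZr shH _ vg vt) cJJ.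
by rewrite divfK // subrr.
Qed.

End HalfLineComponent.

(** * Direct sums *)

Section SumSpace.
Variables (R : realType) (V W : lmodType R[i]) (H : ip_space V) (K : ip_space W).
Hypotheses (hH : semi_hilbert H) (hK : semi_hilbert K).

Lemma ip_sum_sh : semi_hilbert (ip_sum H K).
Proof.
split=> /=.
- by split; exact: sh_vec0.
- by move=> a u v [h1 h2] [h3 h4]; split; exact: sh_vecD.
- by move=> a u v w [? ?] [? ?] [? ?]; rewrite !sh_ipl //; ring.
- by move=> u v [h1 h2] [h3 h4]; rewrite (sh_conj hH h1 h3) (sh_conj hK h2 h4) rmorphD.
- by move=> u [h1 h2]; rewrite cReD addr_ge0 // sh_pos.
Qed.

Lemma sqnorm_sum u : sqnorm (ip_sum H K) u = sqnorm H u.1 + sqnorm K u.2.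
Proof. by rewrite /sqnorm /= cReD. Qed.

Lemma null_sum u : null (ip_sum H K) u <-> null H u.1 /\ null K u.2.
Proof.
split=> [[[h1 h2] h0]|[[h1 e1] [h2 e2]]]; last by split=> //=; rewrite e1 e2 addr0.
move: h0; rewrite /= (sqnorm_ip hH h1) (sqnorm_ip hK h2) -rmorphD /= => /(congr1 (@complex.Re R)) /= h0.
have p1 := sqnorm_ge0 hH h1; have p2 := sqnorm_ge0 hK h2.
by split; split=> //; rewrite ?(sqnorm_ip hH h1) ?(sqnorm_ip hK h2);
  rewrite (_ : sqnorm _ _ = 0) //; lra.
Qed.

End SumSpace.

(** * Reduction of the weighted component to the unweighted one *)

Section Weighted.
Variable R : realType.
Local Notation H1 := (L2 (@one1 R)).
Local Notation mu := (@lebesgue_measure R).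
Local Notation wexp := (fun x : R => expR (2%:R * pi * x)).
Local Notation W := (L2 wexp).
Implicit Types (x y e : R) (f g : R -> R[i]^o) (a : R[i]) (F h : R[i] -> R[i]).

(** The unitary map from the weighted space onto [L^2(R)], with inverse [Psi]; [twist] is the same
    multiplication on functions of a complex variable. *)
Definition Phi f : R -> R[i]^o := fun x => (expR (pi * x))%:C * f x.
Definition Psi f : R -> R[i]^o := fun x => (expR (- (pi * x)))%:C * f x.

Lemma PsiK f : Phi (Psi f) = f.
Proof. by apply/funext => x; rewrite /Phi /Psi mulrA -rmorphM -expRD subrr expR0 mul1r. Qed.

Lemma Phi_lin a f g : Phi (a *: f + g) = a *: Phi f + Phi g.
Proof.
apply/funext => x; rewrite -[RHS]/(a * (_ * f x) + _ * g x) /Phi.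
by rewrite -[(a *: f + g) x]/(a * f x + g x); ring.
Qed.

Lemma PhiB f g : Phi (f - g) = Phi f - Phi g.
Proof. by rewrite addrC -scaleN1r Phi_lin scaleN1r addrC. Qed.

Lemma PhiZ a f : Phi (a *: f) = a *: Phi f.
Proof.
by apply/funext => x; rewrite /Phi -[(a *: f) x]/(a * f x) mulrCA.
Qed.

Lemma PsiZ a f : Psi (a *: f) = a *: Psi f.
Proof.
by apply/funext => x; rewrite /Psi -[(a *: f) x]/(a * f x) mulrCA.
Qed.

Lemma expR_lin_meas (k : R) : measurable_fun (setT : set R) (fun x => expR (k * x)).
Proof.
apply: continuous_measurable_fun => x; apply: continuous_comp; last exact: continuous_expR.
by apply: cvgM; [exact: cvg_cst|exact: cvg_id].
Qed.

Lemma wexp_ge0 x : 0 <= wexp x.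
Proof. exact: expR_ge0. Qed.

Lemma wexp_meas : measurable_fun (setT : set R) wexp.
Proof. exact: expR_lin_meas. Qed.

Lemma wexpE x : wexp x = expR (pi * x) * expR (pi * x).
Proof. by rewrite -expRD; congr expR; ring. Qed.

Lemma W_sh : semi_hilbert W.
Proof. exact: L2_semi_hilbert wexp_meas wexp_ge0. Qed.

Lemma Phi_vec f : vec W f <-> vec H1 (Phi f).
Proof.
have E : (fun x => nc (f x) ^+ 2 * wexp x) = (fun x => nc (Phi f x) ^+ 2).
  apply/funext => x; rewrite wexpE /Phi ncM nc_real ger0_norm ?expR_ge0 //; ring.
have mE : cmeas f <-> cmeas (Phi f).
  split=> mf.
    by apply: cmeasM => //; apply: cmeas_real; exact: expR_lin_meas.
  have -> : f = fun x => (expR ((- pi) * x))%:C * Phi f x.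
    apply/funext => x; rewrite /Phi mulrA -rmorphM -expRD.
    by rewrite mulNr addNr expR0 mul1r.
  by apply: cmeasM => //; apply: cmeas_real; exact: expR_lin_meas.
split.
  move=> /(L2_vecP wexp_meas wexp_ge0)[m i]; apply/H1_vecP; split; first exact/mE.
  by rewrite -E.
move=> /H1_vecP[m i]; apply/(L2_vecP wexp_meas wexp_ge0); split; first exact/mE.
by rewrite E.
Qed.

Lemma Phi_ip f g : ip W f g = ip H1 (Phi f) (Phi g).
Proof.
rewrite -[LHS]/(L2_ip _ _ _) -[RHS]/(L2_ip _ _ _) !L2_ipE; apply: eq_cI => x _.
by rewrite wexpE /Phi /one1 cJM conjc_real; ring.
Qed.

Lemma Phi_null f : null W f <-> null H1 (Phi f).
Proof. by rewrite /null /= -[L2_ip _ _ _]/(ip W f f) Phi_ip; split=> -[/Phi_vec]. Qed.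

Lemma L2_sum_sh : semi_hilbert (L2_sum R).
Proof. exact: (ip_sum_sh (H1_sh R) W_sh). Qed.

Definition twist F : R[i] -> R[i] := fun s => cexp (pi%:C * s) * F s.
Definition untwist F : R[i] -> R[i] := fun s => cexp (- pi%:C * s) * F s.

Lemma untwistK F : twist (untwist F) = F.
Proof.
apply/funext => s; rewrite /twist /untwist mulrA -cexpD.
by rewrite mulNr subrr cexp0 mul1r.
Qed.

Lemma twistK F : untwist (twist F) = F.
Proof.
apply/funext => s; rewrite /twist /untwist mulrA -cexpD.
by rewrite mulNr addNr cexp0 mul1r.
Qed.

Lemma onR_twist F : onR (twist F) = Phi (onR F).
Proof. by apply/funext => x; rewrite /onR /twist /Phi -rmorphM cexp_real. Qed.

Lemma cexp_pi_i : cexp (pi%:C * 'i%C) = -1 :> R[i].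
Proof.
rewrite /cexp (_ : complex.Re _ = 0); last by rewrite cReM /=; ring.
rewrite (_ : complex.Im _ = pi); last by rewrite cImM /=; ring.
by rewrite expR0 cospi sinpi mul1r; apply: complex_ext; rewrite /= ?oppr0.
Qed.

(* Multiplication by [exp (pi s)] changes sign under the shifts by [i] and [-i]. *)
Lemma Lc_twist tau c F : Phi (onR (Lc tau c F)) = - onR (Lc tau (- c) (twist F)).
Proof.
apply/funext => x; rewrite -[RHS]/(- Lc tau (- c) (twist F) x%:C) /Phi /onR /Lc /twist.
have e1 : cexp (pi%:C * (x%:C + 'i%C)) = - (expR (pi * x))%:C :> R[i].
  by rewrite mulrDr cexpD cexp_pi_i mulrN1 -rmorphM cexp_real.
have e2 : cexp (pi%:C * (x%:C - 'i%C)) = - (expR (pi * x))%:C :> R[i].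
  by rewrite mulrBr cexpD cexpN cexp_pi_i invrN invr1 mulrN1 -rmorphM cexp_real.
have e3 : cexp (pi%:C * x%:C) = (expR (pi * x))%:C :> R[i] by rewrite -rmorphM cexp_real.
by rewrite e1 e2 e3; ring.
Qed.

End Weighted.

(** * The two domains in terms of residues *)

Section DomainDescription.
Variables (R : realType) (tau sigma : R).
Local Notation H1 := (L2 (@one1 R)).
Local Notation p1 := (pole1 R).
Local Notation p2 := (pole2 tau).
Implicit Types (x y e : R) (a b k : R[i]) (f h : R[i] -> R[i]) (F G : (R[i] -> R[i]) * (R[i] -> R[i])).

Definition phase : R[i] := cexp ((2%:R * pi)%:C * (tau +i* sigma)).
Definition kap1 : R[i] := cexp (pi%:C * p1).
Definition kap2 : R[i] := cexp (pi%:C * p2).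

(** Here [a] and [b] are the residues of [F.2], and the relations of [space_H_sigma] are built into
    those of [F.1]. The second function enters through its twist, with residues multiplied by
    [e^(pi s)] at the poles. *)
Definition sigma_pair a b F : Prop :=
  MerR tau F.1 a (- phase * b) /\ MerR tau (twist F.2) (kap1 * a) (kap2 * b).

Lemma decay_pairP F : decay_pair F <->
  (exists2 e, 0 < e & decay e F.1) /\ (exists2 e, 0 < e & decay e (twist F.2)).
Proof.
split=> [[e e0 [h1 h2]]|[[e e0 h1] [e' e'0 h2]]]; first by split; exists e.
exists (Num.min e e'); first by rewrite lt_min e0.
by split; [apply: decay_mono h1|apply: decay_mono h2]; rewrite ge_min lexx ?orbT.
Qed.

Lemma HolR_twist f a b : HolR tau (twist f) (kap1 * a) (kap2 * b) <-> HolR tau f a b.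
Proof.
split=> h; last exact: HolR_cexp.
have := HolR_cexp (- pi%:C) h => h2; rewrite -(twistK f).
by apply: HolR_eq h2 _ _; rewrite mulrA -cexpD mulNr addNr cexp0 mul1r.
Qed.

Lemma H_sigmaP F : space_H_sigma tau sigma F <-> exists a b, sigma_pair a b F.
Proof.
split.
  move=> [[h1 h2] /decay_pairP[d1 d2] r1 r2].
  exists (res F.2 p1), (res F.2 p2); split; split=> //.
    by apply/HolRP; split=> //.
  by apply/HolR_twist/HolRP.
move=> [a [b [[h1 d1] [h2 d2]]]].
move/HolR_twist: h2 => /HolRP[h2 r1 r2]; move/HolRP: h1 => [h1 r3 r4].
split=> //; first exact/decay_pairP.
  by rewrite r3 r1.
by rewrite r4 r2.
Qed.

Lemma H_pair F : space_H F -> sigma_pair 0 0 F.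
Proof.
move=> [[d d0 [h1 h2]] /decay_pairP[d1 d2]]; split; split=> //; rewrite !mulr0.
  by apply: HolR_entire; exists d => // s hs; apply/dvP; exact: h1.
apply: HolR_entire; exists d => // s hs; apply: dvM; last by apply/dvP; exact: h2.
by apply: dv_scale; exact: dv_cexp.
Qed.

Lemma sigma_pair_lin k a b a' b' F G : sigma_pair a b F -> sigma_pair a' b' G ->
  sigma_pair (k * a + a') (k * b + b') (fun s => k * F.1 s + G.1 s, fun s => k * F.2 s + G.2 s).
Proof.
move=> [f1 f2] [g1 g2]; split=> /=.
  by apply: MerR_eq (MerR_lin k f1 g1) _ _ => //; ring.
have := MerR_lin k f2 g2 => h; apply: MerR_ext (MerR_eq h _ _); try ring.
by move=> s; rewrite /twist; ring.
Qed.

Lemma H_lin k F G : space_H F -> space_H G ->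
  space_H (fun s => k * F.1 s + G.1 s, fun s => k * F.2 s + G.2 s).
Proof.
move=> hF hG; have [[_ dF1] [_ dF2]] := sigma_pair_lin k (H_pair hF) (H_pair hG).
split; last exact/decay_pairP.
case: hF => [[d d0 [h1 h2]] _]; case: hG => [[e e0 [h3 h4]] _].
exists (Num.min d e); first by rewrite lt_min d0.
have key s : strip (Num.min d e) s -> strip d s /\ strip e s.
  by rewrite /strip /= => hs; split; apply: lt_le_trans hs _; rewrite lerD2l ge_min lexx ?orbT.
by split=> s /key[k1 k2] /=; apply/dvP; apply: dvD; try apply: dvZ; apply/dvP;
  [exact: h1|exact: h3|exact: h2|exact: h4].
Qed.

(* A function with removable singularities at the poles is corrected there. *)
Lemma MerR_fix f : MerR tau f 0 0 -> exists f',
  [/\ exists2 d, 0 < d & forall s, `|complex.Im s| < 1 + d -> dv f' s,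
      forall s, s != p1 -> s != p2 -> f' s = f s &
      exists2 e, 0 < e & decay e f'].
Proof.
move=> [[[d d0 df] [g1 [r1 [r10 dg1 fg1]]] [g2 [r2 [r20 dg2 fg2]]]] [e e0 [M [B hM]]]].
pose f' s := if s == p1 then g1 s else if s == p2 then g2 s else f s.
have p12 : p1 != p2 by apply/eqP => /(congr1 (@complex.Im R)) /=; lra.
have off s : s != p1 -> s != p2 -> f' s = f s.
  by rewrite /f' => /negbTE -> /negbTE ->.
exists f'; split=> //.
  exists d => // s hs.
  have [->|s1] := eqVneq s p1.
    apply: (@dv_near _ g1); last by apply: dg1; rewrite subrr nc0.
    exists (Num.min r1 (nc (p2 - p1))); first by rewrite lt_min r10 nc_gt0 subr_eq0 eq_sym.
    move=> t; rewrite lt_min /f' => /andP[t1 t2].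
    case: eqP => // /eqP tp1; case: eqP => [E|_]; first by rewrite E ltxx in t2.
    by rewrite fg1 // mul0r add0r.
  have [->|s2] := eqVneq s p2.
    apply: (@dv_near _ g2); last by apply: dg2; rewrite subrr nc0.
    exists (Num.min r2 (nc (p1 - p2))); first by rewrite lt_min r20 nc_gt0 subr_eq0.
    move=> t; rewrite lt_min /f' => /andP[t1 t2].
    case: eqP => [E|_]; first by rewrite E ltxx in t2.
    by case: eqP => // /eqP tp2; rewrite fg2 // mul0r add0r.
  apply: (@dv_near _ f); last exact: df.
  exists (Num.min (nc (s - p1)) (nc (s - p2))); first by rewrite lt_min !nc_gt0 !subr_eq0 s1.
  move=> t; rewrite lt_min => /andP[t1 t2]; rewrite off //.
    by apply: contraTneq t1 => ->; rewrite nc_distC ltxx.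
  by apply: contraTneq t2 => ->; rewrite nc_distC ltxx.
exists e => //; exists M, (Num.max B (`|2 * tau| + 1)) => s s1; rewrite ge_max => /andP[s2 s3].
rewrite off; first exact: hM.
  by apply: contraTneq s3 => ->; rewrite /= normr0 -ltNge ltr_wpDl.
by apply: contraTneq s3 => ->; rewrite /= -ltNge ltrDl.
Qed.

End DomainDescription.

(** * Symmetry and defect indices of the direct sum *)

Section DifferenceOperator.
Variables (R : realType) (tau sigma phi : R).
Hypotheses (hphi0 : 0 < phi) (hphipi : phi < pi).
Local Notation H1 := (L2 (@one1 R)).
Local Notation W := (L2 (fun x : R => expR (2%:R * pi * x))).
Local Notation S := (L2_sum R).
Local Notation p1 := (pole1 R).
Local Notation p2 := (pole2 tau).
Local Notation c := (cos phi).
Local Notation Lf := (Lc tau c).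
Implicit Types (x e : R) (a b k z : R[i]) (f h : R[i] -> R[i]) (y g : R -> R[i]^o)
  (F G : (R[i] -> R[i]) * (R[i] -> R[i])) (D : set ((R[i]^o -> R[i]^o) * (R[i]^o -> R[i]^o))).

Lemma cos_sqr_lt1 : c ^+ 2 < 1.
Proof.
have s0 : 0 < sin phi by apply: sin_gt0_pi; rewrite hphi0.
by have := cos2Dsin2 phi; have := exprn_gt0 2 s0; lra.
Qed.

Lemma cosN_sqr_lt1 : (- c) ^+ 2 < 1.
Proof. by rewrite sqrrN cos_sqr_lt1. Qed.

Lemma sigma_vec a b F : sigma_pair tau sigma a b F ->
  vec S (onR F.1, onR F.2) /\ vec S (onR (Lf F.1), onR (Lf F.2)).
Proof.
move=> [h1 h2]; have [v1 v2] := Lc_L2 c h1; have [v3 v4] := Lc_L2 (- c) h2.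
split; split=> //=; first by apply/Phi_vec; rewrite -onR_twist.
by apply/Phi_vec; rewrite Lc_twist -scaleN1r; exact: (sh_vecZ (H1_sh R)).
Qed.

(** Both moduli are [e^(2 pi tau)]: a real [sigma] only rotates the phase. *)
Lemma phase_kap2 : nc (phase tau sigma) = nc (kap2 tau).
Proof.
by rewrite !nc_cexp; congr expR; rewrite !cReM /=; ring.
Qed.

Lemma mulcJ k : k * conjc k = (nc k ^+ 2)%:C.
Proof.
by rewrite normc_sqr; apply: complex_ext; case: k => u v /=; ring.
Qed.

Lemma nc_kap1 : nc (kap1 R) = 1.
Proof. by rewrite nc_cexp cReM /= mulr0 mul0r subr0 expR0. Qed.

(** The minus sign of [Lc_twist] opposes the boundary forms of the two components, and the
    equalities [|kap1| = 1] and [|phase| = |kap2|] make them cancel. *)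
Lemma sigma_symmetric a b a' b' F G : sigma_pair tau sigma a b F -> sigma_pair tau sigma a' b' G ->
  ip S (onR (Lf F.1), onR (Lf F.2)) (onR G.1, onR G.2) =
  ip S (onR F.1, onR F.2) (onR (Lf G.1), onR (Lf G.2)).
Proof.
move=> [f1 f2] [g1 g2].
have [vf vLf] := Lc_L2 (- c) f2; have [vg vLg] := Lc_L2 (- c) g2.
have shH := H1_sh R.
rewrite -[LHS]/(ip H1 (onR (Lf F.1)) (onR G.1) + ip W (onR (Lf F.2)) (onR G.2)).
rewrite -[RHS]/(ip H1 (onR F.1) (onR (Lf G.1)) + ip W (onR F.2) (onR (Lf G.2))).
rewrite !Phi_ip !Lc_twist -!onR_twist.
rewrite -[- onR _ in LHS]scaleN1r -[- onR _ in RHS]scaleN1r (ipZl shH _ vLf vg) (ipZr shH _ vLg vf).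
have -> : conjc (-1 : R[i]) = -1 by apply: complex_ext; rewrite /= ?oppr0.
apply/eqP; rewrite -subr_eq0; apply/eqP.
have /eqP := green c f1 g1; rewrite subr_eq => /eqP ->.
have /eqP := green (- c) f2 g2; rewrite subr_eq => /eqP ->.
have h1 := mulcJ (kap1 R); rewrite nc_kap1 expr1n in h1.
have h2 := mulcJ (phase tau sigma); rewrite phase_kap2 -mulcJ in h2.
move: (kap1 R) (phase tau sigma) (kap2 tau) h1 h2 => K P Q h1 h2.
rewrite !cJM (_ : conjc (- P) = - conjc P); last by case: (P).
rewrite [LHS](_ : _ = (1 - K * conjc K) * (a * conjc a' * jump p1) +
  (P * conjc P - Q * conjc Q) * (b * conjc b' * jump p2)); last by ring.
by rewrite h1 h2 !subrr !mul0r addr0.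
Qed.

Lemma onR_lin k f h : onR (fun s => k * f s + h s) = k *: onR f + onR h :> (R -> R[i]^o).
Proof. by []. Qed.

Lemma Lc_lin k f h : Lf (fun s => k * f s + h s) = (fun s => k * Lf f s + Lf h s).
Proof. by apply/funext => s; rewrite /Lc; ring. Qed.

Lemma Lc0 : Lf (fun=> 0) = (fun=> 0).
Proof. by apply/funext => s; rewrite /Lc !mulr0 addr0 subrr. Qed.

Lemma space_H0 : space_H (fun=> 0 : R[i]^o, fun=> 0 : R[i]^o).
Proof.
split; last first.
  apply/decay_pairP; split; exists 1 => //; first exact: decay0.
  by exists 0, 0 => s _ _; rewrite /twist mulr0 nc0 mul0r.
by exists 1 => //; split=> s _; apply/dvP; exact: dv_cst.
Qed.

(** On the real line the operator sees only the heights 0, 1 and -1, so repairing removable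
    singularities at height 1/2 or -1/2 leaves the L^2 vectors unchanged. *)
Lemma H_of_Mer f h : MerR tau f 0 0 -> MerR tau h 0 0 -> exists F,
  [/\ space_H F, onR F.1 = onR f, onR (Lf F.1) = onR (Lf f),
      onR (twist F.2) = onR h & onR (Lc tau (- c) (twist F.2)) = onR (Lc tau (- c) h)].
Proof.
move=> /MerR_fix[f' [[d d0 df] ff df']] /MerR_fix[h' [[e e0 dh] hh dh']].
have off (q : R) : q != 2^-1 -> q != - 2^-1 ->
    forall (k : R[i]) x, complex.Im k = q -> (x%:C + k != p1) /\ (x%:C + k != p2).
  move=> q1 q2 k x kq; split.
    apply: contra_neq q1 => /(congr1 (@complex.Im R)); rewrite cImD kq /= => E; lra.
  apply: contra_neq q2 => /(congr1 (@complex.Im R)); rewrite cImD kq /= => E; lra.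
have pt (k : R[i]) x : complex.Im k = 0 \/ complex.Im k = 1 \/ complex.Im k = -1 ->
    (x%:C + k != p1) /\ (x%:C + k != p2).
  by case=> [|[]]; apply: off; apply/eqP; lra.
have pt0 x : (x%:C != p1) /\ (x%:C != p2).
  by have := pt 0 x; rewrite addr0; apply; left.
have [pti ptm] : (forall x, (x%:C + 'i%C != p1) /\ (x%:C + 'i%C != p2)) /\
    (forall x, (x%:C - 'i%C != p1) /\ (x%:C - 'i%C != p2)).
  by split=> x; apply: pt; right; [left|right].
have eqL (c0 : R) (u v : R[i] -> R[i]) : (forall s, s != p1 -> s != p2 -> u s = v s) ->
    onR u = onR v /\ onR (Lc tau c0 u) = onR (Lc tau c0 v).
  move=> uv; split; apply/funext => x.
    by have [a1 a2] := pt0 x; exact: uv.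
  have [a1 a2] := pt0 x; have [b1 b2] := pti x; have [c1 c2] := ptm x.
  by rewrite /onR /Lc !uv.
have [h1 h2] := eqL c _ _ ff; have [h3 h4] := eqL (- c) _ _ hh.
exists (f', untwist h'); split; rewrite /= ?untwistK //.
split; last by apply/decay_pairP; rewrite /= untwistK.
exists (Num.min d e); first by rewrite lt_min d0.
split=> s hs /=; apply/dvP.
  by apply: df; apply: lt_le_trans hs _; rewrite lerD2l ge_min lexx.
apply: dvM; first by apply: dv_scale; exact: dv_cexp.
by apply: dh; apply: lt_le_trans hs _; rewrite lerD2l ge_min lexx orbT.
Qed.

Lemma H_dense u e : vec S u -> 0 < e -> exists2 F, space_H F &
  sqnorm S (u - (onR F.1, onR F.2)) < e.
Proof.
case: u => u1 u2 [/= v1 /Phi_vec v2] e0; have shH := H1_sh R.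
pose d := Num.sqrt (e / 2); have d0 : 0 < d by rewrite sqrtr_gt0 divr_gt0.
have dE : d ^+ 2 = e / 2 by rewrite sqr_sqrtr // ltW // divr_gt0.
have [f mf hf] := mer_dense tau v1 d0; have [h mh hh] := mer_dense tau v2 d0.
have [F [HF e1 _ e2 _]] := H_of_Mer mf mh; exists F => //.
rewrite sqnorm_sum /= e1.
have -> : sqnorm W (u2 - onR F.2) = sqnorm H1 (Phi u2 - onR h).
  by rewrite /sqnorm Phi_ip PhiB -onR_twist e2.
have vf := sh_vecB shH v1 (Lc_L2 c mf).1; have vh := sh_vecB shH v2 (Lc_L2 c mh).1.
rewrite -(hn_lt shH vf d0) dE in hf; rewrite -(hn_lt shH vh d0) dE in hh.
by rewrite (splitr e); exact: ltrD.
Qed.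

Lemma symmetric_LL D : (forall F, D F -> exists a b, sigma_pair tau sigma a b F) ->
  (forall F, space_H F -> D F) ->
  (forall k F G, D F -> D G ->
    D (fun s => k * F.1 s + G.1 s, fun s => k * F.2 s + G.2 s)) ->
  symmetric_op S (LL_op tau phi D).
Proof.
move=> Dp HD Dl; split.
- by move=> _ [F DF <-]; have [a [b hF]] := Dp _ DF; have [] := sigma_vec hF.
- split.
    exists (fun=> 0, fun=> 0); first exact: HD space_H0.
    by rewrite /= -[L_op tau phi _]/(Lf _) Lc0.
  move=> k _ _ [F DF <-] [G DG <-].
  exists (fun s => k * F.1 s + G.1 s, fun s => k * F.2 s + G.2 s); first exact: Dl.
  by rewrite /= -![L_op tau phi _]/(Lf _) !Lc_lin.
- move=> u e vu e0; have [F HF hF] := H_dense vu e0.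
  exists (onR F.1, onR F.2) => //.
  exists ((onR F.1, onR F.2), (onR (Lf F.1), onR (Lf F.2))) => //.
  by exists F => //; exact: HD.
- move=> _ _ [F DF <-] [G DG <-]; have [a [b hF]] := Dp _ DF; have [a' [b' hG]] := Dp _ DG.
  exact: (sigma_symmetric hF hG).
Qed.

Lemma symmetric_H : symmetric_op S (LL_op tau phi (@space_H R)).
Proof.
apply: symmetric_LL => // [F HF|k F G]; last exact: H_lin tau sigma k F G.
by exists 0, 0; exact: H_pair.
Qed.

Lemma symmetric_H_sigma : symmetric_op S (LL_op tau phi (space_H_sigma tau sigma)).
Proof.
apply: symmetric_LL => [F /H_sigmaP //|F HF|k F G].
  by apply/H_sigmaP; exists 0, 0; exact: H_pair.
move=> /H_sigmaP[a [b hF]] /H_sigmaP[a' [b' hG]]; apply/H_sigmaP.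
by exists (k * a + a'), (k * b + b'); exact: sigma_pair_lin.
Qed.

(** The domain contains pairs that vanish on the line in one component, so the condition splits; by
    [Lc_twist] the second component has [- c] and [- z] in place of [c] and [z]. *)
Lemma ker_adjoint z u : ker_sub (adjoint S (LL_op tau phi (@space_H R))) z u <->
  def_vec tau c z u.1 /\ def_vec tau (- c) (- z) (Phi u.2).
Proof.
have shH := H1_sh R; have shW := W_sh R.
split.
  move=> [[v1 v2] _ hu]; have v2' := (Phi_vec u.2).1 v2.
  have hF F : space_H F -> ip H1 (onR (Lf F.1)) u.1 + - ip H1 (onR (Lc tau (- c) (twist F.2))) (Phi u.2) =
      ip H1 (onR F.1) (z *: u.1) + ip H1 (onR (twist F.2)) (z *: Phi u.2).
    move=> HF; have [_ mF] := H_pair tau sigma HF; have [vF vLF] := Lc_L2 (- c) mF.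
    have : ip H1 (onR (Lf F.1)) u.1 + ip W (onR (Lf F.2)) u.2 =
        ip H1 (onR F.1) (z *: u.1) + ip W (onR F.2) (z *: u.2).
      by apply: (hu ((onR F.1, onR F.2), (onR (Lf F.1), onR (Lf F.2)))); exists F.
    by rewrite !Phi_ip Lc_twist -onR_twist PhiZ -scaleN1r (ipZl shH _ vLF v2') mulN1r.
  have m0 := MerR0 tau.
  split; split=> // f mf.
    have [F [HF <- <- e1 e2]] := H_of_Mer mf m0.
    have := hF F HF; rewrite e1 e2 -[Lc _ _ (fun=> 0)](_ : (fun=> 0) = _); last first.
      by apply/funext => s; rewrite /Lc !mulr0 addr0 subrr.
    rewrite -[onR (fun=> 0)]/(0 : R -> R[i]^o) (ip0l shH v2') (ip0l shH (sh_vecZ shH z v2')).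
    by rewrite oppr0 !addr0.
  have [F [HF e1 e2 <- <-]] := H_of_Mer m0 mf.
  have := hF F HF; rewrite e1 e2 Lc0 -[onR (fun=> 0)]/(0 : R -> R[i]^o).
  rewrite (ip0l shH v1) (ip0l shH (sh_vecZ shH z v1)) !add0r => E.
  have [_ mF] := H_pair tau sigma HF; have [vF _] := Lc_L2 (- c) mF.
  rewrite !(ipZr shH) // in E *.
  by rewrite -[LHS]opprK E rmorphN mulNr.
move=> [[v1 d1] [v2 d2]]; have w2 : vec W u.2 by exact/Phi_vec.
split=> /=; first by split.
  by split; [exact: (sh_vecZ shH)|exact: (sh_vecZ shW)].
move=> _ [F HF <-] /=; have [m1 m2] := H_pair tau sigma HF; rewrite !mulr0 in m1 m2.
have [vF vLF] := Lc_L2 (- c) m2.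
rewrite -[LHS]/(ip H1 (onR (Lf F.1)) u.1 + ip W (onR (Lf F.2)) u.2).
rewrite -[RHS]/(ip H1 _ _ + ip W _ _) (d1 _ m1); congr (_ + _).
rewrite !Phi_ip Lc_twist -onR_twist PhiZ -scaleN1r (ipZl shH _ vLF v2) (d2 _ m2).
by rewrite !(ipZr shH) // rmorphN !mulNr mul1r opprK.
Qed.

Lemma ker_dim2 z : dim_mod_null S (ker_sub (adjoint S (LL_op tau phi (@space_H R))) z) 2%N.
Proof.
have shH := H1_sh R.
have [g1 [d1 n1 h1]] := def_vec_dim1 tau cos_sqr_lt1 z.
have [g2 [d2 n2 h2]] := def_vec_dim1 tau cosN_sqr_lt1 (- z).
have zero c0 z0 : def_vec tau c0 z0 0.
  split=> [|f mf]; first exact: sh_vec0.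
  have [vf vLf] := Lc_L2 c0 mf.
  have ip0r (v : R -> R[i]^o) : vec H1 v -> ip H1 v 0 = 0.
    by move=> vv; rewrite (sh_conj shH (sh_vec0 shH) vv) (ip0l shH vv) conjc0.
  by rewrite scaler0 !ip0r.
have Phi0 : Phi (0 : R -> R[i]^o) = 0 by apply/funext => x; rewrite /Phi mulr0.
pose e (j : 'I_2) : (R -> R[i]^o) * (R -> R[i]^o) :=
  if j == ord0 then (g1, 0) else (0, Psi g2).
have sumE (k : 'I_2 -> R[i]) :
    \sum_j k j *: e j = (k ord0 *: g1, k ord_max *: Psi g2).
  rewrite 2!big_ord_recl big_ord0 addr0 /e /=.
  rewrite (_ : lift ord0 ord0 = ord_max); last exact: val_inj.
  by rewrite -[LHS]/(_ + _, _ + _) /= !scaler0 addr0 add0r.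
exists e; split.
- move=> j; apply/ker_adjoint; rewrite /e; case: ifP => _ /=.
    by split=> //; rewrite Phi0; exact: zero.
  by rewrite PsiK; split=> //; exact: zero.
- move=> k; rewrite sumE => /(null_sum (H1_sh R) (W_sh R))[/= k1 /Phi_null]; rewrite PhiZ PsiK => k2.
  have key (g : R -> R[i]^o) a : ~ null H1 g -> null H1 (a *: g) -> a = 0.
    move=> ng na; apply/eqP/negPn/negP => a0; apply: ng.
    by have := nullZ shH a^-1 na; rewrite scalerA mulVf // scale1r.
  have k10 := key _ _ n1 k1; have k20 := key _ _ n2 k2.
  move=> j; have [/eqP j0|/eqP j0] := boolP (j == ord0); first by rewrite j0.
  rewrite (_ : j = ord_max) //; apply: val_inj; case: j j0 => -[|[|//]] //= i j0.
  by case: j0; exact: val_inj.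
- move=> u /ker_adjoint[u1 u2]; have [a ha] := h1 _ u1; have [b hb] := h2 _ u2.
  exists (fun j => if j == ord0 then a else b); rewrite sumE /=.
  apply/(null_sum (H1_sh R) (W_sh R)); split=> //=.
  by apply/Phi_null; rewrite PhiB PhiZ PsiK.
Qed.

End DifferenceOperator.

(** * Density of the range under the residue conditions *)

Section SelfAdjointness.
Variables (R : realType) (tau sigma phi : R).
Hypotheses (hphi0 : 0 < phi) (hphipi : phi < pi).
Local Notation H1 := (L2 (@one1 R)).
Local Notation W := (L2 (fun x : R => expR (2%:R * pi * x))).
Local Notation S := (L2_sum R).
Implicit Types (x e : R) (a b k z : R[i]) (f h : R[i] -> R[i]) (g : R -> R[i]^o)
  (w u p q : {poly R[i]}).

Lemma nc_vz0 (c : R) z : nc (vz c tau z 0) = expR (- (complex.Im z * theta c 0)).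
Proof.
rewrite /vz /vab (_ : qq c 0 = 1); last by rewrite /qq; ring.
rewrite ln1 mulr0 add0r nc_cexp; congr expR.
by rewrite !ReImE /=; ring.
Qed.

(** By [nc_vz0] the two sides are exponentials of opposite nonzero multiples of
    [theta c 0 + theta (- c) 0], which is positive. *)
Lemma endpoint_ratio (c : R) z : c ^+ 2 < 1 -> complex.Im z != 0 ->
  nc (vz (- c) tau (- z) 0) * nc (vz c tau (- z) 0) !=
  nc (vz c tau z 0) * nc (vz (- c) tau z 0).
Proof.
move=> hc z0; have hc' : (- c) ^+ 2 < 1 by rewrite sqrrN.
have t1 := theta0_gt0 hc; have t2 := theta0_gt0 hc'.
rewrite !nc_vz0 -!expRD; apply: contra_neq z0 => /expR_inj; rewrite cImN => E.
have : complex.Im z * (theta c 0 + theta (- c) 0) = 0 by lra.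
by move/eqP; rewrite mulf_eq0 [X in _ || X]gt_eqF ?addr_gt0 // orbF => /eqP.
Qed.

Lemma TzD (c : R) z w u p q : Tz tau c z (p + w) (q + u) = Tz tau c z p q + Tz tau c z w u.
Proof. by have := Tz_linear tau c z 1 p q w u; rewrite !scale1r. Qed.

(** Near-solutions with exact endpoint values: multiples of them adjust the boundary data at an
    arbitrarily small cost in the range. The endpoint values do not depend on [e], so [a] and [b]
    can be fixed beforehand. *)
Lemma correction (c : R) z a b e : c ^+ 2 < 1 -> 0 < e -> exists p q,
  [/\ p.[0] = vz c tau z 0, q.[0] = vz c tau (- z) 0, p.[1] = vz c tau z 1,
      q.[1] = vz c tau z 1 & hn H1 (Tz tau c z (a *: p) (b *: q)) < e].
Proof.
move=> hc e0; have [K K0 hK] := Tz_small tau c.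
have [w_ [u_ [_ [hv hE _ _]]]] := eigen_approx tau hc z.
pose N := nc a + nc b; have N0 : 0 <= N by rewrite addr_ge0 ?nc_ge0.
pose n := Num.trunc (K * N / e); have hn := truncnS_gt (K * N / e).
exists (w_ n), (u_ n); have [v1 v2 v3 v4] := hv n; split=> //.
have EzZ z' k r : Ez c tau z' (k *: r) = k *: Ez c tau z' r.
  by rewrite /Ez /EE derivZ -!mul_polyC; ring.
have bnd z' k r : nc k <= N -> app1 (Ez c tau z' r) (fun=> 0) (fun=> 0) n.+1%:R^-1 ->
    app1 (Ez c tau z' (k *: r)) (fun=> 0) (fun=> 0) (N * n.+1%:R^-1).
  move=> kN [h1 h2]; rewrite EzZ; split=> x hx; rewrite ?derivZ hornerZ subr0 ncM.
    by apply: ler_pM; rewrite ?nc_ge0 //; have := h1 x hx; rewrite subr0.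
  by apply: ler_pM; rewrite ?nc_ge0 //; have := h2 x hx; rewrite subr0.
have [e1 e2] := hE n.
apply: le_lt_trans (hK z _ _ (N * n.+1%:R^-1) (bnd _ a _ _ e1) (bnd _ b _ _ e2)) _.
- by rewrite lerDl nc_ge0.
- by rewrite lerDr nc_ge0.
by rewrite mulrA ltr_pdivrMr // [e * _]mulrC -ltr_pdivrMr.
Qed.

(* Existence of the four coefficients of the correction terms: two endpoint
   matching conditions and two residue conditions. *)
Lemma coefficients (l1 r1 l2 r2 k1 k2 P d1 d2 : R[i]) :
  l1 != 0 -> r1 != 0 -> k1 != 0 -> k2 != 0 ->
  nc k1 = 1 -> nc P = nc k2 -> nc l2 * nc r1 != nc l1 * nc r2 ->
  exists a1 b1 a2 b2 : R[i], [/\ a1 - b1 = d1, a2 - b2 = d2,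
    k1 * (a1 * l1) = a2 * l2 & k2 * (b1 * r1) = - P * (b2 * r2)].
Proof.
move=> l10 r10 k10 k20 nk1 nP ne.
pose A := l2 / (k1 * l1); pose B := P * r2 / (k2 * r1).
(* The determinant of the system up to nonzero factors; if it vanished, comparing moduli would
   contradict [ne]. *)
have AB : A + B != 0.
  apply: contra_neq ne => /eqP; rewrite addr_eq0 => /eqP /(congr1 (@nc R)).
  have n1 : nc l1 != 0 by rewrite nc_eq0.
  have n2 : nc r1 != 0 by rewrite nc_eq0.
  have n3 : nc k2 != 0 by rewrite nc_eq0.
  rewrite ncN /A /B !(ncM, ncV) nk1 nP mul1r => E.
  have -> : nc l2 = nc l2 / nc l1 * nc l1 by rewrite divfK.
  by rewrite E; field; rewrite n2 n3.
pose a2 := (d1 + B * d2) / (A + B).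
exists (A * a2), (- B * (a2 - d2)), a2, (a2 - d2); split.
- have : a2 * (A + B) = d1 + B * d2 by rewrite /a2 divfK.
  move=> E; rewrite (_ : _ - _ = a2 * (A + B) - B * d2); last by ring.
  by rewrite E addrK.
- by ring.
- by rewrite /A; field; rewrite k10 l10.
- by rewrite /B; field; rewrite k20 r10.
Qed.

Lemma hn_sum_le (v : (R -> R[i]^o) * (R -> R[i]^o)) : vec S v ->
  hn S v <= hn H1 v.1 + hn H1 (Phi v.2).
Proof.
move=> vv; have [v1 /Phi_vec v2] := vv; have shH := H1_sh R.
rewrite -(@ler_pXn2r _ 2) ?nnegrE ?addr_ge0 ?hn_ge0 //.
rewrite (hn_sqr (L2_sum_sh R) vv) sqnorm_sum sqrrD !(hn_sqr shH) //.
rewrite (_ : sqnorm W v.2 = sqnorm H1 (Phi v.2)); last by rewrite /sqnorm Phi_ip.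
rewrite [leRHS]addrAC lerDl.
by rewrite mulrn_wge0 // mulr_ge0 ?hn_ge0.
Qed.

(** Each component is approximated by data vanishing at [y = 0] but mismatched at [y = 1]. Multiples
    of the near-solutions of [correction] then repair the matching and create residues that satisfy
    the two relations. *)
Lemma sigma_range z (v : (R -> R[i]^o) * (R -> R[i]^o)) e :
  complex.Im z != 0 -> vec S v -> 0 < e ->
  exists2 x, LL_op tau phi (space_H_sigma tau sigma) x & hn S (v - (x.2 - z *: x.1)) < e.
Proof.
move=> z0 vv e0; have [v1 /Phi_vec v2] := vv; have shH := H1_sh R.
pose c := cos phi; have hc := cos_sqr_lt1 hphi0 hphipi; have hc' := cosN_sqr_lt1 hphi0 hphipi.
have e4 : 0 < e / 4 by exact: divr_gt0.
(* Because of the minus sign in [Lc_twist], the second target is [- Phi v.2], treated with [- c] and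
   [- z]. *)
have vN : vec H1 (- Phi v.2) by rewrite -scaleN1r; exact: (sh_vecZ shH).
have [w1 [u1 [w10 u10 h1]]] := range_dense tau hc z v1 e4.
have [w2 [u2 [w20 u20 h2]]] := range_dense tau hc' (- z) vN e4.
set V1 := vz c tau z 1; set V2 := vz (- c) tau (- z) 1.
have V10 : V1 != 0 by exact: vz_neq0.
have V20 : V2 != 0 by exact: vz_neq0.
(* The first four arguments are the values at 0 of the solutions on the two sides of each component;
   the right-hand sides are the mismatches at 1 divided by the common value of the solutions
   there. *)
have [a1 [b1 [a2 [b2 [E1 E2 E3 E4]]]]] := @coefficients (vz c tau z 0) (vz c tau (- z) 0)
  (vz (- c) tau (- z) 0) (vz (- c) tau z 0) (kap1 R) (kap2 tau) (phase tau sigma)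
  ((u1.[1] - w1.[1]) / V1) ((u2.[1] - w2.[1]) / V2) (vz_neq0 _ _ _ _) (vz_neq0 _ _ _ _)
  (cexp_neq0 _) (cexp_neq0 _) (nc_kap1 R) (phase_kap2 tau sigma) (endpoint_ratio hc z0).
have [p1 [q1 [p10 q10 p11 q11 hp1]]] := correction z a1 b1 hc e4.
have [p2 [q2 [p20 q20 p21 q21 hp2]]] := correction (- z) a2 b2 hc' e4.
rewrite opprK in q20.
have m1 : (a1 *: p1 + w1).[1] = (b1 *: q1 + u1).[1].
  rewrite !hornerE p11 q11 -/c -/V1; have : (a1 - b1) * V1 = u1.[1] - w1.[1] by rewrite E1 divfK.
  by move=> E; apply/eqP; rewrite -subr_eq0 (_ : _ - _ = (a1 - b1) * V1 - (u1.[1] - w1.[1]));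
    [rewrite E subrr|ring].
have m2 : (a2 *: p2 + w2).[1] = (b2 *: q2 + u2).[1].
  rewrite !hornerE p21 q21 -/c -/V2; have : (a2 - b2) * V2 = u2.[1] - w2.[1] by rewrite E2 divfK.
  by move=> E; apply/eqP; rewrite -subr_eq0 (_ : _ - _ = (a2 - b2) * V2 - (u2.[1] - w2.[1]));
    [rewrite E subrr|ring].
pose f1 := Utr tau (a1 *: p1 + w1) (b1 *: q1 + u1).
pose f2 := Utr tau (a2 *: p2 + w2) (b2 *: q2 + u2).
have hF : sigma_pair tau sigma (- 'i%C * (a1 * vz c tau z 0)) ('i%C * (b2 * vz (- c) tau z 0) / kap2 tau)
    (f1, untwist f2).
  have k20 : kap2 tau != 0 := cexp_neq0 _.
  have M1 := MerR_Utr tau m1; have M2 := MerR_Utr tau m2.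
  rewrite !(hornerD, hornerZ) p10 w10 q10 u10 !addr0 in M1.
  rewrite !(hornerD, hornerZ) p20 w20 q20 u20 !addr0 in M2.
  split.
    apply: (MerR_eq M1) => //; apply: (mulfI k20); rewrite mulrCA E4.
    by rewrite -/c; move: (vz (- c) tau z 0) => r; field; exact: k20.
  rewrite [twist _](untwistK f2); apply: (MerR_eq M2).
    by rewrite [RHS]mulrCA E3.
  by rewrite [RHS]mulrC divfK.
exists ((onR f1, onR (untwist f2)), (onR (Lc tau c f1), onR (Lc tau c (untwist f2)))).
  by exists (f1, untwist f2) => //; apply/H_sigmaP; eexists; eexists; exact: hF.
have [vx1 vx2] := sigma_vec phi hF.
have shS := L2_sum_sh R.
apply: le_lt_trans (hn_sum_le _) _.
  by apply: (sh_vecB shS vv); apply: (sh_vecB shS) => //; exact: (sh_vecZ shS).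
rewrite -[ltLHS]/(hn H1 (v.1 - (onR (Lc tau c f1) - z *: onR f1)) +
  hn H1 (Phi (v.2 - (onR (Lc tau c (untwist f2)) - z *: onR (untwist f2))))).
have -> : e = (e / 4 + e / 4) + (e / 4 + e / 4) by field.
have sE (X A B : R -> R[i]^o) : X - (A + B) = X - B - A by rewrite opprD addrCA addrC.
apply: ltrD.
  rewrite (Tz_matched tau c z m1) TzD sE.
  have vA := sh_vecB shH v1 (Tz_vec tau c z w1 u1).
  by apply: le_lt_trans (hnB shH vA (Tz_vec _ _ _ _ _)) _; exact: ltrD.
rewrite (PhiB v.2) (PhiB (onR (Lc tau c (untwist f2)))) PhiZ Lc_twist -onR_twist untwistK.
have -> : Phi v.2 - (- onR (Lc tau (- c) f2) - z *: onR f2) =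
    - ((- Phi v.2) - (onR (Lc tau (- c) f2) - (- z) *: onR f2)) :> (R -> R[i]^o).
  move: (Phi v.2) (onR (Lc tau (- c) f2)) (onR f2) => A B C.
  by apply/funext => x; rewrite -[LHS]/(A x - (- B x - z * C x))
    -[RHS]/(- (- A x - (B x - - z * C x))); ring.
rewrite (Tz_matched tau (- c) (- z) m2) TzD sE.
have vA := sh_vecB shH vN (Tz_vec tau (- c) (- z) w2 u2).
have vB := sh_vecB shH vA (Tz_vec tau (- c) (- z) (a2 *: p2) (b2 *: q2)).
have hnN (g : R -> R[i]^o) : vec H1 g -> hn H1 (- g) = hn H1 g.
  by move=> vg; rewrite -scaleN1r (hnZ shH) // ncN nc1 mul1r.
rewrite (hnN _ vB).
by apply: le_lt_trans (hnB shH vA (Tz_vec _ _ _ _ _)) _; exact: ltrD.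
Qed.

Lemma sigma_esa : essentially_selfadjoint S (LL_op tau phi (space_H_sigma tau sigma)).
Proof.
apply: (esa_of_dense_range (L2_sum_sh R) (symmetric_H_sigma tau sigma phi)).
by move=> z hz v e; apply: sigma_range; case: hz => -> /=; rewrite ?oppr_eq0 oner_eq0.
Qed.

End SelfAdjointness.

Theorem proposition6p2 (R : realType) (tau sigma phi : R)
    (hphi0 : 0 < phi) (hphipi : phi < pi) :
  defect_indices (L2_sum R) (LL_op tau phi (@space_H R)) 2%N 2%N
  /\ essentially_selfadjoint (L2_sum R)
       (LL_op tau phi (space_H_sigma tau sigma)).
Proof.
split; last exact: sigma_esa.
by split; [exact: symmetric_H tau sigma phi|exact: ker_dim2|exact: ker_dim2].
Qed.
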